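(* For $x=(x_1,x_2)$ sufficiently close to $(0,0)$, the function $$F_{21}(x)=x_1^{1-b_2}x_2^{1-b_3}F\left(\begin{matrix}a_1-b_2-b_3+2,&a_2-b_2-b_3+2,&a_3-b_2-b_3+2\\ b_1-b_2+1,&2-b_2,&1\\2-b_3,&b_4-b_3+1,&1\end{matrix};x\right)$$ is expressed as $F_{21}(x)=C_{21}\int_{\Delta_{21}}u(t,x)\,dt$, where $dt=dt_1\wedge dt_3\wedge dt_2\wedge dt_4$, $$u(t,x)=\Bigl(\prod_{j=1}^4t_j^{-b_j}\Bigr)(1-t_1-t_3)^{b_1+b_3-a_1-2}(1-t_2-t_4)^{b_2+b_4-a_2-2}\Bigl(1-\frac{x_1}{t_1t_2}-\frac{x_2}{t_3t_4}\Bigr)^{-a_3},$$ $$C_{21}=\frac{\Gamma(b_2+b_3-a_1-1)\Gamma(b_2+b_3-a_2-1)\Gamma(b_2+b_3-a_3-1)}{\Gamma(b_1+b_3-a_1-1)\Gamma(b_2+b_4-a_2-1)\Gamma(1-a_3)}\cdot\frac1{\Gamma(b_2-1)\Gamma(b_3-1)\Gamma(b_2-b_1)\Gamma(b_3-b_4)},$$ and $\Delta_{21}$ is the image of $-\mathrm{reg}(\square_1\times\triangle_2)$, associated with the weight $$s_1^{b_2-b_1-1}(1-s_1)^{b_1+b_3-a_1-2}s_3^{b_3-b_4-1}(1-s_3)^{b_2+b_4-a_2-2}\cdot s_2^{b_2-2}s_4^{b_3-2}(1-s_2-s_4)^{-a_3},$$ under the map $\imath_{21}:(s_1,s_2,s_3,s_4)\mapsto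 t=\bigl(s_1,\frac{x_1}{s_1s_2},\frac{x_2}{s_3s_4},s_3\bigr)$.
   Context: With $(\alpha,n)=\alpha(\alpha+1)\cdots(\alpha+n-1)$, $$F\left(\begin{matrix}a_1,a_2,a_3\\ b_1,b_2,1\\ b_3,b_4,1\end{matrix};x\right)=\sum_{n_1,n_2\ge0}\frac{\prod_{i=1}^3(a_i,n_1+n_2)}{(b_1,n_1)(b_2,n_1)(1,n_1)(b_3,n_2)(b_4,n_2)(1,n_2)}x_1^{n_1}x_2^{n_2}.$$ The parameters are such that the regularization is defined and $C_{21}$ is finite: $b_2,b_3,a_3,b_1-b_2,b_3-b_4,b_1+b_3-a_1,b_2+b_4-a_2\notin\mathbb Z$ and $b_2+b_3-a_i-1\notin\{0,-1,-2,\dots\}$ $(i=1,2,3)$. $\square_1=\{(s_1,s_3)\in\mathbb R^2\mid0<s_1<1,0<s_3<1\}$, $\triangle_2=\{(s_2,s_4)\in\mathbb R^2\mid s_2,s_4,1-s_2-s_4>0\}$. For an open polygon $P$ of this kind and a weight $w$ (product of powers, with non-integral exponents, of the linear forms defining the edges), the regularization $\mathrm{reg}(P)$ is the compact twisted cycle supported in a small neighborhood of $\overline P$, loaded with branches of $w$, homologous as a locally finite twisted chain to $P$ loaded with the standard branch of $w$ (all linear forms positive on $P$); explicitly $\sigma+\sum_i\frac{S_i\times\sigma_i}{c_i-1}+\sum\frac{S_i\times S_j}{(c_i-1)(c_j-1)}$ (last sum over vertices), $c_i=e^{2\pi\sqrt{-1}p_i}$ for the exponent $p_i$ on the $i$-th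 edge, $\sigma$ the shrunken polygon, $\sigma_i$ its edges, $S_i$ small positive circles around the edge lines. $\mathrm{reg}(\square_1\times\triangle_2)=\mathrm{reg}(\square_1)\times\mathrm{reg}(\triangle_2)$ with the $(s_1,s_3)$- and $(s_2,s_4)$-factors of the displayed weight, oriented by $ds=ds_1\wedge ds_3\wedge ds_2\wedge ds_4$. ''Close to $(0,0)$'' means that $|\frac{x_2}{(1-s_1)s_3s_4}|<1$ and $|\frac{x_1}{(1-s_3)s_1s_2}|<1$ on this chain. The branch of $u$ on $\Delta_{21}$ is such that $\imath_{21}^*(u\,dt)$ equals $-x_1^{1-b_2}x_2^{1-b_3}$ times the displayed weight times $\bigl(1-\frac{x_2}{(1-s_1)s_3s_4}\bigr)^{b_1+b_3-a_1-2}\bigl(1-\frac{x_1}{(1-s_3)s_1s_2}\bigr)^{b_2+b_4-a_2-2}ds$, with principal branches of the last two factors and the same branch of $x_1^{1-b_2}x_2^{1-b_3}$ as in $F_{21}$. *)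

(* Defs.v *)
From Stdlib Require Import Reals List ZArith.
From Coquelicot Require Import Coquelicot.
Import ListNotations.
Local Open Scope C_scope.

(** * Complex functions *)

Definition not_int (z : C) : Prop := forall k : Z, z <> RtoC (IZR k).

Definition Cexp (z : C) : C :=
  ((exp (Re z) * cos (Im z))%R, (exp (Re z) * sin (Im z))%R).

(* Principal logarithm on C minus (-oo, 0]; the half-angle formula gives the
   argument in (-PI, PI). *)
Definition Clog (z : C) : C :=
  (ln (Cmod z), (2 * atan (Im z / (Cmod z + Re z)))%R).

Definition CLim_seq (v : nat -> C) : C :=
  (real (Lim_seq (fun n => Re (v n))), real (Lim_seq (fun n => Im (v n)))).

Definition CSeries (v : nat -> C) : C :=
  (Series (fun n => Re (v n)), Series (fun n => Im (v n))).

Definition CInt (f : R -> C) (a b : R) : C :=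
  RInt (V := C_R_CompleteNormedModule) f a b.

Definition CDerive (f : R -> C) (x : R) : C :=
  (Derive (fun y => Re (f y)) x, Derive (fun y => Im (f y)) x).

(* (z, n) = z (z+1) ... (z+n-1) *)
Fixpoint poch (z : C) (n : nat) : C :=
  match n with
  | O => 1
  | S m => poch z m * (z + RtoC (INR m))
  end.

(* Euler's limit n! n^z / (z (z+1) ... (z+n)), valid for every z outside
   {0, -1, -2, ...}. *)
Definition CGamma (z : C) : C :=
  CLim_seq (fun n =>
    RtoC (INR (fact n)) * Cexp (z * RtoC (ln (INR n))) / poch z (S n)).

Definition F3 (a1 a2 a3 b1 b2 b3 b4 x1 x2 : C) : C :=
  CSeries (fun n1 => CSeries (fun n2 =>
    poch a1 (n1 + n2) * poch a2 (n1 + n2) * poch a3 (n1 + n2)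
    / (poch b1 n1 * poch b2 n1 * poch 1 n1
       * (poch b3 n2 * poch b4 n2 * poch 1 n2))
    * x1 ^ n1 * x2 ^ n2)).

(** * Loaded values

    A multivalued power product is handled by carrying, along with the value of
    each linear form, the chosen value of its logarithm.  On all the chains below, [Cexp (log f) =
    val f] holds for every linear form [f]; principal logarithms are only taken
    of numbers with positive real part. *)

Record loaded := Loaded { val : C; log : C }.

Definition lpow (f : loaded) (p : C) : C := Cexp (p * log f).
Definition lprinc (z : C) : loaded := Loaded z (Clog z).
Definition lmul (f g : loaded) : loaded := Loaded (val f * val g) (log f + log g).
Definition ldiv (f g : loaded) : loaded := Loaded (val f / val g) (log f - log g).

(* eps e^{2 pi i tau}, continued from the positive real value eps at tau = 0 *)
Definition lcircle (eps tau : R) : loaded :=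
  Loaded (RtoC eps * Cexp (RtoC (2 * PI * tau) * Ci))
       (RtoC (ln eps) + RtoC (2 * PI * tau) * Ci).

(** * Twisted chains

    A chain is a formal combination of cells parametrized by the unit cube of
    [D] (with [D] = R, R * R or (R * R) * (R * R), in the standard orientation);
    a point of a cell is given by the loaded values of the linear forms. *)

Definition chain (D P : Type) : Type := list (C * (D -> P)).

Definition chain_scal {D P} (k : C) (K : chain D P) : chain D P :=
  map (fun c => (k * fst c, snd c)) K.

Definition chain_map {D P Q} (f : P -> Q) (K : chain D P) : chain D Q :=
  map (fun c => (fst c, fun tau => f (snd c tau))) K.

Definition chain_prod {D P D' P'} (K : chain D P) (L : chain D' P') :
    chain (D * D') (P * P') :=
  map (fun cd => (fst (fst cd) * fst (snd cd),
                  fun tau => (snd (fst cd) (fst tau), snd (snd cd) (snd tau))))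
      (list_prod K L).

Definition monodromy (p : C) : C := Cexp (2 * RtoC PI * Ci * p).

(* reg(0,1) for the weight s^p (1-s)^q.  Points are the loaded (s, 1-s).  The
   circle around s = 1 starts at 1 - eps; its minus sign is the orientation of
   the upper end point of [eps, 1 - eps]. *)
Definition reg_interval (eps : R) (p q : C) : chain R (loaded * loaded) :=
  [ (RtoC 1, fun r : R =>
       let s := RtoC eps + RtoC r * (1 - 2 * RtoC eps) in
       (lprinc s, lprinc (1 - s)));
    (1 / (monodromy p - 1), fun th : R =>
       let s := lcircle eps th in (s, lprinc (1 - val s)));
    (- (1 / (monodromy q - 1)), fun th : R =>
       let s' := lcircle eps th in (lprinc (1 - val s'), s')) ].

(* reg of the unit square, for s^p (1-s)^q s'^p' (1-s')^q' oriented by ds /\ ds'.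
   The product of the two intervals expands to the shrunken square, the four
   S_i x sigma_i / (c_i - 1) and the four S_i x S_j / ((c_i - 1) (c_j - 1)). *)
Definition reg_square (eps : R) (p q p' q' : C) :
    chain (R * R) ((loaded * loaded) * (loaded * loaded)) :=
  chain_prod (reg_interval eps p q) (reg_interval eps p' q').

Definition rot3 (P : loaded * loaded * loaded) : loaded * loaded * loaded :=
  let '(x, y, z) := P in (z, x, y).

(* The pieces of reg of the triangle, written in barycentric coordinates
   (y0, y1, y2), y0 + y1 + y2 = 1, whose cyclic rotations all give the same
   orientation dy0 /\ dy1 = dy1 /\ dy2 = dy2 /\ dy0. *)
Definition tri_inner (eps : R) (r : R * R) : loaded * loaded * loaded :=
  let e := RtoC eps in
  let y0 := e + RtoC (fst r) * (1 - 3 * e) in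
  let y1 := e + (1 - RtoC (fst r)) * RtoC (snd r) * (1 - 3 * e) in
  (lprinc y0, lprinc y1, lprinc (1 - y0 - y1)).

(* S_0 x sigma_0: y0 turns around 0 while (y1, y2) goes from (eps, 1-eps-y0) to
   (1-eps-y0, eps), so that the ends match the corner tori. *)
Definition tri_tube (eps : R) (r : R * R) : loaded * loaded * loaded :=
  let e := RtoC eps in
  let y0 := lcircle eps (fst r) in
  let len := 1 - 2 * e - val y0 in
  (y0, lprinc (e + RtoC (snd r) * len), lprinc (e + (1 - RtoC (snd r)) * len)).

(* S_0 x S_1 *)
Definition tri_corner (eps : R) (r : R * R) : loaded * loaded * loaded :=
  let y0 := lcircle eps (fst r) in
  let y1 := lcircle eps (snd r) in
  (y0, y1, lprinc (1 - val y0 - val y1)).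

(* reg of the triangle s, s', 1-s-s' > 0, for the weight s^p s'^q (1-s-s')^r
   oriented by ds /\ ds'.  Points are the loaded (s, s', 1-s-s'). *)
Definition reg_triangle (eps : R) (p q r : C) :
    chain (R * R) (loaded * loaded * loaded) :=
  let cp := monodromy p - 1 in
  let cq := monodromy q - 1 in
  let cr := monodromy r - 1 in
  [ (RtoC 1, tri_inner eps);
    (1 / cp, tri_tube eps);
    (1 / cq, fun tau => rot3 (tri_tube eps tau));
    (1 / cr, fun tau => rot3 (rot3 (tri_tube eps tau)));
    (1 / (cp * cq), tri_corner eps);
    (1 / (cq * cr), fun tau => rot3 (tri_corner eps tau));
    (1 / (cr * cp), fun tau => rot3 (rot3 (tri_corner eps tau))) ].

(** * Integration of a twisted 4-form *)

Definition cube4 : Type := ((R * R) * (R * R))%type.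

Definition unit_itv (y : R) : Prop := (0 <= y <= 1)%R.

Definition in_cube4 (tau : cube4) : Prop :=
  let '((y1, y2), (y3, y4)) := tau in
  unit_itv y1 /\ unit_itv y2 /\ unit_itv y3 /\ unit_itv y4.

Definition on_chain {P : Type} (Q : P -> Prop) (K : chain cube4 P) : Prop :=
  forall (c : C) (phi : cube4 -> P), In (c, phi) K ->
  forall tau : cube4, in_cube4 tau -> Q (phi tau).

Definition cube_int (f : cube4 -> C) : C :=
  CInt (fun y1 => CInt (fun y2 => CInt (fun y3 => CInt (fun y4 =>
    f ((y1, y2), (y3, y4))) 0 1) 0 1) 0 1) 0 1.

Definition partial (j : nat) (f : cube4 -> C) (tau : cube4) : C :=
  let '((y1, y2), (y3, y4)) := tau in
  match j with
  | 0%nat => CDerive (fun y => f ((y, y2), (y3, y4))) y1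
  | 1%nat => CDerive (fun y => f ((y1, y), (y3, y4))) y2
  | 2%nat => CDerive (fun y => f ((y1, y2), (y, y4))) y3
  | _ => CDerive (fun y => f ((y1, y2), (y3, y))) y4
  end.

(* Determinant, by expansion along the first row. *)
Fixpoint Cdet (n : nat) (M : nat -> nat -> C) : C :=
  match n with
  | O => 1
  | S m => sum_n (fun k =>
      (- (1)) ^ k * M 0%nat k
      * Cdet m (fun i j => M (S i) (if Nat.ltb j k then j else S j))) m
  end.

(* A point t with loaded values of t1, ..., t4, of 1-t1-t3, of 1-t2-t4 and of
   1 - x1/(t1 t2) - x2/(t3 t4). *)
Record tpoint := TPoint {
  t1 : loaded; t2 : loaded; t3 : loaded; t4 : loaded;
  l13 : loaded; l24 : loaded; lx : loaded }.

(* The integral over K of u(t) dt1 /\ dt3 /\ dt2 /\ dt4. *)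
Definition int_dt (u : tpoint -> C) (K : chain cube4 tpoint) : C :=
  fold_right Cplus 0 (map (fun c : C * (cube4 -> tpoint) =>
    fst c * cube_int (fun tau =>
      u (snd c tau)
      * Cdet 4 (fun i j =>
          partial j (fun sg =>
            val (nth i [t1; t3; t2; t4] t1 (snd c sg))) tau))) K).

(** * The integral representation *)

Definition u_form (a1 a2 a3 b1 b2 b3 b4 : C) (t : tpoint) : C :=
  lpow (t1 t) (- b1) * lpow (t2 t) (- b2) * lpow (t3 t) (- b3) * lpow (t4 t) (- b4)
  * lpow (l13 t) (b1 + b3 - a1 - 2) * lpow (l24 t) (b2 + b4 - a2 - 2)
  * lpow (lx t) (- a3).

(* Points of reg(square_1 x triangle_2): the loaded values of
   ((s1, 1-s1), (s3, 1-s3)) and of (s2, s4, 1-s2-s4). *)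
Definition spoint : Type :=
  (((loaded * loaded) * (loaded * loaded)) * (loaded * loaded * loaded))%type.

(* The moduli required to be < 1 are those of x2/((1-s1) s3 s4) and of
   x1/((1-s3) s1 s2). *)
Definition small_at (x1 x2 : C) (s : spoint) : Prop :=
  let '(((s1, s1'), (s3, s3')), (s2, s4, _)) := s in
  (Cmod (x2 / (val s1' * val s3 * val s4)) < 1)%R /\
  (Cmod (x1 / (val s3' * val s1 * val s2)) < 1)%R.

(* On the image,
     1 - t1 - t3 = (1-s1) (1 - x2/((1-s1) s3 s4)),
     1 - t2 - t4 = (1-s3) (1 - x1/((1-s3) s1 s2)),
     1 - x1/(t1 t2) - x2/(t3 t4) = 1 - s2 - s4,
   and the logarithms follow these factorizations, with principal branches for
   the second factors.  As the Jacobian of iota21 in these orientations is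
   - x1 x2/(s1 s2^2 s3 s4^2), the pull-back of u dt is
   - x1^(1-b2) x2^(1-b3) times the weight times the two principal powers ds. *)
Definition iota21 (x1 x2 : loaded) (s : spoint) : tpoint :=
  let '(((s1, s1'), (s3, s3')), (s2, s4, s0)) := s in
  let T1 := s1 in
  let T2 := ldiv x1 (lmul s1 s2) in
  let T3 := ldiv x2 (lmul s3 s4) in
  let T4 := s3 in
  {| t1 := T1; t2 := T2; t3 := T3; t4 := T4;
     l13 := Loaded (1 - val T1 - val T3)
       (log s1' + Clog (1 - val x2 / (val s1' * val s3 * val s4)));
     l24 := Loaded (1 - val T2 - val T4)
       (log s3' + Clog (1 - val x1 / (val s3' * val s1 * val s2)));
     lx := Loaded (1 - val x1 / (val T1 * val T2) - val x2 / (val T3 * val T4))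
       (log s0) |}.

Definition reg21 (eps : R) (a1 a2 a3 b1 b2 b3 b4 : C) : chain cube4 spoint :=
  chain_prod
    (reg_square eps (b2 - b1 - 1) (b1 + b3 - a1 - 2)
                    (b3 - b4 - 1) (b2 + b4 - a2 - 2))
    (reg_triangle eps (b2 - 2) (b3 - 2) (- a3)).

Definition Delta21 (eps : R) (a1 a2 a3 b1 b2 b3 b4 : C) (x1 x2 : loaded) :
    chain cube4 tpoint :=
  chain_map (iota21 x1 x2)
    (chain_scal (- (1)) (reg21 eps a1 a2 a3 b1 b2 b3 b4)).

Definition F21 (a1 a2 a3 b1 b2 b3 b4 : C) (x1 x2 : loaded) : C :=
  lpow x1 (1 - b2) * lpow x2 (1 - b3)
  * F3 (a1 - b2 - b3 + 2) (a2 - b2 - b3 + 2) (a3 - b2 - b3 + 2)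
       (b1 - b2 + 1) (2 - b2) (2 - b3) (b4 - b3 + 1) (val x1) (val x2).

Definition C21 (a1 a2 a3 b1 b2 b3 b4 : C) : C :=
  CGamma (b2 + b3 - a1 - 1) * CGamma (b2 + b3 - a2 - 1) * CGamma (b2 + b3 - a3 - 1)
  / (CGamma (b1 + b3 - a1 - 1) * CGamma (b2 + b4 - a2 - 1) * CGamma (1 - a3))
  * (1 / (CGamma (b2 - 1) * CGamma (b3 - 1) * CGamma (b2 - b1) * CGamma (b3 - b4))).

(* Main.v *)
(* Pulling [u dt] back by [iota21] gives the weight of the regularized chain times two binomial
   factors in [x1] and [x2], which on the chain expand into uniformly convergent binomial series;
   smallness on the products of end circles with corner tori gives [|xi| < eps^3], which bounds
   both arguments on all cells at once. Each term is a product of two regularized Beta integrals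
   and one regularized Dirichlet integral, with exponents shifted by integers.

   These integrals satisfy the recurrences that integration by parts (the chains are cycles) and
   the relations s + (1-s) = 1, y0 + y1 + y2 = 1 impose, so the shifts produce Pochhammer symbols
   and the double series is the one of [F21] times its constant term. The constant term is
   evaluated by running the recurrences towards infinitely large last exponent: there the integral
   concentrates at the end point (resp. the corner), the end circle collapses onto a convergent
   real integral, and the limit is the one in Euler's definition of the Gamma function. *)

Require Import Defs.
From Stdlib Require Import Reals List ZArith Lra Lia Psatz ClassicalEpsilon.
From Coquelicot Require Import Coquelicot.
Import ListNotations.
Local Open Scope C_scope.

(** A direct estimate on an end circle is useless: [|1 - z|^N] reaches [(1 + e)^N] there, while the
    limit sought has size [N^(- Re p)]. This is why the circle is deformed onto the real segment
    before anything is bounded. The deformation needs a positive real part of the exponent at the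
    collapsing end; the remaining exponents are reached by the recurrences, whose factors do not
    vanish for non-integral exponents.

    Stokes' theorem is not applied to the chain as a whole. Each kind of cell (segment, circle,
    tube, corner torus, inner triangle) has its own integration by parts with explicit boundary
    terms, and being a cycle means that these terms cancel algebraically. Tubes and corners contain
    an inner integral depending on a point of the outer circle, which must be holomorphic in that
    point; hence the theory of integrals with a complex parameter.

    The regularized triangle is not a product, so it is not reduced to two Beta integrals; its
    corner decouples only in the limit. The bound [e < 1/3] keeps the shrunken triangle
    nondegenerate and the principal logarithms in the right half-plane. *)

Notation cont := (@continuous _ C_UniformSpace).

(** * Elementary inequalities for the modulus *)

Lemma C_pair (z : C) : z = (Re z, Im z).
Proof. now destruct z. Qed.

Lemma C_eq_parts (z w : C) : Re z = Re w -> Im z = Im w -> z = w.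
Proof. destruct z, w; simpl; intros -> ->; reflexivity. Qed.

Lemma Cmod_le_parts (z : C) : (Cmod z <= Rabs (Re z) + Rabs (Im z))%R.
Proof.
  destruct z as [x y]. unfold Re, Im; simpl fst; simpl snd.
  replace ((x, y) : C) with (RtoC x + Ci * RtoC y)
    by (apply C_eq_parts; simpl; ring).
  eapply Rle_trans; [apply Cmod_triangle|].
  rewrite Cmod_mult, Cmod_Ci, !Cmod_R; lra.
Qed.

Lemma Re_le_Cmod (z : C) : (Rabs (Re z) <= Cmod z)%R.
Proof. apply re_le_Cmod. Qed.

Lemma Im_le_Cmod (z : C) : (Rabs (Im z) <= Cmod z)%R.
Proof.
  eapply Rle_trans; [|apply Rmax_Cmod]. apply Rmax_r.
Qed.

Lemma Cmod_minus_sym (z w : C) : Cmod (z - w) = Cmod (w - z).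
Proof. rewrite <- Cmod_opp. f_equal. ring. Qed.

Lemma Cmod_minus_le (z w : C) : (Cmod (z - w) <= Cmod z + Cmod w)%R.
Proof.
  unfold Cminus. eapply Rle_trans; [apply Cmod_triangle|]. rewrite Cmod_opp. lra.
Qed.

Lemma Cmod_reverse (z w : C) : (Cmod z - Cmod w <= Cmod (z + w))%R.
Proof.
  replace (Cmod z) with (Cmod ((z + w) - w)) by (f_equal; ring).
  generalize (Cmod_minus_le (z + w) w); lra.
Qed.

Lemma Cmod_RtoC_nonneg (x : R) : (0 <= x)%R -> Cmod (RtoC x) = x.
Proof. intros; rewrite Cmod_R; now apply Rabs_pos_eq. Qed.

(** * Continuity of complex-valued functions *)

Lemma cont_pair {U : UniformSpace} (f g : U -> R) (x : U) :
  continuous f x -> continuous g x -> cont (fun y => (f y, g y)) x.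
Proof.
  intros Hf Hg. 
  eapply (filterlim_comp_2 f g pair); [exact Hf|exact Hg|].
  intros P [d Hd]. exists (fun u => ball (f x) d u) (fun v => ball (g x) d v).
  - now exists d.
  - now exists d.
  - intros u v Hu Hv. apply Hd. split; assumption.
Qed.

Lemma cont_Re {U : UniformSpace} (f : U -> C) (x : U) :
  cont f x -> continuous (fun y => Re (f y)) x.
Proof.
  intros H. apply (continuous_comp (V := C_UniformSpace) f Re x H).
  unfold Re. destruct (f x). apply continuous_fst.
Qed.

Lemma cont_Im {U : UniformSpace} (f : U -> C) (x : U) :
  cont f x -> continuous (fun y => Im (f y)) x.
Proof.
  intros H. apply (continuous_comp (V := C_UniformSpace) f Im x H).
  unfold Im. destruct (f x). apply continuous_snd.
Qed.

Lemma cont_parts {U : UniformSpace} (f : U -> C) (x : U) :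
  continuous (fun y => Re (f y)) x -> continuous (fun y => Im (f y)) x -> cont f x.
Proof.
  intros H1 H2. eapply continuous_ext; [|apply (cont_pair _ _ x H1 H2)].
  intros y; simpl. now rewrite <- C_pair.
Qed.

Lemma cont_const {U : UniformSpace} (c : C) (x : U) : cont (fun _ => c) x.
Proof. apply continuous_const. Qed.

Lemma cont_RtoC {U : UniformSpace} (f : U -> R) (x : U) :
  continuous f x -> cont (fun y => RtoC (f y)) x.
Proof. intros H. apply cont_pair; [exact H|apply continuous_const]. Qed.

Lemma cont_plus {U : UniformSpace} (f g : U -> C) (x : U) :
  cont f x -> cont g x -> cont (fun y => f y + g y) x.
Proof.
  intros Hf Hg. apply cont_parts; simpl.
  - apply (continuous_plus (V := R_NormedModule)); apply cont_Re; assumption.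
  - apply (continuous_plus (V := R_NormedModule)); apply cont_Im; assumption.
Qed.

Lemma cont_opp {U : UniformSpace} (f : U -> C) (x : U) :
  cont f x -> cont (fun y => - f y) x.
Proof.
  intros Hf. apply cont_parts; simpl.
  - apply (continuous_opp (V := R_NormedModule)); apply cont_Re; assumption.
  - apply (continuous_opp (V := R_NormedModule)); apply cont_Im; assumption.
Qed.

Lemma cont_minus {U : UniformSpace} (f g : U -> C) (x : U) :
  cont f x -> cont g x -> cont (fun y => f y - g y) x.
Proof. intros. apply cont_plus; [|apply cont_opp]; assumption. Qed.

Lemma cont_mult {U : UniformSpace} (f g : U -> C) (x : U) :
  cont f x -> cont g x -> cont (fun y => f y * g y) x.
Proof.
  intros Hf Hg.
  assert (Hr := cont_Re _ _ Hf). assert (Hi := cont_Im _ _ Hf).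
  assert (Gr := cont_Re _ _ Hg). assert (Gi := cont_Im _ _ Hg).
  apply cont_parts; simpl.
  - apply (continuous_minus (V := R_NormedModule));
      apply (continuous_mult (K := R_AbsRing)); assumption.
  - apply (continuous_plus (V := R_NormedModule));
      apply (continuous_mult (K := R_AbsRing)); assumption.
Qed.

(** The uniform structure is that of a product, with squares as balls, whereas all estimates are in
    terms of the modulus; squares and discs compare up to the factor [sqrt 2]. *)
Lemma cont_ball {U : UniformSpace} (f : U -> C) (x : U) :
  cont f x <-> forall e : R, (0 < e)%R -> locally x (fun y => (Cmod (f y - f x) < e)%R).
Proof.
  split.
  - intros H e He.
    assert (Hs : (0 < sqrt 2)%R) by (apply sqrt_lt_R0; lra).
    assert (He' : (0 < e / sqrt 2)%R) by (apply Rdiv_lt_0_compat; lra).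
    assert (Hl := H (ball (f x) (mkposreal _ He')) (locally_ball (f x) (mkposreal _ He'))).
    unfold filtermap in Hl. revert Hl. apply filter_imp. intros y Hy.
    destruct Hy as [H1 H2].
    unfold ball, AbsRing_ball, abs, minus, plus, opp in H1, H2; simpl in H1, H2.
    unfold AbsRing_ball, abs, minus, plus, opp in H1, H2; simpl in H1, H2.
    eapply Rle_lt_trans; [apply Cmod_2Rmax|].
    apply Rmult_lt_reg_l with (/ sqrt 2)%R; [now apply Rinv_0_lt_compat|].
    rewrite <- Rmult_assoc, Rinv_l, Rmult_1_l by lra.
    replace (/ sqrt 2 * e)%R with (e / sqrt 2)%R by (unfold Rdiv; ring).
    apply Rmax_lub_lt; assumption.
  - intros H P [d Hd].
    generalize (H d (cond_pos d)). unfold filtermap. apply filter_imp.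
    intros y Hy. apply Hd. split.
    + unfold ball; simpl. unfold AbsRing_ball, abs, minus, plus, opp; simpl.
      eapply Rle_lt_trans; [|exact Hy]. apply (Re_le_Cmod (f y - f x)).
    + unfold ball; simpl. unfold AbsRing_ball, abs, minus, plus, opp; simpl.
      eapply Rle_lt_trans; [|exact Hy]. apply (Im_le_Cmod (f y - f x)).
Qed.

Lemma locally_Cball (z : C) (e : R) :
  (0 < e)%R -> locally z (fun w : C => (Cmod (w - z) < e)%R).
Proof.
  intros He.
  exact (proj1 (cont_ball (fun w : C => w) z) (continuous_id z) e He).
Qed.

Lemma locally_C_ex (z : C) (P : C -> Prop) :
  locally z P -> exists e : R, (0 < e)%R /\ forall w, (Cmod (w - z) < e)%R -> P w.
Proof.
  intros [d Hd]. exists d. split; [apply cond_pos|]. intros w Hw. apply Hd.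
  split; unfold ball; simpl; unfold AbsRing_ball, abs, minus, plus, opp; simpl;
    (eapply Rle_lt_trans; [|exact Hw]);
    [apply (Re_le_Cmod (w - z))|apply (Im_le_Cmod (w - z))].
Qed.

Lemma cont_Cmod {U : UniformSpace} (f : U -> C) (x : U) :
  cont f x -> continuous (fun y => Cmod (f y)) x.
Proof.
  intros H. unfold Cmod.
  assert (Hr := cont_Re _ _ H). assert (Hi := cont_Im _ _ H).
  apply (continuous_comp (fun y => (fst (f y) ^ 2 + snd (f y) ^ 2)%R) sqrt);
    [|apply continuous_sqrt].
  apply (continuous_ext (fun y => (Re (f y) * Re (f y) + Im (f y) * Im (f y))%R)).
  { intros y. unfold Re, Im. simpl. now rewrite !Rmult_1_r. }
  exact (continuous_plus (V := R_NormedModule) _ _ x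
    (continuous_mult (K := R_AbsRing) _ _ x Hr Hr)
    (continuous_mult (K := R_AbsRing) _ _ x Hi Hi)).
Qed.

Lemma continuous_Rplus {U : UniformSpace} (f g : U -> R) (x : U) :
  continuous f x -> continuous g x -> continuous (fun y => (f y + g y)%R) x.
Proof. apply (continuous_plus (V := R_NormedModule)). Qed.

Lemma continuous_Rmult {U : UniformSpace} (f g : U -> R) (x : U) :
  continuous f x -> continuous g x -> continuous (fun y => (f y * g y)%R) x.
Proof. apply (continuous_mult (K := R_AbsRing)). Qed.

Lemma continuous_Rinv_fun {U : UniformSpace} (f : U -> R) (x : U) :
  continuous f x -> f x <> 0%R -> continuous (fun y => (/ f y)%R) x.
Proof.
  intros H H0. apply (continuous_comp f Rinv); [exact H|]. now apply continuous_Rinv.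
Qed.

Lemma cont_inv {U : UniformSpace} (f : U -> C) (x : U) :
  cont f x -> f x <> 0 -> cont (fun y => / f y) x.
Proof.
  intros H H0.
  assert (Hr := cont_Re _ _ H). assert (Hi := cont_Im _ _ H).
  assert (Hd : continuous (fun y => (/ (Re (f y) ^ 2 + Im (f y) ^ 2))%R) x).
  { apply continuous_Rinv_fun.
    - apply (continuous_ext (fun y => (Re (f y) * Re (f y) + Im (f y) * Im (f y))%R)).
      { intros y. simpl. now rewrite !Rmult_1_r. }
      exact (continuous_Rplus _ _ x
        (continuous_Rmult _ _ x Hr Hr) (continuous_Rmult _ _ x Hi Hi)).
    - intros E. apply H0. apply Cmod_eq_0. unfold Cmod.
      unfold Re, Im in E. rewrite E. apply sqrt_0. }
  apply cont_parts.
  - eapply continuous_ext; [|exact (continuous_Rmult _ _ x Hr Hd)].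
    intros y; reflexivity.
  - eapply continuous_ext;
      [|exact (continuous_Rmult _ _ x (continuous_opp (V := R_NormedModule) _ x Hi) Hd)].
    intros y; reflexivity.
Qed.

Lemma cont_div {U : UniformSpace} (f g : U -> C) (x : U) :
  cont f x -> cont g x -> g x <> 0 -> cont (fun y => f y / g y) x.
Proof. intros. apply cont_mult; [|apply cont_inv]; assumption. Qed.

Lemma cont_pow {U : UniformSpace} (f : U -> C) (n : nat) (x : U) :
  cont f x -> cont (fun y => f y ^ n) x.
Proof.
  intros H. induction n as [|n IH]; simpl; [apply cont_const|].
  apply cont_mult; assumption.
Qed.

Lemma cont_Cexp {U : UniformSpace} (f : U -> C) (x : U) :
  cont f x -> cont (fun y => Cexp (f y)) x.
Proof.
  intros H.
  assert (Hr := cont_Re _ _ H). assert (Hi := cont_Im _ _ H).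
  unfold Cexp. apply cont_pair; apply continuous_Rmult.
  - apply (continuous_comp _ exp); [exact Hr|apply continuous_exp].
  - apply (continuous_comp _ cos); [exact Hi|apply continuous_cos].
  - apply (continuous_comp _ exp); [exact Hr|apply continuous_exp].
  - apply (continuous_comp _ sin); [exact Hi|apply continuous_sin].
Qed.

Lemma Re_pos_neq_0 (z : C) : (0 < Re z)%R -> z <> 0.
Proof. intros H E. rewrite E in H. simpl in H. lra. Qed.

Lemma Re_pos_Cmod (z : C) : (0 < Re z)%R -> (0 < Cmod z)%R.
Proof. intros H. apply Cmod_gt_0. now apply Re_pos_neq_0. Qed.

Lemma cont_Clog {U : UniformSpace} (f : U -> C) (x : U) :
  cont f x -> (0 < Re (f x))%R -> cont (fun y => Clog (f y)) x.
Proof.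
  intros H Hp.
  assert (Hr := cont_Re _ _ H). assert (Hi := cont_Im _ _ H).
  assert (Hm := cont_Cmod _ _ H). assert (Hmp := Re_pos_Cmod _ Hp).
  unfold Clog. apply cont_pair.
  - apply (continuous_comp _ ln); [exact Hm|now apply continuous_ln].
  - apply continuous_Rmult; [apply continuous_const|].
    apply (continuous_comp (fun y => (Im (f y) / (Cmod (f y) + Re (f y)))%R) atan);
      [|apply continuous_atan].
    apply continuous_Rmult; [exact Hi|]. apply continuous_Rinv_fun; [|lra].
    now apply continuous_Rplus.
Qed.

Lemma cont_comp {U V : UniformSpace} (h : V -> C) (f : U -> V) (x : U) :
  continuous f x -> cont h (f x) -> cont (fun y => h (f y)) x.
Proof. apply continuous_comp. Qed.

(** * Exponential and principal logarithm *)

Lemma Cexp_plus (z w : C) : Cexp (z + w) = Cexp z * Cexp w.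
Proof.
  destruct z as [a b], w as [c d]. unfold Cexp, Cplus, Cmult; simpl.
  rewrite exp_plus, cos_plus, sin_plus. f_equal; ring.
Qed.

Lemma Cexp_0 : Cexp 0 = 1.
Proof. apply C_eq_parts; simpl; rewrite exp_0, ?cos_0, ?sin_0; ring. Qed.

Lemma Cexp_opp_l (z : C) : Cexp (- z) * Cexp z = 1.
Proof. rewrite <- Cexp_plus, <- Cexp_0. f_equal. ring. Qed.

Lemma Cexp_neq_0 (z : C) : Cexp z <> 0.
Proof.
  intros E. generalize (Cexp_opp_l z). rewrite E, Cmult_0_r.
  intros H. apply (f_equal Re) in H. simpl in H. lra.
Qed.

Lemma Cexp_opp (z : C) : Cexp (- z) = / Cexp z.
Proof.
  rewrite <- (Cmult_1_l (/ _)), <- (Cexp_opp_l z), <- Cmult_assoc, Cinv_r, Cmult_1_r;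
    [reflexivity|apply Cexp_neq_0].
Qed.

Lemma Cmod_Cexp (z : C) : Cmod (Cexp z) = exp (Re z).
Proof.
  unfold Cmod, Cexp; simpl fst; simpl snd.
  rewrite <- (sqrt_pow2 (exp (Re z))) at 3 by (left; apply exp_pos).
  f_equal. generalize (sin2_cos2 (Im z)); unfold Rsqr. intros H.
  transitivity (exp (Re z) ^ 2 *
    (sin (Im z) * sin (Im z) + cos (Im z) * cos (Im z)))%R; [|rewrite H]; ring.
Qed.

Lemma Cexp_RtoC (x : R) : Cexp (RtoC x) = RtoC (exp x).
Proof. apply C_eq_parts; simpl; rewrite ?cos_0, ?sin_0; ring. Qed.

Lemma Cexp_ln (x : R) : (0 < x)%R -> Cexp (RtoC (ln x)) = RtoC x.
Proof. intros H. now rewrite Cexp_RtoC, exp_ln. Qed.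

Lemma Cexp_mult_nat (z : C) (n : nat) : Cexp (RtoC (INR n) * z) = Cexp z ^ n.
Proof.
  induction n as [|n IH].
  - simpl. rewrite Cmult_0_l. apply Cexp_0.
  - rewrite S_INR, RtoC_plus. simpl Cpow. rewrite <- IH, <- Cexp_plus. f_equal. ring.
Qed.

(** With [u = y / (m + x)], the tangent of half the argument, the double angle formulas must give
    [(1 - u^2) / (1 + u^2) = x / m] and [2 u / (1 + u^2) = y / m]. Both follow from
    [(1 + u^2) (m + x) = 2 m]. *)
Lemma Cexp_Clog (z : C) : (0 < Re z)%R -> Cexp (Clog z) = z.
Proof.
  intros Hp. assert (Hm := Re_pos_Cmod _ Hp).
  set (x := Re z) in *. set (y := Im z). set (m := Cmod z) in *.
  assert (Hmm : (m * m = x * x + y * y)%R).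
  { unfold m, x, y. generalize (Cmod2_alt z). simpl. lra. }
  set (u := (y / (m + x))%R).
  assert (Hu : (0 < 1 + u²)%R) by (generalize (Rle_0_sqr u); lra).
  assert (Hs := sqrt_lt_R0 _ Hu).
  assert (Hss : (sqrt (1 + u²) * sqrt (1 + u²) = 1 + u²)%R) by (apply sqrt_sqrt; lra).
  assert (Hm' : (m + x <> 0)%R) by lra.
  assert (Huy : (u * (m + x) = y)%R) by (unfold u; field; lra).
  unfold Cexp, Clog; simpl. fold x y m u.
  rewrite exp_ln by assumption.
  replace (2 * atan u)%R with (atan u + atan u)%R by ring.
  rewrite cos_plus, sin_plus, sin_atan, cos_atan.
  set (s := sqrt (1 + u²)) in *. unfold Rsqr in *.
  assert (K : ((1 + u * u) * (m + x) = 2 * m)%R).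
  { apply Rmult_eq_reg_r with (m + x)%R; [|lra].
    transitivity ((m + x) * (m + x) + (u * (m + x)) * (u * (m + x)))%R; [ring|].
    rewrite Huy. nra. }
  assert (A1 : (m * (1 / s * (1 / s) - u / s * (u / s)) = x)%R).
  { replace (m * (1 / s * (1 / s) - u / s * (u / s)))%R
      with (m * (1 - u * u) / (s * s))%R by (field; lra).
    rewrite Hss. apply Rmult_eq_reg_r with (1 + u * u)%R; [|lra].
    unfold Rdiv. rewrite Rmult_assoc, Rinv_l, Rmult_1_r by lra.
    apply Rmult_eq_reg_r with (m + x)%R; [|lra].
    transitivity (m * (2 * (m + x) - (1 + u * u) * (m + x)))%R; [ring|].
    transitivity (x * ((1 + u * u) * (m + x)))%R; [|ring]. rewrite K. ring. }
  assert (A2 : (m * (u / s * (1 / s) + 1 / s * (u / s)) = y)%R).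
  { replace (m * (u / s * (1 / s) + 1 / s * (u / s)))%R
      with (2 * m * u / (s * s))%R by (field; lra).
    rewrite Hss, <- K, <- Huy. field. lra. }
  rewrite A1, A2. symmetry. apply C_pair.
Qed.

Lemma Clog_pos (x : R) : (0 < x)%R -> Clog (RtoC x) = RtoC (ln x).
Proof.
  intros H. unfold Clog. rewrite Cmod_RtoC_nonneg by lra. simpl.
  unfold Rdiv. rewrite Rmult_0_l, atan_0, Rmult_0_r. reflexivity.
Qed.

Lemma Clog_1 : Clog 1 = 0.
Proof. change (RtoC 1) with (RtoC 1). rewrite Clog_pos by lra. now rewrite ln_1. Qed.

(** Everything comes from [1 + t <= exp t]. Taken at [- x] it gives [exp x <= 1 / (1 - x)], which is
    sharp enough up to [1/2]; beyond, taken at [1 - x] and combined with [exp 1 <= 3], it gives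
    [exp x <= 3 / (2 - x)]. *)
Lemma Rabs_exp_minus_1 (x : R) :
  (Rabs x <= 1 -> Rabs (exp x - 1 - x) <= 2 * (x * x))%R.
Proof.
  intros H. assert (Hx : (-1 <= x <= 1)%R) by (apply Rabs_le_between; exact H).
  assert (H1 := exp_ineq1_le x). rewrite Rabs_pos_eq by lra.
  assert (Hpx := exp_pos x).
  destruct (Rle_lt_dec x (1 / 2)) as [Hs|Hs].
  - assert (H2 := exp_ineq1_le (- x)). rewrite exp_Ropp in H2.
    assert (H3 : ((1 - x) * exp x <= 1)%R).
    { apply Rmult_le_reg_r with (/ exp x)%R; [now apply Rinv_0_lt_compat|].
      rewrite Rmult_assoc, Rinv_r, Rmult_1_r by lra. lra. }
    assert (H4 : (1 <= (1 + x + 2 * (x * x)) * (1 - x))%R) by nra.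
    nra.
  - assert (He : (exp x = exp (x - 1) * exp 1)%R) by (rewrite <- exp_plus; f_equal; ring).
    assert (H4 := exp_le_3).
    assert (H5 : (1 + (1 - x) <= exp (1 - x))%R) by apply exp_ineq1_le.
    assert (H6 : (exp (x - 1) = / exp (1 - x))%R)
      by (rewrite <- exp_Ropp; f_equal; ring).
    assert (Hp := exp_pos (1 - x)).
    assert (H7 : (exp x * exp (1 - x) <= 3)%R).
    { rewrite He, H6. 
      replace (/ exp (1 - x) * exp 1 * exp (1 - x))%R with (exp 1)%R by (field; lra). lra. }
    assert (H8 : (exp x * (2 - x) <= 3)%R) by nra.
    (* After expansion the difference of the two sides is [(1 - x) (2 x - 1) (1 + x) + x (2 x - 1)],
       and both terms are nonnegative on this range. *)
    assert (H9 : (3 <= (1 + x + 2 * (x * x)) * (2 - x))%R).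
    { assert (0 <= (1 - x) * (2 * x - 1) * (1 + x))%R
        by (repeat apply Rmult_le_pos; lra). nra. }
    apply Rmult_le_reg_r with (2 - x)%R; lra.
Qed.

(** [sin_lb] is a Taylor polynomial bounding the sine from below; for [0 <= t <= 1] its terms after
    the first are dominated by [t * t]. Negative arguments follow by oddness. *)
Lemma Rabs_sin_minus (y : R) : (Rabs y <= 1 -> Rabs (sin y - y) <= y * y)%R.
Proof.
  assert (P : (forall t, 0 <= t <= 1 -> Rabs (sin t - t) <= t * t)%R).
  { intros t Ht. destruct (Req_dec t 0) as [->|Hn].
    { rewrite sin_0, Rminus_0_r, Rabs_R0. lra. }
    assert (H1 : (sin t < t)%R) by (apply sin_lt_x; lra).
    assert (H2 := proj1 (SIN t ltac:(lra) ltac:(generalize PI2_3_2; lra))).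
    unfold sin_lb, sin_approx, sin_term in H2. simpl in H2.
    rewrite Rabs_left1 by lra. 
    assert (t * t * t <= t * t)%R by nra.
    assert (0 <= t * t * t)%R by nra.
    assert (t * t * t * (t * t) <= t * t * t)%R by nra.
    assert (0 <= t * t * t * (t * t))%R by nra.
    assert (t * t * t * (t * t) * (t * t) <= t * t * t * (t * t))%R by nra.
    nra. }
  intros Hy. destruct (Rle_lt_dec 0 y) as [H|H].
  - apply P. rewrite Rabs_pos_eq in Hy by lra. lra.
  - rewrite Rabs_left in Hy by lra.
    replace (sin y - y)%R with (- (sin (- y) - - y))%R by (rewrite sin_neg; ring).
    rewrite Rabs_Ropp. replace (y * y)%R with (- y * - y)%R by ring. apply P. lra.
Qed.

Lemma Rabs_cos_minus_1 (y : R) : (Rabs y <= 1 -> Rabs (cos y - 1) <= y * y)%R.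
Proof.
  intros H. replace y with (2 * (y / 2))%R at 1 by field.
  rewrite cos_2a_sin. replace (1 - 2 * sin (y / 2) * sin (y / 2) - 1)%R
    with (- (2 * (sin (y / 2) * sin (y / 2))))%R by ring.
  assert (Hy : (-1 <= y <= 1)%R) by (apply Rabs_le_between; exact H).
  assert (H1 := Rabs_sin_minus (y / 2)
    ltac:(apply Rabs_le_between; lra)).
  apply Rabs_le_between in H1.
  assert (Hs : (Rabs (sin (y / 2)) <= Rabs (y / 2))%R).
  { destruct (Rle_lt_dec 0 y) as [H0|H0].
    - destruct (Req_dec y 0) as [->|Hn].
      + replace (0 / 2)%R with 0%R by field. rewrite sin_0. lra.
      + assert (Hl := sin_lt_x (y / 2) ltac:(lra)).
        assert (0 < sin (y / 2))%R by (apply sin_gt_0; generalize PI2_3_2; lra).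
        rewrite !Rabs_pos_eq by lra. lra.
    - assert (Hl := sin_lt_x (- (y / 2)) ltac:(lra)).
      assert (0 < sin (- (y / 2)))%R by (apply sin_gt_0; generalize PI2_3_2; lra).
      rewrite sin_neg in *. rewrite !Rabs_left1 by lra. lra. }
  rewrite Rabs_Ropp, Rabs_pos_eq by nra.
  assert (Hq : (sin (y / 2) * sin (y / 2) <= (y / 2) * (y / 2))%R).
  { apply Rsqr_le_abs_1 in Hs. exact Hs. }
  nra.
Qed.

(** The real part contributes [5 |h|^2] and the imaginary part [7 |h|^2], whence 12. What matters is
    the quadratic order: it yields the derivative of [Cexp] at 0 and the summability behind Euler's
    limit. *)
Lemma Cmod_Cexp_minus_1_lin (h : C) :
  (Cmod h <= 1)%R -> (Cmod (Cexp h - 1 - h) <= 12 * (Cmod h * Cmod h))%R.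
Proof.
  intros Hh. assert (Hx := Re_le_Cmod h). assert (Hy := Im_le_Cmod h).
  set (x := Re h) in *. set (y := Im h) in *. set (m := Cmod h) in *.
  assert (Hm : (0 <= m)%R) by apply Cmod_ge_0.
  assert (E1 := Rabs_exp_minus_1 x ltac:(lra)).
  assert (E2 := Rabs_sin_minus y ltac:(lra)).
  assert (E3 := Rabs_cos_minus_1 y ltac:(lra)).
  assert (Sx : (x * x <= m * m)%R).
  { rewrite <- (Rabs_pos_eq m) in Hx by lra. apply Rsqr_le_abs_1 in Hx. exact Hx. }
  assert (Sy : (y * y <= m * m)%R).
  { rewrite <- (Rabs_pos_eq m) in Hy by lra. apply Rsqr_le_abs_1 in Hy. exact Hy. }
  eapply Rle_trans; [apply Cmod_le_parts|].
  change (Re (Cexp h - 1 - h)) with (exp x * cos y + - (1) + - x)%R.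
  change (Im (Cexp h - 1 - h)) with (exp x * sin y + - 0 + - y)%R.
  apply Rabs_le_between in E1. apply Rabs_le_between in E2. apply Rabs_le_between in E3.
  apply Rabs_le_between in Hx. apply Rabs_le_between in Hy.
  assert (Hex : (0 < exp x <= 3)%R).
  { split; [apply exp_pos|]. eapply Rle_trans; [|apply exp_le_3].
    destruct (Req_dec x 1) as [->|]; [lra|]. left. apply exp_increasing. lra. }
  assert (B1 : (Rabs (exp x * cos y + - (1) + - x) <= 5 * (m * m))%R).
  { apply Rabs_le_between. 
    replace (exp x * cos y + - (1) + - x)%R
      with ((exp x - 1 - x) + exp x * (cos y - 1))%R by ring. nra. }
  assert (Hxy : (- (m * m) <= x * y <= m * m)%R) by nra.
  assert (B2 : (Rabs (exp x * sin y + - 0 + - y) <= 7 * (m * m))%R).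
  { apply Rabs_le_between.
    replace (exp x * sin y + - 0 + - y)%R
      with (exp x * (sin y - y) + (exp x - 1 - x) * y + x * y)%R by ring.
    assert (- (2 * (m * m)) <= (exp x - 1 - x) * y <= 2 * (m * m))%R by nra.
    nra. }
  lra.
Qed.

Lemma Cmod_Cexp_minus_1 (h : C) : (Cmod (Cexp h - 1) <= 13 * Cmod h * exp (Cmod h))%R.
Proof.
  assert (Hm := Cmod_ge_0 h).
  assert (He := exp_ineq1_le (Cmod h)).
  destruct (Rle_lt_dec (Cmod h) 1) as [H|H].
  - assert (H1 := Cmod_Cexp_minus_1_lin h H).
    replace (Cexp h - 1) with ((Cexp h - 1 - h) + h) by ring.
    eapply Rle_trans; [apply Cmod_triangle|]. nra.
  - eapply Rle_trans; [apply Cmod_minus_le|]. rewrite Cmod_Cexp, Cmod_1.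
    assert (exp (Re h) <= exp (Cmod h))%R.
    { assert (Hle : (Re h <= Cmod h)%R)
        by (eapply Rle_trans; [apply Rle_abs|apply Re_le_Cmod]).
      destruct (Req_dec (Re h) (Cmod h)) as [E|E]; [rewrite E; lra|].
      left. apply exp_increasing. lra. }
    assert (exp (Cmod h) <= Cmod h * exp (Cmod h))%R by nra. lra.
Qed.

(** * Derivatives *)

(* Caratheodory's form of the derivative of [f] with respect to [i]; it covers
   both functions of a complex variable ([holo]) and of a real one ([rder]). *)
Definition dq {X : UniformSpace} (i f : X -> C) (x : X) (l : C) : Prop :=
  exists q : X -> C, cont q x /\ q x = l /\
    locally x (fun y => f y = f x + (i y - i x) * q y).

Notation holo := (@dq C_UniformSpace (fun w : C => w)).
Notation rder := (@dq R_UniformSpace RtoC).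

Lemma dq_eq {X : UniformSpace} (i f : X -> C) (x : X) (l l' : C) :
  dq i f x l -> l = l' -> dq i f x l'.
Proof. now intros H <-. Qed.

Lemma dq_ext_loc {X : UniformSpace} (i f g : X -> C) (x : X) (l : C) :
  locally x (fun y => f y = g y) -> dq i f x l -> dq i g x l.
Proof.
  intros He [q [H1 [H2 H3]]]. exists q. repeat split; [exact H1|exact H2|].
  assert (Hx := locally_singleton _ _ He). simpl in Hx.
  generalize (filter_and _ _ He H3). apply filter_imp.
  intros y [E1 E2]. now rewrite <- E1, <- Hx.
Qed.

Lemma dq_ext {X : UniformSpace} (i f g : X -> C) (x : X) (l : C) :
  (forall y, f y = g y) -> dq i f x l -> dq i g x l.
Proof. intros H. apply dq_ext_loc. now apply filter_forall. Qed.

Lemma dq_const {X : UniformSpace} (i : X -> C) (c : C) (x : X) :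
  dq i (fun _ => c) x 0.
Proof.
  exists (fun _ => 0). repeat split; [apply cont_const|].
  apply filter_forall. intros y. ring.
Qed.

Lemma dq_id {X : UniformSpace} (i : X -> C) (x : X) : dq i i x 1.
Proof.
  exists (fun _ => 1). repeat split; [apply cont_const|].
  apply filter_forall. intros y. ring.
Qed.

Lemma dq_cont {X : UniformSpace} (i f : X -> C) (x : X) (l : C) :
  cont i x -> dq i f x l -> cont f x.
Proof.
  intros Hi [q [H1 [H2 H3]]].
  apply continuous_ext_loc with (fun y => f x + (i y - i x) * q y).
  - revert H3. apply filter_imp. intros y ->. reflexivity.
  - apply cont_plus; [apply cont_const|]. apply cont_mult; [|exact H1].
    apply cont_minus; [exact Hi|apply cont_const].
Qed.

Lemma dq_plus {X : UniformSpace} (i f g : X -> C) (x : X) (l m : C) :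
  dq i f x l -> dq i g x m -> dq i (fun y => f y + g y) x (l + m).
Proof.
  intros [q [H1 [H2 H3]]] [r [G1 [G2 G3]]].
  exists (fun y => q y + r y). repeat split.
  - now apply cont_plus.
  - now rewrite H2, G2.
  - generalize (filter_and _ _ H3 G3). apply filter_imp.
    intros y [E1 E2]. rewrite E1, E2. ring.
Qed.

Lemma dq_opp {X : UniformSpace} (i f : X -> C) (x : X) (l : C) :
  dq i f x l -> dq i (fun y => - f y) x (- l).
Proof.
  intros [q [H1 [H2 H3]]].
  exists (fun y => - q y). repeat split.
  - now apply cont_opp.
  - now rewrite H2.
  - revert H3. apply filter_imp. intros y ->. ring.
Qed.

Lemma dq_minus {X : UniformSpace} (i f g : X -> C) (x : X) (l m : C) :
  dq i f x l -> dq i g x m -> dq i (fun y => f y - g y) x (l - m).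
Proof. intros H1 H2. apply dq_plus; [exact H1|now apply dq_opp]. Qed.

Lemma dq_mult {X : UniformSpace} (i f g : X -> C) (x : X) (l m : C) :
  cont i x -> dq i f x l -> dq i g x m ->
  dq i (fun y => f y * g y) x (l * g x + f x * m).
Proof.
  intros Hi Hf Hg. assert (Cg := dq_cont _ _ _ _ Hi Hg).
  destruct Hf as [q [H1 [H2 H3]]]. destruct Hg as [r [G1 [G2 G3]]].
  exists (fun y => q y * g y + f x * r y). repeat split.
  - apply cont_plus; apply cont_mult; try assumption. apply cont_const.
  - now rewrite H2, G2.
  - generalize (filter_and _ _ H3 G3). apply filter_imp.
    intros y [E1 E2]. rewrite E1, E2. ring.
Qed.

Lemma dq_scal {X : UniformSpace} (i f : X -> C) (c : C) (x : X) (l : C) :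
  dq i f x l -> dq i (fun y => c * f y) x (c * l).
Proof.
  intros [q [H1 [H2 H3]]].
  exists (fun y => c * q y). repeat split.
  - apply cont_mult; [apply cont_const|exact H1].
  - now rewrite H2.
  - revert H3. apply filter_imp. intros y ->. ring.
Qed.

Lemma dq_comp {X : UniformSpace} (i f : X -> C) (h : C -> C) (x : X) (l m : C) :
  cont i x -> dq i f x l -> holo h (f x) m ->
  dq i (fun y => h (f y)) x (m * l).
Proof.
  intros Hi Hf [r [G1 [G2 G3]]]. assert (Cf := dq_cont _ _ _ _ Hi Hf).
  destruct Hf as [q [H1 [H2 H3]]].
  exists (fun y => r (f y) * q y). repeat split.
  - apply cont_mult; [|exact H1]. now apply (cont_comp r f).
  - now rewrite H2, G2.
  - assert (L := Cf _ G3). unfold filtermap in L.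
    generalize (filter_and _ _ H3 L). apply filter_imp.
    intros y [E1 E2]. rewrite E2. rewrite E1 at 1. ring.
Qed.

Lemma cont_C_id (z : C) : cont (fun w : C => w) z.
Proof. apply continuous_id. Qed.

Lemma cont_R_RtoC (t : R) : cont RtoC t.
Proof. apply cont_RtoC. apply continuous_id. Qed.

#[local] Hint Resolve cont_C_id cont_R_RtoC : core.

Lemma holo_Cexp_0 : holo Cexp (RtoC 0) 1.
Proof.
  exists (fun h : C => if excluded_middle_informative (h = 0) then RtoC 1 else (Cexp h - 1) / h).
  repeat split.
  - apply cont_ball. intros e He.
    assert (Hp : (0 < Rmin 1 (e / 13))%R)
      by (apply Rmin_glb_lt; [lra|apply Rdiv_lt_0_compat; lra]).
    generalize (locally_Cball (RtoC 0) _ Hp). apply filter_imp. intros h Hh.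
    change C in h. replace (h - 0) with h in Hh by ring.
    assert (H1 : (Cmod h < 1)%R) by (eapply Rlt_le_trans; [exact Hh|apply Rmin_l]).
    assert (H2 : (Cmod h < e / 13)%R) by (eapply Rlt_le_trans; [exact Hh|apply Rmin_r]).
    destruct (excluded_middle_informative (RtoC 0 = RtoC 0)) as [_|N]; [|now elim N].
    destruct (excluded_middle_informative (h = 0)) as [_|N].
    { replace (1 - 1) with (RtoC 0) by ring. rewrite Cmod_0. exact He. }
    assert (Hm : (0 < Cmod h)%R) by now apply Cmod_gt_0.
    replace ((Cexp h - 1) / h - 1) with ((Cexp h - 1 - h) / h) by (field; exact N).
    rewrite Cmod_div by exact N.
    assert (H3 := Cmod_Cexp_minus_1_lin h ltac:(lra)).
    apply Rle_lt_trans with (12 * Cmod h)%R; [|lra].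
    apply Rmult_le_reg_r with (Cmod h); [exact Hm|].
    unfold Rdiv. rewrite Rmult_assoc, Rinv_l, Rmult_1_r by lra. lra.
  - destruct (excluded_middle_informative (RtoC 0 = RtoC 0)) as [_|N]; [reflexivity|now elim N].
  - apply filter_forall. intros h. change C in h. rewrite Cexp_0.
    destruct (excluded_middle_informative (h = 0)) as [->|N]; [rewrite Cexp_0; ring|].
    field. exact N.
Qed.

Lemma holo_Cexp (z : C) : holo Cexp z (Cexp z).
Proof.
  apply dq_ext with (fun w => Cexp z * Cexp (w - z)).
  { intros w. change C in w. rewrite <- Cexp_plus. f_equal. ring. }
  apply dq_eq with (Cexp z * 1); [|ring]. apply dq_scal.
  apply dq_eq with (1 * (1 - 0)); [|ring].
  apply (dq_comp _ (fun w => w - z) Cexp); [auto| |].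
  - apply dq_minus; [apply dq_id|apply dq_const].
  - replace (z - z) with (RtoC 0) by ring. apply holo_Cexp_0.
Qed.

Lemma Re_pos_open (z : C) : (0 < Re z)%R -> locally z (fun w => (0 < Re w)%R).
Proof.
  intros H. generalize (locally_Cball z (Re z) H). apply filter_imp. intros w Hw. change C in w.
  assert (H1 := Re_le_Cmod (w - z)).
  assert (H2 : Re (w - z) = (Re w - Re z)%R) by reflexivity. rewrite H2 in H1.
  assert (H3 : (Rabs (Re w - Re z) < Re z)%R) by lra.
  apply Rabs_lt_between in H3. lra.
Qed.

(** In Caratheodory's form the inverse function rule is algebra: as [Cexp (Clog w) = w], the
    quotient of [Clog] at [w] is the reciprocal of the quotient of [Cexp] at [Clog w], which stays
    away from 0 near [z] by continuity. *)
Lemma holo_Clog (z : C) : (0 < Re z)%R -> holo Clog z (/ z).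
Proof.
  intros Hp. assert (Hz := Re_pos_neq_0 _ Hp).
  assert (Cl : cont Clog z) by (apply (cont_Clog (fun w => w)); auto).
  destruct (holo_Cexp (Clog z)) as [q [H1 [H2 H3]]].
  rewrite Cexp_Clog in H2 by exact Hp.
  assert (Cq : cont (fun w => q (Clog w)) z) by now apply (cont_comp q Clog).
  exists (fun w => / q (Clog w)). repeat split.
  - apply cont_inv; [exact Cq|]. now rewrite H2.
  - now rewrite H2.
  - assert (Hn : locally z (fun w => q (Clog w) <> 0)).
    { assert (Hm : (0 < Cmod z)%R) by now apply Cmod_gt_0.
      generalize (proj1 (cont_ball _ _) Cq _ Hm). apply filter_imp.
      intros w Hw E. change C in w. rewrite E, H2 in Hw.
      replace (0 - z) with (- z) in Hw by ring. rewrite Cmod_opp in Hw. lra. }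
    assert (L := Cl _ H3). unfold filtermap in L.
    assert (P0 := Re_pos_open _ Hp).
    generalize (filter_and _ _ Hn (filter_and _ _ L P0)).
    apply filter_imp. intros w [N [E P]]. change C in w.
    rewrite !Cexp_Clog in E by assumption.
    assert (E' : w - z = (Clog w - Clog z) * q (Clog w)) by (rewrite E at 1; ring).
    rewrite E'. field. exact N.
Qed.

(** Convertible with [lpow (lprinc z) k], the form in which it occurs on the cells of the chains. *)
Definition cpow (z k : C) : C := Cexp (k * Clog z).

Lemma cpow_plus (z k l : C) : cpow z (k + l) = cpow z k * cpow z l.
Proof. unfold cpow. rewrite <- Cexp_plus. f_equal. ring. Qed.

Lemma cpow_0 (z : C) : cpow z 0 = 1.
Proof. unfold cpow. rewrite Cmult_0_l. apply Cexp_0. Qed.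

Lemma cpow_1 (z : C) : (0 < Re z)%R -> cpow z 1 = z.
Proof. intros H. unfold cpow. rewrite Cmult_1_l. now apply Cexp_Clog. Qed.

Lemma cpow_S (z k : C) : (0 < Re z)%R -> cpow z (k + 1) = z * cpow z k.
Proof. intros H. rewrite cpow_plus, cpow_1 by exact H. ring. Qed.

Lemma cpow_pred (z k : C) : (0 < Re z)%R -> cpow z k = z * cpow z (k - 1).
Proof. intros H. rewrite <- cpow_S by exact H. f_equal. ring. Qed.

Lemma cpow_nat (z k : C) (n : nat) :
  (0 < Re z)%R -> cpow z (k + RtoC (INR n)) = cpow z k * z ^ n.
Proof.
  intros H. rewrite cpow_plus. f_equal. unfold cpow.
  now rewrite Cexp_mult_nat, Cexp_Clog.
Qed.

Lemma cpow_one (k : C) : cpow 1 k = 1.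
Proof. unfold cpow. rewrite Clog_1, Cmult_0_r. apply Cexp_0. Qed.

Lemma cont_cpow {U : UniformSpace} (f : U -> C) (k : C) (x : U) :
  cont f x -> (0 < Re (f x))%R -> cont (fun y => cpow (f y) k) x.
Proof.
  intros H Hp. unfold cpow. apply cont_Cexp. apply cont_mult; [apply cont_const|].
  now apply cont_Clog.
Qed.

Lemma dq_cpow {X : UniformSpace} (i f : X -> C) (k : C) (x : X) (l : C) :
  cont i x -> dq i f x l -> (0 < Re (f x))%R ->
  dq i (fun y => cpow (f y) k) x (k * cpow (f x) (k - 1) * l).
Proof.
  intros Hi Hf Hp. assert (Hz := Re_pos_neq_0 _ Hp).
  apply (dq_comp i f (fun z => cpow z k)); [exact Hi|exact Hf|].
  unfold cpow at 1.
  apply dq_eq with (Cexp (k * Clog (f x)) * (k * / f x)).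
  - apply (dq_comp (X := C_UniformSpace) _ (fun z => k * Clog z) Cexp); [auto| |].
    + apply dq_scal. now apply holo_Clog.
    + apply holo_Cexp.
  - change (Cexp (k * Clog (f x))) with (cpow (f x) k).
    rewrite (cpow_pred (f x) k Hp). field. exact Hz.
Qed.

Lemma dq_Cexp {X : UniformSpace} (i f : X -> C) (x : X) (l : C) :
  cont i x -> dq i f x l -> dq i (fun y => Cexp (f y)) x (Cexp (f x) * l).
Proof. intros Hi Hf. apply (dq_comp i f Cexp); auto. apply holo_Cexp. Qed.

Lemma holo_rder (h : C -> C) (t : R) (m : C) :
  holo h (RtoC t) m -> rder (fun s => h (RtoC s)) t m.
Proof.
  intros H. apply dq_eq with (m * 1); [|ring].
  apply (dq_comp RtoC RtoC h); [auto|apply dq_id|exact H].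
Qed.

Lemma scal_C_R (k : R) (z : C) : scal (V := C_R_NormedModule) k z = RtoC k * z.
Proof.
  destruct z as [x y]. unfold scal; simpl. unfold prod_scal; simpl.
  unfold scal; simpl. unfold mult, Cmult; simpl. f_equal; ring.
Qed.

Lemma rder_is_derive (f : R -> C) (t : R) (l : C) :
  rder f t l -> is_derive (V := C_R_NormedModule) f t l.
Proof.
  intros [q [H1 [H2 H3]]]. split.
  - apply is_linear_scal_l.
  - intros x Hx. assert (E := @is_filter_lim_locally_unique R_AbsRing R_NormedModule _ _ Hx).
    rewrite <- E. clear Hx E x. intros e.
    generalize (filter_and _ _ H3 (proj1 (cont_ball _ _) H1 e (cond_pos e))).
    apply filter_imp. intros y [E1 E2].
    rewrite <- Cmod_norm.
    change (norm (minus y t)) with (Rabs (y - t)).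
    match goal with |- (Cmod ?a <= _)%R =>
      replace a with ((RtoC y - RtoC t) * (q y - q t)) end.
    + rewrite Cmod_mult, <- RtoC_minus, Cmod_R.
      rewrite Rmult_comm. apply Rmult_le_compat_r; [apply Rabs_pos|lra].
    + match goal with |- _ = minus ?u (scal ?k ?v) =>
        change ((RtoC y - RtoC t) * (q y - q t) = u - scal (V := C_R_NormedModule) k v) end.
      rewrite scal_C_R.
      change (minus (f y) (f t)) with (f y - f t). change (minus y t) with (y - t)%R.
      rewrite E1, H2, RtoC_minus. ring.
Qed.

Lemma rder_CDerive (f : R -> C) (t : R) (l : C) : rder f t l -> CDerive f t = l.
Proof.
  intros H. apply rder_is_derive in H.
  unfold CDerive. rewrite (C_pair l). f_equal; apply is_derive_unique.
  - destruct H as [_ H]. split; [apply is_linear_scal_l|].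
    intros x Hx e. generalize (H x Hx e). apply filter_imp. intros y Hy.
    eapply Rle_trans; [|exact Hy].
    rewrite <- Cmod_norm. eapply Rle_trans; [|apply Re_le_Cmod].
    right. reflexivity.
  - destruct H as [_ H]. split; [apply is_linear_scal_l|].
    intros x Hx e. generalize (H x Hx e). apply filter_imp. intros y Hy.
    eapply Rle_trans; [|exact Hy].
    rewrite <- Cmod_norm. eapply Rle_trans; [|apply Im_le_Cmod].
    right. reflexivity.
Qed.

Ltac cont_step :=
  match goal with
  | |- _ => assumption
  | |- continuous (fun _ => ?c) ?x => apply (cont_const c x)
  | |- continuous (fun y => y) ?x => apply (cont_C_id x)
  | |- continuous (fun y => RtoC y) ?x => apply (cont_R_RtoC x)
  | |- continuous RtoC ?x => apply (cont_R_RtoC x)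
  | |- continuous (fun y => Cplus (@?f y) (@?g y)) ?x => apply (cont_plus f g x)
  | |- continuous (fun y => Cminus (@?f y) (@?g y)) ?x => apply (cont_minus f g x)
  | |- continuous (fun y => Copp (@?f y)) ?x => apply (cont_opp f x)
  | |- continuous (fun y => Cmult (@?f y) (@?g y)) ?x => apply (cont_mult f g x)
  | |- continuous (fun y => Cpow (@?f y) ?n) ?x => apply (cont_pow f n x)
  | |- continuous (fun y => Cexp (@?f y)) ?x => apply (cont_Cexp f x)
  | |- continuous (fun y => cpow (@?f y) ?k) ?x => apply (cont_cpow f k x)
  end.

Ltac cont_tac := repeat cont_step.

(** * Integrals of complex-valued functions *)

Notation isI := (@is_RInt C_R_NormedModule).
Notation exI := (@ex_RInt C_R_NormedModule).

Lemma isI_unique (f : R -> C) (a b : R) (l : C) : isI f a b l -> CInt f a b = l.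
Proof. intros H. apply (is_RInt_unique (V := C_R_CompleteNormedModule)). exact H. Qed.

Lemma isI_CInt (f : R -> C) (a b : R) : exI f a b -> isI f a b (CInt f a b).
Proof. intros H. apply (RInt_correct (V := C_R_CompleteNormedModule)). exact H. Qed.

Lemma isI_ext (f g : R -> C) (a b : R) (l : C) :
  (a <= b)%R -> (forall t, (a <= t <= b)%R -> f t = g t) -> isI f a b l -> isI g a b l.
Proof.
  intros Hab H. apply is_RInt_ext. intros t Ht.
  rewrite Rmin_left, Rmax_right in Ht by exact Hab. apply H. lra.
Qed.

Lemma exI_ext (f g : R -> C) (a b : R) :
  (a <= b)%R -> (forall t, (a <= t <= b)%R -> f t = g t) -> exI f a b -> exI g a b.
Proof. intros Hab H [l Hl]. exists l. now apply isI_ext with f. Qed.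

Lemma CInt_ext (f g : R -> C) (a b : R) :
  (a <= b)%R -> (forall t, (a <= t <= b)%R -> f t = g t) -> CInt f a b = CInt g a b.
Proof.
  intros Hab H. apply (RInt_ext (V := C_R_CompleteNormedModule)). intros t Ht.
  rewrite Rmin_left, Rmax_right in Ht by exact Hab. apply H. lra.
Qed.

Lemma isI_plus (f g : R -> C) (a b : R) (l m : C) :
  isI f a b l -> isI g a b m -> isI (fun t => f t + g t) a b (l + m).
Proof. apply (is_RInt_plus (V := C_R_NormedModule)). Qed.

Lemma isI_opp (f : R -> C) (a b : R) (l : C) :
  isI f a b l -> isI (fun t => - f t) a b (- l).
Proof. apply (is_RInt_opp (V := C_R_NormedModule)). Qed.

Lemma isI_minus (f g : R -> C) (a b : R) (l m : C) :
  isI f a b l -> isI g a b m -> isI (fun t => f t - g t) a b (l - m).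
Proof. apply (is_RInt_minus (V := C_R_NormedModule)). Qed.

(** The values are integrated in a normed module over the reals, so linearity over a complex [c] has
    to be assembled from the components. *)
Lemma isI_scal (f : R -> C) (c : C) (a b : R) (l : C) :
  isI f a b l -> isI (fun t => c * f t) a b (c * l).
Proof.
  intros H.
  assert (H1 := is_RInt_fct_extend_fst (U := R_NormedModule) (V := R_NormedModule) _ _ _ _ H).
  assert (H2 := is_RInt_fct_extend_snd (U := R_NormedModule) (V := R_NormedModule) _ _ _ _ H).
  apply (is_RInt_fct_extend_pair (U := R_NormedModule) (V := R_NormedModule)).
  - exact (is_RInt_minus (V := R_NormedModule) _ _ _ _ _ _
      (is_RInt_scal (V := R_NormedModule) _ _ _ (fst c) _ H1)
      (is_RInt_scal (V := R_NormedModule) _ _ _ (snd c) _ H2)).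
  - exact (is_RInt_plus (V := R_NormedModule) _ _ _ _ _ _
      (is_RInt_scal (V := R_NormedModule) _ _ _ (fst c) _ H2)
      (is_RInt_scal (V := R_NormedModule) _ _ _ (snd c) _ H1)).
Qed.

Lemma isI_const (c : C) (a b : R) : isI (fun _ => c) a b (RtoC (b - a) * c).
Proof.
  rewrite <- scal_C_R. apply (is_RInt_const (V := C_R_NormedModule)).
Qed.

Lemma exI_cont (f : R -> C) (a b : R) :
  (a <= b)%R -> (forall t, (a <= t <= b)%R -> cont f t) -> exI f a b.
Proof.
  intros Hab H. apply (ex_RInt_continuous (V := C_R_CompleteNormedModule)).
  intros t Ht. rewrite Rmin_left, Rmax_right in Ht by exact Hab.
  apply H. exact Ht.
Qed.

Lemma CInt_plus (f g : R -> C) (a b : R) :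
  exI f a b -> exI g a b -> CInt (fun t => f t + g t) a b = CInt f a b + CInt g a b.
Proof. intros Hf Hg. apply isI_unique. apply isI_plus; now apply isI_CInt. Qed.

Lemma CInt_minus (f g : R -> C) (a b : R) :
  exI f a b -> exI g a b -> CInt (fun t => f t - g t) a b = CInt f a b - CInt g a b.
Proof. intros Hf Hg. apply isI_unique. apply isI_minus; now apply isI_CInt. Qed.

Lemma CInt_scal (f : R -> C) (c : C) (a b : R) :
  exI f a b -> CInt (fun t => c * f t) a b = c * CInt f a b.
Proof. intros Hf. apply isI_unique. apply isI_scal; now apply isI_CInt. Qed.

Lemma exI_scal (f : R -> C) (c : C) (a b : R) :
  exI f a b -> exI (fun t => c * f t) a b.
Proof. intros [l Hl]. exists (c * l). now apply isI_scal. Qed.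

Lemma isI_FTC (f df : R -> C) (a b : R) :
  (a <= b)%R ->
  (forall t, (a <= t <= b)%R -> rder f t (df t)) ->
  (forall t, (a <= t <= b)%R -> cont df t) ->
  isI df a b (f b - f a).
Proof.
  intros Hab H1 H2.
  apply (is_RInt_derive (V := C_R_CompleteNormedModule)).
  - intros t Ht. rewrite Rmin_left, Rmax_right in Ht by exact Hab.
    apply rder_is_derive. now apply H1.
  - intros t Ht. rewrite Rmin_left, Rmax_right in Ht by exact Hab.
    now apply H2.
Qed.

Lemma Cmod_isI_le (f : R -> C) (g : R -> R) (a b : R) (l : C) (m : R) :
  (a <= b)%R -> (forall t, (a <= t <= b)%R -> (Cmod (f t) <= g t)%R) ->
  isI f a b l -> is_RInt g a b m -> (Cmod l <= m)%R.
Proof.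
  intros Hab H Hf Hg. rewrite Cmod_norm.
  apply (norm_RInt_le (V := C_R_NormedModule) f g a b); auto.
  intros t Ht. rewrite <- Cmod_norm. now apply H.
Qed.

Lemma is_RInt_const_unit (M : R) : is_RInt (fun _ => M) 0 1 M.
Proof.
  assert (H := is_RInt_const (V := R_NormedModule) 0 1 M).
  match type of H with is_RInt _ _ _ ?l => replace l with M in H; [exact H|] end.
  unfold scal; simpl. unfold mult; simpl. ring.
Qed.

Lemma Cmod_CInt_le (f : R -> C) (a b M : R) :
  (a <= b)%R -> exI f a b -> (forall t, (a <= t <= b)%R -> (Cmod (f t) <= M)%R) ->
  (Cmod (CInt f a b) <= (b - a) * M)%R.
Proof.
  intros Hab Hf H. apply (Cmod_isI_le f (fun _ => M) a b); auto.
  - now apply isI_CInt.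
  - exact (is_RInt_const (V := R_NormedModule) a b M).
Qed.

Lemma cont_slice {U : UniformSpace} (f : U * R -> C) (x : U) (t : R) :
  cont f (x, t) -> cont (fun s => f (x, s)) t.
Proof.
  intros H. apply (cont_comp f (fun s : R => (x, s))); [|exact H].
  intros P [d Hd]. exists d. intros s Hs. apply Hd. split; [apply ball_center|exact Hs].
Qed.

(** Tube lemma: compactness of [[a, b]] makes the continuity in the parameter uniform in [t]. It
    supplies the uniform bounds both for continuity and for differentiation under the integral
    sign. *)
Lemma tube {U : UniformSpace} (f : U * R -> C) (x : U) (a b e : R) :
  (0 < e)%R -> (forall t, (a <= t <= b)%R -> cont f (x, t)) ->
  locally x (fun y => forall t, (a <= t <= b)%R -> (Cmod (f (y, t) - f (x, t)) < e)%R).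
Proof.
  intros He H.
  assert (H1 : forall t, exists d : posreal, (a <= t <= b)%R ->
    forall y s, ball x d y -> (Rabs (s - t) < d)%R -> (Cmod (f (y, s) - f (x, t)) < e / 2)%R).
  { intros t. destruct (classic (a <= t <= b)%R) as [Ht|Ht].
    - destruct (proj1 (cont_ball _ _) (H t Ht) (e / 2)%R ltac:(lra)) as [d Hd].
      exists d. intros _ y s Hy Hs. apply (Hd (y, s)). split; [exact Hy|exact Hs].
    (* An arbitrary radius outside [[a, b]], as [compactness_value_1d] takes a radius function
       defined on the whole line. *)
    - exists (mkposreal 1 Rlt_0_1). intros Ht'. contradiction. }
  set (D := fun t => proj1_sig (constructive_indefinite_description _ (H1 t))).
  assert (HD : forall t, (a <= t <= b)%R -> forall y s, ball x (D t) y ->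
    (Rabs (s - t) < D t)%R -> (Cmod (f (y, s) - f (x, t)) < e / 2)%R).
  { intros t. exact (proj2_sig (constructive_indefinite_description _ (H1 t))). }
  destruct (compactness_value_1d a b D) as [d Hd].
  exists d. intros y Hy t Ht. apply NNPP. intros N. apply (Hd t Ht).
  intros [s [Hs [Hts Hds]]]. apply N.
  replace (f (y, t) - f (x, t)) with ((f (y, t) - f (x, s)) - (f (x, t) - f (x, s))) by ring.
  eapply Rle_lt_trans; [apply Cmod_minus_le|].
  assert (A1 := HD s Hs y t (ball_le x d (D s) Hds y Hy) Hts).
  assert (A2 := HD s Hs x t (ball_center x (D s)) Hts). lra.
Qed.

(** Continuity in [t] is asked for every parameter near [x], because the difference of two values of
    [CInt] is the integral of the difference only when both integrals exist. *)
Lemma cont_CInt {U : UniformSpace} (f : U -> R -> C) (x : U) (a b : R) :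
  (a <= b)%R ->
  locally x (fun y => forall t, (a <= t <= b)%R -> cont (fun p => f (fst p) (snd p)) (y, t)) ->
  cont (fun y => CInt (f y) a b) x.
Proof.
  intros Hab H. apply cont_ball. intros e He.
  assert (Hx := locally_singleton _ _ H). simpl in Hx.
  set (F := fun p : U * R => f (fst p) (snd p)).
  assert (He' : (0 < e / (b - a + 1))%R) by (apply Rdiv_lt_0_compat; lra).
  generalize (filter_and _ _ H (tube F x a b _ He' Hx)). apply filter_imp.
  intros y [Hy Ht].
  assert (Iy : exI (f y) a b)
    by (apply exI_cont; [exact Hab|]; intros t Htt; apply (cont_slice F y t); now apply Hy).
  assert (Ix : exI (f x) a b)
    by (apply exI_cont; [exact Hab|]; intros t Htt; apply (cont_slice F x t); now apply Hx).
  rewrite <- CInt_minus by assumption.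
  apply Rle_lt_trans with ((b - a) * (e / (b - a + 1)))%R.
  - apply Cmod_CInt_le; [exact Hab| |].
    + exists (CInt (f y) a b - CInt (f x) a b). apply isI_minus; now apply isI_CInt.
    + intros t Htt. left. now apply (Ht t Htt).
  - apply Rmult_lt_reg_r with (b - a + 1)%R; [lra|].
    replace ((b - a) * (e / (b - a + 1)) * (b - a + 1))%R with ((b - a) * e)%R by (field; lra).
    nra.
Qed.

Lemma cont_fst {U V : UniformSpace} (f : U -> C) (p : U * V) :
  cont f (fst p) -> cont (fun q : U * V => f (fst q)) p.
Proof. intros H. apply (cont_comp f fst); [|exact H]. destruct p. apply continuous_fst. Qed.

Lemma cont_snd {U V : UniformSpace} (f : V -> C) (p : U * V) :
  cont f (snd p) -> cont (fun q : U * V => f (snd q)) p.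
Proof. intros H. apply (cont_comp f snd); [|exact H]. destruct p. apply continuous_snd. Qed.

(** A complex-valued function has no mean value point; the bound is obtained by integrating
    [(dh - d) (z - z0)] along the segment from [z0] to [z]. *)
Lemma holo_mean_value (h dh : C -> C) (z0 z d : C) (M : R) :
  (forall s, (0 <= s <= 1)%R ->
    holo h (z0 + RtoC s * (z - z0)) (dh (z0 + RtoC s * (z - z0))) /\
    cont dh (z0 + RtoC s * (z - z0)) /\
    (Cmod (dh (z0 + RtoC s * (z - z0))%C - d) <= M)%R) ->
  (Cmod (h z - h z0 - (z - z0) * d) <= M * Cmod (z - z0))%R.
Proof.
  intros H.
  set (seg := fun s : R => z0 + RtoC s * (z - z0)).
  assert (Ds : forall s, rder seg s (z - z0)%C).
  { intros s. unfold seg. apply dq_eq with (RtoC 0 + (RtoC 1 * (z - z0) + RtoC s * RtoC 0)); [|ring].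
    apply dq_plus; [apply dq_const|]. apply (dq_mult RtoC RtoC (fun _ => z - z0)); [apply cont_R_RtoC|apply dq_id|apply dq_const]. }
  assert (Cs : forall s, cont seg s).
  { intros s. exact (dq_cont _ _ _ _ (cont_R_RtoC s) (Ds s)). }
  assert (I : isI (fun s => (dh (seg s) - d) * (z - z0)) 0 1
    ((h (seg 1) - RtoC 1 * ((z - z0) * d)) - (h (seg 0) - RtoC 0 * ((z - z0) * d)))).
  { apply (isI_FTC (fun s => h (seg s) - RtoC s * ((z - z0) * d))); [lra| |].
    - intros s Hs. destruct (H s Hs) as [H1 [H2 H3]].
      apply dq_eq with (dh (seg s) * (z - z0) - (RtoC 1 * ((z - z0) * d) + RtoC s * RtoC 0)); [|ring].
      apply dq_minus.
      + apply (dq_comp RtoC seg h); [apply cont_R_RtoC|apply Ds|exact H1].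
      + apply (dq_mult RtoC RtoC (fun _ => (z - z0) * d)); [apply cont_R_RtoC|apply dq_id|apply dq_const].
    - intros s Hs. destruct (H s Hs) as [H1 [H2 H3]].
      apply cont_mult; [|apply cont_const]. apply cont_minus; [|apply cont_const].
      apply (cont_comp dh seg); [apply Cs|exact H2]. }
  replace (h z - h z0 - (z - z0) * d) with
    ((h (seg 1) - RtoC 1 * ((z - z0) * d)) - (h (seg 0) - RtoC 0 * ((z - z0) * d))).
  2: { replace (seg 1) with z by (unfold seg; ring).
       replace (seg 0) with z0 by (unfold seg; ring). ring. }
  apply (Cmod_isI_le _ (fun _ => (M * Cmod (z - z0))%R) 0 1 _ _ ltac:(lra)) with (2 := I).
  - intros s Hs. rewrite Cmod_mult. apply Rmult_le_compat_r; [apply Cmod_ge_0|].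
    now apply H.
  - apply is_RInt_const_unit.
Qed.

(** Differentiation under the integral sign. By [holo_mean_value] the error of the linear
    approximation at each [t] is controlled by the variation of [df] near [z0], and [tube] makes
    that variation small uniformly in [t]. *)
Lemma holo_CInt (f df : C -> R -> C) (z0 : C) :
  locally z0 (fun z : C => forall t, (0 <= t <= 1)%R ->
    holo (fun w => f w t) z (df z t) /\
    cont (fun p : C * R => df (fst p) (snd p)) (z, t) /\
    cont (f z) t) ->
  holo (fun z => CInt (f z) 0 1) z0 (CInt (df z0) 0 1).
Proof.
  intros H.
  set (F := fun z => CInt (f z) 0 1). set (l := CInt (df z0) 0 1).
  assert (H0 := locally_singleton _ _ H). simpl in H0.
  assert (I0 : exI (f z0) 0 1) by (apply exI_cont; [lra|]; intros t Ht; now apply H0).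
  assert (D0 : exI (df z0) 0 1).
  { apply exI_cont; [lra|]; intros t Ht.
    exact (cont_slice (fun p : C * R => df (fst p) (snd p)) z0 t (proj1 (proj2 (H0 t Ht)))). }
  (* The difference quotient receives the expected derivative as its value at [z0]; all the content
     then lies in its continuity there. *)
  exists (fun z : C => if excluded_middle_informative (z = z0) then l else (F z - F z0) / (z - z0)).
  repeat split.
  - apply cont_ball. intros e He.
    destruct (excluded_middle_informative (z0 = z0)) as [_|N]; [|now elim N].
    assert (T : locally z0 (fun z : C => forall t, (0 <= t <= 1)%R ->
        (Cmod (df z t - df z0 t) < e / 2)%R)).
    { exact (tube (fun p : C * R => df (fst p) (snd p)) z0 0 1 (e / 2) ltac:(lra)
        (fun t Ht => proj1 (proj2 (H0 t Ht)))). }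
    destruct (locally_C_ex _ _ (filter_and _ _ H T)) as [r [Hr HT]].
    generalize (locally_Cball z0 r Hr). apply filter_imp. intros z Hz. change C in z.
    destruct (excluded_middle_informative (z = z0)) as [_|N].
    { replace (l - l) with (RtoC 0) by ring. now rewrite Cmod_0. }
    assert (N' : z - z0 <> 0).
    { intros E. apply N. replace z with ((z - z0) + z0) by ring. rewrite E. ring. }
    assert (Hm := proj1 (Cmod_gt_0 _) N').
    assert (I : exI (f z) 0 1)
      by (apply exI_cont; [lra|]; intros t Ht; now apply (proj1 (HT z Hz))).
    replace ((F z - F z0) / (z - z0) - l) with ((F z - F z0 - (z - z0) * l) / (z - z0))
      by (field; exact N').
    rewrite Cmod_div by exact N'.
    apply Rle_lt_trans with (e / 2)%R; [|lra].
    apply Rmult_le_reg_r with (Cmod (z - z0)); [exact Hm|].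
    unfold Rdiv at 1. rewrite Rmult_assoc, Rinv_l, Rmult_1_r by lra.
    replace (e / 2 * Cmod (z - z0))%R with ((1 - 0) * (e / 2 * Cmod (z - z0)))%R by ring.
    unfold F, l.
    assert (J : isI (fun t => f z t - f z0 t - (z - z0) * df z0 t) 0 1
      (CInt (f z) 0 1 - CInt (f z0) 0 1 - (z - z0) * CInt (df z0) 0 1)).
    { apply isI_minus; [apply isI_minus|apply isI_scal]; now apply isI_CInt. }
    rewrite <- (isI_unique _ _ _ _ J).
    apply Cmod_CInt_le; [lra|eexists; exact J|].
    intros t Ht.
    apply (holo_mean_value (fun w => f w t) (fun w => df w t)).
    intros s Hs.
    set (w := z0 + RtoC s * (z - z0)).
    assert (Hw : (Cmod (w - z0) < r)%R).
    { unfold w. replace (z0 + RtoC s * (z - z0) - z0) with (RtoC s * (z - z0)) by ring.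
      rewrite Cmod_mult, Cmod_RtoC_nonneg by lra.
      generalize (Cmod_ge_0 (z - z0)). nra. }
    destruct (HT w Hw) as [K1 K2]. destruct (K1 t Ht) as [L1 [L2 L3]].
    repeat split.
    + exact L1.
    + apply (cont_comp (fun p : C * R => df (fst p) (snd p)) (fun v : C => (v, t))); [|exact L2].
      intros P [d Hd]. exists d. intros v Hv. apply Hd. split; [exact Hv|apply ball_center].
    + left. now apply K2.
  - destruct (excluded_middle_informative (z0 = z0)) as [_|N]; [reflexivity|now elim N].
  - apply filter_forall. intros z. change C in z. fold (F z). fold (F z0).
    destruct (excluded_middle_informative (z = z0)) as [->|N]; [ring|].
    field. intros E. apply N. replace z with ((z - z0) + z0) by ring. rewrite E. ring.
Qed.

(** * The regularized integral around an end point *)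

Lemma Cexp_eq_1 (z : C) : Cexp z = 1 -> exists k : Z, z = RtoC (2 * PI * IZR k) * Ci.
Proof.
  intros H.
  assert (Hr : Re z = 0%R).
  { apply (f_equal Cmod) in H. rewrite Cmod_Cexp, Cmod_1 in H.
    rewrite <- exp_0 in H. now apply exp_inv. }
  assert (Hc : cos (Im z) = 1%R).
  { apply (f_equal Re) in H. unfold Cexp in H. simpl in H.
    change (exp (Re z) * cos (Im z) = 1)%R in H. rewrite Hr, exp_0 in H. lra. }
  assert (Hs : sin (Im z / 2) = 0%R).
  { replace (Im z) with (2 * (Im z / 2))%R in Hc by field.
    rewrite cos_2a_sin in Hc. 
    apply Rsqr_0_uniq. unfold Rsqr. lra. }
  destruct (sin_eq_0_0 _ Hs) as [k Hk]. exists k.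
  apply C_eq_parts.
  - rewrite Hr. simpl. ring.
  - replace (Im z) with (2 * (Im z / 2))%R by field. rewrite Hk. simpl. ring.
Qed.

Lemma two_PI_Ci_neq_0 : 2 * RtoC PI * Ci <> 0.
Proof.
  intros E. apply (f_equal Im) in E. simpl in E. generalize PI_RGT_0. lra.
Qed.

Lemma monodromy_neq (p : C) : not_int p -> monodromy p - 1 <> 0.
Proof.
  intros H E. assert (E' : monodromy p = 1).
  { replace (monodromy p) with ((monodromy p - 1) + 1) by ring. rewrite E. ring. }
  destruct (Cexp_eq_1 _ E') as [k Hk]. apply (H k).
  assert (E2 : (2 * RtoC PI * Ci) * (p - RtoC (IZR k)) = 0).
  { rewrite !RtoC_mult in Hk. 
    replace ((2 * RtoC PI * Ci) * (p - RtoC (IZR k))) with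
      (2 * RtoC PI * Ci * p - 2 * RtoC PI * RtoC (IZR k) * Ci) by ring.
    rewrite Hk. ring. }
  destruct (classic (p - RtoC (IZR k) = 0)) as [E3|N].
  - replace p with ((p - RtoC (IZR k)) + RtoC (IZR k)) by ring. rewrite E3. ring.
  - elim (Cmult_neq_0 _ _ two_PI_Ci_neq_0 N E2).
Qed.

Lemma monodromy_plus_1 (p : C) : monodromy (p + 1) = monodromy p.
Proof.
  unfold monodromy. replace (2 * RtoC PI * Ci * (p + 1))
    with (2 * RtoC PI * Ci * p + RtoC (2 * PI) * Ci).
  2: { rewrite RtoC_mult. ring. }
  rewrite Cexp_plus. replace (Cexp (RtoC (2 * PI) * Ci)) with (RtoC 1); [ring|].
  apply C_eq_parts; unfold Cexp; simpl.
  - replace (2 * PI * 0 - 0 * 1)%R with 0%R by ring.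
    replace (2 * PI * 1 + 0 * 0)%R with (2 * PI)%R by ring.
    rewrite exp_0, cos_2PI. ring.
  - replace (2 * PI * 0 - 0 * 1)%R with 0%R by ring.
    replace (2 * PI * 1 + 0 * 0)%R with (2 * PI)%R by ring.
    rewrite exp_0, sin_2PI. ring.
Qed.

Lemma monodromy_plus_nat (p : C) (n : nat) : monodromy (p + RtoC (INR n)) = monodromy p.
Proof.
  induction n as [|n IH].
  - simpl. f_equal. ring.
  - rewrite S_INR, RtoC_plus, Cplus_assoc, monodromy_plus_1. exact IH.
Qed.

Lemma monodromy_minus_nat (p : C) (n : nat) : monodromy (p - RtoC (INR n)) = monodromy p.
Proof. rewrite <- (monodromy_plus_nat _ n). f_equal. ring. Qed.

Lemma not_int_plus_Z (p : C) (k : Z) : not_int p -> not_int (p + RtoC (IZR k)).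
Proof.
  intros H j E. apply (H (j - k)%Z). rewrite minus_IZR, RtoC_minus, <- E. ring.
Qed.

Lemma not_int_plus_1 (p : C) : not_int p -> not_int (p + 1).
Proof. apply (not_int_plus_Z p 1). Qed.

Lemma not_int_plus_nat (p : C) (n : nat) : not_int p -> not_int (p + RtoC (INR n)).
Proof. rewrite INR_IZR_INZ. apply not_int_plus_Z. Qed.

Lemma not_int_minus_nat (p : C) (n : nat) : not_int p -> not_int (p - RtoC (INR n)).
Proof.
  intros H. replace (p - RtoC (INR n)) with (p + RtoC (IZR (- Z.of_nat n))).
  - now apply not_int_plus_Z.
  - rewrite opp_IZR, <- INR_IZR_INZ, RtoC_opp. reflexivity.
Qed.

Lemma not_int_opp (p : C) : not_int p -> not_int (- p).
Proof.
  intros H k E. apply (H (- k)%Z). rewrite opp_IZR, RtoC_opp, <- E. ring.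
Qed.

Lemma not_int_neq_0 (p : C) : not_int p -> p <> 0.
Proof. intros H E. now apply (H 0%Z). Qed.

(** A circle around 0 lifted to the logarithm: [Cexp (circ z tau)] closes up after one turn, while
    [circ z tau] itself remembers the branch. *)
Definition circ (z : C) (tau : R) : C := z + RtoC (2 * PI * tau) * Ci.

(** The integral of [z^(p-1) G z] over the circle of radius [e], divided by [c - 1] with [c] the
    monodromy. As [dz = 2 pi i z dtau], the exponent in the parametrized form is [p]. It replaces
    the integral from 0 to [e], with which it agrees when that one converges. *)
Definition Rop (e : R) (p : C) (G : C -> C) : C :=
  / (monodromy p - 1) *
  CInt (fun tau => Cexp (p * circ (RtoC (ln e)) tau) * G (Cexp (circ (RtoC (ln e)) tau))
                   * (2 * RtoC PI * Ci)) 0 1.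

Lemma rder_circ (z : C) (t : R) : rder (circ z) t (2 * RtoC PI * Ci).
Proof.
  apply dq_ext with (fun s => z + (2 * RtoC PI * Ci) * RtoC s).
  - intros s. change R in s. unfold circ. rewrite !RtoC_mult. ring.
  - apply dq_eq with (RtoC 0 + (2 * RtoC PI * Ci) * 1); [|ring].
    apply dq_plus; [apply dq_const|]. apply (dq_scal RtoC RtoC). apply dq_id.
Qed.

Lemma cont_circ (z : C) (t : R) : cont (circ z) t.
Proof. exact (dq_cont _ _ _ _ (cont_R_RtoC t) (rder_circ z t)). Qed.

Lemma circ_0 (z : C) : circ z 0 = z.
Proof. unfold circ. rewrite Rmult_0_r. ring. Qed.

Lemma circ_1 (z : C) : circ z 1 = z + 2 * RtoC PI * Ci.
Proof. unfold circ. rewrite Rmult_1_r, RtoC_mult. ring. Qed.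

Lemma Re_circ (z : C) (t : R) : Re (circ z t) = Re z.
Proof. unfold circ. simpl. change (fst z) with (Re z). ring. Qed.

Lemma Cmod_circ (e t : R) : (0 < e)%R -> Cmod (Cexp (circ (RtoC (ln e)) t)) = e.
Proof. intros He. rewrite Cmod_Cexp, Re_circ. simpl. now apply exp_ln. Qed.

Lemma Cexp_2PI_Ci : Cexp (2 * RtoC PI * Ci) = 1.
Proof.
  assert (H := monodromy_plus_1 0). unfold monodromy in H.
  replace (2 * RtoC PI * Ci * (0 + 1)) with (2 * RtoC PI * Ci) in H by ring.
  rewrite H, Cmult_0_r. apply Cexp_0.
Qed.

Lemma Cexp_circ_1 (z : C) : Cexp (circ z 1) = Cexp z.
Proof. rewrite circ_1, Cexp_plus, Cexp_2PI_Ci. ring. Qed.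

Lemma Cexp_mult_circ_1 (p z : C) : Cexp (p * circ z 1) = monodromy p * Cexp (p * z).
Proof. rewrite circ_1. unfold monodromy. rewrite <- Cexp_plus. f_equal. ring. Qed.

Lemma cpow_pos (e : R) (p : C) : (0 < e)%R -> cpow (RtoC e) p = Cexp (p * RtoC (ln e)).
Proof. intros He. unfold cpow. now rewrite Clog_pos. Qed.

Lemma cont_Rop_integrand (p : C) (G : C -> C) (z : C) (t : R) :
  cont G (Cexp (circ z t)) ->
  cont (fun tau => Cexp (p * circ z tau) * G (Cexp (circ z tau)) * (2 * RtoC PI * Ci)) t.
Proof.
  intros H. apply cont_mult; [|apply cont_const]. apply cont_mult.
  - apply cont_Cexp. apply cont_mult; [apply cont_const|apply cont_circ].
  - apply (cont_comp G (fun tau => Cexp (circ z tau))); [|exact H].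
    apply cont_Cexp. apply cont_circ.
Qed.

Lemma exI_Rop (e : R) (p : C) (G : C -> C) :
  (0 < e)%R -> (forall z, Cmod z = e -> cont G z) ->
  exI (fun tau => Cexp (p * circ (RtoC (ln e)) tau) * G (Cexp (circ (RtoC (ln e)) tau))
                   * (2 * RtoC PI * Ci)) 0 1.
Proof.
  intros He H. apply exI_cont; [lra|]. intros t _. apply cont_Rop_integrand.
  apply H. now apply Cmod_circ.
Qed.

Lemma Rop_ext (e : R) (p : C) (G H : C -> C) :
  (0 < e)%R -> (forall z, Cmod z = e -> G z = H z) -> Rop e p G = Rop e p H.
Proof.
  intros He E. unfold Rop. f_equal. apply CInt_ext; [lra|]. intros t _.
  rewrite E; [reflexivity|]. now apply Cmod_circ.
Qed.

Lemma Rop_plus (e : R) (p : C) (G H : C -> C) :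
  (0 < e)%R -> (forall z, Cmod z = e -> cont G z) -> (forall z, Cmod z = e -> cont H z) ->
  Rop e p (fun z => G z + H z) = Rop e p G + Rop e p H.
Proof.
  intros He HG HH. unfold Rop. rewrite <- Cmult_plus_distr_l. f_equal.
  rewrite <- CInt_plus by now apply exI_Rop.
  apply CInt_ext; [lra|]. intros t _. ring.
Qed.

Lemma Rop_scal (e : R) (p c : C) (G : C -> C) :
  (0 < e)%R -> (forall z, Cmod z = e -> cont G z) ->
  Rop e p (fun z => c * G z) = c * Rop e p G.
Proof.
  intros He HG. unfold Rop.
  transitivity (/ (monodromy p - 1) * (c * CInt (fun tau => Cexp (p * circ (RtoC (ln e)) tau)
     * G (Cexp (circ (RtoC (ln e)) tau)) * (2 * RtoC PI * Ci)) 0 1)); [f_equal|ring].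
  rewrite <- CInt_scal by now apply exI_Rop.
  apply CInt_ext; [lra|]. intros t _. ring.
Qed.

Lemma Rop_minus (e : R) (p : C) (G H : C -> C) :
  (0 < e)%R -> (forall z, Cmod z = e -> cont G z) -> (forall z, Cmod z = e -> cont H z) ->
  Rop e p (fun z => G z - H z) = Rop e p G - Rop e p H.
Proof.
  intros He HG HH.
  rewrite (Rop_ext e p _ (fun z => G z + (- (1)) * H z) He) by (intros; ring).
  rewrite Rop_plus, Rop_scal; auto; [ring|].
  intros z Hz. apply cont_mult; [apply cont_const|auto].
Qed.

Lemma Rop_shift (e : R) (p : C) (G : C -> C) :
  Rop e (p + 1) G = Rop e p (fun z => z * G z).
Proof.
  unfold Rop. rewrite monodromy_plus_1. f_equal. apply CInt_ext; [lra|]. intros t _.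
  rewrite Cmult_plus_distr_r, Cmult_1_l, Cexp_plus. ring.
Qed.

(** One turn multiplies the primitive [z^p G z] by the monodromy [c], and division by [c - 1] leaves
    exactly its value at [e]. The circle thus behaves like the segment from 0 to [e] with nothing
    coming from 0. *)
Lemma Rop_parts (e : R) (p : C) (G dG : C -> C) :
  (0 < e)%R -> not_int p ->
  (forall z, Cmod z = e -> holo G z (dG z) /\ cont dG z) ->
  p * Rop e p G + Rop e (p + 1) dG = cpow (RtoC e) p * G (RtoC e).
Proof.
  intros He Hp H. assert (Hm := monodromy_neq p Hp).
  set (z := RtoC (ln e)).
  assert (Cdg : forall z, Cmod z = e -> cont dG z) by (intros; now apply H).
  assert (Cg : forall z, Cmod z = e -> cont G z).
  { intros w Hw. apply (dq_cont (X := C_UniformSpace) (fun w => w) _ _ _ (cont_C_id w) (proj1 (H w Hw))). }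
  rewrite Rop_shift. unfold Rop. fold z.
  set (I1 := CInt (fun tau => Cexp (p * circ z tau) * G (Cexp (circ z tau)) * (2 * RtoC PI * Ci)) 0 1).
  set (I2 := CInt (fun tau => Cexp (p * circ z tau) *
    (Cexp (circ z tau) * dG (Cexp (circ z tau))) * (2 * RtoC PI * Ci)) 0 1).
  assert (E1 : isI (fun tau => Cexp (p * circ z tau) * G (Cexp (circ z tau)) * (2 * RtoC PI * Ci)) 0 1 I1).
  { apply isI_CInt. now apply exI_Rop. }
  assert (E2 : isI (fun tau => Cexp (p * circ z tau) *
    (Cexp (circ z tau) * dG (Cexp (circ z tau))) * (2 * RtoC PI * Ci)) 0 1 I2).
  { apply isI_CInt. apply (exI_Rop e p (fun z => z * dG z) He).
    intros w Hw. apply cont_mult; [apply cont_C_id|now apply Cdg]. }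
  assert (E3 : isI (fun tau => (Cexp (p * circ z tau) * (p * (2 * RtoC PI * Ci))) * G (Cexp (circ z tau))
      + Cexp (p * circ z tau) * (dG (Cexp (circ z tau)) * (Cexp (circ z tau) * (2 * RtoC PI * Ci)))) 0 1
      (Cexp (p * circ z 1) * G (Cexp (circ z 1)) - Cexp (p * circ z 0) * G (Cexp (circ z 0)))).
  { apply (isI_FTC (fun tau => Cexp (p * circ z tau) * G (Cexp (circ z tau)))); [lra| |].
    - intros t _. assert (Hw := Cmod_circ e t He). fold z in Hw.
      apply (dq_mult RtoC (fun tau => Cexp (p * circ z tau)) (fun tau => G (Cexp (circ z tau))));
        [apply cont_R_RtoC| |].
      + apply (dq_Cexp RtoC (fun tau => p * circ z tau)); [apply cont_R_RtoC|]. apply dq_scal. apply rder_circ.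
      + apply (dq_comp RtoC (fun tau => Cexp (circ z tau)) G); [apply cont_R_RtoC| |now apply H].
        apply dq_Cexp; [apply cont_R_RtoC|]. apply rder_circ.
    - intros t _. assert (Hw := Cmod_circ e t He). fold z in Hw.
      assert (K1 : cont (fun tau => Cexp (circ z tau)) t) by (apply cont_Cexp, cont_circ).
      assert (K2 : cont (fun tau => Cexp (p * circ z tau)) t).
      { apply cont_Cexp. apply cont_mult; [apply cont_const|apply cont_circ]. }
      assert (K3 : cont (fun tau => G (Cexp (circ z tau))) t).
      { apply (cont_comp G _ _ K1). now apply Cg. }
      assert (K4 : cont (fun tau => dG (Cexp (circ z tau))) t).
      { apply (cont_comp dG _ _ K1). now apply Cdg. }
      cont_tac. }
  assert (E4 : isI (fun tau => (Cexp (p * circ z tau) * (p * (2 * RtoC PI * Ci))) * G (Cexp (circ z tau))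
      + Cexp (p * circ z tau) * (dG (Cexp (circ z tau)) * (Cexp (circ z tau) * (2 * RtoC PI * Ci)))) 0 1
      (p * I1 + I2)).
  { eapply isI_ext; [lra| |apply isI_plus; [apply isI_scal; exact E1|exact E2]].
    intros t _. simpl. ring. }
  apply isI_unique in E3. apply isI_unique in E4. rewrite E3 in E4.
  rewrite Cexp_mult_circ_1, Cexp_circ_1, circ_0 in E4.
  rewrite cpow_pos by exact He. fold z.
  unfold z in E4 at 2 4. rewrite Cexp_ln in E4 by exact He.
  transitivity (/ (monodromy p - 1) * (p * I1 + I2)); [ring|].
  rewrite <- E4. field. exact Hm.
Qed.

Lemma Rop_holo (e : R) (p : C) (f df : C -> C -> C) (w0 : C) :
  (0 < e)%R ->
  locally w0 (fun w : C => forall z, Cmod z = e ->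
    holo (fun v => f v z) w (df w z) /\
    cont (fun q : C * C => df (fst q) (snd q)) (w, z) /\ cont (f w) z) ->
  holo (fun w => Rop e p (f w)) w0 (Rop e p (df w0)).
Proof.
  intros He H. unfold Rop. apply dq_scal.
  apply (holo_CInt
    (fun w tau => Cexp (p * circ (RtoC (ln e)) tau) * f w (Cexp (circ (RtoC (ln e)) tau))
       * (2 * RtoC PI * Ci))
    (fun w tau => Cexp (p * circ (RtoC (ln e)) tau) * df w (Cexp (circ (RtoC (ln e)) tau))
       * (2 * RtoC PI * Ci))).
  revert H. apply filter_imp. intros w H t _. change C in w.
  assert (Hz := Cmod_circ e t He).
  destruct (H _ Hz) as [H1 [H2 H3]]. repeat split.
  - eapply dq_ext; [|eapply dq_eq;
      [apply (dq_scal (X := C_UniformSpace) _ _ (Cexp (p * circ (RtoC (ln e)) t) * (2 * RtoC PI * Ci)) _ _ H1)|]].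
    + intros v. simpl. ring.
    + ring.
  - apply cont_mult; [|apply cont_const]. apply cont_mult.
    + apply cont_Cexp. apply cont_mult; [apply cont_const|].
      apply (cont_snd (U := C_UniformSpace) (circ (RtoC (ln e)))). apply cont_circ.
    + apply (continuous_comp_2 (U := prod_UniformSpace C_UniformSpace R_UniformSpace)
        (V := C_UniformSpace) (W := C_UniformSpace)
        (fun q : C * R => fst q) (fun q : C * R => Cexp (circ (RtoC (ln e)) (snd q))) df).
      * apply (cont_fst (fun z : C => z)). apply cont_C_id.
      * apply cont_Cexp. apply (cont_snd (U := C_UniformSpace) (circ (RtoC (ln e)))).
        apply cont_circ.
      * exact H2.
  - apply cont_Rop_integrand. exact H3.
Qed.

Lemma exp_le (x y : R) : (x <= y -> exp x <= exp y)%R.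
Proof.
  intros H. destruct (Req_dec x y) as [->|N]; [lra|]. left. apply exp_increasing. lra.
Qed.

Lemma Cmod_Cexp_le (z : C) : (Cmod (Cexp z) <= exp (Cmod z))%R.
Proof.
  rewrite Cmod_Cexp. apply exp_le. eapply Rle_trans; [apply Rle_abs|apply Re_le_Cmod].
Qed.

Lemma Cmod_circ_le (e t : R) :
  (0 <= t <= 1)%R -> (Cmod (circ (RtoC (ln e)) t) <= Rabs (ln e) + 2 * PI)%R.
Proof.
  intros Ht. unfold circ. eapply Rle_trans; [apply Cmod_triangle|].
  rewrite Cmod_mult, Cmod_Ci, !Cmod_R, Rmult_1_r.
  generalize PI_RGT_0. intros HP. rewrite (Rabs_pos_eq (2 * PI * t)) by nra. nra.
Qed.

(** [K] is uniform in [N]: an integral shift of the exponent preserves the monodromy and multiplies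
    the integrand by a factor of modulus [e ^ N]. *)
Lemma Rop_bound (e : R) (p : C) :
  (0 < e)%R -> exists K : R, (0 <= K)%R /\ forall (N : nat) (G : C -> C) (M : R),
    (forall z, Cmod z = e -> cont G z /\ (Cmod (G z) <= M)%R) ->
    (Cmod (Rop e (p + RtoC (INR N)) G) <= K * e ^ N * M)%R.
Proof.
  intros He.
  set (B := exp (Cmod p * (Rabs (ln e) + 2 * PI))).
  exists (Cmod (/ (monodromy p - 1)) * (B * (2 * PI)))%R. split.
  { apply Rmult_le_pos; [apply Cmod_ge_0|]. apply Rmult_le_pos; [left; apply exp_pos|].
    generalize PI_RGT_0; lra. }
  intros N G M H. unfold Rop. rewrite monodromy_plus_nat, Cmod_mult.
  rewrite !Rmult_assoc. apply Rmult_le_compat_l; [apply Cmod_ge_0|].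
  replace (B * (2 * (PI * (e ^ N * M))))%R with ((1 - 0) * (B * (2 * (PI * (e ^ N * M)))))%R by ring.
  apply Cmod_CInt_le; [lra| |].
  { apply exI_Rop; [exact He|]. intros z Hz. now apply H. }
  intros t Ht. rewrite !Cmod_mult, Cmod_Ci, !Cmod_R.
  rewrite (Rabs_pos_eq 2), (Rabs_pos_eq PI) by (generalize PI_RGT_0; lra).
  replace ((p + RtoC (INR N)) * circ (RtoC (ln e)) t)
    with (p * circ (RtoC (ln e)) t + RtoC (INR N) * circ (RtoC (ln e)) t) by ring.
  rewrite Cexp_plus, Cexp_mult_nat, Cmod_mult, Cmod_pow, Cmod_circ by exact He.
  assert (H1 : (Cmod (Cexp (p * circ (RtoC (ln e)) t)) <= B)%R).
  { eapply Rle_trans; [apply Cmod_Cexp_le|]. apply exp_le. rewrite Cmod_mult.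
    apply Rmult_le_compat_l; [apply Cmod_ge_0|now apply Cmod_circ_le]. }
  assert (H2 : (Cmod (G (Cexp (circ (RtoC (ln e)) t))) <= M)%R)
    by (apply H; now apply Cmod_circ).
  assert (H3 := Cmod_ge_0 (G (Cexp (circ (RtoC (ln e)) t)))).
  assert (H4 := Cmod_ge_0 (Cexp (p * circ (RtoC (ln e)) t))).
  assert (H5 : (0 < e ^ N)%R) by now apply pow_lt.
  assert (H6 := PI_RGT_0).
  replace (B * (2 * (PI * (e ^ N * M))))%R with (B * e ^ N * M * (2 * PI * 1))%R by ring.
  apply Rmult_le_compat_r; [nra|].
  apply Rmult_le_compat; auto.
  - apply Rmult_le_pos; lra.
  - apply Rmult_le_compat_r; lra.
Qed.

(* With [z = e^zeta], the circle of radius [e^(Re zeta)] contributes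
   [K zeta], the integral of [H (zeta + 2 pi i tau)], and [K' = (c - 1) H] by
   periodicity up to the monodromy [c]; letting [Re zeta] tend to [-oo] turns the circle into
   [c - 1] times the segment from [0] to [e]. *)
Lemma Rop_collapse (e e' : R) (p : C) (G dG : C -> C) (A Psi : R -> R) :
  (0 < e < e')%R -> not_int p -> (0 < Re p)%R ->
  (forall z, (Cmod z < e')%R -> holo G z (dG z) /\ cont dG z) ->
  (forall y, (0 < y <= e)%R -> (Cmod (G (RtoC y)) <= A y)%R) ->
  (forall y, (0 < y <= e)%R ->
     is_derive Psi y (Rpower y (Re p - 1) * A y)%R /\ continuous A y) ->
  (forall y, (0 < y <= e)%R -> (0 <= Psi y)%R) ->
  (Cmod (Rop e p G) <= Psi e)%R.
Proof.
  intros He Hp Hr HG HA HP HP0.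
  assert (Cg : forall z, (Cmod z < e')%R -> cont G z).
  { intros w Hw. apply (dq_cont (X := C_UniformSpace) (fun w => w) _ _ _ (cont_C_id w) (proj1 (HG w Hw))). }
  set (H := fun z : C => Cexp (p * z) * G (Cexp z)).
  set (dH := fun z : C => Cexp (p * z) * p * G (Cexp z) + Cexp (p * z) * (dG (Cexp z) * Cexp z)).
  assert (Dom : forall z, (Re z < ln e')%R -> (Cmod (Cexp z) < e')%R).
  { intros z Hz. rewrite Cmod_Cexp. rewrite <- (exp_ln e') by lra. now apply exp_increasing. }
  assert (DH : forall z : C, (Re z < ln e')%R -> holo H z (dH z)).
  { intros z Hz. apply Dom in Hz. unfold H, dH.
    apply (dq_mult (X := C_UniformSpace) _ (fun z => Cexp (p * z)) (fun z => G (Cexp z)));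
      [apply cont_C_id| |].
    - apply (dq_Cexp (X := C_UniformSpace) _ (fun z => p * z)); [apply cont_C_id|].
      eapply dq_eq; [apply dq_scal; apply dq_id|ring].
    - apply (dq_comp (X := C_UniformSpace) _ Cexp G); [apply cont_C_id|apply holo_Cexp|].
      now apply HG. }
  assert (CdH : forall z : C, (Re z < ln e')%R -> cont dH z).
  { intros z Hz. apply Dom in Hz. unfold dH.
    assert (K1 : cont Cexp z) by (apply (cont_Cexp (fun z => z)); apply cont_C_id).
    assert (K2 : cont (fun z => Cexp (p * z)) z).
    { apply cont_Cexp. apply cont_mult; [apply cont_const|apply cont_C_id]. }
    assert (K3 : cont (fun z => G (Cexp z)) z) by (apply (cont_comp G Cexp _ K1); now apply Cg).
    assert (K4 : cont (fun z => dG (Cexp z)) z) by (apply (cont_comp dG Cexp _ K1); now apply HG).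
    cont_tac. }
  assert (CH : forall z : C, (Re z < ln e')%R -> cont H z).
  { intros z Hz. apply (dq_cont (X := C_UniformSpace) (fun w => w) _ _ _ (cont_C_id z) (DH z Hz)). }
  set (c := 2 * RtoC PI * Ci).
  set (K := fun z : C => CInt (fun t => H (circ z t) * c) 0 1).
  assert (HRe : forall z : C, (Re z < ln e')%R -> forall t, (Re (circ z t) < ln e')%R)
    by (intros z Hz t; now rewrite Re_circ).
  assert (DK : forall z : C, (Re z < ln e')%R -> holo K z ((monodromy p - 1) * H z)).
  { intros z Hz. apply dq_eq with (CInt (fun t => dH (circ z t) * c) 0 1).
    - apply (holo_CInt (fun z t => H (circ z t) * c) (fun z t => dH (circ z t) * c)).
      assert (Ho : locally z (fun w : C => (Re w < ln e')%R)).
      { generalize (locally_Cball z (ln e' - Re z) ltac:(lra)). apply filter_imp.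
        intros w Hw. change C in w. assert (B := Re_le_Cmod (w - z)).
        change (Re (w - z)) with (Re w - Re z)%R in B.
        assert (B2 := Rle_abs (Re w - Re z)). lra. }
      revert Ho. apply filter_imp. intros w Hw t _. change C in w. repeat split.
      + apply dq_ext with (fun v => c * H (circ v t)); [intros; ring|].
        apply dq_eq with (c * (dH (circ w t) * 1)); [|ring].
        apply dq_scal.
        apply (dq_comp (X := C_UniformSpace) _ (fun v => circ v t) H); [apply cont_C_id| |].
        * unfold circ. eapply dq_eq; [apply dq_plus; [apply dq_id|apply dq_const]|ring].
        * apply DH. now apply HRe.
      + apply cont_mult; [|apply cont_const].
        apply (cont_comp dH (fun q : C * R => circ (fst q) (snd q))); [|apply CdH; now apply HRe].
        unfold circ. apply cont_plus.
        * apply (cont_fst (fun z : C => z)). apply cont_C_id.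
        * apply cont_mult; [|apply cont_const]. apply cont_RtoC.
          apply continuous_Rmult; [apply continuous_const|apply continuous_snd].
      + apply cont_mult; [|apply cont_const].
        apply (cont_comp H (circ w)); [apply cont_circ|apply CH; now apply HRe].
    - transitivity (H (circ z 1) - H (circ z 0)).
      + apply isI_unique. apply (isI_FTC (fun t => H (circ z t))); [lra| |].
        * intros t _. apply (dq_comp RtoC (circ z) H); [apply cont_R_RtoC|apply rder_circ|].
          apply DH. now apply HRe.
        * intros t _. apply cont_mult; [|apply cont_const].
          apply (cont_comp dH (circ z)); [apply cont_circ|apply CdH; now apply HRe].
      + unfold H. rewrite Cexp_mult_circ_1, Cexp_circ_1, circ_0. ring. }
  set (m := monodromy p - 1) in *. assert (Hm := monodromy_neq p Hp). fold m in Hm.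
  assert (ERop : Rop e p G = / m * K (RtoC (ln e))) by reflexivity.
  assert (Hln : (ln e < ln e')%R) by (apply ln_increasing; lra).
  (* [Psi] stands for the integral of [y^(Re p - 1) A y] from 0. Being a nonnegative primitive, it
     bounds the integral over every segment ending at [e], so that no improper integral has to be
     formed. *)
  assert (Hdiff : forall x, (x <= ln e)%R ->
    (Cmod (K (RtoC (ln e)) - K (RtoC x)) <= Cmod m * Psi e)%R).
  { intros x Hx.
    assert (Ix : isI (fun t => m * H (RtoC t)) x (ln e) (K (RtoC (ln e)) - K (RtoC x))).
    { apply (isI_FTC (fun t => K (RtoC t))); [exact Hx| |].
      - intros t Ht. apply holo_rder. apply DK. simpl. lra.
      - intros t Ht. apply cont_mult; [apply cont_const|].
        apply (cont_comp H RtoC); [apply cont_R_RtoC|]. apply CH. simpl. lra. }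
    assert (Ey : forall t, (x <= t <= ln e)%R -> (0 < exp t <= e)%R).
    { intros t Ht. split; [apply exp_pos|]. rewrite <- (exp_ln e) by lra. apply exp_le. lra. }
    assert (Ir : is_RInt (fun t => Cmod m * (exp t * (Rpower (exp t) (Re p - 1) * A (exp t))))%R
      x (ln e) (Cmod m * Psi (exp (ln e)) - Cmod m * Psi (exp x))%R).
    { apply (is_RInt_derive (V := R_CompleteNormedModule) (fun t => Cmod m * Psi (exp t))%R).
      - intros t Ht. rewrite Rmin_left, Rmax_right in Ht by exact Hx.
        destruct (HP _ (Ey t Ht)) as [P1 P2].
        apply (is_derive_scal (fun t => Psi (exp t))).
        apply (is_derive_comp Psi exp); [exact P1|].
        apply is_derive_exp.
      - intros t Ht. rewrite Rmin_left, Rmax_right in Ht by exact Hx.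
        destruct (HP _ (Ey t Ht)) as [P1 P2].
        assert (Ce : continuous exp t) by apply continuous_exp.
        apply continuous_Rmult; [apply continuous_const|].
        apply continuous_Rmult; [exact Ce|].
        apply continuous_Rmult.
        + unfold Rpower. apply (continuous_comp (fun t => ((Re p - 1) * ln (exp t))%R) exp);
            [|apply continuous_exp].
          apply continuous_Rmult; [apply continuous_const|].
          apply (continuous_comp exp ln); [exact Ce|]. apply continuous_ln. apply exp_pos.
        + apply (continuous_comp exp A); assumption. }
    rewrite exp_ln in Ir by lra.
    apply Rle_trans with (Cmod m * Psi e - Cmod m * Psi (exp x))%R.
    - refine (Cmod_isI_le _ _ _ _ _ _ Hx _ Ix Ir).
      intros t Ht. rewrite Cmod_mult. apply Rmult_le_compat_l; [apply Cmod_ge_0|].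
      unfold H. rewrite Cmod_mult, Cexp_RtoC, Cmod_Cexp.
      replace (Re (p * RtoC t)) with (t + (Re p - 1) * t)%R
        by (unfold Re; simpl; ring).
      unfold Rpower. rewrite ln_exp, exp_plus, Rmult_assoc.
      apply Rmult_le_compat_l; [left; apply exp_pos|].
      apply Rmult_le_compat_l; [left; apply exp_pos|].
      apply HA. now apply Ey.
    - assert (0 <= Cmod m * Psi (exp x))%R; [|lra].
      apply Rmult_le_pos; [apply Cmod_ge_0|]. apply HP0. apply Ey. lra. }
  assert (Hsmall : forall d, (0 < d)%R -> exists x, (x <= ln e)%R /\ (Cmod (K (RtoC x)) <= d)%R).
  { intros d Hd.
    assert (C0 := Cg (RtoC 0) ltac:(rewrite Cmod_0; lra)).
    destruct (locally_C_ex _ _ (proj1 (cont_ball _ _) C0 1 ltac:(lra))) as [r [Hr1 Hr2]].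
    set (M := (Cmod (G 0) + 1)%R).
    assert (HM : (0 < M)%R) by (unfold M; generalize (Cmod_ge_0 (G 0)); lra).
    set (L := (exp (Rabs (Im p) * (2 * PI)) * M * (2 * PI))%R).
    assert (HL : (0 < L)%R).
    { unfold L. generalize PI_RGT_0; intros.
      apply Rmult_lt_0_compat; [apply Rmult_lt_0_compat; [apply exp_pos|exact HM]|lra]. }
    (* The first bound stays in the domain, the second puts the circle where [|G| <= M], and the
       third makes [e^(x Re p) <= d / L]. The last one is where [Re p > 0] enters. *)
    set (x := Rmin (ln e) (Rmin (ln (r / 2)) (ln (d / L) / Re p))).
    assert (X1 : (x <= ln e)%R) by apply Rmin_l.
    assert (X2 : (x <= ln (r / 2))%R) by (eapply Rle_trans; [apply Rmin_r|apply Rmin_l]).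
    assert (X3 : (x <= ln (d / L) / Re p)%R) by (eapply Rle_trans; [apply Rmin_r|apply Rmin_r]).
    exists x. split; [exact X1|].
    replace d with ((1 - 0) * d)%R by ring. unfold K.
    apply Cmod_CInt_le; [lra| |].
    - apply exI_cont; [lra|]. intros t _. apply cont_mult; [|apply cont_const].
      apply (cont_comp H (circ (RtoC x))); [apply cont_circ|]. apply CH. apply HRe. simpl. lra.
    - intros t Ht. unfold H, c. rewrite !Cmod_mult, Cmod_Ci, !Cmod_R.
      rewrite (Rabs_pos_eq 2), (Rabs_pos_eq PI) by (generalize PI_RGT_0; lra).
      assert (Hc : (Cmod (Cexp (circ (RtoC x) t)) < r)%R).
      { rewrite Cmod_Cexp, Re_circ. simpl.
        apply Rle_lt_trans with (exp (ln (r / 2))); [now apply exp_le|].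
        rewrite exp_ln by lra. lra. }
      assert (Hg : (Cmod (G (Cexp (circ (RtoC x) t))) <= M)%R).
      { assert (Q := Hr2 (Cexp (circ (RtoC x) t))).
        replace (Cexp (circ (RtoC x) t) - RtoC 0) with (Cexp (circ (RtoC x) t)) in Q by ring.
        specialize (Q Hc).
        replace (G (Cexp (circ (RtoC x) t))) with
          ((G (Cexp (circ (RtoC x) t)) - G (RtoC 0)) + G (RtoC 0)) by ring.
        eapply Rle_trans; [apply Cmod_triangle|]. unfold M. lra. }
      assert (He1 : (Cmod (Cexp (p * circ (RtoC x) t)) <=
        (d / L) * exp (Rabs (Im p) * (2 * PI)))%R).
      { rewrite Cmod_Cexp. rewrite <- (exp_ln (d / L)) by (apply Rdiv_lt_0_compat; lra).
        rewrite <- exp_plus. apply exp_le.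
        replace (Re (p * circ (RtoC x) t)) with (Re p * x - Im p * (2 * PI * t))%R
          by (unfold circ, Re, Im; simpl; ring).
        assert (Re p * x <= ln (d / L))%R.
        { apply Rmult_le_compat_l with (r := Re p) in X3; [|lra].
          replace (Re p * (ln (d / L) / Re p))%R with (ln (d / L)) in X3 by (field; lra). lra. }
        assert (B1 := Rle_abs (- Im p)). rewrite Rabs_Ropp in B1.
        assert (B2 := Rabs_pos (Im p)). assert (B3 := PI_RGT_0).
        assert (- Im p * (2 * PI * t) <= Rabs (Im p) * (2 * PI))%R.
        { apply Rle_trans with (Rabs (Im p) * (2 * PI * t))%R.
          - apply Rmult_le_compat_r; [nra|exact B1].
          - apply Rmult_le_compat_l; [exact B2|nra]. }
        lra. }
      replace d with ((d / L) * exp (Rabs (Im p) * (2 * PI)) * M * (2 * PI * 1))%R.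
      2: { replace ((d / L) * exp (Rabs (Im p) * (2 * PI)) * M * (2 * PI * 1))%R
             with ((d / L) * L)%R by (unfold L; ring). field. lra. }
      apply Rmult_le_compat_r; [generalize PI_RGT_0; lra|].
      apply Rmult_le_compat; auto using Cmod_ge_0. }
  assert (HK : (Cmod (K (RtoC (ln e))) <= Cmod m * Psi e)%R).
  { apply le_epsilon. intros d Hd. destruct (Hsmall d Hd) as [x [Hx1 Hx2]].
    replace (K (RtoC (ln e))) with ((K (RtoC (ln e)) - K (RtoC x)) + K (RtoC x)) by ring.
    eapply Rle_trans; [apply Cmod_triangle|].
    assert (Q := Hdiff x Hx1). lra. }
  rewrite ERop, Cmod_mult, Cmod_inv by exact Hm.
  assert (Hm' : (0 < Cmod m)%R) by now apply Cmod_gt_0.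
  apply Rmult_le_reg_l with (Cmod m); [exact Hm'|].
  rewrite <- Rmult_assoc, Rinv_r, Rmult_1_l by lra. exact HK.
Qed.

(** * Limits of complex sequences *)

Definition Clim (u : nat -> C) (l : C) : Prop := is_lim_seq (fun n => Cmod (u n - l)) 0%R.

Lemma Clim_eps (u : nat -> C) (l : C) :
  Clim u l <-> forall e : R, (0 < e)%R -> exists N, forall n, (N <= n)%nat -> (Cmod (u n - l) < e)%R.
Proof.
  unfold Clim. split.
  - intros H e He. apply is_lim_seq_spec in H. destruct (H (mkposreal e He)) as [N HN].
    exists N. intros n Hn. specialize (HN n Hn). simpl in HN.
    rewrite Rminus_0_r, Rabs_pos_eq in HN by apply Cmod_ge_0. exact HN.
  - intros H. apply is_lim_seq_spec. intros e. destruct (H e (cond_pos e)) as [N HN].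
    exists N. intros n Hn. rewrite Rminus_0_r, Rabs_pos_eq by apply Cmod_ge_0. now apply HN.
Qed.

Lemma Clim_le (u : nat -> C) (l : C) (b : nat -> R) :
  (exists N, forall n, (N <= n)%nat -> (Cmod (u n - l) <= b n)%R) -> is_lim_seq b 0%R -> Clim u l.
Proof.
  intros [N HN] Hb. unfold Clim.
  apply is_lim_seq_le_le_loc with (fun _ => 0%R) b; [|apply is_lim_seq_const|exact Hb].
  exists N. intros n Hn. split; [apply Cmod_ge_0|now apply HN].
Qed.

Lemma Clim_parts (u : nat -> C) (l : C) :
  is_lim_seq (fun n => Re (u n)) (Re l) -> is_lim_seq (fun n => Im (u n)) (Im l) -> Clim u l.
Proof.
  intros H1 H2.
  apply Clim_le with (fun n => Rabs (Re (u n) - Re l) + Rabs (Im (u n) - Im l))%R.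
  - exists 0%nat. intros n _. apply (Cmod_le_parts (u n - l)).
  - replace (Finite 0) with (Rbar_plus 0 0) by (simpl; now rewrite Rplus_0_r).
    apply is_lim_seq_plus with 0%R 0%R.
    + apply (is_lim_seq_abs_0 (fun n => Re (u n) - Re l)%R).
      replace (Finite 0) with (Finite (Re l - Re l)) by (f_equal; ring).
      apply is_lim_seq_minus'; [exact H1|apply is_lim_seq_const].
    + apply (is_lim_seq_abs_0 (fun n => Im (u n) - Im l)%R).
      replace (Finite 0) with (Finite (Im l - Im l)) by (f_equal; ring).
      apply is_lim_seq_minus'; [exact H2|apply is_lim_seq_const].
    + unfold is_Rbar_plus. simpl. now rewrite Rplus_0_r.
Qed.

Lemma Clim_Re (u : nat -> C) (l : C) : Clim u l -> is_lim_seq (fun n => Re (u n)) (Re l).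
Proof.
  intros H. apply is_lim_seq_spec. intros e.
  destruct (proj1 (Clim_eps u l) H e (cond_pos e)) as [N HN]. exists N. intros n Hn.
  eapply Rle_lt_trans; [apply (Re_le_Cmod (u n - l))|]. now apply HN.
Qed.

Lemma Clim_Im (u : nat -> C) (l : C) : Clim u l -> is_lim_seq (fun n => Im (u n)) (Im l).
Proof.
  intros H. apply is_lim_seq_spec. intros e.
  destruct (proj1 (Clim_eps u l) H e (cond_pos e)) as [N HN]. exists N. intros n Hn.
  eapply Rle_lt_trans; [apply (Im_le_Cmod (u n - l))|]. now apply HN.
Qed.

Lemma Clim_CLim_seq (u : nat -> C) (l : C) : Clim u l -> CLim_seq u = l.
Proof.
  intros H. unfold CLim_seq.
  rewrite (is_lim_seq_unique _ _ (Clim_Re _ _ H)), (is_lim_seq_unique _ _ (Clim_Im _ _ H)).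
  simpl. symmetry. apply C_pair.
Qed.

Lemma Clim_unique (u : nat -> C) (l m : C) : Clim u l -> Clim u m -> l = m.
Proof. intros H1 H2. now rewrite <- (Clim_CLim_seq u l H1), <- (Clim_CLim_seq u m H2). Qed.

Lemma Clim_ext_loc (u v : nat -> C) (l : C) :
  (exists N, forall n, (N <= n)%nat -> u n = v n) -> Clim u l -> Clim v l.
Proof.
  intros [N HN] H. apply is_lim_seq_ext_loc with (2 := H).
  exists N. intros n Hn. now rewrite HN.
Qed.

Lemma Clim_ext (u v : nat -> C) (l : C) : (forall n, u n = v n) -> Clim u l -> Clim v l.
Proof. intros H. apply Clim_ext_loc. exists 0%nat. intros n _. apply H. Qed.

Lemma Clim_eq (u : nat -> C) (l m : C) : l = m -> Clim u l -> Clim u m.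
Proof. now intros <-. Qed.

Lemma Clim_const (c : C) : Clim (fun _ => c) c.
Proof.
  apply Clim_eps. intros e He. exists 0%nat. intros n _.
  replace (c - c) with (RtoC 0) by ring. now rewrite Cmod_0.
Qed.

Lemma Clim_plus (u v : nat -> C) (l m : C) :
  Clim u l -> Clim v m -> Clim (fun n => u n + v n) (l + m).
Proof.
  intros H1 H2. apply Clim_parts; simpl; apply is_lim_seq_plus';
    auto using Clim_Re, Clim_Im.
Qed.

Lemma Clim_mult (u v : nat -> C) (l m : C) :
  Clim u l -> Clim v m -> Clim (fun n => u n * v n) (l * m).
Proof.
  intros H1 H2. apply Clim_parts; simpl.
  - apply is_lim_seq_minus'; apply is_lim_seq_mult'; auto using Clim_Re, Clim_Im.
  - apply is_lim_seq_plus'; apply is_lim_seq_mult'; auto using Clim_Re, Clim_Im.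
Qed.

Lemma Clim_scal (u : nat -> C) (c l : C) : Clim u l -> Clim (fun n => c * u n) (c * l).
Proof. intros H. apply Clim_mult; [apply Clim_const|exact H]. Qed.

Lemma Clim_Cmod (u : nat -> C) (l : C) : Clim u l -> is_lim_seq (fun n => Cmod (u n)) (Cmod l).
Proof.
  intros H. apply is_lim_seq_spec. intros e.
  destruct (proj1 (Clim_eps u l) H e (cond_pos e)) as [N HN]. exists N. intros n Hn.
  eapply Rle_lt_trans; [|apply (HN n Hn)].
  apply Rabs_le_between.
  assert (A1 := Cmod_reverse (u n) (- l)). rewrite Cmod_opp in A1.
  assert (A2 := Cmod_reverse l (- u n)). rewrite Cmod_opp in A2.
  change (l + - u n) with (l - u n) in A2. rewrite Cmod_minus_sym in A2.
  change (u n + - l) with (u n - l) in A1. lra.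
Qed.

Lemma Clim_inv (u : nat -> C) (l : C) : l <> 0 -> Clim u l -> Clim (fun n => / u n) (/ l).
Proof.
  intros Hl H. assert (Hm := proj1 (Cmod_gt_0 l) Hl).
  apply Clim_eps. intros e He.
  assert (He' : (0 < Rmin (Cmod l / 2) (e * (Cmod l * Cmod l) / 2))%R).
  { apply Rmin_glb_lt; [lra|]. apply Rdiv_lt_0_compat; [|lra]. repeat apply Rmult_lt_0_compat; lra. }
  destruct (proj1 (Clim_eps u l) H _ He') as [N HN]. exists N. intros n Hn.
  specialize (HN n Hn).
  assert (H1 : (Cmod (u n - l) < Cmod l / 2)%R) by (eapply Rlt_le_trans; [exact HN|apply Rmin_l]).
  assert (H2 : (Cmod (u n - l) < e * (Cmod l * Cmod l) / 2)%R)
    by (eapply Rlt_le_trans; [exact HN|apply Rmin_r]).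
  assert (H3 : (Cmod l / 2 < Cmod (u n))%R).
  { assert (A := Cmod_reverse l (u n - l)). replace (l + (u n - l)) with (u n) in A by ring. lra. }
  assert (Hu : u n <> 0) by (apply Cmod_gt_0; lra).
  replace (/ u n - / l) with (- (u n - l) / (u n * l)) by (field; auto).
  rewrite Cmod_div by now apply Cmult_neq_0.
  rewrite Cmod_opp, Cmod_mult.
  apply Rmult_lt_reg_r with (Cmod (u n) * Cmod l)%R; [nra|].
  unfold Rdiv. rewrite Rmult_assoc, Rinv_l, Rmult_1_r by nra.
  assert (e * (Cmod l * Cmod l) / 2 < e * (Cmod (u n) * Cmod l))%R; [|lra].
  replace (e * (Cmod l * Cmod l) / 2)%R with (e * (Cmod l / 2 * Cmod l))%R by field.
  apply Rmult_lt_compat_l; [exact He|]. apply Rmult_lt_compat_r; lra.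
Qed.

Lemma Clim_div (u v : nat -> C) (l m : C) :
  m <> 0 -> Clim u l -> Clim v m -> Clim (fun n => u n / v n) (l / m).
Proof. intros Hm H1 H2. apply Clim_mult; [exact H1|now apply Clim_inv]. Qed.

Lemma Clim_incr_n (u : nat -> C) (N : nat) (l : C) :
  Clim (fun n => u (n + N)%nat) l <-> Clim u l.
Proof.
  rewrite !Clim_eps. split; intros H e He; destruct (H e He) as [M HM].
  - exists (M + N)%nat. intros n Hn. replace n with ((n - N) + N)%nat by lia. apply HM. lia.
  - exists M. intros n Hn. apply HM. lia.
Qed.

(** [1 + t <= exp t] bounds the products from above, so the increments [u n * e n] are absolutely
    summable. From below, [1 - t >= exp (- 2 t)] for [t <= 1/2] keeps the limit away from 0. *)
Lemma Clim_product (u : nat -> C) (e : nat -> C) :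
  (forall n, u (S n) = u n * (1 + e n)) -> u 0%nat <> 0 ->
  (forall n, (Cmod (e n) <= 1 / 2)%R) -> ex_series (fun n => Cmod (e n)) ->
  exists l : C, l <> 0 /\ Clim u l.
Proof.
  intros Hu H0 Hh [S HS].
  (* The sum of the first [n] moduli, starting with the empty sum; [sum_n] includes its last index,
     hence the shift. *)
  set (s := fun n => match n with O => 0%R | Datatypes.S m => sum_n (fun k => Cmod (e k)) m end).
  assert (Hs1 : forall n, s (Datatypes.S n) = (s n + Cmod (e n))%R).
  { intros [|n]; simpl.
    - rewrite sum_O. ring.
    - rewrite sum_Sn. reflexivity. }
  assert (HsS : forall n, (s n <= S)%R).
  { intros n. apply Rle_trans with (s (Datatypes.S n)).
    { rewrite Hs1. generalize (Cmod_ge_0 (e n)). lra. }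
    simpl. apply (is_lim_seq_incr_compare (sum_n (fun k => Cmod (e k)))).
    - exact HS.
    - intros k. rewrite sum_Sn. unfold plus; simpl. generalize (Cmod_ge_0 (e (Datatypes.S k))). lra. }
  assert (HS0 : (0 <= S)%R) by (apply (HsS 0%nat)).
  assert (Hup : forall n, (Cmod (u n) <= Cmod (u 0%nat) * exp (s n))%R).
  { induction n as [|n IH].
    - simpl. rewrite exp_0. lra.
    - rewrite Hu, Cmod_mult, Hs1, exp_plus, <- Rmult_assoc.
      apply Rmult_le_compat; auto using Cmod_ge_0.
      eapply Rle_trans; [apply Cmod_triangle|]. rewrite Cmod_1. apply exp_ineq1_le. }
  assert (Hlo : forall n, (Cmod (u 0%nat) * exp (- (2 * s n)) <= Cmod (u n))%R).
  { induction n as [|n IH].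
    - simpl. rewrite Rmult_0_r, Ropp_0, exp_0. lra.
    - rewrite Hu, Cmod_mult, Hs1.
      replace (- (2 * (s n + Cmod (e n))))%R with (- (2 * s n) + - (2 * Cmod (e n)))%R by ring.
      rewrite exp_plus, <- Rmult_assoc.
      apply Rmult_le_compat; [apply Rmult_le_pos; [apply Cmod_ge_0|left; apply exp_pos]
        |left; apply exp_pos|exact IH|].
      assert (A1 := Cmod_reverse 1 (e n)). rewrite Cmod_1 in A1.
      apply Rle_trans with (1 - Cmod (e n))%R; [|exact A1].
      set (t := Cmod (e n)) in *. assert (Ht0 : (0 <= t)%R) by apply Cmod_ge_0.
      specialize (Hh n). fold t in Hh.
      rewrite exp_Ropp. assert (A2 := exp_ineq1_le (2 * t)).
      apply Rmult_le_reg_l with (exp (2 * t)); [apply exp_pos|].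
      rewrite Rinv_r by (generalize (exp_pos (2 * t)); lra). nra. }
  set (B := (Cmod (u 0%nat) * exp S)%R).
  assert (HB : forall n, (Cmod (u n) <= B)%R).
  { intros n. eapply Rle_trans; [apply Hup|]. unfold B.
    apply Rmult_le_compat_l; [apply Cmod_ge_0|].
    destruct (Req_dec (s n) S) as [->|N]; [lra|]. left. apply exp_increasing.
    generalize (HsS n). lra. }
  (* Stated for an additive [P] bounded by the modulus, so that the real and the imaginary part are
     handled at once. *)
  assert (Hex : forall (P : C -> R), (forall z w, P (z + w) = (P z + P w)%R) ->
    (forall z, (Rabs (P z) <= Cmod z)%R) -> ex_finite_lim_seq (fun n => P (u n))).
  { intros P Padd Ple.
    assert (Es : ex_series (fun n => P (u n * e n))).
    { apply (ex_series_le (V := R_CompleteNormedModule) _ (fun n => B * Cmod (e n))%R).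
      - intros n. eapply Rle_trans; [apply Ple|]. rewrite Cmod_mult.
        apply Rmult_le_compat_r; [apply Cmod_ge_0|apply HB].
      - apply (ex_series_scal (V := R_NormedModule) B (fun n => Cmod (e n))). now exists S. }
    destruct Es as [l Hl]. exists (l + P (u 0%nat))%R.
    apply is_lim_seq_incr_1.
    apply is_lim_seq_ext with (fun n => sum_n (fun k => P (u k * e k)%C) n + P (u 0%nat))%R.
    - induction n as [|n IH].
      + rewrite sum_O, Hu. rewrite <- Padd. f_equal. ring.
      + rewrite sum_Sn. unfold plus; simpl. rewrite (Hu (Datatypes.S n)).
        replace (u (Datatypes.S n) * (1 + e (Datatypes.S n)))
          with (u (Datatypes.S n) * e (Datatypes.S n) + u (Datatypes.S n)) by ring.
        rewrite Padd, <- IH. ring.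
    - apply is_lim_seq_plus'; [exact Hl|apply is_lim_seq_const]. }
  destruct (Hex Re) as [lr Hr]; [reflexivity|apply Re_le_Cmod|].
  destruct (Hex Im) as [li Hi]; [reflexivity|apply Im_le_Cmod|].
  assert (HL : Clim u (lr, li)) by (apply Clim_parts; assumption).
  set (L := (lr, li) : C) in *.
  exists L. split; [|exact HL].
  intros E. rewrite E in HL.
  assert (Hc := Clim_Cmod _ _ HL). rewrite Cmod_0 in Hc.
  assert (Hle : (Cmod (u 0%nat) * exp (- (2 * S)) <= 0)%R).
  { apply (is_lim_seq_le (fun _ => (Cmod (u 0%nat) * exp (- (2 * S)))%R) (fun n => Cmod (u n))
      (Cmod (u 0%nat) * exp (- (2 * S)))%R 0%R); [|apply is_lim_seq_const|exact Hc].
    intros n. eapply Rle_trans; [|apply Hlo].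
    apply Rmult_le_compat_l; [apply Cmod_ge_0|].
    destruct (Req_dec (s n) S) as [->|N]; [lra|]. left. apply exp_increasing.
    generalize (HsS n). lra. }
  assert (A := proj1 (Cmod_gt_0 _) H0). generalize (exp_pos (- (2 * S))). nra.
Qed.

(** * The Gamma function *)

Definition nonpole (z : C) : Prop := forall n : nat, z <> - RtoC (INR n).

Lemma nonpole_neq (z : C) (n : nat) : nonpole z -> z + RtoC (INR n) <> 0.
Proof.
  intros H E. apply (H n). replace z with ((z + RtoC (INR n)) - RtoC (INR n)) by ring.
  rewrite E. ring.
Qed.

Lemma not_int_nonpole (z : C) : not_int z -> nonpole z.
Proof.
  intros H n E. apply (H (- Z.of_nat n)%Z). now rewrite opp_IZR, <- INR_IZR_INZ, RtoC_opp.
Qed.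

Lemma Re_pos_nonpole (z : C) : (0 < Re z)%R -> nonpole z.
Proof.
  intros H n E. rewrite E in H. simpl in H. generalize (pos_INR n). lra.
Qed.

Lemma nonpole_plus_1 (z : C) : nonpole z -> nonpole (z + 1).
Proof.
  intros H n E. apply (H (S n)). rewrite S_INR, RtoC_plus.
  replace z with ((z + 1) - 1) by ring. rewrite E. ring.
Qed.

Lemma poch_neq_0 (z : C) (n : nat) : nonpole z -> poch z n <> 0.
Proof.
  intros H. induction n as [|n IH]; simpl.
  - intros E. apply (f_equal Re) in E. simpl in E. lra.
  - apply Cmult_neq_0; [exact IH|now apply nonpole_neq].
Qed.

Lemma poch_S_l (z : C) (n : nat) : poch z (S n) = z * poch (z + 1) n.
Proof.
  induction n as [|n IH].
  - simpl. ring.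
  - change (poch z (S (S n))) with (poch z (S n) * (z + RtoC (INR (S n)))).
    rewrite IH. simpl poch. rewrite S_INR, RtoC_plus. ring.
Qed.

Definition gam (n : nat) (z : C) : C :=
  RtoC (INR (fact n)) * Cexp (z * RtoC (ln (INR n))) / poch z (S n).

Lemma ln_S_bounds (n : nat) :
  (1 <= n)%nat ->
  (/ INR (S n) <= ln (INR (S n)) - ln (INR n) <= / INR n)%R.
Proof.
  intros Hn. assert (H1 : (1 <= INR n)%R) by (apply (le_INR 1); lia).
  assert (H2 : (INR (S n) = INR n + 1)%R) by apply S_INR.
  assert (L : forall x, (0 < x)%R -> (ln x <= x - 1)%R).
  { intros x Hx. assert (A := exp_ineq1_le (ln x)). rewrite exp_ln in A by exact Hx. lra. }
  split.
  - assert (A := L (INR n / INR (S n))%R ltac:(apply Rdiv_lt_0_compat; lra)).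
    rewrite ln_div in A by lra.
    replace (INR n / INR (S n) - 1)%R with (- / INR (S n))%R in A by (rewrite H2; field; lra).
    lra.
  - assert (A := L (INR (S n) / INR n)%R ltac:(apply Rdiv_lt_0_compat; lra)).
    rewrite ln_div in A by lra.
    replace (INR (S n) / INR n - 1)%R with (/ INR n)%R in A by (rewrite H2; field; lra).
    lra.
Qed.

(** For [x >= 1] one has [1 / x^2 <= 2 (1/x - 1/(x+1))], and the right-hand side telescopes. *)
Lemma ex_series_inv_sq (N : nat) : (1 <= N)%nat ->
  ex_series (fun n => / (INR (n + N) * INR (n + N)))%R.
Proof.
  intros HN.
  apply (ex_series_le (V := R_CompleteNormedModule) _
    (fun n => 2 * (/ INR (n + N) - / INR (S n + N)))%R).
  - intros n. assert (H : (1 <= INR (n + N))%R) by (apply (le_INR 1); lia).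
    rewrite plus_Sn_m, S_INR. set (x := INR (n + N)) in *.
    change (norm (/ (x * x))%R) with (Rabs (/ (x * x))).
    rewrite Rabs_pos_eq by (left; apply Rinv_0_lt_compat; nra).
    replace (2 * (/ x - / (x + 1)))%R with (/ (x * x) * (2 * x / (x + 1)))%R by (field; lra).
    rewrite <- (Rmult_1_r (/ (x * x))) at 1.
    apply Rmult_le_compat_l; [left; apply Rinv_0_lt_compat; nra|].
    apply Rmult_le_reg_r with (x + 1)%R; [lra|].
    unfold Rdiv. rewrite Rmult_assoc, Rinv_l by lra. lra.
  - apply (ex_series_scal (V := R_NormedModule) 2%R (fun n => / INR (n + N) - / INR (S n + N))%R). exists (/ INR N)%R.
    change (is_lim_seq (sum_n (fun n => / INR (n + N) - / INR (S n + N))%R) (/ INR N)%R).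
    apply is_lim_seq_ext with (fun n => / INR N - / INR (S n + N))%R.
    + induction n as [|n IH].
      * rewrite sum_O. simpl. reflexivity.
      * rewrite sum_Sn, <- IH. unfold plus; simpl. ring.
    + replace (Finite (/ INR N)) with (Finite (/ INR N - 0)) by (f_equal; ring).
      apply is_lim_seq_minus'; [apply is_lim_seq_const|].
      replace (Finite 0) with (Rbar_inv p_infty) by reflexivity.
      apply is_lim_seq_inv; [|discriminate].
      apply is_lim_seq_ext with (fun n => INR (n + S N)).
      * intros n. f_equal. lia.
      * apply -> is_lim_seq_incr_n. apply is_lim_seq_INR.
Qed.

(** The factor is the ratio of consecutive terms of Euler's sequence. Its first order parts [z h]
    and [z / (n+1)], with [h = ln (n+1) - ln n], cancel up to [|z| / n^2]; the quadratic error of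
    the exponential adds [12 |z|^2 / n^2], and the factor 2 comes from a denominator of modulus at
    least [1/2]. *)
Lemma gam_ratio_bound (z : C) (n : nat) :
  (1 <= n)%nat -> (2 * Cmod z <= INR n)%R ->
  (Cmod (Cexp (z * RtoC (ln (INR (S n)) - ln (INR n))) / (1 + z / RtoC (INR (S n))) - 1)
   <= 2 * (12 * (Cmod z * Cmod z) + Cmod z) * / (INR n * INR n))%R.
Proof.
  intros Hn Hz. assert (H1 : (1 <= INR n)%R) by (apply (le_INR 1); lia).
  assert (HS : (INR (S n) = INR n + 1)%R) by apply S_INR.
  destruct (ln_S_bounds n Hn) as [L1 L2].
  set (h := (ln (INR (S n)) - ln (INR n))%R) in *. rewrite HS in *.
  set (x := INR n) in *. set (m := Cmod z) in *. assert (Hm : (0 <= m)%R) by apply Cmod_ge_0.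
  assert (Ix : (0 < / x)%R) by (apply Rinv_0_lt_compat; lra).
  assert (Ix1 : (0 < / (x + 1))%R) by (apply Rinv_0_lt_compat; lra).
  assert (Ixx : (/ x * x = 1)%R) by (apply Rinv_l; lra).
  assert (Hx1 : RtoC (x + 1) <> 0).
  { intros E. apply (f_equal Re) in E. simpl in E. lra. }
  assert (Hw : (Cmod (z / RtoC (x + 1)) <= 1 / 2)%R).
  { rewrite Cmod_div by exact Hx1. rewrite Cmod_RtoC_nonneg by lra. fold m.
    apply Rmult_le_reg_r with (x + 1)%R; [lra|]. unfold Rdiv at 1.
    rewrite Rmult_assoc, Rinv_l by lra. lra. }
  assert (Hd : (1 / 2 <= Cmod (1 + z / RtoC (x + 1)))%R).
  { assert (A := Cmod_reverse 1 (z / RtoC (x + 1))). rewrite Cmod_1 in A. lra. }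
  assert (Hd0 : 1 + z / RtoC (x + 1) <> 0) by (apply Cmod_gt_0; lra).
  set (w := Cexp (z * RtoC h)).
  replace (w / (1 + z / RtoC (x + 1)) - 1)
    with (((w - 1 - z * RtoC h) + z * RtoC (h - / (x + 1))) / (1 + z / RtoC (x + 1))).
  2: { rewrite RtoC_minus, RtoC_inv by lra. field. split; [exact Hx1|].
       intros E. apply Hd0.
       replace (1 + z / RtoC (x + 1)) with ((RtoC (x + 1) + z) / RtoC (x + 1)) by (field; exact Hx1).
       rewrite E. unfold Cdiv. ring. }
  rewrite Cmod_div by exact Hd0.
  assert (Hzh : (Cmod (z * RtoC h) <= m * / x)%R).
  { rewrite Cmod_mult, Cmod_RtoC_nonneg by lra. fold m. apply Rmult_le_compat_l; lra. }
  assert (Hmx : (m * / x <= 1 / 2)%R) by nra.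
  assert (B1 := Cmod_Cexp_minus_1_lin (z * RtoC h) ltac:(lra)). fold w in B1.
  assert (B1' : (Cmod (w - 1 - z * RtoC h) <= 12 * (m * m) * (/ x * / x))%R).
  { eapply Rle_trans; [exact B1|].
    replace (12 * (m * m) * (/ x * / x))%R with (12 * ((m * / x) * (m * / x)))%R by ring.
    apply Rmult_le_compat_l; [lra|].
    apply Rmult_le_compat; auto using Cmod_ge_0. }
  assert (B2 : (Cmod (z * RtoC (h - / (x + 1))) <= m * (/ x * / x))%R).
  { rewrite Cmod_mult, Cmod_RtoC_nonneg by lra. fold m. apply Rmult_le_compat_l; [lra|].
    apply Rle_trans with (/ x - / (x + 1))%R; [lra|].
    replace (/ x - / (x + 1))%R with (/ x * / (x + 1))%R by (field; lra).
    apply Rmult_le_compat_l; [lra|]. apply Rinv_le_contravar; lra. }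
  rewrite Rinv_mult.
  apply Rmult_le_reg_r with (Cmod (1 + z / RtoC (x + 1))); [lra|].
  unfold Rdiv at 1. rewrite Rmult_assoc, Rinv_l, Rmult_1_r by lra.
  eapply Rle_trans; [apply Cmod_triangle|].
  set (Q := (/ x * / x)%R) in *. assert (HQ : (0 < Q)%R) by (unfold Q; nra).
  apply Rle_trans with ((12 * (m * m) + m) * Q)%R; [lra|].
  assert (0 <= (12 * (m * m) + m) * Q)%R by (apply Rmult_le_pos; nra).
  replace (2 * (12 * (m * m) + m) * Q * Cmod (1 + z / RtoC (x + 1)))%R
    with ((12 * (m * m) + m) * Q * (2 * Cmod (1 + z / RtoC (x + 1))))%R by ring.
  rewrite <- (Rmult_1_r ((12 * (m * m) + m) * Q)) at 1.
  apply Rmult_le_compat_l; lra.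
Qed.

Lemma RtoC_INR_neq_0 (n : nat) : (1 <= n)%nat -> RtoC (INR n) <> 0.
Proof.
  intros Hn E. apply (f_equal Re) in E. simpl in E.
  assert (1 <= INR n)%R by (apply (le_INR 1); lia). lra.
Qed.

Lemma gam_neq_0 (z : C) (n : nat) : nonpole z -> gam n z <> 0.
Proof.
  intros Hz. unfold gam. apply Cmult_neq_0.
  - apply Cmult_neq_0; [|apply Cexp_neq_0]. apply RtoC_INR_neq_0. apply lt_O_fact.
  - intros E. assert (H := poch_neq_0 z (S n) Hz).
    assert (H1 : / poch z (S n) * poch z (S n) = 1) by (apply Cinv_l; exact H).
    rewrite E, Cmult_0_l in H1. apply (f_equal Re) in H1. simpl in H1. lra.
Qed.

Lemma gam_S (z : C) (n : nat) :
  nonpole z -> (1 <= n)%nat ->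
  gam (S n) z = gam n z *
    (Cexp (z * RtoC (ln (INR (S n)) - ln (INR n))) / (1 + z / RtoC (INR (S n)))).
Proof.
  intros Hz Hn. unfold gam.
  change (poch z (S (S n))) with (poch z (S n) * (z + RtoC (INR (S n)))).
  rewrite fact_simpl, mult_INR, RtoC_mult, RtoC_minus.
  replace (z * RtoC (ln (INR (S n)))) with
    (z * RtoC (ln (INR n)) + z * (RtoC (ln (INR (S n))) - RtoC (ln (INR n)))) by ring.
  rewrite Cexp_plus.
  assert (H1 := poch_neq_0 z (S n) Hz). assert (H2 := nonpole_neq z (S n) Hz).
  assert (H3 := RtoC_INR_neq_0 (S n) ltac:(lia)).
  set (P := poch z (S n)) in *. set (m := RtoC (INR (S n))) in *.
  field. repeat split; auto. now rewrite Cplus_comm.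
Qed.

Lemma gam_Clim (z : C) : nonpole z -> exists l : C, l <> 0 /\ Clim (fun n => gam n z) l.
Proof.
  intros Hz.
  set (K := (2 * (12 * (Cmod z * Cmod z) + Cmod z))%R).
  assert (HK : (0 <= K)%R) by (unfold K; generalize (Cmod_ge_0 z); nra).
  (* Beyond this index the hypothesis of [gam_ratio_bound] holds and its bound [K / n^2] is at most
     [1/2], as [Clim_product] requires. *)
  destruct (nfloor_ex (2 * Cmod z + 2 * K + 1)) as [N [_ HN]].
  { generalize (Cmod_ge_0 z); lra. }
  rewrite <- S_INR in HN. set (n0 := S N) in *.
  assert (Hn0 : forall n, (2 * Cmod z + 2 * K + 1 < INR (n + n0))%R).
  { intros n. eapply Rlt_le_trans; [exact HN|]. apply le_INR. lia. }
  destruct (Clim_product (fun n => gam (n + n0) z)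
    (fun n => Cexp (z * RtoC (ln (INR (S (n + n0))) - ln (INR (n + n0))))
       / (1 + z / RtoC (INR (S (n + n0)))) - 1)) as [l [Hl1 Hl2]].
  - intros n. rewrite plus_Sn_m, gam_S by (auto; unfold n0; lia). f_equal. ring.
  - now apply gam_neq_0.
  - intros n. eapply Rle_trans; [apply gam_ratio_bound|].
    + unfold n0; lia.
    + generalize (Hn0 n) (Cmod_ge_0 z); lra.
    + fold K. specialize (Hn0 n). set (x := INR (n + n0)) in *.
      assert (B := Cmod_ge_0 z).
      apply Rmult_le_reg_r with (x * x)%R; [nra|].
      rewrite Rmult_assoc, Rinv_l by nra. nra.
  - apply (ex_series_le (V := R_CompleteNormedModule) _
      (fun n => K * / (INR (n + n0) * INR (n + n0)))%R).
    + intros n. eapply Rle_trans; [|apply gam_ratio_bound].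
      * right. apply Rabs_pos_eq. apply Cmod_ge_0.
      * unfold n0; lia.
      * generalize (Hn0 n) (Cmod_ge_0 z); lra.
    + apply (ex_series_scal (V := R_NormedModule) K
        (fun n => / (INR (n + n0) * INR (n + n0)))%R).
      apply ex_series_inv_sq. unfold n0; lia.
  - exists l. split; [exact Hl1|]. exact (proj1 (Clim_incr_n (fun n => gam n z) n0 l) Hl2).
Qed.

Lemma CGamma_Clim (z : C) : nonpole z -> Clim (fun n => gam n z) (CGamma z).
Proof.
  intros Hz. destruct (gam_Clim z Hz) as [l [_ Hl]].
  replace (CGamma z) with l; [exact Hl|]. symmetry. exact (Clim_CLim_seq _ _ Hl).
Qed.

Lemma CGamma_neq_0 (z : C) : nonpole z -> CGamma z <> 0.
Proof.
  intros Hz. destruct (gam_Clim z Hz) as [l [H0 Hl]].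
  now rewrite (Clim_unique _ _ _ (CGamma_Clim z Hz) Hl).
Qed.

Lemma Clim_ratio_S (w : C) : Clim (fun n => RtoC (INR n) / (w + RtoC (INR n))) 1.
Proof.
  apply Clim_ext_loc with (fun n => / (1 + w * / RtoC (INR n))).
  - destruct (nfloor_ex (Cmod w + 1)) as [N [_ HN]]; [generalize (Cmod_ge_0 w); lra|].
    rewrite <- S_INR in HN. exists (S N). intros n Hn.
    assert (H1 : (Cmod w + 1 < INR n)%R) by (eapply Rlt_le_trans; [exact HN|apply le_INR; lia]).
    assert (H2 := RtoC_INR_neq_0 n ltac:(lia)).
    assert (H3 : w + RtoC (INR n) <> 0).
    { apply Cmod_gt_0. rewrite Cplus_comm. assert (A := Cmod_reverse (RtoC (INR n)) w).
      rewrite Cmod_RtoC_nonneg in A by apply pos_INR. lra. }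
    assert (H4 : RtoC (INR n) + w <> 0) by (rewrite Cplus_comm; exact H3).
    field. auto.
  - assert (E : / (1 + w * 0) = RtoC 1) by (rewrite Cmult_0_r, Cplus_0_r; field).
    apply (Clim_eq _ _ _ E). clear E.
    apply Clim_inv.
    { rewrite Cmult_0_r, Cplus_0_r. intros E. apply (f_equal Re) in E. simpl in E. lra. }
    apply Clim_plus; [apply Clim_const|]. apply Clim_scal.
    apply (proj1 (Clim_incr_n (fun n => / RtoC (INR n)) 1 0)).
    apply Clim_le with (fun n => / INR (n + 1))%R.
    + exists 0%nat. intros n _. replace (/ RtoC (INR (n + 1)) - 0) with (/ RtoC (INR (n + 1))) by ring.
      rewrite Cmod_inv by (apply RtoC_INR_neq_0; lia).
      rewrite Cmod_RtoC_nonneg by apply pos_INR. lra.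
    + replace (Finite 0) with (Rbar_inv p_infty) by reflexivity.
      apply is_lim_seq_inv; [|discriminate].
      apply -> is_lim_seq_incr_n. apply is_lim_seq_INR.
Qed.

Lemma CGamma_plus_1 (z : C) : nonpole z -> CGamma (z + 1) = z * CGamma z.
Proof.
  intros Hz. apply (Clim_unique (fun n => gam n (z + 1))).
  - apply CGamma_Clim. now apply nonpole_plus_1.
  - apply Clim_ext_loc with (fun n => z * gam n z * (RtoC (INR n) / ((z + 1) + RtoC (INR n)))).
    + exists 1%nat. intros n Hn. unfold gam.
      assert (Hn' : (1 <= INR n)%R) by (apply (le_INR 1); lia).
      rewrite Cmult_plus_distr_r, Cmult_1_l, Cexp_plus, Cexp_ln by lra.
      assert (H0 := nonpole_plus_1 z Hz).
      assert (H1 := poch_neq_0 z (S n) Hz). assert (H2 := poch_neq_0 (z + 1) n H0).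
      assert (H3 := nonpole_neq _ n H0). rewrite (poch_S_l z n) in H1 |- *.
      change (poch (z + 1) (S n)) with (poch (z + 1) n * ((z + 1) + RtoC (INR n))).
      assert (Hz0 : z <> 0) by (intros E; apply H1; rewrite E; ring).
      field. auto.
    + replace (z * CGamma z) with (z * CGamma z * 1) by ring.
      apply Clim_mult; [apply Clim_scal; now apply CGamma_Clim|apply Clim_ratio_S].
Qed.

(** * The Beta integral *)

(* [mom N alpha y] is the integral of [s^(alpha-1) (1-s)^N] from [0] to [y], for [alpha > 0]. *)
Fixpoint mom (N : nat) (alpha y : R) : R :=
  match N with
  | O => (Rpower y alpha / alpha)%R
  | S M => (Rpower y alpha * (1 - y) ^ N / alpha + INR N / alpha * mom M (alpha + 1) y)%R
  end.

Lemma is_derive_Rpower (a y : R) :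
  (0 < y)%R -> is_derive (fun x => Rpower x a) y (a * Rpower y (a - 1))%R.
Proof. intros Hy. apply is_derive_Reals. now apply derivable_pt_lim_power. Qed.

(** The recursion defining [mom] is the integrated form of an integration by parts, so on
    differentiating it the terms with [(1 - y)^(N-1)] cancel and only the integrand survives. The
    moments are thereby usable as primitives without integrals from 0. *)
Lemma mom_derive (N : nat) (a y : R) :
  (0 < a)%R -> (0 < y)%R -> is_derive (mom N a) y (Rpower y (a - 1) * (1 - y) ^ N)%R.
Proof.
  revert a. induction N as [|N IH]; intros a Ha Hy.
  - replace (Rpower y (a - 1) * (1 - y) ^ 0)%R with (/ a * (a * Rpower y (a - 1)))%R
      by (simpl; field; lra).
    apply is_derive_ext with (fun x => / a * Rpower x a)%R.
    { intros x. simpl. unfold Rdiv. ring. }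
    apply (is_derive_scal (fun x => Rpower x a)). now apply is_derive_Rpower.
  - assert (D1 := is_derive_Rpower a y Hy).
    assert (D2 := IH (a + 1)%R ltac:(lra) Hy).
    replace (a + 1 - 1)%R with a in D2 by ring.
    assert (D3 : is_derive (fun x => (1 - x) ^ S N)%R y (- (INR (S N) * (1 - y) ^ N))%R).
    { auto_derive; [exact I|]. change (match N with O => 1%R | S _ => (INR N + 1)%R end) with (INR (S N)). change (1 + - y)%R with (1 - y)%R. ring. }
    set (c := INR (S N)) in *.
    replace (Rpower y (a - 1) * (1 - y) ^ S N)%R with
      (/ a * ((a * Rpower y (a - 1)) * (1 - y) ^ S N + Rpower y a * (- (c * (1 - y) ^ N)))
       + c / a * (Rpower y a * (1 - y) ^ N))%R by (field; lra).
    apply is_derive_ext with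
      (fun x => / a * (Rpower x a * (1 - x) ^ S N) + c / a * mom N (a + 1) x)%R.
    { intros x. change R in x. cbn [mom pow]. fold c. unfold Rdiv.
      match goal with |- ?a = ?b => change (@eq R a b) end. ring. }
    apply (is_derive_plus (V := R_NormedModule) (fun x => / a * (Rpower x a * (1 - x) ^ S N))%R
      (fun x => c / a * mom N (a + 1) x)%R).
    + apply (is_derive_scal (fun x => Rpower x a * (1 - x) ^ S N)%R).
      apply (is_derive_mult (fun x => Rpower x a) (fun x => (1 - x) ^ S N)%R); auto.
      intros u v. apply Rmult_comm.
    + apply (is_derive_scal (mom N (a + 1))). exact D2.
Qed.

Lemma Rpower_pos (x a : R) : (0 < Rpower x a)%R.
Proof. apply exp_pos. Qed.

Lemma mom_nonneg (N : nat) (a y : R) : (0 < a)%R -> (0 < y <= 1)%R -> (0 <= mom N a y)%R.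
Proof.
  revert a. induction N as [|N IH]; intros a Ha Hy; simpl mom;
    assert (H1 := Rpower_pos y a).
  - left. now apply Rdiv_lt_0_compat.
  - assert (H2 := IH (a + 1)%R ltac:(lra) Hy).
    assert (H3 : (0 <= (1 - y) ^ S N)%R) by (apply pow_le; lra).
    apply Rplus_le_le_0_compat.
    + apply Rmult_le_pos; [|left; now apply Rinv_0_lt_compat]. apply Rmult_le_pos; [lra|exact H3].
    + apply Rmult_le_pos; [|exact H2]. apply Rmult_le_pos; [apply (pos_INR (S N))|].
      left; now apply Rinv_0_lt_compat.
Qed.

Lemma mom_le_1 (N : nat) (a y : R) :
  (0 < a)%R -> (0 < y <= 1)%R -> (mom N a y <= mom N a 1)%R.
Proof.
  intros Ha Hy.
  destruct (MVT_gen (mom N a) y 1 (fun x => Rpower x (a - 1) * (1 - x) ^ N)%R) as [c [Hc E]].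
  - intros x Hx. rewrite Rmin_left, Rmax_right in Hx by lra. apply mom_derive; lra.
  - intros x Hx. rewrite Rmin_left, Rmax_right in Hx by lra.
    apply continuity_pt_filterlim. 
    apply (ex_derive_continuous (mom N a) x). eexists. apply mom_derive; lra.
  - rewrite Rmin_left, Rmax_right in Hc by lra.
    assert (0 <= Rpower c (a - 1) * (1 - c) ^ N * (1 - y))%R; [|lra].
    apply Rmult_le_pos; [|lra]. apply Rmult_le_pos; [left; apply Rpower_pos|apply pow_le; lra].
Qed.

Lemma mom_1_eq (N : nat) (a : R) :
  (0 < a)%R -> RtoC (mom N a 1) = RtoC (INR (fact N)) / poch (RtoC a) (S N).
Proof.
  assert (Hone : forall b, Rpower 1 b = 1%R).
  { intros b. unfold Rpower. rewrite ln_1, Rmult_0_r. apply exp_0. }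
  revert a. induction N as [|N IH]; intros a Ha.
  - simpl. rewrite Hone. unfold Rdiv. rewrite Rmult_1_l, RtoC_inv by lra.
    field. intros E. apply (f_equal Re) in E. simpl in E. lra.
  - rewrite poch_S_l. cbn [mom]. rewrite Hone.
    replace (1 - 1)%R with 0%R by ring. rewrite pow_i by lia.
    replace (1 * 0 / a + INR (S N) / a * mom N (a + 1) 1)%R
      with (INR (S N) * (/ a * mom N (a + 1) 1))%R by (field; lra).
    rewrite !RtoC_mult, RtoC_inv by lra. rewrite IH by lra.
    rewrite fact_simpl, mult_INR, RtoC_mult.
    rewrite RtoC_plus.
    assert (H1 : poch (RtoC a + 1) (S N) <> 0).
    { apply poch_neq_0. apply Re_pos_nonpole. simpl. lra. }
    assert (H2 : RtoC a <> 0).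
    { intros E. apply (f_equal Re) in E. simpl in E. lra. }
    field. auto.
Qed.

(** [mom N a 1] equals [gam N a * N^(-a)] by [mom_1_eq], and the convergent sequence [gam N a] is
    bounded. *)
Lemma mom_1_bound (a : R) :
  (0 < a)%R -> exists (K : R) (N0 : nat), (0 < K)%R /\ (1 <= N0)%nat /\
    forall N, (N0 <= N)%nat -> (mom N a 1 <= K * exp (- (a * ln (INR N))))%R.
Proof.
  intros Ha. assert (Hp : nonpole (RtoC a)) by (apply Re_pos_nonpole; simpl; lra).
  destruct (proj1 (Clim_eps _ _) (CGamma_Clim _ Hp) 1%R Rlt_0_1) as [N0 HN].
  exists (Cmod (CGamma (RtoC a)) + 1)%R, (S N0).
  split; [generalize (Cmod_ge_0 (CGamma (RtoC a))); lra|]. split; [lia|].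
  intros N HNN. specialize (HN N ltac:(lia)).
  rewrite <- (Cmod_RtoC_nonneg (mom N a 1)) by (apply mom_nonneg; lra).
  rewrite mom_1_eq by exact Ha.
  replace (RtoC (INR (fact N)) / poch (RtoC a) (S N))
    with (gam N (RtoC a) * Cexp (- (RtoC a * RtoC (ln (INR N))))).
  2: { unfold gam. rewrite Cexp_opp. assert (H1 := poch_neq_0 _ (S N) Hp).
       field. split; [exact H1|apply Cexp_neq_0]. }
  rewrite Cmod_mult, <- RtoC_mult, <- RtoC_opp, Cexp_RtoC.
  rewrite (Cmod_RtoC_nonneg (exp _)) by (left; apply exp_pos).
  apply Rmult_le_compat_r; [left; apply exp_pos|].
  replace (gam N (RtoC a)) with ((gam N (RtoC a) - CGamma (RtoC a)) + CGamma (RtoC a)) by ring.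
  eapply Rle_trans; [apply Cmod_triangle|]. lra.
Qed.

(** The boundary term of [mom N a e] is already [e^a (1 - e)^N / a]. This lets every geometrically
    small error be absorbed into a moment. *)
Lemma geom_le_mom (N : nat) (a e : R) :
  (0 < a)%R -> (0 < e <= 1)%R -> ((1 - e) ^ N <= a / Rpower e a * mom N a 1)%R.
Proof.
  intros Ha He. assert (Hp := Rpower_pos e a).
  apply Rle_trans with (a / Rpower e a * mom N a e)%R.
  2: { apply Rmult_le_compat_l; [left; now apply Rdiv_lt_0_compat|now apply mom_le_1]. }
  destruct N as [|N]; cbn [mom].
  - simpl. right. field. lra.
  - replace (a / Rpower e a * (Rpower e a * (1 - e) ^ S N / a + INR (S N) / a * mom N (a + 1) e))%R
      with ((1 - e) ^ S N + INR (S N) / Rpower e a * mom N (a + 1) e)%R by (field; lra).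
    assert (0 <= INR (S N) / Rpower e a * mom N (a + 1) e)%R; [|lra].
    apply Rmult_le_pos; [|apply mom_nonneg; lra].
    apply Rmult_le_pos; [apply pos_INR|left; now apply Rinv_0_lt_compat].
Qed.

(** The only majorants needed are an affine function times [(1 - y)^N]. A factor [y] raises the
    exponent of the moment by one, which gains a factor [1/N] in size. *)
Lemma Rop_collapse_mom (e e' : R) (p : C) (G dG : C -> C) (c0 c1 : R) (N : nat) :
  (0 < e < e')%R -> (e < 1)%R -> not_int p -> (0 < Re p)%R -> (0 <= c0)%R -> (0 <= c1)%R ->
  (forall z, (Cmod z < e')%R -> holo G z (dG z) /\ cont dG z) ->
  (forall y, (0 < y <= e)%R -> (Cmod (G (RtoC y)) <= (c0 + c1 * y) * (1 - y) ^ N)%R) ->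
  (Cmod (Rop e p G) <= c0 * mom N (Re p) 1 + c1 * mom N (Re p + 1) 1)%R.
Proof.
  intros He He1 Hp Hr H0 H1 HG HA.
  apply Rle_trans with (c0 * mom N (Re p) e + c1 * mom N (Re p + 1) e)%R.
  2: { apply Rplus_le_compat; apply Rmult_le_compat_l; auto; apply mom_le_1; lra. }
  apply (Rop_collapse e e' p G dG (fun y => (c0 + c1 * y) * (1 - y) ^ N)%R
    (fun y => c0 * mom N (Re p) y + c1 * mom N (Re p + 1) y)%R He Hp Hr HG HA).
  - intros y Hy. split.
    + replace (Rpower y (Re p - 1) * ((c0 + c1 * y) * (1 - y) ^ N))%R with
        (c0 * (Rpower y (Re p - 1) * (1 - y) ^ N) + c1 * (Rpower y (Re p + 1 - 1) * (1 - y) ^ N))%R.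
      * apply (is_derive_plus (V := R_NormedModule) (fun y => c0 * mom N (Re p) y)%R
          (fun y => c1 * mom N (Re p + 1) y)%R).
        -- apply (is_derive_scal (mom N (Re p))). apply mom_derive; lra.
        -- apply (is_derive_scal (mom N (Re p + 1))). apply mom_derive; lra.
      * replace (Re p + 1 - 1)%R with ((Re p - 1) + 1)%R by ring.
        rewrite Rpower_plus, Rpower_1 by lra. ring.
    + apply continuous_Rmult.
      * apply continuous_Rplus; [apply continuous_const|].
        apply continuous_Rmult; [apply continuous_const|apply continuous_id].
      * apply (ex_derive_continuous (fun y => (1 - y) ^ N)%R). auto_derive. exact I.
  - intros y Hy. apply Rplus_le_le_0_compat; apply Rmult_le_pos; auto; apply mom_nonneg; lra.
Qed.

(** The range starts at [1/3] because [1 - y0 - y1 > 1/3] when [y0, y1 <= e < 1/3]. On it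
    [|ln x| <= 3 (1 - x)], and the constant 13 of [Cmod_Cexp_minus_1] gives [39 = 13 * 3]. *)
Lemma cpow_near_1 (k : C) :
  exists c : R, (0 <= c)%R /\ forall x, (1 / 3 <= x <= 1)%R ->
    (Cmod (cpow (RtoC x) k - 1) <= c * (1 - x))%R.
Proof.
  exists (39 * Cmod k * exp (3 * Cmod k))%R.
  assert (Hk := Cmod_ge_0 k). split.
  { apply Rmult_le_pos; [lra|left; apply exp_pos]. }
  intros x Hx. rewrite cpow_pos by lra.
  assert (L : (Rabs (ln x) <= 3 * (1 - x))%R).
  { rewrite Rabs_left1.
    - rewrite <- ln_Rinv by lra.
      assert (A := exp_ineq1_le (ln (/ x))).
      rewrite exp_ln in A by (apply Rinv_0_lt_compat; lra).
      assert (Hi : (/ x - 1 <= 3 * (1 - x))%R); [|lra].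
      apply Rmult_le_reg_r with x; [lra|]. rewrite Rmult_minus_distr_r, Rinv_l by lra. nra.
    - rewrite <- ln_1. destruct (Req_dec x 1) as [->|N]; [lra|]. left. apply ln_increasing; lra. }
  eapply Rle_trans; [apply Cmod_Cexp_minus_1|].
  rewrite Cmod_mult, Cmod_R.
  assert (E : (exp (Cmod k * Rabs (ln x)) <= exp (3 * Cmod k))%R).
  { apply exp_le. generalize (Rabs_pos (ln x)). nra. }
  replace (39 * Cmod k * exp (3 * Cmod k) * (1 - x))%R
    with (13 * (Cmod k * (3 * (1 - x))) * exp (3 * Cmod k))%R by ring.
  apply Rmult_le_compat; [|left; apply exp_pos| |exact E].
  - generalize (Rabs_pos (ln x)). nra.
  - apply Rmult_le_compat_l; [lra|]. apply Rmult_le_compat_l; lra.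
Qed.

Lemma Re_1_minus_pos (z : C) : (Cmod z < 1)%R -> (0 < Re (1 - z))%R.
Proof.
  intros H. assert (A := Re_le_Cmod z). assert (B := Rle_abs (Re z)).
  change (Re (1 - z)) with (1 - Re z)%R. lra.
Qed.

Lemma holo_cpow_1m (k z : C) :
  (Cmod z < 1)%R -> holo (fun w => cpow (1 - w) k) z (- (k * cpow (1 - z) (k - 1))).
Proof.
  intros H. eapply dq_eq.
  - apply (dq_cpow (X := C_UniformSpace) _ (fun w => 1 - w)); [apply cont_C_id| |].
    + apply dq_minus; [apply dq_const|apply dq_id].
    + now apply Re_1_minus_pos.
  - ring.
Qed.

Lemma cont_cpow_1m (k z : C) : (Cmod z < 1)%R -> cont (fun w => cpow (1 - w) k) z.
Proof. intros H. cont_tac. now apply Re_1_minus_pos. Qed.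

(** * The integral over the regularized interval, its recurrences and its value *)

Definition seg (a b : R) (r : R) : C := RtoC (a + r * (b - a)).

Definition Bint (a b : R) (p q : C) : C :=
  CInt (fun r => cpow (seg a b r) (p - 1) * cpow (1 - seg a b r) (q - 1) * RtoC (b - a)) 0 1.

Lemma seg_bounds (a b r : R) : (a <= b)%R -> (0 <= r <= 1)%R ->
  (a <= Re (seg a b r) <= b)%R.
Proof. intros Hab Hr. simpl. nra. Qed.

Lemma rder_seg (a b r : R) : rder (seg a b) r (RtoC (b - a)).
Proof.
  apply dq_ext with (fun s => RtoC a + RtoC (b - a) * RtoC s).
  - intros s. change R in s. unfold seg. rewrite RtoC_plus, RtoC_mult. ring.
  - eapply dq_eq; [apply dq_plus; [apply dq_const|apply (dq_scal RtoC RtoC); apply dq_id]|ring].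
Qed.

Lemma cont_seg (a b r : R) : cont (seg a b) r.
Proof. exact (dq_cont _ _ _ _ (cont_R_RtoC r) (rder_seg a b r)). Qed.

Lemma seg_0 (a b : R) : seg a b 0 = RtoC a.
Proof. unfold seg. f_equal. ring. Qed.

Lemma seg_1 (a b : R) : seg a b 1 = RtoC b.
Proof. unfold seg. f_equal. ring. Qed.

Lemma cont_Bint (a b : R) (p q : C) (r : R) :
  (0 < a)%R -> (a <= b < 1)%R -> (0 <= r <= 1)%R ->
  cont (fun r => cpow (seg a b r) (p - 1) * cpow (1 - seg a b r) (q - 1) * RtoC (b - a)) r.
Proof.
  intros Ha Hb Hr. assert (S := seg_bounds a b r ltac:(lra) Hr).
  assert (K := cont_seg a b r).
  cont_tac; [lra|]. change (Re (1 - seg a b r)) with (1 - Re (seg a b r))%R. lra.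
Qed.

Lemma Bint_parts (a b : R) (p q : C) :
  (0 < a)%R -> (a <= b < 1)%R ->
  p * Bint a b p (q + 1) - q * Bint a b (p + 1) q =
  cpow (RtoC b) p * cpow (1 - RtoC b) q - cpow (RtoC a) p * cpow (1 - RtoC a) q.
Proof.
  intros Ha Hb.
  set (s := seg a b).
  assert (I : isI (fun r => p * (cpow (s r) (p - 1) * cpow (1 - s r) (q + 1 - 1) * RtoC (b - a))
     - q * (cpow (s r) (p + 1 - 1) * cpow (1 - s r) (q - 1) * RtoC (b - a))) 0 1
     (p * Bint a b p (q + 1) - q * Bint a b (p + 1) q)).
  { apply isI_minus; apply isI_scal; apply isI_CInt; apply exI_cont; try lra;
      intros r Hr; now apply cont_Bint. }
  assert (J : isI (fun r => p * (cpow (s r) (p - 1) * cpow (1 - s r) (q + 1 - 1) * RtoC (b - a))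
     - q * (cpow (s r) (p + 1 - 1) * cpow (1 - s r) (q - 1) * RtoC (b - a))) 0 1
     (cpow (s 1%R) p * cpow (1 - s 1%R) q - cpow (s 0%R) p * cpow (1 - s 0%R) q)).
  { apply (isI_FTC (fun r => cpow (s r) p * cpow (1 - s r) q)); [lra| |].
    - intros r Hr. assert (S := seg_bounds a b r ltac:(lra) Hr). fold s in S.
      assert (D := rder_seg a b r). fold s in D.
      eapply dq_eq.
      + apply (dq_mult RtoC (fun r => cpow (s r) p) (fun r => cpow (1 - s r) q)); [apply cont_R_RtoC| |].
        * apply (dq_cpow RtoC s); [apply cont_R_RtoC|exact D|lra].
        * apply (dq_cpow RtoC (fun r => 1 - s r)); [apply cont_R_RtoC| |].
          -- apply dq_minus; [apply dq_const|exact D].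
          -- change (Re (1 - s r)) with (1 - Re (s r))%R. lra.
      + replace (p + 1 - 1) with p by ring. replace (q + 1 - 1) with q by ring.
        change R in r. ring.
    - intros r Hr. apply cont_minus; apply cont_mult; try apply cont_const; now apply cont_Bint. }
  rewrite <- (isI_unique _ _ _ _ I), (isI_unique _ _ _ _ J).
  unfold s. now rewrite seg_0, seg_1.
Qed.

Lemma Bint_sum (a b : R) (p q : C) :
  (0 < a)%R -> (a <= b < 1)%R ->
  Bint a b p q = Bint a b (p + 1) q + Bint a b p (q + 1).
Proof.
  intros Ha Hb. unfold Bint. rewrite <- CInt_plus.
  - apply CInt_ext; [lra|]. intros r Hr. assert (S := seg_bounds a b r ltac:(lra) Hr).
    replace (p + 1 - 1) with (p - 1 + 1) by ring. replace (q + 1 - 1) with (q - 1 + 1) by ring.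
    rewrite !cpow_S; [ring| |lra].
    change (Re (1 - seg a b r)) with (1 - Re (seg a b r))%R. lra.
  - apply exI_cont; [lra|]; intros r Hr; now apply cont_Bint.
  - apply exI_cont; [lra|]; intros r Hr; now apply cont_Bint.
Qed.

Lemma RtoC_1m (x : R) : 1 - RtoC x = RtoC (1 - x).
Proof. now rewrite RtoC_minus. Qed.

(* The integral of [s^(p-1) (1-s)^(q-1)] over the regularization of (0, 1). *)
Definition Ireg (e : R) (p q : C) : C :=
  Bint e (1 - e) p q + Rop e p (fun z => cpow (1 - z) (q - 1))
  + Rop e q (fun z => cpow (1 - z) (p - 1)).

Lemma Rop_cpow_parts (e : R) (p q : C) :
  (0 < e < 1)%R -> not_int p ->
  p * Rop e p (fun z => cpow (1 - z) (q + 1 - 1)) - q * Rop e (p + 1) (fun z => cpow (1 - z) (q - 1))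
  = cpow (RtoC e) p * cpow (RtoC (1 - e)) q.
Proof.
  intros He Hp. replace (q + 1 - 1) with q by ring.
  rewrite <- RtoC_1m.
  rewrite <- (Rop_parts e p (fun z => cpow (1 - z) q) (fun z => - (q * cpow (1 - z) (q - 1)))
    ltac:(lra) Hp).
  - rewrite (Rop_ext e (p + 1) (fun z => - (q * cpow (1 - z) (q - 1)))
      (fun z => (- q) * cpow (1 - z) (q - 1)) ltac:(lra)) by (intros; ring).
    rewrite Rop_scal; [ring|lra|]. intros z Hz. apply cont_cpow_1m. lra.
  - intros z Hz. split; [apply holo_cpow_1m; lra|].
    apply cont_opp. apply cont_mult; [apply cont_const|]. apply cont_cpow_1m. lra.
Qed.

Lemma Rop_cpow_sum (e : R) (p q : C) :
  (0 < e < 1)%R ->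
  Rop e p (fun z => cpow (1 - z) (q - 1)) =
  Rop e (p + 1) (fun z => cpow (1 - z) (q - 1)) + Rop e p (fun z => cpow (1 - z) (q + 1 - 1)).
Proof.
  intros He. rewrite Rop_shift, <- Rop_plus; [|lra| |].
  - apply Rop_ext; [lra|]. intros z Hz.
    replace (q + 1 - 1) with (q - 1 + 1) by ring.
    rewrite (cpow_S (1 - z)) by (apply Re_1_minus_pos; lra). ring.
  - intros z Hz. apply cont_mult; [apply cont_C_id|]. apply cont_cpow_1m. lra.
  - intros z Hz. apply cont_cpow_1m. lra.
Qed.

(** The cycle condition: the boundary values of the middle segment at [e] and [1 - e] cancel against
    those left by the two circles. *)
Lemma Ireg_parts (e : R) (p q : C) :
  (0 < e < 1 / 2)%R -> not_int p -> not_int q ->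
  p * Ireg e p (q + 1) = q * Ireg e (p + 1) q.
Proof.
  intros He Hp Hq. unfold Ireg.
  assert (B := Bint_parts e (1 - e) p q ltac:(lra) ltac:(lra)).
  rewrite !RtoC_1m in B. replace (1 - (1 - e))%R with e in B by ring.
  assert (C1 := Rop_cpow_parts e p q ltac:(lra) Hp).
  assert (C2 := Rop_cpow_parts e q p ltac:(lra) Hq).
  set (B1 := Bint e (1 - e) p (q + 1)) in *. set (B2 := Bint e (1 - e) (p + 1) q) in *.
  set (R1 := Rop e p (fun z => cpow (1 - z) (q + 1 - 1))) in *.
  set (R2 := Rop e (p + 1) (fun z => cpow (1 - z) (q - 1))) in *.
  set (R3 := Rop e q (fun z => cpow (1 - z) (p + 1 - 1))) in *.
  set (R4 := Rop e (q + 1) (fun z => cpow (1 - z) (p - 1))) in *.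
  replace (p * (B1 + R1 + R4)) with (q * (B2 + R2 + R3) +
    ((p * B1 - q * B2) + (p * R1 - q * R2) - (q * R3 - p * R4))) by ring.
  rewrite B, C1, C2. ring.
Qed.

Lemma Ireg_sum (e : R) (p q : C) :
  (0 < e < 1 / 2)%R -> Ireg e p q = Ireg e (p + 1) q + Ireg e p (q + 1).
Proof.
  intros He. unfold Ireg.
  rewrite (Bint_sum e (1 - e)) by lra.
  rewrite (Rop_cpow_sum e p q), (Rop_cpow_sum e q p) by lra. ring.
Qed.

Lemma Ireg_S_l (e : R) (p q : C) :
  (0 < e < 1 / 2)%R -> not_int p -> not_int q ->
  (p + q) * Ireg e (p + 1) q = p * Ireg e p q.
Proof.
  intros He Hp Hq. rewrite (Ireg_sum e p q He), Cmult_plus_distr_l.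
  rewrite Ireg_parts by assumption. ring.
Qed.

Lemma Ireg_S_r (e : R) (p q : C) :
  (0 < e < 1 / 2)%R -> not_int p -> not_int q ->
  (p + q) * Ireg e p (q + 1) = q * Ireg e p q.
Proof.
  intros He Hp Hq. rewrite (Ireg_sum e p q He), Cmult_plus_distr_l.
  rewrite <- Ireg_parts by assumption. ring.
Qed.

(* [Rop e p (1-z)^N] is the regularized integral over (0, e) of [s^(p-1) (1-s)^N];
   completing it by the segment (e, 1) gives the value at [q = N + 1] in closed form. *)
Definition Jint (e : R) (p : C) (N : nat) : C :=
  CInt (fun r => cpow (seg e 1 r) (p - 1) * (1 - seg e 1 r) ^ N * RtoC (1 - e)) 0 1.

Lemma cont_Jint (e : R) (p : C) (N : nat) (r : R) :
  (0 < e < 1)%R -> (0 <= r <= 1)%R ->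
  cont (fun r => cpow (seg e 1 r) (p - 1) * (1 - seg e 1 r) ^ N * RtoC (1 - e)) r.
Proof.
  intros He Hr. assert (S := seg_bounds e 1 r ltac:(lra) Hr).
  assert (K := cont_seg e 1 r). cont_tac. lra.
Qed.

Lemma dq_pow {X : UniformSpace} (i f : X -> C) (n : nat) (x : X) (l : C) :
  cont i x -> dq i f x l ->
  dq i (fun y => f y ^ n) x (RtoC (INR n) * f x ^ (pred n) * l).
Proof.
  intros Hi Hf. induction n as [|n IH].
  - apply dq_ext with (fun _ => RtoC 1); [reflexivity|].
    eapply dq_eq; [apply dq_const|simpl; ring].
  - cbn [Cpow]. eapply dq_eq; [apply (dq_mult i f (fun y => f y ^ n)); [exact Hi|exact Hf|exact IH]|].
    rewrite S_INR, RtoC_plus. destruct n as [|n]; simpl; ring.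
Qed.

Lemma holo_pow_1m (n : nat) (z : C) :
  holo (fun w => (1 - w) ^ n) z (- (RtoC (INR n) * (1 - z) ^ pred n)).
Proof.
  eapply dq_eq.
  - apply (dq_pow (X := C_UniformSpace) _ (fun w => 1 - w)); [apply cont_C_id|].
    apply dq_minus; [apply dq_const|apply dq_id].
  - ring.
Qed.

(** The value at the end point 1 is kept as [(1 - 1) ^ N], which is 1 for [N = 0] and 0 afterwards;
    in this form one statement serves the start and the step of the induction in
    [Rop_pow_closed]. *)
Lemma Jint_parts (e : R) (p : C) (N : nat) :
  (0 < e < 1)%R ->
  p * Jint e p N - RtoC (INR N) * Jint e (p + 1) (pred N)
  = (1 - 1) ^ N - cpow (RtoC e) p * (1 - RtoC e) ^ N.
Proof.
  intros He.
  set (s := seg e 1).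
  assert (I : isI (fun r => p * (cpow (s r) (p - 1) * (1 - s r) ^ N * RtoC (1 - e))
     - RtoC (INR N) * (cpow (s r) (p + 1 - 1) * (1 - s r) ^ pred N * RtoC (1 - e))) 0 1
     (p * Jint e p N - RtoC (INR N) * Jint e (p + 1) (pred N))).
  { apply isI_minus; apply isI_scal; apply isI_CInt; apply exI_cont; try lra;
      intros r Hr; now apply cont_Jint. }
  assert (J : isI (fun r => p * (cpow (s r) (p - 1) * (1 - s r) ^ N * RtoC (1 - e))
     - RtoC (INR N) * (cpow (s r) (p + 1 - 1) * (1 - s r) ^ pred N * RtoC (1 - e))) 0 1
     (cpow (s 1%R) p * (1 - s 1%R) ^ N - cpow (s 0%R) p * (1 - s 0%R) ^ N)).
  { apply (isI_FTC (fun r => cpow (s r) p * (1 - s r) ^ N)); [lra| |].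
    - intros r Hr. assert (S := seg_bounds e 1 r ltac:(lra) Hr). fold s in S.
      assert (D := rder_seg e 1 r). fold s in D.
      eapply dq_eq.
      + apply (dq_mult RtoC (fun r => cpow (s r) p) (fun r => (1 - s r) ^ N)); [apply cont_R_RtoC| |].
        * apply (dq_cpow RtoC s); [apply cont_R_RtoC|exact D|lra].
        * apply (dq_pow RtoC (fun r => 1 - s r)); [apply cont_R_RtoC|].
          apply dq_minus; [apply dq_const|exact D].
      + replace (p + 1 - 1) with p by ring. change R in r. ring.
    - intros r Hr. apply cont_minus; apply cont_mult; try apply cont_const; now apply cont_Jint. }
  rewrite <- (isI_unique _ _ _ _ I), (isI_unique _ _ _ _ J).
  unfold s. rewrite seg_0, seg_1, cpow_one. ring.
Qed.

Lemma Rop_pow_parts (e : R) (p : C) (N : nat) :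
  (0 < e < 1)%R -> not_int p ->
  p * Rop e p (fun z => (1 - z) ^ N) - RtoC (INR N) * Rop e (p + 1) (fun z => (1 - z) ^ pred N)
  = cpow (RtoC e) p * (1 - RtoC e) ^ N.
Proof.
  intros He Hp.
  assert (Cp : forall n z, cont (fun w => (1 - w) ^ n) z).
  { intros n z. cont_tac. }
  rewrite <- (Rop_parts e p (fun z => (1 - z) ^ N) (fun z => - (RtoC (INR N) * (1 - z) ^ pred N))
    ltac:(lra) Hp).
  - rewrite (Rop_ext e (p + 1) (fun z => - (RtoC (INR N) * (1 - z) ^ pred N))
      (fun z => (- RtoC (INR N)) * (1 - z) ^ pred N) ltac:(lra)) by (intros; ring).
    rewrite Rop_scal; [ring|lra|]. intros z Hz. apply Cp.
  - intros z Hz. split; [apply holo_pow_1m|].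
    apply cont_opp. apply cont_mult; [apply cont_const|]. apply Cp.
Qed.

(** The boundary values at [e] of the circle and of the segment cancel, so the sum obeys the
    recursion of the Beta value [B(p, N+1)]. The circle makes this valid for all non-integral [p],
    without any sign of [Re p]. *)
Lemma Rop_pow_closed (e : R) (p : C) (N : nat) :
  (0 < e < 1)%R -> not_int p ->
  Rop e p (fun z => (1 - z) ^ N) + Jint e p N = RtoC (INR (fact N)) / poch p (S N).
Proof.
  intros He. revert p. induction N as [|N IH]; intros p Hp;
    assert (Hp0 := not_int_neq_0 _ Hp).
  - assert (A := Rop_pow_parts e p 0 He Hp). assert (B := Jint_parts e p 0 He).
    simpl INR in A, B. rewrite !Cmult_0_l in A, B.
    replace (RtoC (INR (fact 0)) / poch p 1) with (/ p) by (simpl; field; exact Hp0).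
    set (J := Jint e p 0) in *. set (P := Rop e p (fun z => (1 - z) ^ 0)) in *.
    transitivity (((p * P - 0) + (p * J - 0)) / p); [field; exact Hp0|].
    rewrite A, B. simpl Cpow. field. exact Hp0.
  - assert (A := Rop_pow_parts e p (S N) He Hp). assert (B := Jint_parts e p (S N) He).
    specialize (IH (p + 1) (not_int_plus_1 _ Hp)). simpl pred in *.
    set (J := Jint e p (S N)) in *. set (P := Rop e p (fun z => (1 - z) ^ S N)) in *.
    set (J1 := Jint e (p + 1) N) in *. set (P1 := Rop e (p + 1) (fun z => (1 - z) ^ N)) in *.
    rewrite poch_S_l, fact_simpl, mult_INR, RtoC_mult.
    assert (H1 : poch (p + 1) (S N) <> 0).
    { apply poch_neq_0. apply not_int_nonpole. now apply not_int_plus_1. }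
    transitivity (RtoC (INR (S N)) * (RtoC (INR (fact N)) / poch (p + 1) (S N)) / p);
      [|field; auto].
    rewrite <- IH.
    transitivity (((p * P - RtoC (INR (S N)) * P1) + (p * J - RtoC (INR (S N)) * J1)
      + RtoC (INR (S N)) * (P1 + J1)) / p); [field; exact Hp0|].
    rewrite A, B. f_equal. 
    replace ((1 - 1) ^ S N) with (RtoC 0) by (simpl; ring). ring.
Qed.

Lemma cpow_pos_bound (e x : R) (k : C) :
  (0 < e <= x)%R -> (x <= 1)%R -> (Cmod (cpow (RtoC x) k) <= exp (Cmod k * Rabs (ln e)))%R.
Proof.
  intros He Hx. rewrite cpow_pos by lra.
  eapply Rle_trans; [apply Cmod_Cexp_le|]. apply exp_le. rewrite Cmod_mult, Cmod_R.
  apply Rmult_le_compat_l; [apply Cmod_ge_0|].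
  assert (L1 : (ln e <= ln x)%R).
  { destruct (Req_dec e x) as [->|N]; [lra|]. left. apply ln_increasing; lra. }
  assert (L2 : (ln x <= 0)%R).
  { rewrite <- ln_1. destruct (Req_dec x 1) as [->|N]; [lra|]. left. apply ln_increasing; lra. }
  rewrite !Rabs_left1 by lra. lra.
Qed.

Lemma Jint_bound (e : R) (p : C) :
  (0 < e < 1)%R -> exists K, (0 <= K)%R /\ forall N, (Cmod (Jint e p N) <= K * (1 - e) ^ N)%R.
Proof.
  intros He. exists (exp (Cmod (p - 1) * Rabs (ln e)) * (1 - e))%R. split.
  { apply Rmult_le_pos; [left; apply exp_pos|lra]. }
  intros N. unfold Jint.
  match goal with |- (_ <= ?M)%R => replace M with ((1 - 0) * M)%R by ring end.
  apply Cmod_CInt_le; [lra| |].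
  { apply exI_cont; [lra|]. intros r Hr. now apply cont_Jint. }
  intros r Hr. rewrite !Cmod_mult, Cmod_pow.
  assert (S := seg_bounds e 1 r ltac:(lra) Hr).
  unfold seg in *. set (x := (e + r * (1 - e))%R) in *. change (Re (RtoC x)) with x in S.
  rewrite RtoC_1m, !Cmod_RtoC_nonneg by lra.
  assert (B := cpow_pos_bound e x (p - 1) ltac:(lra) ltac:(lra)).
  assert (D : ((1 - x) ^ N <= (1 - e) ^ N)%R) by (apply pow_incr; lra).
  assert (D0 : (0 <= (1 - x) ^ N)%R) by (apply pow_le; lra).
  replace (exp (Cmod (p - 1) * Rabs (ln e)) * (1 - e) * (1 - e) ^ N)%R
    with (exp (Cmod (p - 1) * Rabs (ln e)) * (1 - e) ^ N * (1 - e))%R by ring.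
  apply Rmult_le_compat_r; [lra|].
  apply Rmult_le_compat; auto using Cmod_ge_0.
Qed.

Lemma Bint_bound (e : R) (p q : C) :
  (0 < e < 1 / 2)%R -> exists K, (0 <= K)%R /\
    forall N, (Cmod (Bint e (1 - e) p (q + RtoC (INR N))) <= K * (1 - e) ^ N)%R.
Proof.
  intros He.
  exists (exp (Cmod (p - 1) * Rabs (ln e)) * exp (Cmod (q - 1) * Rabs (ln e)))%R. split.
  { apply Rmult_le_pos; left; apply exp_pos. }
  intros N. unfold Bint.
  match goal with |- (_ <= ?M)%R => replace M with ((1 - 0) * M)%R by ring end.
  apply Cmod_CInt_le; [lra| |].
  { apply exI_cont; [lra|]. intros r Hr. apply cont_Bint; lra. }
  intros r Hr.
  assert (S := seg_bounds e (1 - e) r ltac:(lra) Hr).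
  unfold seg in *. set (x := (e + r * (1 - e - e))%R) in *. change (Re (RtoC x)) with x in S.
  replace (q + RtoC (INR N) - 1) with (q - 1 + RtoC (INR N)) by ring.
  rewrite RtoC_1m, cpow_nat by (simpl; lra).
  rewrite !Cmod_mult, Cmod_pow, !(Cmod_RtoC_nonneg (1 - x)), (Cmod_RtoC_nonneg (1 - e - e)) by lra.
  assert (B1 := cpow_pos_bound e x (p - 1) ltac:(lra) ltac:(lra)).
  assert (B2 := cpow_pos_bound e (1 - x) (q - 1) ltac:(lra) ltac:(lra)).
  assert (D : ((1 - x) ^ N <= (1 - e) ^ N)%R) by (apply pow_incr; lra).
  assert (D0 : (0 <= (1 - x) ^ N)%R) by (apply pow_le; lra).
  set (E1 := exp (Cmod (p - 1) * Rabs (ln e))) in *.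
  set (E2 := exp (Cmod (q - 1) * Rabs (ln e))) in *.
  assert (P1 := Cmod_ge_0 (cpow (RtoC x) (p - 1))).
  assert (P2 := Cmod_ge_0 (cpow (RtoC (1 - x)) (q - 1))).
  apply Rle_trans with (E1 * (E2 * (1 - e) ^ N) * 1)%R; [|right; ring].
  apply Rmult_le_compat; [| lra | | lra].
  - apply Rmult_le_pos; [lra|]. now apply Rmult_le_pos.
  - apply Rmult_le_compat; auto; [now apply Rmult_le_pos|].
    apply Rmult_le_compat; auto.
Qed.

(** On the circle around [s = 0] the weight is split as [(1-z)^N + ((1-z)^q - 1) (1-z)^N]. The first
    part gives the closed form up to [Jint]; the second carries a factor that is [O(y)] on the
    segment and collapses to a moment of exponent [Re p + 1]. The middle segment, the other circle
    and [Jint] are geometrically small. *)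
Lemma Ireg_asymptotic (e : R) (p q : C) :
  (0 < e < 1 / 3)%R -> not_int p -> not_int q -> (0 < Re p)%R ->
  exists K, (0 <= K)%R /\ forall N,
    (Cmod (Ireg e p (q + 1 + RtoC (INR N)) - RtoC (INR (fact N)) / poch p (S N))
     <= K * mom N (Re p + 1) 1)%R.
Proof.
  intros He Hp Hq Hr.
  destruct (Jint_bound e p ltac:(lra)) as [K1 [HK1 B1]].
  destruct (Bint_bound e p (q + 1) ltac:(lra)) as [K2 [HK2 B2]].
  destruct (Rop_bound e (q + 1) ltac:(lra)) as [K3 [HK3 B3]].
  destruct (cpow_near_1 q) as [c [Hc Bc]].
  (* For [|z| = e < 1/3] the modulus of [1 - z] lies between [2/3] and [4/3], so its logarithm is at
     most 1 in absolute value; [2 pi] is a crude bound for the argument. *)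
  assert (HM : exists M, (0 <= M)%R /\ forall z, Cmod z = e -> (Cmod (cpow (1 - z) (p - 1)) <= M)%R).
  { exists (exp (Cmod (p - 1) * (1 + 2 * PI))). split; [left; apply exp_pos|].
    intros z Hz. eapply Rle_trans; [apply Cmod_Cexp_le|]. apply exp_le. rewrite Cmod_mult.
    apply Rmult_le_compat_l; [apply Cmod_ge_0|].
    eapply Rle_trans; [apply Cmod_le_parts|].
    assert (A1 := Cmod_reverse 1 (- z)). rewrite Cmod_1, Cmod_opp in A1. change (1 + - z) with (1 - z) in A1.
    assert (A2 := Cmod_minus_le 1 z). rewrite Cmod_1 in A2.
    unfold Clog, Re, Im; simpl.
    apply Rplus_le_compat.
    - set (m := Cmod (1 - z)) in *.
      assert (L1 : (ln m <= m - 1)%R).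
      { assert (A := exp_ineq1_le (ln m)). rewrite exp_ln in A by lra. lra. }
      assert (L2 : (- ln m <= / m - 1)%R).
      { rewrite <- ln_Rinv by lra.
        assert (A := exp_ineq1_le (ln (/ m))). rewrite exp_ln in A by (apply Rinv_0_lt_compat; lra). lra. }
      assert (/ m <= 3 / 2)%R.
      { apply Rmult_le_reg_r with m; [lra|]. rewrite Rinv_l by lra. lra. }
      apply Rabs_le_between. lra.
    - match goal with |- (Rabs (2 * atan ?u) <= _)%R => assert (A := atan_bound u) end.
      apply Rabs_le_between. lra. }
  destruct HM as [M' [HM' BM]].
  assert (Ha : (0 < Re p + 1)%R) by lra.
  set (g := ((Re p + 1) / Rpower e (Re p + 1))%R).
  assert (Hg : (0 <= g)%R) by (left; apply Rdiv_lt_0_compat; [lra|apply Rpower_pos]).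
  exists (c + g * (K1 + K2 + K3 * M'))%R. split.
  { apply Rplus_le_le_0_compat; [exact Hc|]. apply Rmult_le_pos; [exact Hg|].
    apply Rplus_le_le_0_compat; [lra|]. now apply Rmult_le_pos. }
  intros N.
  assert (G := geom_le_mom N (Re p + 1) e Ha ltac:(lra)). fold g in G.
  rewrite <- (Rop_pow_closed e p N) by (auto; lra).
  unfold Ireg.
  set (T3 := Rop e (q + 1 + RtoC (INR N)) (fun z => cpow (1 - z) (p - 1))).
  assert (E : Rop e p (fun z => cpow (1 - z) (q + 1 + RtoC (INR N) - 1)) =
    Rop e p (fun z => (cpow (1 - z) q - 1) * (1 - z) ^ N) + Rop e p (fun z => (1 - z) ^ N)).
  { rewrite <- Rop_plus; [|lra| |].
    - apply Rop_ext; [lra|]. intros z Hz.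
      replace (q + 1 + RtoC (INR N) - 1) with (q + RtoC (INR N)) by ring.
      rewrite cpow_nat by (apply Re_1_minus_pos; lra). ring.
    - intros z Hz. apply cont_mult; [|cont_tac]. apply cont_minus; [|apply cont_const].
      apply cont_cpow_1m. lra.
    - intros z Hz. cont_tac. }
  rewrite E. clear E.
  assert (BD : (Cmod (Rop e p (fun z => (cpow (1 - z) q - 1) * (1 - z) ^ N)%C)
    <= 0 * mom N (Re p) 1 + c * mom N (Re p + 1) 1)%R).
  { apply (Rop_collapse_mom e 1 p _ (fun z => (- (q * cpow (1 - z) (q - 1)) - 0) * (1 - z) ^ N
      + (cpow (1 - z) q - 1) * (- (RtoC (INR N) * (1 - z) ^ pred N)))); auto; try lra.
    - intros z Hz. split.
      + apply (dq_mult (X := C_UniformSpace) _ (fun z => cpow (1 - z) q - 1) (fun z => (1 - z) ^ N));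
          [apply cont_C_id| |apply holo_pow_1m].
        apply dq_minus; [now apply holo_cpow_1m|apply dq_const].
      + assert (C1 := cont_cpow_1m q z Hz). assert (C2 := cont_cpow_1m (q - 1) z Hz). cont_tac;
          now apply Re_1_minus_pos.
    - intros y Hy. rewrite RtoC_1m, Cmod_mult, Cmod_pow, Cmod_RtoC_nonneg by lra.
      apply Rmult_le_compat_r; [apply pow_le; lra|].
      eapply Rle_trans; [apply Bc; lra|]. right. ring. }
  assert (BT : (Cmod T3 <= K3 * e ^ N * M')%R).
  { apply B3. intros z Hz. split; [|now apply BM]. apply cont_cpow_1m. lra. }
  assert (BeN : (e ^ N <= (1 - e) ^ N)%R) by (apply pow_incr; lra).
  specialize (B1 N). specialize (B2 N).
  set (T1 := Bint e (1 - e) p (q + 1 + RtoC (INR N))) in *.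
  set (T2 := Rop e p (fun z => (cpow (1 - z) q - 1) * (1 - z) ^ N)) in *.
  set (T4 := Rop e p (fun z => (1 - z) ^ N)). set (T5 := Jint e p N) in *.
  replace (T1 + (T2 + T4) + T3 - (T4 + T5)) with (T1 + T2 + T3 - T5) by ring.
  eapply Rle_trans; [apply Cmod_minus_le|].
  eapply Rle_trans; [apply Rplus_le_compat_r, Cmod_triangle|].
  eapply Rle_trans; [apply Rplus_le_compat_r, Rplus_le_compat_r, Cmod_triangle|].
  set (m := mom N (Re p + 1) 1) in *.
  assert (Q1 : (K1 * (1 - e) ^ N <= K1 * (g * m))%R) by now apply Rmult_le_compat_l.
  assert (Q2 : (K2 * (1 - e) ^ N <= K2 * (g * m))%R) by now apply Rmult_le_compat_l.
  assert (Q3 : (K3 * e ^ N * M' <= K3 * (g * m) * M')%R).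
  { apply Rmult_le_compat_r; [exact HM'|]. apply Rmult_le_compat_l; [exact HK3|]. lra. }
  replace ((c + g * (K1 + K2 + K3 * M')) * m)%R
    with (c * m + K1 * (g * m) + K2 * (g * m) + K3 * (g * m) * M')%R by ring.
  lra.
Qed.

Lemma is_lim_seq_inv_INR : is_lim_seq (fun n => / INR n)%R 0%R.
Proof.
  replace (Finite 0) with (Rbar_inv p_infty) by reflexivity.
  apply is_lim_seq_inv; [apply is_lim_seq_INR|discriminate].
Qed.

(** The error of [Ireg_asymptotic] is of order [N^(- Re p - 1)], against a scaling factor of modulus
    [N^(Re p)]; what is left is [gam N p] plus [O(1/N)]. *)
Lemma Ireg_Clim (e : R) (p q : C) :
  (0 < e < 1 / 3)%R -> not_int p -> not_int q -> (0 < Re p)%R ->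
  Clim (fun N => Cexp (p * RtoC (ln (INR N))) * Ireg e p (q + 1 + RtoC (INR N))) (CGamma p).
Proof.
  intros He Hp Hq Hr.
  destruct (Ireg_asymptotic e p q He Hp Hq Hr) as [K [HK B]].
  destruct (mom_1_bound (Re p + 1) ltac:(lra)) as [K' [N0 [HK' [HN0 B']]]].
  assert (Hd : Clim (fun N => Cexp (p * RtoC (ln (INR N))) * Ireg e p (q + 1 + RtoC (INR N))
     - gam N p) 0).
  { apply Clim_le with (fun N => K * K' * / INR N)%R.
    - exists N0. intros N HN. assert (HN1 : (1 <= INR N)%R) by (apply (le_INR 1); lia).
      specialize (B N). specialize (B' N HN).
      unfold gam.
      match goal with |- (Cmod ?z <= _)%R =>
        replace z with (Cexp (p * RtoC (ln (INR N))) *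
          (Ireg e p (q + 1 + RtoC (INR N)) - RtoC (INR (fact N)) / poch p (S N)))
          by (unfold Cdiv; ring) end.
      rewrite Cmod_mult, Cmod_Cexp.
      replace (Re (p * RtoC (ln (INR N)))) with (Re p * ln (INR N))%R by (simpl; unfold Re; ring).
      apply Rle_trans with (exp (Re p * ln (INR N)) * (K * (K' * exp (- ((Re p + 1) * ln (INR N))))))%R.
      + apply Rmult_le_compat_l; [left; apply exp_pos|].
        eapply Rle_trans; [exact B|]. now apply Rmult_le_compat_l.
      + right. replace (- ((Re p + 1) * ln (INR N)))%R
          with (- (Re p * ln (INR N)) + - ln (INR N))%R by ring.
        rewrite exp_plus, !exp_Ropp, exp_ln by lra.
        field. split; [lra|]. generalize (exp_pos (Re p * ln (INR N))). lra.
    - replace (Finite 0) with (Rbar_mult (K * K')%R 0%R) by (simpl; now rewrite Rmult_0_r).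
      apply is_lim_seq_scal_l. apply is_lim_seq_inv_INR. }
  apply Clim_ext with (fun N => (Cexp (p * RtoC (ln (INR N))) * Ireg e p (q + 1 + RtoC (INR N))
     - gam N p) + gam N p); [intros; ring|].
  apply (Clim_eq _ (0 + CGamma p)); [ring|].
  apply Clim_plus; [exact Hd|]. apply CGamma_Clim. now apply not_int_nonpole.
Qed.

Lemma Ireg_nat_r (e : R) (p q : C) (N : nat) :
  (0 < e < 1 / 2)%R -> not_int p -> not_int q ->
  poch (p + q) N * Ireg e p (q + RtoC (INR N)) = poch q N * Ireg e p q.
Proof.
  intros He Hp Hq. induction N as [|N IH].
  - simpl. rewrite Cplus_0_r. ring.
  - rewrite S_INR, RtoC_plus. simpl poch. rewrite (Cplus_assoc q).
    set (q' := q + RtoC (INR N)) in *.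
    assert (A := Ireg_S_r e p q' He Hp (not_int_plus_nat _ N Hq)).
    transitivity (poch (p + q) N * ((p + q') * Ireg e p (q' + 1))); [unfold q'; ring|].
    rewrite A. transitivity (q' * (poch (p + q) N * Ireg e p q')); [ring|].
    rewrite IH. ring.
Qed.

(** Raising [q] by [N + 1] through the recurrence produces a quotient of Pochhammer symbols, which
    is [N^p * gam N q / gam N (p + q)]. A constant sequence is thus written as a product of three
    sequences with known limits. *)
Lemma Beta_Re_pos (e : R) (p q : C) :
  (0 < e < 1 / 3)%R -> not_int p -> not_int q -> nonpole (p + q) -> (0 < Re p)%R ->
  Ireg e p q = CGamma p * CGamma q / CGamma (p + q).
Proof.
  intros He Hp Hq Hpq Hr.
  apply (Clim_unique (fun _ => Ireg e p q)); [apply Clim_const|].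
  apply Clim_ext_loc with (fun N => (Cexp (p * RtoC (ln (INR N))) * Ireg e p (q + 1 + RtoC (INR N)))
    * gam N q / gam N (p + q)).
  - exists 1%nat. intros N HN.
    assert (A := Ireg_nat_r e p q (S N) ltac:(lra) Hp Hq).
    rewrite S_INR, RtoC_plus in A.
    replace (q + (RtoC (INR N) + 1)) with (q + 1 + RtoC (INR N)) in A by ring.
    assert (P1 := poch_neq_0 (p + q) (S N) Hpq).
    assert (P2 := poch_neq_0 q (S N) (not_int_nonpole _ Hq)).
    assert (P3 := RtoC_INR_neq_0 (fact N) (lt_O_fact N)).
    assert (P4 := Cexp_neq_0 ((p + q) * RtoC (ln (INR N)))).
    unfold gam. rewrite Cmult_plus_distr_r, Cexp_plus in *.
    set (X := Ireg e p (q + 1 + RtoC (INR N))) in *.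
    set (E1 := Cexp (p * RtoC (ln (INR N)))) in *. set (E2 := Cexp (q * RtoC (ln (INR N)))) in *.
    set (Q := poch q (S N)) in *. set (PQ := poch (p + q) (S N)) in *.
    assert (H1 : E1 <> 0) by apply Cexp_neq_0. assert (H2 : E2 <> 0) by apply Cexp_neq_0.
    transitivity (PQ * X / Q); [field; auto|]. rewrite A. field. exact P2.
  - apply Clim_div; [now apply CGamma_neq_0| |now apply CGamma_Clim].
    apply Clim_mult; [now apply Ireg_Clim|]. apply CGamma_Clim. now apply not_int_nonpole.
Qed.

(** Both sides obey the same recurrence in [p], and finitely many upward steps reach [Re p > 0]; the
    induction is on the number of steps. *)
Lemma Beta_CGamma (e : R) (p q : C) :
  (0 < e < 1 / 3)%R -> not_int p -> not_int q -> nonpole (p + q) ->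
  Ireg e p q = CGamma p * CGamma q / CGamma (p + q).
Proof.
  intros He Hp Hq Hpq.
  destruct (nfloor_ex (Rabs (Re p) + 1)) as [n [_ Hn]]; [generalize (Rabs_pos (Re p)); lra|].
  assert (Hn' : (0 < Re p + INR (S n))%R).
  { rewrite S_INR. assert (A := Rle_abs (- Re p)). rewrite Rabs_Ropp in A. lra. }
  clear Hn. revert p Hp Hpq Hn'. induction (S n) as [|k IH]; intros p Hp Hpq Hn'.
  - apply Beta_Re_pos; auto. simpl in Hn'. lra.
  - assert (H0 := not_int_neq_0 _ Hp). assert (H1 := nonpole_neq _ 0 Hpq).
    simpl INR in H1. rewrite Cplus_0_r in H1.
    assert (Hpq1 : nonpole (p + 1 + q)).
    { replace (p + 1 + q) with (p + q + 1) by ring. now apply nonpole_plus_1. }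
    assert (A := Ireg_S_l e p q ltac:(lra) Hp Hq).
    assert (B := IH (p + 1) (not_int_plus_1 _ Hp) Hpq1).
    rewrite B in A.
    + replace (p + 1 + q) with (p + q + 1) in A by ring.
      rewrite !CGamma_plus_1 in A by (auto; now apply not_int_nonpole).
      assert (G := CGamma_neq_0 _ Hpq).
      transitivity ((p * Ireg e p q) / p); [field; exact H0|].
      rewrite <- A. field. auto.
    + rewrite S_INR in Hn'. simpl. unfold Re in Hn'. lra.
Qed.

(** * The Dirichlet integral *)

(* The integral of [y^(q-1) (2e+l-y)^(r-1)] along the segment from [e] to [e+l]. *)
Definition gseg (e : R) (q r l : C) : C :=
  CInt (fun t => cpow (RtoC e + RtoC t * l) (q - 1)
    * cpow (RtoC e + (1 - RtoC t) * l) (r - 1) * l) 0 1.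

(** [- e < Re l] is an open condition that contains [l = 0], the degenerate segment at the tip of
    the inner triangle, so that [gseg] can be differentiated there as well. *)
Lemma Re_gseg (e t : R) (l : C) :
  (0 < e)%R -> (- e < Re l)%R -> (0 <= t <= 1)%R ->
  (0 < Re (RtoC e + RtoC t * l))%R /\ (0 < Re (RtoC e + (1 - RtoC t) * l))%R.
Proof.
  intros He Hl Ht.
  replace (Re (RtoC e + RtoC t * l)) with (e + t * Re l)%R by (unfold Re; simpl; ring).
  replace (Re (RtoC e + (1 - RtoC t) * l)) with (e + (1 - t) * Re l)%R by (unfold Re; simpl; ring).
  assert (P : forall x, (0 <= x <= 1)%R -> (0 < e + x * Re l)%R).
  { intros x Hx. destruct (Rle_lt_dec (Re l) 0); nra. }
  split; apply P; lra.
Qed.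

Lemma cont_gseg_integrand (e : R) (q r l : C) (t : R) :
  (0 < e)%R -> (- e < Re l)%R -> (0 <= t <= 1)%R ->
  cont (fun p : C * R => cpow (RtoC e + RtoC (snd p) * fst p) (q - 1)
    * cpow (RtoC e + (1 - RtoC (snd p)) * fst p) (r - 1)) (l, t).
Proof.
  intros He Hl Ht. destruct (Re_gseg e t l He Hl Ht) as [H1 H2].
  assert (C1 : cont (fun p : C * R => RtoC (snd p)) (l, t)).
  { apply (cont_snd (U := C_UniformSpace) RtoC). apply cont_R_RtoC. }
  assert (C2 : cont (fun p : C * R => fst p) (l, t)).
  { apply (cont_fst (fun z : C => z)). apply cont_C_id. }
  cont_tac; assumption.
Qed.

Lemma cont_gseg_slice (e : R) (q r l : C) (t : R) :
  (0 < e)%R -> (- e < Re l)%R -> (0 <= t <= 1)%R ->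
  cont (fun t => cpow (RtoC e + RtoC t * l) (q - 1)
    * cpow (RtoC e + (1 - RtoC t) * l) (r - 1)) t.
Proof.
  intros He Hl Ht.
  exact (cont_slice (fun p : C * R => cpow (RtoC e + RtoC (snd p) * fst p) (q - 1)
    * cpow (RtoC e + (1 - RtoC (snd p)) * fst p) (r - 1)) l t (cont_gseg_integrand e q r l t He Hl Ht)).
Qed.

Lemma isI_gseg (e : R) (q r l : C) :
  (0 < e)%R -> (- e < Re l)%R ->
  isI (fun t => cpow (RtoC e + RtoC t * l) (q - 1)
    * cpow (RtoC e + (1 - RtoC t) * l) (r - 1) * l) 0 1 (gseg e q r l).
Proof.
  intros He Hl. apply isI_CInt. apply exI_cont; [lra|]. intros t Ht.
  apply cont_mult; [now apply cont_gseg_slice|apply cont_const].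
Qed.

Lemma gseg_sum (e : R) (q r l : C) :
  (0 < e)%R -> (- e < Re l)%R ->
  gseg e (q + 1) r l + gseg e q (r + 1) l = (2 * RtoC e + l) * gseg e q r l.
Proof.
  intros He Hl.
  rewrite <- (isI_unique _ _ _ _ (isI_plus _ _ _ _ _ _ (isI_gseg e (q + 1) r l He Hl)
    (isI_gseg e q (r + 1) l He Hl))).
  rewrite <- (isI_unique _ _ _ _ (isI_scal _ (2 * RtoC e + l) _ _ _ (isI_gseg e q r l He Hl))).
  apply CInt_ext; [lra|]. intros t Ht. destruct (Re_gseg e t l He Hl Ht) as [H1 H2].
  replace (q + 1 - 1) with (q - 1 + 1) by ring. replace (r + 1 - 1) with (r - 1 + 1) by ring.
  rewrite (cpow_S _ (q - 1) H1), (cpow_S _ (r - 1) H2). ring.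
Qed.

Lemma gseg_sym (e : R) (q r l : C) :
  (0 < e)%R -> (- e < Re l)%R -> gseg e q r l = gseg e r q l.
Proof.
  intros He Hl. symmetry. unfold gseg at 1. apply isI_unique.
  assert (I := isI_gseg e q r l He Hl).
  apply (is_RInt_swap (V := C_R_NormedModule)) in I.
  assert (J := is_RInt_comp_lin (V := C_R_NormedModule)
    (fun t => cpow (RtoC e + RtoC t * l) (q - 1)
    * cpow (RtoC e + (1 - RtoC t) * l) (r - 1) * l) (-1) 1 0 1 (opp (gseg e q r l))).
  replace (-1 * 0 + 1)%R with 1%R in J by ring. replace (-1 * 1 + 1)%R with 0%R in J by ring.
  assert (J' := isI_opp _ _ _ _ (J I)). clear J I.
  change (opp (gseg e q r l)) with (- gseg e q r l) in J'.
  replace (- - gseg e q r l) with (gseg e q r l) in J' by ring.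
  eapply isI_ext; [lra| |exact J']. intros t Ht. simpl.
  rewrite scal_C_R.
  replace (RtoC (-1 * t + 1)) with (1 - RtoC t)
    by (rewrite RtoC_plus, RtoC_mult; apply C_eq_parts; simpl; ring).
  replace (1 - (1 - RtoC t)) with (RtoC t) by ring.
  replace (RtoC (-1)) with (- (1) : C) by (apply C_eq_parts; simpl; ring). ring.
Qed.

Lemma rder_affine (a l : C) (t : R) : rder (fun t => a + RtoC t * l) t l.
Proof.
  apply dq_ext with (fun t => a + l * RtoC t); [intros; ring|].
  eapply dq_eq; [apply dq_plus; [apply dq_const|apply (dq_scal RtoC RtoC); apply dq_id]|ring].
Qed.

Lemma rder_affine_rev (a l : C) (t : R) : rder (fun t => a + (1 - RtoC t) * l) t (- l).
Proof.
  apply dq_ext with (fun t => (a + l) + RtoC t * (- l)); [intros; ring|]. apply rder_affine.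
Qed.

Lemma gseg_parts (e : R) (q r l : C) :
  (0 < e)%R -> (- e < Re l)%R ->
  q * gseg e q (r + 1) l - r * gseg e (q + 1) r l =
  cpow (RtoC e + l) q * cpow (RtoC e) r - cpow (RtoC e) q * cpow (RtoC e + l) r.
Proof.
  intros He Hl.
  assert (I := isI_minus _ _ _ _ _ _ (isI_scal _ q _ _ _ (isI_gseg e q (r + 1) l He Hl))
    (isI_scal _ r _ _ _ (isI_gseg e (q + 1) r l He Hl))).
  rewrite <- (isI_unique _ _ _ _ I). apply isI_unique.
  set (A := fun t : R => RtoC e + RtoC t * l). set (B := fun t : R => RtoC e + (1 - RtoC t) * l).
  replace (cpow (RtoC e + l) q * cpow (RtoC e) r) with (cpow (A 1%R) q * cpow (B 1%R) r).
  2: { unfold A, B. f_equal; f_equal; ring. }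
  replace (cpow (RtoC e) q * cpow (RtoC e + l) r) with (cpow (A 0%R) q * cpow (B 0%R) r).
  2: { unfold A, B. f_equal; f_equal; ring. }
  apply (isI_FTC (fun t => cpow (A t) q * cpow (B t) r)); [lra| |].
  - intros t Ht. destruct (Re_gseg e t l He Hl Ht) as [H1 H2].
    eapply dq_eq.
    + apply (dq_mult RtoC (fun t => cpow (A t) q) (fun t => cpow (B t) r)); [apply cont_R_RtoC| |].
      * apply (dq_cpow RtoC A); [apply cont_R_RtoC|apply rder_affine|exact H1].
      * apply (dq_cpow RtoC B); [apply cont_R_RtoC|apply rder_affine_rev|exact H2].
    + replace (q + 1 - 1) with q by ring. replace (r + 1 - 1) with r by ring.
      unfold A, B. change R in t. ring.
  - intros t Ht. apply cont_minus; apply cont_mult; try apply cont_const;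
      (apply cont_mult; [now apply cont_gseg_slice|apply cont_const]).
Qed.

Lemma Re_gt_open (a : R) (z : C) : (a < Re z)%R -> locally z (fun w : C => (a < Re w)%R).
Proof.
  intros H. generalize (locally_Cball z (Re z - a) ltac:(lra)). apply filter_imp.
  intros w Hw. change C in w. assert (B := Re_le_Cmod (w - z)).
  change (Re (w - z)) with (Re w - Re z)%R in B.
  assert (B2 := Rabs_le_between (Re w - Re z) (Cmod (w - z))). lra.
Qed.

Lemma Re_lt_open (a : R) (z : C) : (Re z < a)%R -> locally z (fun w : C => (Re w < a)%R).
Proof.
  intros H. generalize (locally_Cball z (a - Re z) ltac:(lra)). apply filter_imp.
  intros w Hw. change C in w. assert (B := Re_le_Cmod (w - z)).
  change (Re (w - z)) with (Re w - Re z)%R in B.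
  assert (B2 := Rle_abs (Re w - Re z)). lra.
Qed.

(** Leibniz' rule for [y^(q-1) (2e+l-y)^(r-1)] with moving upper end [e + l]. In the fixed
    parametrization the derivative has terms weighted by [t] and [1 - t]; the total derivative of
    [t] times the integrand turns the former into the end point value. *)
Lemma holo_gseg (e : R) (q r l : C) :
  (0 < e)%R -> (- e < Re l)%R ->
  holo (gseg e q r) l
    (cpow (RtoC e + l) (q - 1) * cpow (RtoC e) (r - 1) + (r - 1) * gseg e q (r - 1) l).
Proof.
  intros He Hl.
  set (A := fun (l : C) (t : R) => RtoC e + RtoC t * l).
  set (B := fun (l : C) (t : R) => RtoC e + (1 - RtoC t) * l).
  set (df := fun (l : C) (t : R) =>
    (q - 1) * cpow (A l t) (q - 1 - 1) * RtoC t * cpow (B l t) (r - 1) * l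
    + (r - 1) * cpow (B l t) (r - 1 - 1) * (1 - RtoC t) * cpow (A l t) (q - 1) * l
    + cpow (A l t) (q - 1) * cpow (B l t) (r - 1)).
  apply dq_eq with (CInt (df l) 0 1).
  - apply (holo_CInt (fun l t => cpow (A l t) (q - 1) * cpow (B l t) (r - 1) * l) df).
    generalize (Re_gt_open (- e) l Hl). apply filter_imp. intros z Hz t Ht. change C in z.
    destruct (Re_gseg e t z He Hz Ht) as [H1 H2].
    assert (DA : holo (fun w => A w t) z (RtoC t)).
    { unfold A. eapply dq_eq; [apply dq_plus; [apply dq_const|apply (dq_scal (X := C_UniformSpace)); apply dq_id]|ring]. }
    assert (DB : holo (fun w => B w t) z (1 - RtoC t)).
    { unfold B. eapply dq_eq; [apply dq_plus; [apply dq_const|apply (dq_scal (X := C_UniformSpace)); apply dq_id]|ring]. }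
    repeat split.
    + eapply dq_eq.
      * apply (dq_mult (X := C_UniformSpace) _ (fun w => cpow (A w t) (q - 1) * cpow (B w t) (r - 1)) (fun w => w));
          [apply cont_C_id| |apply dq_id].
        apply (dq_mult (X := C_UniformSpace) _ (fun w => cpow (A w t) (q - 1)) (fun w => cpow (B w t) (r - 1)));
          [apply cont_C_id| |].
        -- apply (dq_cpow (X := C_UniformSpace) _ (fun w => A w t)); [apply cont_C_id|exact DA|exact H1].
        -- apply (dq_cpow (X := C_UniformSpace) _ (fun w => B w t)); [apply cont_C_id|exact DB|exact H2].
      * unfold df. ring.
    + unfold df, A, B.
      assert (C1 : cont (fun p : C * R => RtoC (snd p)) (z, t)).
      { apply (cont_snd (U := C_UniformSpace) RtoC). apply cont_R_RtoC. }
      assert (C2 : cont (fun p : C * R => fst p) (z, t)).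
      { apply (cont_fst (fun z : C => z)). apply cont_C_id. }
      cont_tac; assumption.
    + apply cont_mult; [now apply cont_gseg_slice|apply cont_const].
  - assert (K1 := isI_gseg e q (r - 1) l He Hl).
    assert (K2 : isI (fun t => cpow (A l t) (q - 1) * cpow (B l t) (r - 1)
      + RtoC t * ((q - 1) * cpow (A l t) (q - 1 - 1) * l * cpow (B l t) (r - 1)
         + cpow (A l t) (q - 1) * ((r - 1) * cpow (B l t) (r - 1 - 1) * (- l)))) 0 1
      (RtoC 1 * (cpow (A l 1%R) (q - 1) * cpow (B l 1%R) (r - 1))
       - RtoC 0 * (cpow (A l 0%R) (q - 1) * cpow (B l 0%R) (r - 1)))).
    { apply (isI_FTC (fun t => RtoC t * (cpow (A l t) (q - 1) * cpow (B l t) (r - 1)))); [lra| |].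
      - intros t Ht. destruct (Re_gseg e t l He Hl Ht) as [H1 H2].
        eapply dq_eq.
        + apply (dq_mult RtoC RtoC (fun t => cpow (A l t) (q - 1) * cpow (B l t) (r - 1)));
            [apply cont_R_RtoC|apply dq_id|].
          apply (dq_mult RtoC (fun t => cpow (A l t) (q - 1)) (fun t => cpow (B l t) (r - 1)));
            [apply cont_R_RtoC| |].
          * apply (dq_cpow RtoC (A l)); [apply cont_R_RtoC|apply rder_affine|exact H1].
          * apply (dq_cpow RtoC (B l)); [apply cont_R_RtoC|apply rder_affine_rev|exact H2].
        + change R in t. ring.
      - intros t Ht. destruct (Re_gseg e t l He Hl Ht) as [H1 H2].
        unfold A, B. cont_tac; assumption. }
    assert (K3 := isI_plus _ _ _ _ _ _ K2 (isI_scal _ (r - 1) _ _ _ K1)).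
    transitivity (RtoC 1 * (cpow (A l 1%R) (q - 1) * cpow (B l 1%R) (r - 1))
       - RtoC 0 * (cpow (A l 0%R) (q - 1) * cpow (B l 0%R) (r - 1)) + (r - 1) * gseg e q (r - 1) l).
    + apply isI_unique. eapply isI_ext; [lra| |exact K3].
      intros t Ht. unfold df, A, B. simpl. ring.
    + unfold A, B. replace (RtoC e + RtoC 1 * l) with (RtoC e + l) by ring.
      replace (RtoC e + (1 - RtoC 1) * l) with (RtoC e) by ring. ring.
Qed.

Lemma cont_gseg (e : R) (q r l : C) :
  (0 < e)%R -> (- e < Re l)%R -> cont (gseg e q r) l.
Proof.
  intros He Hl. exact (dq_cont (X := C_UniformSpace) _ _ _ _ (cont_C_id l) (holo_gseg e q r l He Hl)).
Qed.

Lemma holo_gseg' (e : R) (q r l : C) :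
  (0 < e)%R -> (- e < Re l)%R ->
  holo (gseg e q r) l
    (cpow (RtoC e) (q - 1) * cpow (RtoC e + l) (r - 1) + (q - 1) * gseg e (q - 1) r l).
Proof.
  intros He Hl. eapply dq_eq; [now apply holo_gseg|].
  assert (P := gseg_parts e (q - 1) (r - 1) l He Hl).
  replace (r - 1 + 1) with r in P by ring. replace (q - 1 + 1) with q in P by ring.
  set (a := (q - 1) * gseg e (q - 1) r l) in *. set (b := (r - 1) * gseg e q (r - 1) l) in *.
  replace a with ((a - b) + b) by ring. rewrite P. ring.
Qed.

Lemma gseg_0 (e : R) (q r : C) : gseg e q r 0 = 0.
Proof.
  unfold gseg. apply isI_unique.
  assert (K := isI_const (RtoC 0) 0 1). rewrite Cmult_0_r in K.
  refine (isI_ext _ _ _ _ _ _ _ K); [lra|]. intros t Ht. simpl. ring.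
Qed.

(** * Corner tori and tubes of the regularized triangle *)

Definition hcor (e : R) (q r y0 : C) : C := Rop e q (fun y1 => cpow (1 - y0 - y1) (r - 1)).

Lemma Re_cor (e : R) (y0 y1 : C) :
  (Re y0 < 1 - e)%R -> Cmod y1 = e -> (0 < Re (1 - y0 - y1))%R.
Proof.
  intros H0 H1. assert (A := Re_le_Cmod y1). assert (B := Rle_abs (Re y1)).
  change (Re (1 - y0 - y1)) with (1 - Re y0 - Re y1)%R. lra.
Qed.

Lemma holo_cor_r (r y0 y1 : C) :
  (0 < Re (1 - y0 - y1))%R ->
  holo (fun z => cpow (1 - y0 - z) r) y1 (- r * cpow (1 - y0 - y1) (r - 1)).
Proof.
  intros H. eapply dq_eq.
  - apply (dq_cpow (X := C_UniformSpace) _ (fun z => 1 - y0 - z)); [apply cont_C_id| |exact H].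
    apply dq_minus; [apply dq_const|apply dq_id].
  - ring.
Qed.

Lemma holo_cor_l (r y0 y1 : C) :
  (0 < Re (1 - y0 - y1))%R ->
  holo (fun z => cpow (1 - z - y1) r) y0 (- r * cpow (1 - y0 - y1) (r - 1)).
Proof.
  intros H. eapply dq_eq.
  - apply (dq_cpow (X := C_UniformSpace) _ (fun z => 1 - z - y1)); [apply cont_C_id| |exact H].
    apply dq_minus; [apply dq_minus; [apply dq_const|apply dq_id]|apply dq_const].
  - ring.
Qed.

Lemma cont_cor_r (r y0 y1 : C) :
  (0 < Re (1 - y0 - y1))%R -> cont (fun z => cpow (1 - y0 - z) r) y1.
Proof. intros H. cont_tac; exact H. Qed.

Lemma holo_hcor (e : R) (q r y0 : C) :
  (0 < e)%R -> (Re y0 < 1 - e)%R ->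
  holo (hcor e q r) y0 (- (r - 1) * hcor e q (r - 1) y0).
Proof.
  intros He Hy. unfold hcor.
  rewrite <- (Rop_scal e q (- (r - 1))) by (auto; intros z Hz; apply cont_cor_r; now apply Re_cor with e).
  apply (Rop_holo e q (fun w z => cpow (1 - w - z) (r - 1))
    (fun w z => - (r - 1) * cpow (1 - w - z) (r - 1 - 1))); [exact He|].
  generalize (Re_lt_open _ _ Hy). apply filter_imp. intros w Hw z Hz. change C in w.
  assert (P := Re_cor e w z Hw Hz). repeat split.
  - now apply holo_cor_l.
  - assert (C1 : cont (fun p : C * C => fst p) (w, z)).
    { apply (cont_fst (fun z : C => z)). apply cont_C_id. }
    assert (C2 : cont (fun p : C * C => snd p) (w, z)).
    { apply (cont_snd (U := C_UniformSpace) (fun z : C => z)). apply cont_C_id. }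
    cont_tac; exact P.
  - now apply cont_cor_r.
Qed.

Lemma cont_hcor (e : R) (q r y0 : C) :
  (0 < e)%R -> (Re y0 < 1 - e)%R -> cont (hcor e q r) y0.
Proof.
  intros He Hy. exact (dq_cont (X := C_UniformSpace) _ _ _ _ (cont_C_id y0) (holo_hcor e q r y0 He Hy)).
Qed.

Lemma hcor_parts (e : R) (q r y0 : C) :
  (0 < e)%R -> not_int q -> (Re y0 < 1 - e)%R ->
  q * hcor e q (r + 1) y0 - r * hcor e (q + 1) r y0 = cpow (RtoC e) q * cpow (1 - y0 - RtoC e) r.
Proof.
  intros He Hq Hy. unfold hcor. replace (r + 1 - 1) with r by ring.
  rewrite <- (Rop_parts e q (fun z => cpow (1 - y0 - z) r) (fun z => - r * cpow (1 - y0 - z) (r - 1)) He Hq).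
  - rewrite Rop_scal; [ring|exact He|]. intros z Hz. apply cont_cor_r. now apply Re_cor with e.
  - intros z Hz. assert (P := Re_cor e y0 z Hy Hz). split; [now apply holo_cor_r|].
    apply cont_mult; [apply cont_const|now apply cont_cor_r].
Qed.

Lemma hcor_sum (e : R) (q r y0 : C) :
  (0 < e)%R -> (Re y0 < 1 - e)%R ->
  hcor e q r y0 = hcor e (q + 1) r y0 + hcor e q (r + 1) y0 + y0 * hcor e q r y0.
Proof.
  intros He Hy. unfold hcor. rewrite Rop_shift.
  assert (Cc : forall k z, Cmod z = e -> cont (fun z => cpow (1 - y0 - z) k) z).
  { intros k z Hz. apply cont_cor_r. now apply Re_cor with e. }
  rewrite <- (Rop_scal e q y0), <- !Rop_plus; auto.
  - apply Rop_ext; [exact He|]. intros z Hz. assert (P := Re_cor e y0 z Hy Hz).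
    replace (r + 1 - 1) with (r - 1 + 1) by ring. rewrite (cpow_S _ (r - 1) P). ring.
  - intros z Hz. apply cont_plus; [|auto]. apply cont_mult; [apply cont_C_id|auto].
  - intros z Hz. apply cont_mult; [apply cont_const|auto].
  - intros z Hz. apply cont_mult; [apply cont_C_id|auto].
Qed.

(** The common boundary of a tube and a corner torus: one coordinate runs around its circle, another
    is held at [e], and the third is what remains of 1. Every such term cancels in [Tbdry_parts]. *)
Definition Scor (e : R) (a b : C) : C := Rop e a (fun y => cpow (1 - RtoC e - y) (b - 1)).

Definition Ttube (e : R) (p q r : C) : C :=
  Rop e p (fun y => gseg e q r (1 - 2 * RtoC e - y)).

Definition Tcor (e : R) (p q r : C) : C := Rop e p (hcor e q r).

Lemma Cmod_Re_lt (e : R) (z : C) : (0 < e < 1 / 2)%R -> Cmod z = e -> (Re z < 1 - e)%R.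
Proof. intros He Hz. assert (A := Re_le_Cmod z). assert (B := Rle_abs (Re z)). lra. Qed.

Lemma Re_tube (e : R) (z : C) : (Re z < 1 - e)%R -> (- e < Re (1 - 2 * RtoC e - z))%R.
Proof.
  intros H. replace (Re (1 - 2 * RtoC e - z)) with (1 - 2 * e - Re z)%R; [lra|].
  unfold Re; simpl; ring.
Qed.

Lemma holo_tube (e : R) (q r y d : C) :
  holo (gseg e q r) (1 - 2 * RtoC e - y) d ->
  holo (fun y => gseg e q r (1 - 2 * RtoC e - y)) y (- d).
Proof.
  intros H. eapply dq_eq.
  - apply (dq_comp (X := C_UniformSpace) _ (fun y => 1 - 2 * RtoC e - y) (gseg e q r)); [apply cont_C_id| |exact H].
    apply dq_minus; [apply dq_const|apply dq_id].
  - ring.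
Qed.

Lemma cont_tube (e : R) (q r y : C) :
  (0 < e)%R -> (Re y < 1 - e)%R -> cont (fun y => gseg e q r (1 - 2 * RtoC e - y)) y.
Proof.
  intros He Hy. apply (cont_comp (gseg e q r) (fun y => 1 - 2 * RtoC e - y)).
  - cont_tac.
  - apply cont_gseg; [exact He|now apply Re_tube].
Qed.

Lemma cont_Scor (e : R) (b y : C) :
  (0 < e < 1 / 2)%R -> Cmod y = e -> cont (fun y => cpow (1 - RtoC e - y) b) y.
Proof. intros He Hy. apply cont_cor_r. apply Re_cor with e; [simpl; lra|exact Hy]. Qed.

(** Integration by parts along the segment of the tube; at either end one of the two remaining
    coordinates equals [e]. *)
Lemma Ttube_parts_23 (e : R) (p q r : C) :
  (0 < e < 1 / 3)%R ->
  q * Ttube e p q (r + 1) - r * Ttube e p (q + 1) r =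
  cpow (RtoC e) r * Scor e p (q + 1) - cpow (RtoC e) q * Scor e p (r + 1).
Proof.
  intros He. unfold Ttube, Scor.
  assert (Ct : forall a b z, Cmod z = e -> cont (fun y => gseg e a b (1 - 2 * RtoC e - y)) z).
  { intros a b z Hz. apply cont_tube; [lra|]. apply Cmod_Re_lt; lra. }
  assert (Cs : forall b z, Cmod z = e -> cont (fun y => cpow (1 - RtoC e - y) b) z).
  { intros b z Hz. apply cont_Scor; [lra|exact Hz]. }
  rewrite <- !Rop_scal; try lra; auto.
  rewrite <- !Rop_minus; try lra;
    try (intros z Hz; apply cont_mult; [apply cont_const|auto]).
  apply Rop_ext; [lra|]. intros z Hz.
  rewrite gseg_parts; [|lra|apply Re_tube; apply Cmod_Re_lt; lra].
  replace (RtoC e + (1 - 2 * RtoC e - z)) with (1 - RtoC e - z) by ring.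
  replace (q + 1 - 1) with q by ring. replace (r + 1 - 1) with r by ring. ring.
Qed.

Lemma gseg_end (e : R) (q r : C) :
  gseg e q r (1 - 2 * RtoC e - RtoC e) = gseg e q r (1 - 3 * RtoC e).
Proof. f_equal. ring. Qed.

(** Integration by parts around the circle. [Rop_parts] evaluates at [y = e], where the segment is
    an edge of the shrunken triangle, while the end point moving with [y] contributes [Scor]. Using
    [holo_gseg'] here and [holo_gseg] in [Ttube_parts_13] decides which of the two other exponents
    is lowered by differentiation. *)
Lemma Ttube_parts_12 (e : R) (a b c : C) :
  (0 < e < 1 / 3)%R -> not_int a ->
  a * Ttube e a (b + 1) c - b * Ttube e (a + 1) b c =
  cpow (RtoC e) a * gseg e (b + 1) c (1 - 3 * RtoC e) + cpow (RtoC e) b * Scor e (a + 1) c.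
Proof.
  intros He Ha. unfold Ttube, Scor. rewrite <- gseg_end.
  assert (Ct : forall a b z, Cmod z = e -> cont (fun y => gseg e a b (1 - 2 * RtoC e - y)) z).
  { intros a' b' z Hz. apply cont_tube; [lra|]. apply Cmod_Re_lt; lra. }
  assert (Cs : forall b z, Cmod z = e -> cont (fun y => cpow (1 - RtoC e - y) b) z).
  { intros b' z Hz. apply cont_Scor; [lra|exact Hz]. }
  rewrite <- (Rop_parts e a (fun y => gseg e (b + 1) c (1 - 2 * RtoC e - y))
    (fun y => (- cpow (RtoC e) b) * cpow (1 - RtoC e - y) (c - 1)
      + (- b) * gseg e b c (1 - 2 * RtoC e - y))); [|lra|exact Ha|].
  - rewrite Rop_plus, !Rop_scal; try lra; auto; [ring| |];
      intros z Hz; (apply cont_mult; [apply cont_const|auto]).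
  - intros z Hz. split.
    + eapply dq_eq; [apply holo_tube; apply holo_gseg'; [lra|]|].
      * apply Re_tube. apply Cmod_Re_lt; lra.
      * replace (b + 1 - 1) with b by ring.
        replace (RtoC e + (1 - 2 * RtoC e - z)) with (1 - RtoC e - z) by ring. ring.
    + apply cont_plus; (apply cont_mult; [apply cont_const|auto]).
Qed.

Lemma Ttube_parts_13 (e : R) (a b c : C) :
  (0 < e < 1 / 3)%R -> not_int a ->
  a * Ttube e a b (c + 1) - c * Ttube e (a + 1) b c =
  cpow (RtoC e) a * gseg e b (c + 1) (1 - 3 * RtoC e) + cpow (RtoC e) c * Scor e (a + 1) b.
Proof.
  intros He Ha. unfold Ttube, Scor. rewrite <- gseg_end.
  assert (Ct : forall a b z, Cmod z = e -> cont (fun y => gseg e a b (1 - 2 * RtoC e - y)) z).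
  { intros a' b' z Hz. apply cont_tube; [lra|]. apply Cmod_Re_lt; lra. }
  assert (Cs : forall b z, Cmod z = e -> cont (fun y => cpow (1 - RtoC e - y) b) z).
  { intros b' z Hz. apply cont_Scor; [lra|exact Hz]. }
  rewrite <- (Rop_parts e a (fun y => gseg e b (c + 1) (1 - 2 * RtoC e - y))
    (fun y => (- cpow (RtoC e) c) * cpow (1 - RtoC e - y) (b - 1)
      + (- c) * gseg e b c (1 - 2 * RtoC e - y))); [|lra|exact Ha|].
  - rewrite Rop_plus, !Rop_scal; try lra; auto; [ring| |];
      intros z Hz; (apply cont_mult; [apply cont_const|auto]).
  - intros z Hz. split.
    + eapply dq_eq; [apply holo_tube; apply holo_gseg; [lra|]|].
      * apply Re_tube. apply Cmod_Re_lt; lra.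
      * replace (c + 1 - 1) with c by ring.
        replace (RtoC e + (1 - 2 * RtoC e - z)) with (1 - RtoC e - z) by ring. ring.
    + apply cont_plus; (apply cont_mult; [apply cont_const|auto]).
Qed.

Lemma Tcor_parts_23 (e : R) (p q r : C) :
  (0 < e < 1 / 3)%R -> not_int q ->
  q * Tcor e p q (r + 1) - r * Tcor e p (q + 1) r = cpow (RtoC e) q * Scor e p (r + 1).
Proof.
  intros He Hq. unfold Tcor, Scor.
  assert (Ch : forall a b z, Cmod z = e -> cont (hcor e a b) z).
  { intros a b z Hz. apply cont_hcor; [lra|]. apply Cmod_Re_lt; lra. }
  assert (Cs : forall b z, Cmod z = e -> cont (fun y => cpow (1 - RtoC e - y) b) z).
  { intros b' z Hz. apply cont_Scor; [lra|exact Hz]. }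
  rewrite <- !Rop_scal; try lra; auto.
  rewrite <- Rop_minus; try lra;
    try (intros z Hz; apply cont_mult; [apply cont_const|auto]).
  apply Rop_ext; [lra|]. intros z Hz.
  rewrite hcor_parts; [|lra|exact Hq|apply Cmod_Re_lt; lra].
  replace (r + 1 - 1) with r by ring. f_equal. f_equal. ring.
Qed.

Lemma Rop_hcor_parts (e : R) (a b c : C) :
  (0 < e < 1 / 3)%R -> not_int a ->
  a * Tcor e a b (c + 1) - c * Tcor e (a + 1) b c = cpow (RtoC e) a * Scor e b (c + 1).
Proof.
  intros He Ha. unfold Tcor.
  assert (Ch : forall a b z, Cmod z = e -> cont (hcor e a b) z).
  { intros a' b' z Hz. apply cont_hcor; [lra|]. apply Cmod_Re_lt; lra. }
  change (Scor e b (c + 1)) with (hcor e b (c + 1) (RtoC e)).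
  rewrite <- (Rop_parts e a (hcor e b (c + 1)) (fun y => (- c) * hcor e b c y)); [|lra|exact Ha|].
  - rewrite Rop_scal; [ring|lra|auto].
  - intros z Hz. split.
    + eapply dq_eq; [apply holo_hcor; [lra|apply Cmod_Re_lt; lra]|].
      replace (c + 1 - 1) with c by ring. reflexivity.
    + apply cont_mult; [apply cont_const|auto].
Qed.

(** Both integrations by parts, taken with third exponent [c - 1], contain the same term
    [Tcor e (a + 1) (b + 1) (c - 1)]; subtraction eliminates it. *)
Lemma Tcor_parts_12 (e : R) (a b c : C) :
  (0 < e < 1 / 3)%R -> not_int a -> not_int b ->
  a * Tcor e a (b + 1) c - b * Tcor e (a + 1) b c =
  cpow (RtoC e) a * Scor e (b + 1) c - cpow (RtoC e) b * Scor e (a + 1) c.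
Proof.
  intros He Ha Hb.
  assert (A := Rop_hcor_parts e a (b + 1) (c - 1) He Ha).
  assert (B := Tcor_parts_23 e (a + 1) b (c - 1) He Hb).
  replace (c - 1 + 1) with c in A, B by ring.
  rewrite <- A, <- B. ring.
Qed.

(** The pieces other than the inner triangle are grouped because together they are invariant under
    cyclic rotation, so that one integration by parts serves for all pairs of coordinates. *)
Definition Tbdry (e : R) (p q r : C) : C :=
  Ttube e p q r + Ttube e q r p + Ttube e r p q + Tcor e p q r + Tcor e q r p + Tcor e r p q.

Lemma Tbdry_rot (e : R) (p q r : C) : Tbdry e p q r = Tbdry e q r p.
Proof. unfold Tbdry. ring. Qed.

(** The circles [Scor] cancel between tubes and corners. Two edges of the shrunken triangle survive,
    to be cancelled by the inner triangle. *)
Lemma Tbdry_parts (e : R) (p q r : C) :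
  (0 < e < 1 / 3)%R -> not_int p -> not_int q -> not_int r ->
  q * Tbdry e p q (r + 1) - r * Tbdry e p (q + 1) r =
  cpow (RtoC e) q * gseg e (r + 1) p (1 - 3 * RtoC e)
  - cpow (RtoC e) r * gseg e p (q + 1) (1 - 3 * RtoC e).
Proof.
  intros He Hp Hq Hr. unfold Tbdry.
  transitivity ((q * Ttube e p q (r + 1) - r * Ttube e p (q + 1) r)
    + (q * Ttube e q (r + 1) p - r * Ttube e (q + 1) r p)
    - (r * Ttube e r p (q + 1) - q * Ttube e (r + 1) p q)
    + (q * Tcor e p q (r + 1) - r * Tcor e p (q + 1) r)
    + (q * Tcor e q (r + 1) p - r * Tcor e (q + 1) r p)
    - (r * Tcor e r p (q + 1) - q * Tcor e (r + 1) p q)); [ring|].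
  rewrite Ttube_parts_23, (Ttube_parts_12 e q r p), (Ttube_parts_13 e r p q),
    Tcor_parts_23, (Tcor_parts_12 e q r p), (Rop_hcor_parts e r p q) by assumption.
  ring.
Qed.

Lemma Tbdry_sum (e : R) (p q r : C) :
  (0 < e < 1 / 3)%R ->
  Tbdry e p q r = Tbdry e (p + 1) q r + Tbdry e p (q + 1) r + Tbdry e p q (r + 1).
Proof.
  intros He.
  assert (T : forall p q r, Ttube e p q r = Ttube e (p + 1) q r + Ttube e p (q + 1) r + Ttube e p q (r + 1)).
  { clear p q r. intros p q r. unfold Ttube. rewrite Rop_shift.
    assert (Ct : forall a b z, Cmod z = e -> cont (fun y => gseg e a b (1 - 2 * RtoC e - y)) z).
    { intros a b z Hz. apply cont_tube; [lra|]. apply Cmod_Re_lt; lra. }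
    rewrite <- !Rop_plus; try lra; auto.
    - apply Rop_ext; [lra|]. intros z Hz. rewrite <- Cplus_assoc, gseg_sum; [ring|lra|].
      apply Re_tube. apply Cmod_Re_lt; lra.
    - intros z Hz. apply cont_plus; [|auto]. apply cont_mult; [apply cont_C_id|auto].
    - intros z Hz. apply cont_mult; [apply cont_C_id|auto]. }
  assert (Co : forall p q r, Tcor e p q r = Tcor e (p + 1) q r + Tcor e p (q + 1) r + Tcor e p q (r + 1)).
  { clear p q r. intros p q r. unfold Tcor. rewrite Rop_shift.
    assert (Ch : forall a b z, Cmod z = e -> cont (hcor e a b) z).
    { intros a' b' z Hz. apply cont_hcor; [lra|]. apply Cmod_Re_lt; lra. }
    rewrite <- !Rop_plus; try lra; auto.
    - apply Rop_ext; [lra|]. intros z Hz.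
      rewrite (hcor_sum e q r z) at 1; [ring|lra|apply Cmod_Re_lt; lra].
    - intros z Hz. apply cont_plus; [|auto]. apply cont_mult; [apply cont_C_id|apply Ch; exact Hz].
    - intros z Hz. apply cont_mult; [apply cont_C_id|apply Ch; exact Hz]. }
  unfold Tbdry. rewrite (T p q r), (T q r p), (T r p q), (Co p q r), (Co q r p), (Co r p q). ring.
Qed.

(** * The inner triangle and the recurrences of the Dirichlet integral *)

Definition Tinner (e : R) (p q r : C) : C :=
  CInt (fun s => cpow (RtoC e + RtoC s * (1 - 3 * RtoC e)) (p - 1)
    * gseg e q r ((1 - RtoC s) * (1 - 3 * RtoC e)) * (1 - 3 * RtoC e)) 0 1.

Lemma Re_inner (e s : R) : (0 < e < 1 / 3)%R -> (0 <= s <= 1)%R ->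
  (- e < Re (1 - 3 * RtoC e))%R /\ (- e < Re ((1 - RtoC s) * (1 - 3 * RtoC e)))%R /\
  (0 < Re (RtoC e + RtoC s * (1 - 3 * RtoC e)))%R /\
  (0 < Re (RtoC e + (1 - RtoC s) * (1 - 3 * RtoC e)))%R.
Proof.
  intros He Hs.
  replace (Re (1 - 3 * RtoC e)) with (1 - 3 * e)%R by (unfold Re; simpl; ring).
  replace (Re ((1 - RtoC s) * (1 - 3 * RtoC e))) with ((1 - s) * (1 - 3 * e))%R
    by (unfold Re; simpl; ring).
  replace (Re (RtoC e + RtoC s * (1 - 3 * RtoC e))) with (e + s * (1 - 3 * e))%R
    by (unfold Re; simpl; ring).
  replace (Re (RtoC e + (1 - RtoC s) * (1 - 3 * RtoC e))) with (e + (1 - s) * (1 - 3 * e))%R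
    by (unfold Re; simpl; ring).
  repeat split; nra.
Qed.

Lemma cont_inner_gseg (e : R) (q r : C) (s : R) :
  (0 < e < 1 / 3)%R -> (0 <= s <= 1)%R ->
  cont (fun s => gseg e q r ((1 - RtoC s) * (1 - 3 * RtoC e))) s.
Proof.
  intros He Hs. apply (cont_comp (gseg e q r) (fun s => (1 - RtoC s) * (1 - 3 * RtoC e))).
  - cont_tac.
  - apply cont_gseg; [lra|]. now apply Re_inner.
Qed.

Lemma cont_inner (e : R) (p q r : C) (s : R) :
  (0 < e < 1 / 3)%R -> (0 <= s <= 1)%R ->
  cont (fun s => cpow (RtoC e + RtoC s * (1 - 3 * RtoC e)) (p - 1)
    * gseg e q r ((1 - RtoC s) * (1 - 3 * RtoC e)) * (1 - 3 * RtoC e)) s.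
Proof.
  intros He Hs. destruct (Re_inner e s He Hs) as [H1 [H2 [H3 H4]]].
  assert (G := cont_inner_gseg e q r s He Hs).
  apply cont_mult; [|apply cont_const]. apply cont_mult; [|exact G].
  cont_tac; exact H3.
Qed.

Lemma isI_inner (e : R) (p q r : C) :
  (0 < e < 1 / 3)%R ->
  isI (fun s => cpow (RtoC e + RtoC s * (1 - 3 * RtoC e)) (p - 1)
    * gseg e q r ((1 - RtoC s) * (1 - 3 * RtoC e)) * (1 - 3 * RtoC e)) 0 1 (Tinner e p q r).
Proof.
  intros He. apply isI_CInt. apply exI_cont; [lra|]. intros s Hs. now apply cont_inner.
Qed.

Lemma Tinner_parts_23 (e : R) (p q r : C) :
  (0 < e < 1 / 3)%R ->
  q * Tinner e p q (r + 1) - r * Tinner e p (q + 1) r =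
  cpow (RtoC e) r * gseg e p (q + 1) (1 - 3 * RtoC e)
  - cpow (RtoC e) q * gseg e p (r + 1) (1 - 3 * RtoC e).
Proof.
  intros He.
  destruct (Re_inner e 0 He ltac:(lra)) as [Hk _].
  assert (I := isI_minus _ _ _ _ _ _ (isI_scal _ q _ _ _ (isI_inner e p q (r + 1) He))
    (isI_scal _ r _ _ _ (isI_inner e p (q + 1) r He))).
  assert (J := isI_minus _ _ _ _ _ _
    (isI_scal _ (cpow (RtoC e) r) _ _ _ (isI_gseg e p (q + 1) (1 - 3 * RtoC e) ltac:(lra) Hk))
    (isI_scal _ (cpow (RtoC e) q) _ _ _ (isI_gseg e p (r + 1) (1 - 3 * RtoC e) ltac:(lra) Hk))).
  rewrite <- (isI_unique _ _ _ _ I), <- (isI_unique _ _ _ _ J).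
  apply CInt_ext; [lra|]. intros s Hs.
  destruct (Re_inner e s He Hs) as [H1 [H2 [H3 H4]]].
  assert (P := gseg_parts e q r _ ltac:(lra) H2).
  replace (q + 1 - 1) with q by ring. replace (r + 1 - 1) with r by ring.
  set (Y := cpow (RtoC e + RtoC s * (1 - 3 * RtoC e)) (p - 1)).
  set (L := (1 - RtoC s) * (1 - 3 * RtoC e)) in *.
  transitivity (Y * (q * gseg e q (r + 1) L - r * gseg e (q + 1) r L) * (1 - 3 * RtoC e)); [ring|].
  rewrite P. ring.
Qed.

(** Integration by parts in the outer variable [s]. One edge is the boundary value at [s = 0], the
    other comes from the end point term in the derivative of the inner [gseg]; at [s = 1] the inner
    segment degenerates and contributes nothing by [gseg_0]. *)
Lemma Tinner_parts_12 (e : R) (p q r : C) :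
  (0 < e < 1 / 3)%R ->
  p * Tinner e p (q + 1) r - q * Tinner e (p + 1) q r =
  cpow (RtoC e) q * gseg e (p + 1) r (1 - 3 * RtoC e)
  - cpow (RtoC e) p * gseg e (q + 1) r (1 - 3 * RtoC e).
Proof.
  intros He.
  destruct (Re_inner e 0 He ltac:(lra)) as [Hk _].
  assert (I := isI_minus _ _ _ _ _ _
    (isI_minus _ _ _ _ _ _ (isI_scal _ p _ _ _ (isI_inner e p (q + 1) r He))
      (isI_scal _ q _ _ _ (isI_inner e (p + 1) q r He)))
    (isI_scal _ (cpow (RtoC e) q) _ _ _ (isI_gseg e (p + 1) r (1 - 3 * RtoC e) ltac:(lra) Hk))).
  set (k := 1 - 3 * RtoC e) in *.
  set (A := fun s : R => RtoC e + RtoC s * k). set (L := fun s : R => (1 - RtoC s) * k).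
  assert (J : CInt (fun t => p * (cpow (RtoC e + RtoC t * k) (p - 1) * gseg e (q + 1) r ((1 - RtoC t) * k) * k)
       - q * (cpow (RtoC e + RtoC t * k) (p + 1 - 1) * gseg e q r ((1 - RtoC t) * k) * k)
       - cpow (RtoC e) q * (cpow (RtoC e + RtoC t * k) (p + 1 - 1)
           * cpow (RtoC e + (1 - RtoC t) * k) (r - 1) * k)) 0 1 =
     cpow (A 1%R) p * gseg e (q + 1) r (L 1%R) - cpow (A 0%R) p * gseg e (q + 1) r (L 0%R)).
  { apply isI_unique. apply (isI_FTC (fun s => cpow (A s) p * gseg e (q + 1) r (L s))); [lra| |].
    - intros s Hs. destruct (Re_inner e s He Hs) as [H1 [H2 [H3 H4]]]. fold k in H1, H2, H3, H4.
      eapply dq_eq.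
      + apply (dq_mult RtoC (fun s => cpow (A s) p) (fun s => gseg e (q + 1) r (L s))); [apply cont_R_RtoC| |].
        * apply (dq_cpow RtoC A); [apply cont_R_RtoC|apply rder_affine|exact H3].
        * apply (dq_comp RtoC L (gseg e (q + 1) r)); [apply cont_R_RtoC| |].
          -- apply dq_ext with (fun t => 0 + (1 - RtoC t) * k); [intros; unfold L; ring|].
             apply (rder_affine_rev 0 k).
          -- apply holo_gseg'; [lra|exact H2].
      + replace (q + 1 - 1) with q by ring. replace (p + 1 - 1) with p by ring.
        unfold A, L. change R in s. ring.
    - intros s Hs. destruct (Re_inner e s He Hs) as [H1 [H2 [H3 H4]]].
      assert (C1 := cont_inner e p (q + 1) r s He Hs).
      assert (C2 := cont_inner e (p + 1) q r s He Hs). fold k in C1, C2, H1, H2, H3, H4.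
      apply cont_minus; [apply cont_minus; (apply cont_mult; [apply cont_const|assumption])|].
      cont_tac; assumption. }
  apply isI_unique in I. fold k in I. rewrite J in I.
  unfold A, L in I.
  replace ((1 - RtoC 1) * k) with (RtoC 0) in I by ring. rewrite gseg_0 in I.
  replace ((1 - RtoC 0) * k) with k in I by ring.
  replace (RtoC e + RtoC 0 * k) with (RtoC e) in I by ring.
  set (X := p * Tinner e p (q + 1) r - q * Tinner e (p + 1) q r) in *.
  set (Z := cpow (RtoC e) q * gseg e (p + 1) r k) in *.
  replace X with ((X - Z) + Z) by ring. rewrite <- I. ring.
Qed.

Lemma Tinner_sum (e : R) (p q r : C) :
  (0 < e < 1 / 3)%R ->
  Tinner e p q r = Tinner e (p + 1) q r + Tinner e p (q + 1) r + Tinner e p q (r + 1).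
Proof.
  intros He.
  rewrite <- (isI_unique _ _ _ _ (isI_plus _ _ _ _ _ _ (isI_plus _ _ _ _ _ _
    (isI_inner e (p + 1) q r He) (isI_inner e p (q + 1) r He)) (isI_inner e p q (r + 1) He))).
  unfold Tinner. apply CInt_ext; [lra|]. intros s Hs.
  destruct (Re_inner e s He Hs) as [H1 [H2 [H3 H4]]].
  assert (G := gseg_sum e q r _ ltac:(lra) H2).
  replace (p + 1 - 1) with (p - 1 + 1) by ring. rewrite (cpow_S _ (p - 1) H3).
  set (Y := cpow (RtoC e + RtoC s * (1 - 3 * RtoC e)) (p - 1)).
  set (k := 1 - 3 * RtoC e) in *. set (L := (1 - RtoC s) * k) in *.
  transitivity (Y * ((RtoC e + RtoC s * k) * gseg e q r L
    + (gseg e (q + 1) r L + gseg e q (r + 1) L)) * k); [|ring].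
  rewrite G. unfold L, k. ring.
Qed.

(* The integral of [y0^(p-1) y1^(q-1) y2^(r-1)] over the regularization of the triangle
   [y0 + y1 + y2 = 1]. *)
Definition Treg (e : R) (p q r : C) : C := Tinner e p q r + Tbdry e p q r.

(** The edges of the inner triangle cancel those left over by the tubes, which run through them in
    the opposite parametrization; [gseg_sym] identifies the two. *)
Lemma Treg_parts_23 (e : R) (p q r : C) :
  (0 < e < 1 / 3)%R -> not_int p -> not_int q -> not_int r ->
  q * Treg e p q (r + 1) = r * Treg e p (q + 1) r.
Proof.
  intros He Hp Hq Hr.
  destruct (Re_inner e 0 He ltac:(lra)) as [Hk _].
  assert (A := Tinner_parts_23 e p q r He). assert (B := Tbdry_parts e p q r He Hp Hq Hr).
  rewrite (gseg_sym e (r + 1) p) in B by (try lra; exact Hk).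
  unfold Treg.
  set (I1 := Tinner e p q (r + 1)) in *. set (I2 := Tinner e p (q + 1) r) in *.
  set (B1 := Tbdry e p q (r + 1)) in *. set (B2 := Tbdry e p (q + 1) r) in *.
  replace (q * (I1 + B1)) with ((q * I1 - r * I2) + (q * B1 - r * B2) + r * (I2 + B2)) by ring.
  rewrite A, B. ring.
Qed.

Lemma Treg_parts_12 (e : R) (p q r : C) :
  (0 < e < 1 / 3)%R -> not_int p -> not_int q -> not_int r ->
  p * Treg e p (q + 1) r = q * Treg e (p + 1) q r.
Proof.
  intros He Hp Hq Hr.
  destruct (Re_inner e 0 He ltac:(lra)) as [Hk _].
  assert (A := Tinner_parts_12 e p q r He). assert (B := Tbdry_parts e r p q He Hr Hp Hq).
  rewrite (gseg_sym e r (p + 1)) in B by (try lra; exact Hk).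
  unfold Treg. rewrite <- (Tbdry_rot e r p (q + 1)), <- (Tbdry_rot e r (p + 1) q).
  set (I1 := Tinner e p (q + 1) r) in *. set (I2 := Tinner e (p + 1) q r) in *.
  set (B1 := Tbdry e r p (q + 1)) in *. set (B2 := Tbdry e r (p + 1) q) in *.
  replace (p * (I1 + B1)) with ((p * I1 - q * I2) + (p * B1 - q * B2) + q * (I2 + B2)) by ring.
  rewrite A, B. ring.
Qed.

Lemma Treg_sum (e : R) (p q r : C) :
  (0 < e < 1 / 3)%R ->
  Treg e p q r = Treg e (p + 1) q r + Treg e p (q + 1) r + Treg e p q (r + 1).
Proof.
  intros He. unfold Treg. rewrite (Tinner_sum e p q r He), (Tbdry_sum e p q r He). ring.
Qed.

Lemma Treg_S_2 (e : R) (p q r : C) :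
  (0 < e < 1 / 3)%R -> not_int p -> not_int q -> not_int r ->
  (p + q + r) * Treg e p (q + 1) r = q * Treg e p q r.
Proof.
  intros He Hp Hq Hr. rewrite (Treg_sum e p q r He), !Cmult_plus_distr_l.
  rewrite Treg_parts_23, <- Treg_parts_12 by assumption. ring.
Qed.

(** Deduced from [Treg_S_2], the index adjacent to both available integrations by parts, and
    division by [q]; an integration by parts between the first and third coordinates is avoided. *)
Lemma Treg_S_1 (e : R) (p q r : C) :
  (0 < e < 1 / 3)%R -> not_int p -> not_int q -> not_int r ->
  (p + q + r) * Treg e (p + 1) q r = p * Treg e p q r.
Proof.
  intros He Hp Hq Hr. assert (Hq0 := not_int_neq_0 _ Hq).
  assert (A := Treg_S_2 e p q r He Hp Hq Hr). assert (B := Treg_parts_12 e p q r He Hp Hq Hr).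
  transitivity ((p + q + r) * (q * Treg e (p + 1) q r) / q); [field; exact Hq0|].
  rewrite <- B.
  transitivity (p * ((p + q + r) * Treg e p (q + 1) r) / q); [field; exact Hq0|].
  rewrite A. field. exact Hq0.
Qed.

Lemma Treg_S_3 (e : R) (p q r : C) :
  (0 < e < 1 / 3)%R -> not_int p -> not_int q -> not_int r ->
  (p + q + r) * Treg e p q (r + 1) = r * Treg e p q r.
Proof.
  intros He Hp Hq Hr. assert (Hq0 := not_int_neq_0 _ Hq).
  assert (A := Treg_S_2 e p q r He Hp Hq Hr). assert (B := Treg_parts_23 e p q r He Hp Hq Hr).
  transitivity ((p + q + r) * (q * Treg e p q (r + 1)) / q); [field; exact Hq0|].
  rewrite B.
  transitivity (r * ((p + q + r) * Treg e p (q + 1) r) / q); [field; exact Hq0|].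
  rewrite A. field. exact Hq0.
Qed.

(** * Uniform bounds, and the limit as the last exponent tends to infinity *)

Definition cpow_max (e : R) (k : C) : R := exp (Cmod k * (Rabs (ln e) + 1 + 2 * PI)).

Lemma cpow_max_pos (e : R) (k : C) : (0 < cpow_max e k)%R.
Proof. apply exp_pos. Qed.

(** The real part of the logarithm lies between [ln e] and 1, the argument within [2 pi]. The
    constant is chosen so that it also covers the logarithm [ln e + 2 pi i tau] carried by a circle,
    and a single [cpow_max] serves all cells. *)
Lemma Cmod_Clog_le (e : R) (w : C) :
  (0 < e <= Re w)%R -> (Cmod w <= 2)%R -> (Cmod (Clog w) <= Rabs (ln e) + 1 + 2 * PI)%R.
Proof.
  intros He Hw. eapply Rle_trans; [apply Cmod_le_parts|].
  assert (A := Re_le_Cmod w). assert (B := Rle_abs (Re w)).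
  apply Rplus_le_compat.
  - unfold Clog, Re; simpl. set (m := Cmod w) in *.
    assert (L1 : (ln m <= m - 1)%R).
    { assert (Q := exp_ineq1_le (ln m)). rewrite exp_ln in Q by lra. lra. }
    assert (L2 : (ln e <= ln m)%R).
    { destruct (Req_dec e m) as [->|N]; [lra|]. left. apply ln_increasing; lra. }
    assert (Q := Rle_abs (- ln e)). rewrite Rabs_Ropp in Q. assert (Q2 := Rabs_pos (ln e)).
    apply Rabs_le_between. lra.
  - unfold Clog, Im; simpl.
    match goal with |- (Rabs (2 * atan ?u) <= _)%R => assert (Q := atan_bound u) end.
    apply Rabs_le_between. generalize PI_RGT_0. lra.
Qed.

Lemma cpow_bound (e : R) (w k : C) :
  (0 < e <= Re w)%R -> (Cmod w <= 2)%R -> (Cmod (cpow w k) <= cpow_max e k)%R.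
Proof.
  intros He Hw. eapply Rle_trans; [apply Cmod_Cexp_le|]. apply exp_le. rewrite Cmod_mult.
  apply Rmult_le_compat_l; [apply Cmod_ge_0|]. now apply Cmod_Clog_le.
Qed.

Ltac mult_pos_tac := first [lra | apply Rmult_le_pos; mult_pos_tac].

Lemma Rmult3_le (a b c A B D : R) :
  (0 <= a <= A)%R -> (0 <= b <= B)%R -> (0 <= c <= D)%R -> (a * b * c <= A * B * D)%R.
Proof.
  intros. apply Rmult_le_compat; [nra|lra| |lra]. apply Rmult_le_compat; lra.
Qed.

Lemma gseg_real_bound (e l : R) (q r : C) (N : nat) :
  (0 < e < 1 / 3)%R -> (0 <= l <= 1 - 2 * e)%R ->
  (Cmod (gseg e q (r + RtoC (INR N)) (RtoC l)) <= cpow_max e (q - 1) * cpow_max e (r - 1) * (1 - e) ^ N)%R.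
Proof.
  intros He Hl.
  match goal with |- (_ <= ?M)%R => replace M with ((1 - 0) * M)%R by ring end.
  apply Cmod_CInt_le; [lra| |].
  { eexists. apply isI_gseg; [lra|simpl; lra]. }
  intros t Ht.
  replace (RtoC e + RtoC t * RtoC l) with (RtoC (e + t * l)) by (now rewrite RtoC_plus, RtoC_mult).
  replace (RtoC e + (1 - RtoC t) * RtoC l) with (RtoC (e + (1 - t) * l))
    by (now rewrite RtoC_plus, RtoC_mult, RtoC_minus).
  assert (U1 : (e <= e + t * l <= 1 - e)%R) by nra.
  assert (U2 : (e <= e + (1 - t) * l <= 1 - e)%R) by nra.
  set (x := (e + t * l)%R) in *. set (y := (e + (1 - t) * l)%R) in *.
  replace (r + RtoC (INR N) - 1) with (r - 1 + RtoC (INR N)) by ring.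
  rewrite cpow_nat by (simpl; lra).
  rewrite !Cmod_mult, Cmod_pow, (Cmod_RtoC_nonneg y), (Cmod_RtoC_nonneg l) by lra.
  assert (B1 := cpow_bound e (RtoC x) (q - 1) ltac:(simpl; lra) ltac:(rewrite Cmod_RtoC_nonneg; lra)).
  assert (B2 := cpow_bound e (RtoC y) (r - 1) ltac:(simpl; lra) ltac:(rewrite Cmod_RtoC_nonneg; lra)).
  assert (D : (0 <= y ^ N <= (1 - e) ^ N)%R) by (split; [apply pow_le; lra|apply pow_incr; lra]).
  assert (P1 := Cmod_ge_0 (cpow (RtoC x) (q - 1))). assert (P2 := Cmod_ge_0 (cpow (RtoC y) (r - 1))).
  apply Rle_trans with (Cmod (cpow (RtoC x) (q - 1)) * (Cmod (cpow (RtoC y) (r - 1)) * y ^ N) * 1)%R.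
  { apply Rmult_le_compat_l; [|lra]. apply Rmult_le_pos; [lra|]. apply Rmult_le_pos; lra. }
  replace (Cmod (cpow (RtoC x) (q - 1)) * (Cmod (cpow (RtoC y) (r - 1)) * y ^ N) * 1)%R
    with (Cmod (cpow (RtoC x) (q - 1)) * Cmod (cpow (RtoC y) (r - 1)) * y ^ N)%R by ring.
  apply Rmult3_le; lra.
Qed.

Lemma gseg_circle_bound (e : R) (p q z : C) :
  (0 < e < 1 / 3)%R -> Cmod z = e ->
  (Cmod (gseg e p q (1 - 2 * RtoC e - z)) <= cpow_max e (p - 1) * cpow_max e (q - 1))%R.
Proof.
  intros He Hz.
  assert (A := Re_le_Cmod z). assert (B := Rle_abs (Re z)).
  set (l := 1 - 2 * RtoC e - z).
  assert (Hl : (1 - 3 * e <= Re l)%R).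
  { replace (Re l) with (1 - 2 * e - Re z)%R by (unfold l, Re; simpl; ring). lra. }
  assert (Hm : (Cmod l <= 1 - e)%R).
  { unfold l. eapply Rle_trans; [apply Cmod_minus_le|].
    replace (1 - 2 * RtoC e) with (RtoC (1 - 2 * e)) by (now rewrite RtoC_minus, RtoC_mult).
    rewrite Cmod_RtoC_nonneg by lra. lra. }
  match goal with |- (_ <= ?M)%R => replace M with ((1 - 0) * M)%R by ring end.
  apply Cmod_CInt_le; [lra| |].
  { eexists. apply isI_gseg; lra. }
  assert (P : forall t, (0 <= t <= 1)%R ->
    (e <= Re (RtoC e + RtoC t * l))%R /\ (Cmod (RtoC e + RtoC t * l) <= 2)%R).
  { intros t Ht. split.
    - replace (Re (RtoC e + RtoC t * l)) with (e + t * Re l)%R by (unfold Re; simpl; ring).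
      assert (0 <= t * Re l)%R by (apply Rmult_le_pos; lra). lra.
    - eapply Rle_trans; [apply Cmod_triangle|]. rewrite Cmod_mult, !Cmod_RtoC_nonneg by lra.
      assert (t * Cmod l <= 1 * (1 - e))%R by (apply Rmult_le_compat; try lra; apply Cmod_ge_0). lra. }
  intros t Ht. destruct (P t Ht) as [P1 P2]. destruct (P (1 - t)%R ltac:(lra)) as [P3 P4].
  rewrite RtoC_minus in P3, P4. rewrite !Cmod_mult.
  assert (B1 := cpow_bound e _ (p - 1) (conj (proj1 He) P1) P2).
  assert (B2 := cpow_bound e _ (q - 1) (conj (proj1 He) P3) P4).
  rewrite <- (Rmult_1_r (cpow_max e (p - 1) * cpow_max e (q - 1))).
  apply Rmult3_le; split; auto using Cmod_ge_0. lra.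
Qed.

Lemma cor_circle_bound (e : R) (k y z : C) :
  (0 < e < 1 / 3)%R -> Cmod y = e -> Cmod z = e ->
  (Cmod (cpow (1 - y - z) k) <= cpow_max e k)%R.
Proof.
  intros He Hy Hz. assert (A := Re_le_Cmod y). assert (B := Rle_abs (Re y)).
  assert (A' := Re_le_Cmod z). assert (B' := Rle_abs (Re z)).
  apply cpow_bound.
  - change (Re (1 - y - z)) with (1 - Re y - Re z)%R. lra.
  - eapply Rle_trans; [apply Cmod_minus_le|].
    eapply Rle_trans; [apply Rplus_le_compat_r, Cmod_minus_le|]. rewrite Cmod_1. lra.
Qed.

Lemma Rop_bound_0 (e : R) (p : C) :
  (0 < e)%R -> exists K : R, (0 <= K)%R /\ forall (G : C -> C) (M : R),
    (forall z, Cmod z = e -> cont G z /\ (Cmod (G z) <= M)%R) ->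
    (Cmod (Rop e p G) <= K * M)%R.
Proof.
  intros He. destruct (Rop_bound e p He) as [K [HK B]]. exists K. split; [exact HK|].
  intros G M H. specialize (B 0%nat G M H). simpl in B.
  rewrite Cplus_0_r, Rmult_1_r in B. exact B.
Qed.

Lemma holo_tube_cont (e : R) (q r z : C) :
  (0 < e < 1 / 3)%R -> (Cmod z < 1 - e)%R ->
  holo (fun y => gseg e q r (1 - 2 * RtoC e - y)) z
    (- (cpow (1 - RtoC e - z) (q - 1) * cpow (RtoC e) (r - 1) + (r - 1) * gseg e q (r - 1) (1 - 2 * RtoC e - z)))
  /\ cont (fun z => - (cpow (1 - RtoC e - z) (q - 1) * cpow (RtoC e) (r - 1)
      + (r - 1) * gseg e q (r - 1) (1 - 2 * RtoC e - z))) z.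
Proof.
  intros He Hz. assert (A := Re_le_Cmod z). assert (B := Rle_abs (Re z)).
  assert (Hr : (Re z < 1 - e)%R) by lra.
  assert (Hp : (0 < Re (1 - RtoC e - z))%R) by (change (Re (1 - RtoC e - z)) with (1 - e - Re z)%R; lra).
  split.
  - eapply dq_eq; [apply holo_tube; apply holo_gseg; [lra|now apply Re_tube]|].
    replace (RtoC e + (1 - 2 * RtoC e - z)) with (1 - RtoC e - z) by ring. reflexivity.
  - assert (Ct := cont_tube e q (r - 1) z ltac:(lra) Hr). cont_tac; assumption.
Qed.

(* Every piece of the regularized triangle other than the corner at [y0 = y1 = 0] is
   negligible when the exponent of [y2] tends to infinity. *)
Lemma Treg_minus_corner (e : R) (p q r : C) :
  (0 < e < 1 / 3)%R -> not_int p -> not_int q -> not_int r -> (0 < Re p)%R -> (0 < Re q)%R ->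
  exists K, (0 <= K)%R /\ forall N,
    (Cmod (Treg e p q (r + RtoC (INR N)) - Tcor e p q (r + RtoC (INR N))) <= K * (1 - e) ^ N)%R.
Proof.
  intros He Hp Hq Hr Rp Rq.
  destruct (Rop_bound e r ltac:(lra)) as [K3 [HK3 B3]].
  destruct (Rop_bound_0 e p ltac:(lra)) as [Kp [HKp Bp]].
  destruct (Rop_bound_0 e q ltac:(lra)) as [Kq [HKq Bq]].
  assert (Ch : forall a b z, Cmod z = e -> cont (hcor e a b) z).
  { intros a' b' z Hz. apply cont_hcor; [lra|]. apply Cmod_Re_lt; lra. }
  set (cp := cpow_max e (p - 1)). set (cq := cpow_max e (q - 1)). set (cr := cpow_max e (r - 1)).
  assert (Hcp : (0 < cp)%R) by apply cpow_max_pos.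
  assert (Hcq : (0 < cq)%R) by apply cpow_max_pos.
  assert (Hcr : (0 < cr)%R) by apply cpow_max_pos.
  set (mp := mom 0 (Re p) 1). set (mq := mom 0 (Re q) 1).
  assert (Hmp : (0 <= mp)%R) by (apply mom_nonneg; lra).
  assert (Hmq : (0 <= mq)%R) by (apply mom_nonneg; lra).
  set (k1 := (cp * (cq * cr))%R). set (k2 := (cq * cr * mp)%R). set (k3 := (cp * cr * mq)%R).
  set (k4 := (K3 * (cp * cq))%R). set (k5 := (Kq * (K3 * cp))%R). set (k6 := (K3 * (Kp * cq))%R).
  exists (k1 + k2 + k3 + k4 + k5 + k6)%R.
  assert (P1 : (0 <= k1)%R) by (unfold k1; mult_pos_tac).
  assert (P2 : (0 <= k2)%R) by (unfold k2; mult_pos_tac).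
  assert (P3 : (0 <= k3)%R) by (unfold k3; mult_pos_tac).
  assert (P4 : (0 <= k4)%R) by (unfold k4; mult_pos_tac).
  assert (P5 : (0 <= k5)%R) by (unfold k5; mult_pos_tac).
  assert (P6 : (0 <= k6)%R) by (unfold k6; mult_pos_tac).
  split; [lra|]. intros N.
  set (rN := r + RtoC (INR N)).
  assert (Pe : (0 <= e ^ N)%R) by (apply pow_le; lra).
  assert (Pe1 : (e ^ N <= (1 - e) ^ N)%R) by (apply pow_incr; lra).
  set (x := ((1 - e) ^ N)%R) in *.
  assert (H1 : (Cmod (Tinner e p q rN) <= k1 * x)%R).
  { replace (k1 * x)%R with ((1 - 0) * (k1 * x))%R by ring.
    apply Cmod_CInt_le; [lra|eexists; now apply isI_inner|].
    intros s Hs. destruct (Re_inner e s He Hs) as [_ [_ [H3 _]]].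
    set (l := ((1 - s) * (1 - 3 * e))%R).
    replace ((1 - RtoC s) * (1 - 3 * RtoC e)) with (RtoC l)
      by (unfold l; now rewrite RtoC_mult, !RtoC_minus, RtoC_mult).
    replace (RtoC e + RtoC s * (1 - 3 * RtoC e)) with (RtoC (e + s * (1 - 3 * e)))
      by (now rewrite RtoC_plus, RtoC_mult, RtoC_minus, RtoC_mult).
    replace (1 - 3 * RtoC e) with (RtoC (1 - 3 * e)) by (now rewrite RtoC_minus, RtoC_mult).
    rewrite !Cmod_mult, (Cmod_RtoC_nonneg (1 - 3 * e)) by lra.
    assert (U : (e <= e + s * (1 - 3 * e) <= 1)%R) by nra.
    assert (G := gseg_real_bound e l q r N He ltac:(unfold l; split; [apply Rmult_le_pos; lra|nra])). fold cq cr rN x in G.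
    assert (Q := cpow_bound e (RtoC (e + s * (1 - 3 * e))) (p - 1) ltac:(simpl; lra)
      ltac:(rewrite Cmod_RtoC_nonneg; lra)). fold cp in Q.
    replace (k1 * x)%R with (cp * (cq * cr * x) * 1)%R by (unfold k1; ring).
    apply Rmult3_le; split; auto using Cmod_ge_0; lra. }
  assert (Px : (0 <= x)%R) by lra.
  (* Around the circle the coordinate with the large exponent can reach modulus 1, which gives no
     decay. After collapsing onto real [y >= 0] it is at most [1 - e]. *)
  assert (H2 : (Cmod (Ttube e p q rN) <= k2 * x)%R).
  { replace (k2 * x)%R with ((cq * cr * x) * mom 0 (Re p) 1 + 0 * mom 0 (Re p + 1) 1)%R
      by (unfold k2, mp; ring).
    assert (P0 : (0 <= cq * cr * x)%R) by (mult_pos_tac).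
    unfold Ttube.
    refine (Rop_collapse_mom e (1 - e) p _ _ (cq * cr * x) 0 0 _ _ Hp Rp P0 (Rle_refl 0)
      (fun z Hz => holo_tube_cont e q rN z He Hz) _); try lra.
    intros y Hy. rewrite Rmult_0_l, Rplus_0_r. simpl pow. rewrite Rmult_1_r.
    replace (1 - 2 * RtoC e - RtoC y) with (RtoC (1 - 2 * e - y))
      by (now rewrite !RtoC_minus, RtoC_mult).
    apply gseg_real_bound; lra. }
  assert (H3 : (Cmod (Ttube e q rN p) <= k3 * x)%R).
  { replace (k3 * x)%R with ((cp * cr * x) * mom 0 (Re q) 1 + 0 * mom 0 (Re q + 1) 1)%R
      by (unfold k3, mq; ring).
    assert (P0 : (0 <= cp * cr * x)%R) by (mult_pos_tac).
    unfold Ttube.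
    refine (Rop_collapse_mom e (1 - e) q _ _ (cp * cr * x) 0 0 _ _ Hq Rq P0 (Rle_refl 0)
      (fun z Hz => holo_tube_cont e rN p z He Hz) _); try lra.
    intros y Hy. rewrite Rmult_0_l, Rplus_0_r. simpl pow. rewrite Rmult_1_r.
    replace (1 - 2 * RtoC e - RtoC y) with (RtoC (1 - 2 * e - y))
      by (now rewrite !RtoC_minus, RtoC_mult).
    rewrite gseg_sym by (simpl; lra).
    apply gseg_real_bound; lra. }
  (* In the remaining pieces the coordinate with the large exponent is itself on a circle of radius
     [e], so a direct bound gives [e ^ N]. *)
  assert (H4 : (Cmod (Ttube e rN p q) <= k4 * x)%R).
  { eapply Rle_trans; [apply (B3 N _ (cp * cq)%R)|].
    - intros z Hz. split; [apply cont_tube; [lra|apply Cmod_Re_lt; lra]|now apply gseg_circle_bound].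
    - replace (K3 * e ^ N * (cp * cq))%R with (k4 * e ^ N)%R by (unfold k4; ring).
      now apply Rmult_le_compat_l. }
  assert (H5 : (Cmod (Tcor e q rN p) <= k5 * x)%R).
  { eapply Rle_trans; [apply (Bq _ (K3 * e ^ N * cp)%R)|].
    - intros z Hz. split; [now apply Ch|]. apply B3. intros w Hw.
      split; [|now apply cor_circle_bound]. apply cont_cor_r.
      apply Re_cor with e; [apply Cmod_Re_lt; lra|exact Hw].
    - replace (Kq * (K3 * e ^ N * cp))%R with (k5 * e ^ N)%R by (unfold k5; ring).
      now apply Rmult_le_compat_l. }
  assert (H6 : (Cmod (Tcor e rN p q) <= k6 * x)%R).
  { eapply Rle_trans; [apply (B3 N _ (Kp * cq)%R)|].
    - intros z Hz. split; [now apply Ch|]. apply Bp. intros w Hw.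
      split; [|now apply cor_circle_bound]. apply cont_cor_r.
      apply Re_cor with e; [apply Cmod_Re_lt; lra|exact Hw].
    - replace (K3 * e ^ N * (Kp * cq))%R with (k6 * e ^ N)%R by (unfold k6; ring).
      now apply Rmult_le_compat_l. }
  unfold Treg, Tbdry.
  replace (Tinner e p q rN + (Ttube e p q rN + Ttube e q rN p + Ttube e rN p q + Tcor e p q rN
      + Tcor e q rN p + Tcor e rN p q) - Tcor e p q rN)
    with (Tinner e p q rN + Ttube e p q rN + Ttube e q rN p + Ttube e rN p q
      + Tcor e q rN p + Tcor e rN p q) by ring.
  repeat (eapply Rle_trans; [apply Cmod_triangle|];
    rewrite ?Rmult_plus_distr_r; apply Rplus_le_compat; [|assumption]).
  exact H1.
Qed.

(** The exact relation is [(a + N) mom N = N mom M] with [N = S M]. It restores the index lost when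
    [pow_diff_le] lowers the power by one. *)
Lemma mom_pred (M : nat) (a : R) : (0 < a)%R -> (mom M a 1 <= (1 + a) * mom (S M) a 1)%R.
Proof.
  intros Ha.
  assert (E : ((a + INR (S M)) * mom (S M) a 1 = INR (S M) * mom M a 1)%R).
  { apply RtoC_inj. rewrite !RtoC_mult, !mom_1_eq, RtoC_plus by exact Ha.
    change (poch (RtoC a) (S (S M))) with (poch (RtoC a) (S M) * (RtoC a + RtoC (INR (S M)))).
    rewrite fact_simpl, mult_INR, RtoC_mult.
    assert (Hp : nonpole (RtoC a)) by (apply Re_pos_nonpole; simpl; lra).
    assert (H1 := poch_neq_0 _ (S M) Hp). assert (H2 := nonpole_neq _ (S M) Hp).
    field. auto. }
  assert (H : (1 <= INR (S M))%R) by (apply (le_INR 1); lia).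
  assert (P := mom_nonneg (S M) a 1 Ha ltac:(lra)).
  set (x := INR (S M)) in *.
  apply Rmult_le_reg_l with x; [lra|]. rewrite <- E.
  replace (x * ((1 + a) * mom (S M) a 1))%R with ((x + x * a) * mom (S M) a 1)%R by ring.
  apply Rmult_le_compat_r; [exact P|]. nra.
Qed.

Lemma pow_diff_le (x b : R) (M : nat) :
  (0 <= x <= b)%R -> (b ^ S M - x ^ S M <= INR (S M) * (b - x) * b ^ M)%R.
Proof.
  intros H. induction M as [|M IH].
  - simpl. lra.
  - rewrite S_INR. assert (Hx : (0 <= x ^ S M <= b ^ S M)%R)
      by (split; [apply pow_le; lra|apply pow_incr; lra]).
    change (b ^ S (S M))%R with (b * b ^ S M)%R. change (x ^ S (S M))%R with (x * x ^ S M)%R.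
    replace (b * b ^ S M - x * x ^ S M)%R
      with (b * (b ^ S M - x ^ S M) + (b - x) * x ^ S M)%R by ring.
    assert (A : (b * (b ^ S M - x ^ S M) <= b * (INR (S M) * (b - x) * b ^ M))%R)
      by (apply Rmult_le_compat_l; lra).
    assert (B : ((b - x) * x ^ S M <= (b - x) * b ^ S M)%R)
      by (apply Rmult_le_compat_l; lra).
    replace ((INR (S M) + 1) * (b - x) * b ^ S M)%R
      with (b * (INR (S M) * (b - x) * b ^ M) + (b - x) * b ^ S M)%R by (simpl; ring).
    lra.
Qed.

(* On the corner, [1-y0-y1] differs from [(1-y0)(1-y1)] by [y0 y1] only, so that the
   integral decouples in the limit. *)
Lemma Tcor_main (e : R) (p q r : C) :
  (0 < e < 1 / 3)%R -> not_int p -> not_int q -> (0 < Re p)%R -> (0 < Re q)%R ->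
  exists c, (0 <= c)%R /\ forall M,
    (Cmod (Tcor e p q (r + 1 + RtoC (INR (S M)))
       - Rop e p (fun z => (1 - z) ^ S M)%C * Rop e q (fun z => (1 - z) ^ S M)%C)
     <= c * mom M (Re q + 1) 1 * mom M (Re p) 1
        + (c * mom M (Re q) 1 + INR (S M) * mom M (Re q + 1) 1) * mom M (Re p + 1) 1)%R.
Proof.
  intros He Hp Hq Rp Rq. destruct (cpow_near_1 r) as [c [Hc Bc]].
  exists c. split; [exact Hc|]. intros M. set (N := S M).
  set (P := Rop e q (fun z => (1 - z) ^ N)).
  set (rN := r + 1 + RtoC (INR N)).
  assert (Cpw : forall z, cont (fun w => (1 - w) ^ N) z) by (intros z; cont_tac).
  assert (Ch : forall a b z, Cmod z = e -> cont (hcor e a b) z).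
  { intros a' b' z Hz. apply cont_hcor; [lra|]. apply Cmod_Re_lt; lra. }
  assert (E1 : Tcor e p q rN - Rop e p (fun z => (1 - z) ^ N) * P =
    Rop e p (fun y0 => hcor e q rN y0 - P * (1 - y0) ^ N)).
  { rewrite Rop_minus, Rop_scal; try lra; auto.
    - unfold Tcor. ring.
    - intros z Hz. apply cont_mult; [apply cont_const|auto]. }
  rewrite E1.
  assert (Mp := mom_nonneg M (Re p) 1 Rp ltac:(lra)).
  assert (Mq := mom_nonneg M (Re q) 1 Rq ltac:(lra)).
  assert (Mp1 := mom_nonneg M (Re p + 1) 1 ltac:(lra) ltac:(lra)).
  assert (Mq1 := mom_nonneg M (Re q + 1) 1 ltac:(lra) ltac:(lra)).
  assert (HN : (0 <= INR N)%R) by apply pos_INR.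
  assert (D0 : (0 <= c * mom M (Re q + 1) 1)%R) by now apply Rmult_le_pos.
  assert (D1 : (0 <= c * mom M (Re q) 1 + INR N * mom M (Re q + 1) 1)%R)
    by (apply Rplus_le_le_0_compat; now apply Rmult_le_pos).
  refine (Rop_collapse_mom e (1 - e) p _
    (fun y0 => - (rN - 1) * hcor e q (rN - 1) y0 - P * (- (RtoC (INR N) * (1 - y0) ^ pred N)))
    _ _ M _ _ Hp Rp D0 D1 _ _); try lra.
  - intros z Hz.
    assert (Hr : (Re z < 1 - e)%R) by (assert (A := Re_le_Cmod z); assert (B := Rle_abs (Re z)); lra).
    split.
    + apply dq_minus; [apply holo_hcor; [lra|exact Hr]|]. apply dq_scal. apply holo_pow_1m.
    + assert (C1 := cont_hcor e q (rN - 1) z ltac:(lra) Hr). cont_tac; assumption.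
  - intros y0 Hy0.
    assert (Cc : forall z, (Cmod z < 1 - e)%R -> (0 < Re (1 - RtoC y0 - z))%R).
    { intros z Hz. assert (A := Re_le_Cmod z). assert (B := Rle_abs (Re z)).
      change (Re (1 - RtoC y0 - z)) with (1 - y0 - Re z)%R. lra. }
    assert (E2 : hcor e q rN (RtoC y0) - P * (1 - RtoC y0) ^ N =
      Rop e q (fun y1 => cpow (1 - RtoC y0 - y1) (rN - 1) - (1 - RtoC y0) ^ N * (1 - y1) ^ N)).
    { rewrite Rop_minus, Rop_scal; try lra; auto.
      - unfold hcor. fold P. ring.
      - intros z Hz. apply cont_cor_r. apply Cc. lra.
      - intros z Hz. apply cont_mult; [apply cont_const|auto]. }
    rewrite E2.
    set (b0 := ((1 - y0) ^ M)%R). assert (Hb0 : (0 <= b0)%R) by (apply pow_le; lra).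
    replace ((c * mom M (Re q + 1) 1 + (c * mom M (Re q) 1 + INR N * mom M (Re q + 1) 1) * y0) * b0)%R
      with ((c * y0 * b0) * mom M (Re q) 1 + ((c + INR N * y0) * b0) * mom M (Re q + 1) 1)%R by ring.
    assert (F0 : (0 <= c * y0 * b0)%R) by mult_pos_tac.
    assert (F1 : (0 <= (c + INR N * y0) * b0)%R).
    { apply Rmult_le_pos; [|exact Hb0]. assert (0 <= INR N * y0)%R by (apply Rmult_le_pos; lra). lra. }
    refine (Rop_collapse_mom e (1 - e) q _
      (fun y1 => - (rN - 1) * cpow (1 - RtoC y0 - y1) (rN - 1 - 1)
         - (1 - RtoC y0) ^ N * (- (RtoC (INR N) * (1 - y1) ^ pred N)))
      _ _ M _ _ Hq Rq F0 F1 _ _); try lra.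
    + intros z Hz. assert (Pz := Cc z Hz). split.
      * apply dq_minus; [now apply holo_cor_r|]. apply dq_scal. apply holo_pow_1m.
      * cont_tac; assumption.
    + intros y1 Hy1.
      replace (1 - RtoC y0 - RtoC y1) with (RtoC (1 - y0 - y1)) by (now rewrite !RtoC_minus).
      rewrite !RtoC_1m, <- !RtoC_pow, <- RtoC_mult.
      replace (rN - 1) with (r + RtoC (INR N)) by (unfold rN; ring).
      rewrite cpow_nat by (simpl; lra). rewrite <- RtoC_pow.
      set (x := (1 - y0 - y1)%R). set (b := ((1 - y0) * (1 - y1))%R).
      assert (Hxb : (b - x = y0 * y1)%R) by (unfold x, b; ring).
      assert (Hx : (1 / 3 <= x <= 1)%R) by (unfold x; lra).
      assert (Hyy : (0 <= y0 * y1)%R) by (apply Rmult_le_pos; lra).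
      assert (Hb : (0 <= b <= 1)%R) by (unfold b; nra).
      replace ((1 - y0) ^ N * (1 - y1) ^ N)%R with (b ^ N)%R by (unfold b; apply Rpow_mult_distr).
      (* Two errors are separated: [x^r - 1] is [O(y0 + y1)], and [b^N - x^N <= N y0 y1 b^M] as
         [b - x = y0 y1]. The power of [b] factors into [(1-y0)^M (1-y1)^M], so each bound is affine
         in [y1] and, after the inner collapse, affine in [y0]. *)
      replace (cpow (RtoC x) r * RtoC (x ^ N) - RtoC (b ^ N))
        with ((cpow (RtoC x) r - 1) * RtoC (x ^ N) - RtoC (b ^ N - x ^ N))
        by (rewrite RtoC_minus; ring).
      eapply Rle_trans; [apply Cmod_minus_le|].
      assert (HxN : (0 <= x ^ N <= b ^ N)%R) by (split; [apply pow_le; lra|apply pow_incr; lra]).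
      assert (HbN : (b ^ N <= b ^ M)%R).
      { unfold N. simpl. rewrite <- (Rmult_1_l (b ^ M)) at 2.
        apply Rmult_le_compat_r; [apply pow_le; lra|lra]. }
      rewrite Cmod_mult, !Cmod_RtoC_nonneg by lra.
      assert (A1 : (Cmod (cpow (RtoC x) r - 1) * x ^ N <= c * (y0 + y1) * b ^ M)%R).
      { apply Rmult_le_compat; [apply Cmod_ge_0|lra| |lra].
        eapply Rle_trans; [apply (Bc x Hx)|]. right. unfold x. ring. }
      assert (A2 := pow_diff_le x b M ltac:(lra)). fold N in A2. rewrite Hxb in A2.
      assert (Ebb : (b ^ M = b0 * (1 - y1) ^ M)%R) by (unfold b, b0; apply Rpow_mult_distr).
      rewrite Ebb in A1, A2.
      replace ((c * y0 * b0 + (c + INR N * y0) * b0 * y1) * (1 - y1) ^ M)%R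
        with (c * (y0 + y1) * (b0 * (1 - y1) ^ M) + INR N * (y0 * y1) * (b0 * (1 - y1) ^ M))%R by ring.
      lra.
Qed.

Lemma exp_mul_ln (a : R) (N : nat) : (1 <= N)%nat ->
  exp (- ((a + 1) * ln (INR N))) = (exp (- (a * ln (INR N))) * / INR N)%R.
Proof.
  intros HN. assert (1 <= INR N)%R by (apply (le_INR 1); lia).
  replace (- ((a + 1) * ln (INR N)))%R with (- (a * ln (INR N)) + - ln (INR N))%R by ring.
  rewrite exp_plus, (exp_Ropp (ln (INR N))), exp_ln by lra. reflexivity.
Qed.

Lemma Clim_scaled (p : C) (u : nat -> C) (K : R) :
  (exists N0, forall N, (N0 <= N)%nat -> (Cmod (u N) <= K * (exp (- (Re p * ln (INR N))) * / INR N))%R) ->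
  Clim (fun N => Cexp (p * RtoC (ln (INR N))) * u N) 0.
Proof.
  intros [N0 H]. apply Clim_le with (fun N => K * / INR N)%R.
  - exists (S N0). intros N HN. specialize (H N ltac:(lia)).
    assert (E0 : forall z : C, z - 0 = z) by (intros; ring). rewrite E0.
    rewrite Cmod_mult, Cmod_Cexp.
    replace (Re (p * RtoC (ln (INR N)))) with (Re p * ln (INR N))%R by (simpl; unfold Re; ring).
    set (E := exp (Re p * ln (INR N))). assert (HE : (0 < E)%R) by apply exp_pos.
    rewrite exp_Ropp in H. fold E in H.
    apply Rle_trans with (E * (K * (/ E * / INR N)))%R; [apply Rmult_le_compat_l; lra|].
    right. replace (E * (K * (/ E * / INR N)))%R with (K * (E * / E) * / INR N)%R by ring.
    rewrite Rinv_r by lra. ring.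
  - replace (Finite 0) with (Rbar_mult K 0%R) by (simpl; now rewrite Rmult_0_r).
    apply is_lim_seq_scal_l. apply is_lim_seq_inv_INR.
Qed.

Lemma geom_bound (e a : R) :
  (0 < e < 1)%R -> (0 < a)%R -> exists K N0, (0 < K)%R /\ forall N, (N0 <= N)%nat ->
    ((1 - e) ^ N <= K * (exp (- (a * ln (INR N))) * / INR N))%R.
Proof.
  intros He Ha. destruct (mom_1_bound (a + 1) ltac:(lra)) as [K [N0 [HK [HN0 B]]]].
  set (g := ((a + 1) / Rpower e (a + 1))%R).
  assert (Hg : (0 < g)%R) by (apply Rdiv_lt_0_compat; [lra|apply Rpower_pos]).
  exists (g * K)%R, N0. split; [now apply Rmult_lt_0_compat|]. intros N HN.
  rewrite <- exp_mul_ln by lia. rewrite Rmult_assoc.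
  eapply Rle_trans; [apply (geom_le_mom N (a + 1) e); lra|]. fold g.
  apply Rmult_le_compat_l; [lra|]. now apply B.
Qed.

Lemma Rop_pow_Clim (e : R) (p : C) :
  (0 < e < 1)%R -> not_int p -> (0 < Re p)%R ->
  Clim (fun N => Cexp (p * RtoC (ln (INR N))) * Rop e p (fun z => (1 - z) ^ N)) (CGamma p).
Proof.
  intros He Hp Rp.
  destruct (Jint_bound e p He) as [K [HK B]].
  destruct (geom_bound e (Re p) He Rp) as [K' [N0 [HK' B']]].
  assert (A : Clim (fun N => Cexp (p * RtoC (ln (INR N))) * (- Jint e p N)) 0).
  { apply Clim_scaled with (K := (K * K')%R). exists N0. intros N HN.
    rewrite Cmod_opp. eapply Rle_trans; [apply B|]. rewrite Rmult_assoc.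
    apply Rmult_le_compat_l; [exact HK|]. now apply B'. }
  apply Clim_ext with (fun N => Cexp (p * RtoC (ln (INR N))) * (- Jint e p N) + gam N p).
  - intros N. unfold gam.
    transitivity (Cexp (p * RtoC (ln (INR N))) * (RtoC (INR (fact N)) / poch p (S N) - Jint e p N)).
    + unfold Cdiv. ring.
    + rewrite <- (Rop_pow_closed e p N He Hp). ring.
  - apply (Clim_eq _ (0 + CGamma p)); [ring|].
    apply Clim_plus; [exact A|]. apply CGamma_Clim. now apply not_int_nonpole.
Qed.

(** The corner is compared with the product of two circle integrals in one variable. These converge
    separately by [Rop_pow_Clim], and every error is smaller by a factor [1/N] than the product. *)
Lemma Treg_Clim (e : R) (p q r : C) :
  (0 < e < 1 / 3)%R -> not_int p -> not_int q -> not_int r -> (0 < Re p)%R -> (0 < Re q)%R ->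
  Clim (fun N => Cexp ((p + q) * RtoC (ln (INR N))) * Treg e p q (r + 1 + RtoC (INR N)))
    (CGamma p * CGamma q).
Proof.
  intros He Hp Hq Hr Rp Rq.
  destruct (Treg_minus_corner e p q (r + 1) He Hp Hq (not_int_plus_1 _ Hr) Rp Rq) as [K1 [HK1 B1]].
  destruct (Tcor_main e p q r He Hp Hq Rp Rq) as [c [Hc B2]].
  set (a := Re p) in *. set (b := Re q) in *.
  destruct (geom_bound e (a + b) ltac:(lra) ltac:(lra)) as [K2 [N2 [HK2 B3]]].
  destruct (mom_1_bound a Rp) as [Ka [Na [HKa [HNa Ba]]]].
  destruct (mom_1_bound b Rq) as [Kb [Nb [HKb [HNb Bb]]]].
  destruct (mom_1_bound (a + 1) ltac:(lra)) as [Ka1 [Na1 [HKa1 [HNa1 Ba1]]]].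
  destruct (mom_1_bound (b + 1) ltac:(lra)) as [Kb1 [Nb1 [HKb1 [HNb1 Bb1]]]].
  set (P := fun N : nat => Rop e p (fun z => (1 - z) ^ N)).
  set (Q := fun N : nat => Rop e q (fun z => (1 - z) ^ N)).
  set (D := ((1 + a) * Ka)%R). set (E := ((1 + b) * Kb)%R).
  set (D1 := ((1 + (a + 1)) * Ka1)%R). set (E1 := ((1 + (b + 1)) * Kb1)%R).
  assert (HD : (0 < D)%R) by (unfold D; nra). assert (HE : (0 < E)%R) by (unfold E; nra).
  assert (HD1 : (0 < D1)%R) by (unfold D1; nra). assert (HE1 : (0 < E1)%R) by (unfold E1; nra).
  assert (A : Clim (fun N => Cexp ((p + q) * RtoC (ln (INR N))) *
    (Treg e p q (r + 1 + RtoC (INR N)) - P N * Q N)) 0).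
  { apply Clim_scaled with (K := (K1 * K2 + (c * E1 * D + (c * E + E1) * D1))%R).
    exists (N2 + Na + Nb + Na1 + Nb1)%nat. intros N HN.
    replace (Treg e p q (r + 1 + RtoC (INR N)) - P N * Q N) with
      ((Treg e p q (r + 1 + RtoC (INR N)) - Tcor e p q (r + 1 + RtoC (INR N)))
       + (Tcor e p q (r + 1 + RtoC (INR N)) - P N * Q N)) by ring.
    eapply Rle_trans; [apply Cmod_triangle|]. rewrite Rmult_plus_distr_r.
    change (Re (p + q)) with (a + b)%R.
    apply Rplus_le_compat.
    - eapply Rle_trans; [apply B1|]. rewrite Rmult_assoc.
      apply Rmult_le_compat_l; [exact HK1|]. apply B3. lia.
    - specialize (Ba N ltac:(lia)). specialize (Bb N ltac:(lia)).
      specialize (Ba1 N ltac:(lia)). specialize (Bb1 N ltac:(lia)).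
      rewrite exp_mul_ln in Ba1, Bb1 by lia.
      destruct N as [|M]; [lia|].
      eapply Rle_trans; [apply (B2 M)|].
      assert (HS : (1 <= INR (S M))%R) by (apply (le_INR 1); lia).
      assert (Ma := mom_pred M a Rp). assert (Mb := mom_pred M b Rq).
      assert (Ma1 := mom_pred M (a + 1) ltac:(lra)). assert (Mb1 := mom_pred M (b + 1) ltac:(lra)).
      assert (Pa := mom_nonneg M a 1 Rp ltac:(lra)). assert (Pb := mom_nonneg M b 1 Rq ltac:(lra)).
      assert (Pa1 := mom_nonneg M (a + 1) 1 ltac:(lra) ltac:(lra)).
      assert (Pb1 := mom_nonneg M (b + 1) 1 ltac:(lra) ltac:(lra)).
      set (x := exp (- (a * ln (INR (S M))))) in *. set (y := exp (- (b * ln (INR (S M))))) in *.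
      replace (- ((a + b) * ln (INR (S M))))%R with (- (a * ln (INR (S M))) + - (b * ln (INR (S M))))%R by ring.
      rewrite exp_plus. fold x y.
      assert (Hx : (0 < x)%R) by apply exp_pos. assert (Hy : (0 < y)%R) by apply exp_pos.
      set (n := INR (S M)) in *. set (i := (/ n)%R) in *.
      assert (Hi : (0 < i)%R) by (apply Rinv_0_lt_compat; lra).
      assert (Hni : (n * i = 1)%R) by (apply Rinv_r; lra).
      assert (Qa : (mom M a 1 <= D * x)%R).
      { unfold D. eapply Rle_trans; [exact Ma|]. rewrite Rmult_assoc. apply Rmult_le_compat_l; lra. }
      assert (Qb : (mom M b 1 <= E * y)%R).
      { unfold E. eapply Rle_trans; [exact Mb|]. rewrite Rmult_assoc. apply Rmult_le_compat_l; lra. }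
      assert (Qa1 : (mom M (a + 1) 1 <= D1 * (x * i))%R).
      { unfold D1. eapply Rle_trans; [exact Ma1|]. rewrite Rmult_assoc. apply Rmult_le_compat_l; lra. }
      assert (Qb1 : (mom M (b + 1) 1 <= E1 * (y * i))%R).
      { unfold E1. eapply Rle_trans; [exact Mb1|]. rewrite Rmult_assoc. apply Rmult_le_compat_l; lra. }
      apply Rle_trans with (c * (E1 * (y * i)) * (D * x) + (c * (E * y) + n * (E1 * (y * i))) * (D1 * (x * i)))%R.
      + apply Rplus_le_compat.
        * apply Rmult_le_compat; [mult_pos_tac|lra| |lra]. apply Rmult_le_compat_l; lra.
        * assert (Z1 : (0 <= c * mom M b 1)%R) by mult_pos_tac.
          assert (Z2 : (0 <= n * mom M (b + 1) 1)%R) by (apply Rmult_le_pos; lra).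
          apply Rmult_le_compat; [lra|lra| |lra].
          apply Rplus_le_compat; apply Rmult_le_compat_l; lra.
      (* The term with the explicit factor [n] has two moments with raised exponent, hence
         [i^2 = 1 / n^2]; one of these factors absorbs [n] and the other is the required decay. *)
      + right. replace (n * (E1 * (y * i)))%R with (E1 * y * (n * i))%R by ring. rewrite Hni. ring. }
  apply Clim_ext with (fun N => Cexp ((p + q) * RtoC (ln (INR N))) *
    (Treg e p q (r + 1 + RtoC (INR N)) - P N * Q N)
    + (Cexp (p * RtoC (ln (INR N))) * P N) * (Cexp (q * RtoC (ln (INR N))) * Q N)).
  - intros N. rewrite Cmult_plus_distr_r, Cexp_plus. ring.
  - apply (Clim_eq _ (0 + CGamma p * CGamma q)); [ring|]. apply Clim_plus; [exact A|].
    exact (Clim_mult _ _ _ _ (Rop_pow_Clim e p ltac:(lra) Hp Rp) (Rop_pow_Clim e q ltac:(lra) Hq Rq)).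
Qed.

Lemma Treg_nat_3 (e : R) (p q r : C) (N : nat) :
  (0 < e < 1 / 3)%R -> not_int p -> not_int q -> not_int r ->
  poch (p + q + r) N * Treg e p q (r + RtoC (INR N)) = poch r N * Treg e p q r.
Proof.
  intros He Hp Hq Hr. induction N as [|N IH].
  - simpl. rewrite Cplus_0_r. ring.
  - rewrite S_INR, RtoC_plus. simpl poch. rewrite (Cplus_assoc r).
    set (r' := r + RtoC (INR N)) in *.
    assert (A := Treg_S_3 e p q r' He Hp Hq (not_int_plus_nat _ N Hr)).
    transitivity (poch (p + q + r) N * ((p + q + r') * Treg e p q (r' + 1))); [unfold r'; ring|].
    rewrite A. transitivity (r' * (poch (p + q + r) N * Treg e p q r')); [ring|].
    rewrite IH. ring.
Qed.

Lemma Dirichlet_Re_pos (e : R) (p q r : C) :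
  (0 < e < 1 / 3)%R -> not_int p -> not_int q -> not_int r -> nonpole (p + q + r) ->
  (0 < Re p)%R -> (0 < Re q)%R ->
  Treg e p q r = CGamma p * CGamma q * CGamma r / CGamma (p + q + r).
Proof.
  intros He Hp Hq Hr Hs Rp Rq.
  apply (Clim_unique (fun _ => Treg e p q r)); [apply Clim_const|].
  apply Clim_ext_loc with (fun N => (Cexp ((p + q) * RtoC (ln (INR N))) * Treg e p q (r + 1 + RtoC (INR N)))
    * gam N r / gam N (p + q + r)).
  - exists 1%nat. intros N HN.
    assert (A := Treg_nat_3 e p q r (S N) He Hp Hq Hr).
    rewrite S_INR, RtoC_plus in A.
    replace (r + (RtoC (INR N) + 1)) with (r + 1 + RtoC (INR N)) in A by ring.
    assert (P1 := poch_neq_0 _ (S N) Hs).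
    assert (P2 := poch_neq_0 r (S N) (not_int_nonpole _ Hr)).
    assert (P3 := RtoC_INR_neq_0 (fact N) (lt_O_fact N)).
    unfold gam. rewrite (Cmult_plus_distr_r (p + q) r), (Cexp_plus ((p + q) * _)).
    set (X := Treg e p q (r + 1 + RtoC (INR N))) in *.
    set (E1 := Cexp ((p + q) * RtoC (ln (INR N)))) in *. set (E2 := Cexp (r * RtoC (ln (INR N)))) in *.
    set (Q := poch r (S N)) in *. set (PQ := poch (p + q + r) (S N)) in *.
    assert (H1 : E1 <> 0) by apply Cexp_neq_0. assert (H2 : E2 <> 0) by apply Cexp_neq_0.
    transitivity (PQ * X / Q); [field; auto|]. rewrite A. field. exact P2.
  - apply Clim_div; [now apply CGamma_neq_0| |now apply CGamma_Clim].
    apply Clim_mult; [now apply Treg_Clim|]. apply CGamma_Clim. now apply not_int_nonpole.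
Qed.

(** Only [p] and [q] have to be moved into the right half-plane, since [r] is the exponent sent to
    infinity. They are raised together, one step each, by the recurrences common to both sides. *)
Lemma Dirichlet_CGamma (e : R) (p q r : C) :
  (0 < e < 1 / 3)%R -> not_int p -> not_int q -> not_int r -> nonpole (p + q + r) ->
  Treg e p q r = CGamma p * CGamma q * CGamma r / CGamma (p + q + r).
Proof.
  intros He Hp Hq Hr Hs.
  destruct (nfloor_ex (Rabs (Re p) + Rabs (Re q) + 1)) as [n [_ Hn]].
  { generalize (Rabs_pos (Re p)) (Rabs_pos (Re q)); lra. }
  assert (Ap := Rle_abs (- Re p)). assert (Aq := Rle_abs (- Re q)). rewrite Rabs_Ropp in Ap, Aq.
  assert (Bp := Rabs_pos (Re p)). assert (Bq := Rabs_pos (Re q)).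
  assert (Hp' : (0 < Re p + INR (S n))%R) by (rewrite S_INR; lra).
  assert (Hq' : (0 < Re q + INR (S n))%R) by (rewrite S_INR; lra).
  clear Hn Ap Aq Bp Bq. revert p q Hp Hq Hs Hp' Hq'.
  induction (S n) as [|k IH]; intros p q Hp Hq Hs Hp' Hq'.
  - simpl in Hp', Hq'. apply Dirichlet_Re_pos; auto; lra.
  - assert (Hp0 := not_int_neq_0 _ Hp). assert (Hq0 := not_int_neq_0 _ Hq).
    assert (Hs1 := nonpole_plus_1 _ Hs). assert (Hs2 := nonpole_plus_1 _ Hs1).
    assert (H0 := nonpole_neq _ 0 Hs). assert (H1 := nonpole_neq _ 0 Hs1).
    simpl INR in H0, H1. rewrite Cplus_0_r in H0, H1.
    assert (Hpp := not_int_plus_1 _ Hp). assert (Hqq := not_int_plus_1 _ Hq).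
    assert (A1 := Treg_S_1 e p q r He Hp Hq Hr).
    assert (A2 := Treg_S_2 e (p + 1) q r He Hpp Hq Hr).
    set (s := p + q + r) in *.
    replace (p + 1 + q + r) with (s + 1) in A2 by (unfold s; ring).
    assert (B := IH (p + 1) (q + 1) Hpp Hqq).
    replace (p + 1 + (q + 1) + r) with (s + 1 + 1) in B by (unfold s; ring).
    rewrite S_INR in Hp', Hq'.
    specialize (B Hs2 ltac:(change (Re (p + 1)) with (Re p + 1)%R; lra)
      ltac:(change (Re (q + 1)) with (Re q + 1)%R; lra)).
    rewrite !CGamma_plus_1 in B by (auto; now apply not_int_nonpole).
    rewrite B in A2. assert (G := CGamma_neq_0 _ Hs).
    transitivity (s * (q * Treg e (p + 1) q r / q) / p).
    + transitivity (s * Treg e (p + 1) q r / p); [rewrite A1; field; exact Hp0|field; auto].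
    + rewrite <- A2. field. auto.
Qed.

(** * The binomial series *)

(** The sum of the first [N] terms, so that it starts from the empty sum; [sum_n] includes the index
    [N], whence the shift by one in [psum_CSeries]. *)
Fixpoint psum (u : nat -> C) (N : nat) : C :=
  match N with
  | O => 0
  | S M => psum u M + u M
  end.

Lemma psum_ext (u v : nat -> C) (N : nat) :
  (forall n, u n = v n) -> psum u N = psum v N.
Proof. intros H. induction N as [|N IH]; simpl; [reflexivity|]. now rewrite IH, H. Qed.

Lemma psum_scal (c : C) (u : nat -> C) (N : nat) : psum (fun n => c * u n) N = c * psum u N.
Proof. induction N as [|N IH]; simpl; [ring|]. rewrite IH. ring. Qed.

Lemma psum_CSeries (u : nat -> C) (l : C) : Clim (psum u) l -> CSeries u = l.
Proof.
  intros H. unfold CSeries. rewrite (C_pair l).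
  assert (Hr := Clim_Re _ _ H). assert (Hi := Clim_Im _ _ H).
  apply is_lim_seq_incr_1 in Hr. apply is_lim_seq_incr_1 in Hi.
  f_equal; apply is_series_unique.
  - apply is_lim_seq_ext with (2 := Hr). intros n. induction n as [|n IH].
    + rewrite sum_O. change (0 + Re (u 0%nat) = Re (u 0%nat))%R. ring.
    + rewrite sum_Sn, <- IH. reflexivity.
  - apply is_lim_seq_ext with (2 := Hi). intros n. induction n as [|n IH].
    + rewrite sum_O. change (0 + Im (u 0%nat) = Im (u 0%nat))%R. ring.
    + rewrite sum_Sn, <- IH. reflexivity.
Qed.

(* The coefficient of [X^n] in [(1-X)^k]. *)
Definition bin (k : C) (n : nat) : C := poch (- k) n / RtoC (INR (fact n)).

Lemma bin_S (k : C) (n : nat) : RtoC (INR (S n)) * bin k (S n) = (RtoC (INR n) - k) * bin k n.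
Proof.
  unfold bin. rewrite fact_simpl, mult_INR, RtoC_mult. simpl poch.
  assert (H1 := RtoC_INR_neq_0 (S n) ltac:(lia)).
  assert (H2 := RtoC_INR_neq_0 (fact n) (lt_O_fact n)).
  field. auto.
Qed.

(** The coefficient of [X^n] in [(1 - X)^(-K)]. With [K = |k| + 1], positive in all cases, it
    majorizes the coefficients of [(1 - X)^k]. *)
Fixpoint bmaj (K : R) (n : nat) : R :=
  match n with
  | O => 1%R
  | S m => (bmaj K m * ((K + INR m) / INR n))%R
  end.

Lemma bmaj_pos (K : R) (n : nat) : (0 < K)%R -> (0 < bmaj K n)%R.
Proof.
  intros HK. induction n as [|n IH]; [simpl; lra|]. cbn [bmaj].
  assert (0 < INR (S n))%R by (apply lt_0_INR; lia).
  apply Rmult_lt_0_compat; [exact IH|]. apply Rdiv_lt_0_compat; [|assumption].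
  generalize (pos_INR n). lra.
Qed.

Lemma bin_le_bmaj (k : C) (n : nat) : (Cmod (bin k n) <= bmaj (Cmod k + 1) n)%R.
Proof.
  assert (Hk := Cmod_ge_0 k).
  induction n as [|n IH].
  - unfold bin. simpl. replace (1 / 1) with (RtoC 1) by (field). rewrite Cmod_1. lra.
  - assert (HS : (0 < INR (S n))%R) by (apply lt_0_INR; lia).
    assert (E := f_equal Cmod (bin_S k n)). rewrite !Cmod_mult, Cmod_RtoC_nonneg in E by lra.
    apply Rmult_le_reg_l with (INR (S n)); [exact HS|]. rewrite E. cbn [bmaj].
    replace (INR (S n) * (bmaj (Cmod k + 1) n * ((Cmod k + 1 + INR n) / INR (S n))))%R
      with ((Cmod k + 1 + INR n) * bmaj (Cmod k + 1) n)%R by (field; lra).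
    apply Rmult_le_compat; auto using Cmod_ge_0.
    eapply Rle_trans; [apply Cmod_minus_le|]. rewrite Cmod_RtoC_nonneg by apply pos_INR. lra.
Qed.

(** Coefficientwise form of [d/dX (1 - X)^(-K) = K (1 - X)^(-K-1)]. *)
Lemma bmaj_shift (K : R) (n : nat) :
  (INR (S n) * bmaj K (S n) = K * bmaj (K + 1) n)%R.
Proof.
  induction n as [|n IH].
  - simpl. field.
  - assert (H1 : (0 < INR (S n))%R) by (apply lt_0_INR; lia).
    assert (H2 : (0 < INR (S (S n)))%R) by (apply lt_0_INR; lia).
    change (bmaj K (S (S n))) with (bmaj K (S n) * ((K + INR (S n)) / INR (S (S n))))%R.
    change (bmaj (K + 1) (S n)) with (bmaj (K + 1) n * ((K + 1 + INR n) / INR (S n)))%R.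
    replace (K + 1 + INR n)%R with (K + INR (S n))%R by (rewrite S_INR; ring).
    transitivity ((INR (S n) * bmaj K (S n)) * ((K + INR (S n)) / INR (S n)))%R; [field; lra|].
    rewrite IH. field. lra.
Qed.

Lemma bmaj_lim (K rho : R) :
  (0 < K)%R -> (0 < rho < 1)%R -> is_lim_seq (fun n => bmaj K n * rho ^ n)%R 0%R.
Proof.
  intros HK Hr.
  assert (P : forall n, (0 < bmaj K n * rho ^ n)%R).
  { intros n. apply Rmult_lt_0_compat; [now apply bmaj_pos|apply pow_lt; lra]. }
  apply ex_series_lim_0. 
  apply ex_series_ext with (fun n => Rabs (bmaj K n * rho ^ n)).
  { intros n. apply Rabs_pos_eq. left. apply P. }
  apply (ex_series_DAlembert _ rho); [lra| |].
  - intros n. apply Rgt_not_eq. apply P.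
  - apply is_lim_seq_ext with (fun n => rho * (1 + (K - 1) * / INR (S n)))%R.
    + intros n. assert (HS : (0 < INR (S n))%R) by (apply lt_0_INR; lia).
      assert (B := bmaj_pos K n HK). assert (Q : (0 < rho ^ n)%R) by (apply pow_lt; lra).
      rewrite Rabs_pos_eq by (left; apply Rdiv_lt_0_compat; apply P).
      cbn [bmaj pow]. rewrite S_INR in *. field. repeat split; lra.
    + replace (Finite rho) with (Finite (rho * (1 + (K - 1) * 0))) by (f_equal; ring).
      apply is_lim_seq_mult'; [apply is_lim_seq_const|].
      apply is_lim_seq_plus'; [apply is_lim_seq_const|].
      apply is_lim_seq_mult'; [apply is_lim_seq_const|].
      apply -> (is_lim_seq_incr_1 (fun n => / INR n)%R). apply is_lim_seq_inv_INR.
Qed.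

Definition bsum (k : C) (N : nat) (X : C) : C := psum (fun n => bin k n * X ^ n) N.

Definition dbsum (k : C) (N : nat) (X : C) : C :=
  psum (fun n => bin k n * (RtoC (INR n) * X ^ pred n)) N.

Lemma holo_bsum (k : C) (N : nat) (X : C) : holo (bsum k N) X (dbsum k N X).
Proof.
  unfold bsum, dbsum. induction N as [|N IH]; simpl.
  - apply dq_const.
  - apply dq_plus; [exact IH|]. apply dq_scal.
    eapply dq_eq; [apply (dq_pow (X := C_UniformSpace) _ (fun w => w)); [apply cont_C_id|apply dq_id]|ring].
Qed.

(** [(1 - X)^k] solves [(1 - X) f' + k f = 0]. By the recursion [bin_S] all terms of the partial sum
    telescope in this equation except the last one. *)
Lemma bsum_ode (k : C) (N : nat) (X : C) :
  (1 - X) * dbsum k N X + k * bsum k N X = - (RtoC (INR N) * bin k N * X ^ pred N).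
Proof.
  induction N as [|N IH].
  - unfold dbsum, bsum. simpl. ring.
  - change (dbsum k (S N) X) with (dbsum k N X + bin k N * (RtoC (INR N) * X ^ pred N)).
    change (bsum k (S N) X) with (bsum k N X + bin k N * X ^ N).
    transitivity (((1 - X) * dbsum k N X + k * bsum k N X)
      + (1 - X) * (bin k N * (RtoC (INR N) * X ^ pred N)) + k * (bin k N * X ^ N)); [ring|].
    rewrite IH, bin_S. simpl (pred (S N)).
    assert (E : RtoC (INR N) * (X * X ^ pred N) = RtoC (INR N) * X ^ N).
    { destruct N as [|N]; [simpl; ring|reflexivity]. }
    transitivity (- bin k N * (RtoC (INR N) * (X * X ^ pred N)) + k * (bin k N * X ^ N)); [ring|].
    rewrite E. ring.
Qed.

Lemma bsum_0 (k : C) (N : nat) : bsum k (S N) 0 = 1.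
Proof.
  unfold bsum. induction N as [|N IH].
  - unfold bin. simpl. field.
  - change (psum (fun n => bin k n * 0 ^ n) (S (S N)))
      with (psum (fun n => bin k n * 0 ^ n) (S N) + bin k (S N) * 0 ^ S N).
    rewrite IH. simpl. ring.
Qed.

Lemma Cmod_lt_1_bounds (rho : R) (X : C) :
  (Cmod X <= rho)%R -> (rho < 1)%R -> (1 - rho <= Re (1 - X))%R /\ (Cmod (1 - X) <= 2)%R.
Proof.
  intros H Hr. assert (A := Re_le_Cmod X). assert (B := Rle_abs (Re X)). split.
  - change (Re (1 - X)) with (1 - Re X)%R. lra.
  - eapply Rle_trans; [apply Cmod_minus_le|]. rewrite Cmod_1. lra.
Qed.

(* [(1-X)^(-k)] times the partial sum has derivative
   [- N bin_N X^(N-1) (1-X)^(-k-1)], which is uniformly small. *)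
Lemma bsum_uniform (k : C) (rho : R) :
  (0 < rho < 1)%R -> exists tau : nat -> R, is_lim_seq tau 0%R /\
    forall (N : nat) (X : C), (Cmod X <= rho)%R ->
      (Cmod (bsum k (S N) X - cpow (1 - X) k) <= tau N)%R.
Proof.
  intros Hr.
  set (K := (Cmod k + 1)%R). assert (HK : (0 < K)%R) by (unfold K; generalize (Cmod_ge_0 k); lra).
  set (m1 := cpow_max (1 - rho) k). set (m2 := cpow_max (1 - rho) (- k - 1)).
  assert (Hm1 : (0 < m1)%R) by apply cpow_max_pos. assert (Hm2 : (0 < m2)%R) by apply cpow_max_pos.
  exists (fun N => (m1 * m2 * K) * (bmaj (K + 1) N * rho ^ N))%R. split.
  { replace (Finite 0) with (Rbar_mult (m1 * m2 * K)%R 0%R) by (simpl; now rewrite Rmult_0_r).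
    apply is_lim_seq_scal_l. apply bmaj_lim; lra. }
  intros N X HX. set (M := S N).
  set (h := fun z => bsum k M z * cpow (1 - z) (- k)).
  set (dh := fun z => - (RtoC (INR M) * bin k M * z ^ N) * cpow (1 - z) (- k - 1)).
  assert (Hz : forall s, (0 <= s <= 1)%R -> (Cmod (0 + RtoC s * (X - 0))%C <= rho)%R).
  { intros s Hs. replace (0 + RtoC s * (X - 0))%C with (RtoC s * X)%C by ring.
    rewrite Cmod_mult, Cmod_RtoC_nonneg by lra. generalize (Cmod_ge_0 X). nra. }
  assert (B : (Cmod (h X - h 0 - (X - 0) * 0) <= m2 * (INR M * bmaj K M * rho ^ N) * Cmod (X - 0))%R).
  { apply (holo_mean_value h dh). intros s Hs. specialize (Hz s Hs).
    set (z := (0 + RtoC s * (X - 0))%C) in *.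
    destruct (Cmod_lt_1_bounds rho z Hz ltac:(lra)) as [Z1 Z2].
    repeat split.
    - eapply dq_eq.
      + apply (dq_mult (X := C_UniformSpace) _ (bsum k M) (fun z => cpow (1 - z) (- k)));
          [apply cont_C_id|apply holo_bsum|]. apply holo_cpow_1m. lra.
      + unfold dh. assert (O := bsum_ode k M z). simpl pred in O. rewrite <- O.
        replace (cpow (1 - z) (- k)) with ((1 - z) * cpow (1 - z) (- k - 1)).
        * ring.
        * rewrite <- cpow_pred by lra. reflexivity.
    - unfold dh. cont_tac. lra.
    - unfold dh. match goal with |- (Cmod ?a <= _)%R =>
        replace a with (- (RtoC (INR M) * bin k M * z ^ N) * cpow (1 - z) (- k - 1)) by ring end.
      rewrite Cmod_mult, Cmod_opp, !Cmod_mult, Cmod_pow, Cmod_RtoC_nonneg by apply pos_INR.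
      rewrite Rmult_comm. apply Rmult_le_compat.
      + apply Cmod_ge_0.
      + apply Rmult_le_pos; [apply Rmult_le_pos; [apply pos_INR|apply Cmod_ge_0]|].
        apply pow_le, Cmod_ge_0.
      + apply cpow_bound; lra.
      + apply Rmult3_le; split; try apply pos_INR; try apply Cmod_ge_0; try lra.
        * apply bin_le_bmaj.
        * apply pow_le, Cmod_ge_0.
        * apply pow_incr. split; [apply Cmod_ge_0|exact Hz]. }
  assert (H0 : h 0 = 1).
  { unfold h, M. rewrite bsum_0. replace (1 - 0) with (RtoC 1) by ring. rewrite cpow_one. ring. }
  destruct (Cmod_lt_1_bounds rho X HX ltac:(lra)) as [Z1 Z2].
  assert (E : bsum k M X - cpow (1 - X) k = cpow (1 - X) k * (h X - h 0 - (X - 0) * 0)).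
  { rewrite H0. unfold h.
    replace (cpow (1 - X) k * (bsum k M X * cpow (1 - X) (- k) - 1 - (X - 0) * 0))
      with (bsum k M X * (cpow (1 - X) k * cpow (1 - X) (- k)) - cpow (1 - X) k) by ring.
    rewrite <- cpow_plus. replace (k + - k) with (RtoC 0) by ring. rewrite cpow_0. ring. }
  rewrite E, Cmod_mult.
  assert (S1 := bmaj_shift K N). fold M in S1. rewrite S1 in B.
  assert (Q : (0 <= K * bmaj (K + 1) N * rho ^ N)%R).
  { assert (A := bmaj_pos (K + 1) N ltac:(lra)). apply Rmult_le_pos; [nra|apply pow_le; lra]. }
  replace (m1 * m2 * K * (bmaj (K + 1) N * rho ^ N))%R
    with (m1 * (m2 * (K * bmaj (K + 1) N * rho ^ N) * 1))%R by ring.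
  apply Rmult_le_compat; try apply Cmod_ge_0; [apply cpow_bound; lra|].
  eapply Rle_trans; [exact B|].
  apply Rmult_le_compat_l; [apply Rmult_le_pos; lra|].
  replace (X - 0) with X by ring. lra.
Qed.

(** * Iterated integrals over the cube *)

Definition uconv {A : Type} (dom : A -> Prop) (F : nat -> A -> C) (G : A -> C) : Prop :=
  forall e : R, (0 < e)%R -> exists N, forall n, (N <= n)%nat -> forall a, dom a ->
    (Cmod (F n a - G a) <= e)%R.

Lemma exI_uniform_limit (f : nat -> R -> C) (g : R -> C) :
  uconv unit_itv f g -> (forall n, exI (f n) 0 1) -> exI g 0 1.
Proof.
  intros H Hf.
  (* [filterlim_RInt] asks for uniform convergence on the whole line, so the functions are set to 0
     outside of [[0, 1]]. *)
  set (cut := fun (h : R -> C) (t : R) =>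
    if excluded_middle_informative (unit_itv t) then h t else RtoC 0).
  assert (Hcut : forall h t, (0 <= t <= 1)%R -> cut h t = h t).
  { intros h t Ht. unfold cut.
    destruct (excluded_middle_informative (unit_itv t)) as [_|N]; [reflexivity|now elim N]. }
  destruct (filterlim_RInt (V := C_R_CompleteNormedModule) (fun n => cut (f n)) 0 1 eventually _
    (cut g) (fun n => CInt (f n) 0 1)) as [l [_ Hl]].
  - intros n. apply (isI_ext (f n)); [lra| |].
    + intros t Ht. now rewrite Hcut.
    + now apply isI_CInt.
  - intros P [d Hd]. destruct (H (d / 2)%R) as [N HN]; [apply Rdiv_lt_0_compat; [apply cond_pos|lra]|].
    exists N. intros n Hn. apply Hd. intros t. unfold cut.
    destruct (excluded_middle_informative (unit_itv t)) as [Ht|_]; [|apply ball_center].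
    apply (norm_compat1 (V := C_R_NormedModule)). rewrite <- Cmod_norm.
    change (Cmod (f n t - g t) < d)%R.
    eapply Rle_lt_trans; [now apply HN|]. generalize (cond_pos d). lra.
  - exists l. apply (isI_ext (cut g)); [lra| |exact Hl]. intros t Ht. now rewrite Hcut.
Qed.

(** The parameter [a] holds the variables not yet integrated. Existence and uniform convergence are
    both passed on, so the lemma can be iterated over the nested integrals. *)
Lemma uconv_CInt {A : Type} (dom : A -> Prop) (f : nat -> A -> R -> C) (g : A -> R -> C) :
  uconv (fun p : A * R => dom (fst p) /\ unit_itv (snd p))
    (fun n p => f n (fst p) (snd p)) (fun p => g (fst p) (snd p)) ->
  (forall n a, dom a -> exI (f n a) 0 1) ->
  (forall a, dom a -> exI (g a) 0 1) /\
  uconv dom (fun n a => CInt (f n a) 0 1) (fun a => CInt (g a) 0 1).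
Proof.
  intros H Hf.
  assert (Hg : forall a, dom a -> exI (g a) 0 1).
  { intros a Ha. apply exI_uniform_limit with (fun n => f n a); [|intros n; now apply Hf].
    intros e He. destruct (H e He) as [N HN]. exists N. intros n Hn t Ht.
    exact (HN n Hn (a, t) (conj Ha Ht)). }
  split; [exact Hg|].
  intros e He. destruct (H e He) as [N HN]. exists N. intros n Hn a Ha.
  assert (I := isI_minus _ _ _ _ _ _ (isI_CInt _ _ _ (Hf n a Ha)) (isI_CInt _ _ _ (Hg a Ha))).
  rewrite <- (isI_unique _ _ _ _ I).
  replace e with ((1 - 0) * e)%R by ring.
  apply Cmod_CInt_le; [lra|eexists; exact I|].
  intros t Ht. exact (HN n Hn (a, t) (conj Ha Ht)).
Qed.

Definition int4 (f : cube4 -> C) (y1 y2 y3 : R) : C :=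
  CInt (fun y4 => f ((y1, y2), (y3, y4))) 0 1.
Definition int34 (f : cube4 -> C) (y1 y2 : R) : C := CInt (fun y3 => int4 f y1 y2 y3) 0 1.
Definition int234 (f : cube4 -> C) (y1 : R) : C := CInt (fun y2 => int34 f y1 y2) 0 1.

(** [cube_int] nests four integrals that are total functions, and it is linear only where each stage
    exists. This record carries the existence of all stages through sums, scalings and limits. *)
Record nex (f : cube4 -> C) : Prop := {
  nex4 : forall y1 y2 y3, unit_itv y1 -> unit_itv y2 -> unit_itv y3 ->
    exI (fun y4 => f ((y1, y2), (y3, y4))) 0 1;
  nex3 : forall y1 y2, unit_itv y1 -> unit_itv y2 -> exI (int4 f y1 y2) 0 1;
  nex2 : forall y1, unit_itv y1 -> exI (int34 f y1) 0 1;
  nex1 : exI (int234 f) 0 1 }.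

Lemma cube_int_eq (f : cube4 -> C) : cube_int f = CInt (int234 f) 0 1.
Proof. reflexivity. Qed.

Lemma cube_ext (f g : cube4 -> C) :
  (forall tau, in_cube4 tau -> f tau = g tau) -> nex f -> nex g /\ cube_int g = cube_int f.
Proof.
  intros H [H4 H3 H2 H1].
  assert (E : forall y1 y2 y3 y4, unit_itv y1 -> unit_itv y2 -> unit_itv y3 -> unit_itv y4 ->
    f ((y1, y2), (y3, y4)) = g ((y1, y2), (y3, y4))).
  { intros y1 y2 y3 y4 U1 U2 U3 U4. apply H. exact (conj U1 (conj U2 (conj U3 U4))). }
  assert (E4 : forall y1 y2 y3, unit_itv y1 -> unit_itv y2 -> unit_itv y3 ->
    int4 f y1 y2 y3 = int4 g y1 y2 y3).
  { intros y1 y2 y3 U1 U2 U3. unfold int4. apply CInt_ext; [lra|]. intros t Ht. now apply E. }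
  assert (E3 : forall y1 y2, unit_itv y1 -> unit_itv y2 -> int34 f y1 y2 = int34 g y1 y2).
  { intros y1 y2 U1 U2. unfold int34. apply CInt_ext; [lra|]. intros t Ht. now apply E4. }
  assert (E2 : forall y1, unit_itv y1 -> int234 f y1 = int234 g y1).
  { intros y1 U1. unfold int234. apply CInt_ext; [lra|]. intros t Ht. now apply E3. }
  split; [split|].
  - intros y1 y2 y3 U1 U2 U3. apply (exI_ext (fun y4 => f ((y1, y2), (y3, y4)))); [lra| |now apply H4].
    intros t Ht. now apply E.
  - intros y1 y2 U1 U2. apply (exI_ext (int4 f y1 y2)); [lra| |now apply H3].
    intros t Ht. now apply E4.
  - intros y1 U1. apply (exI_ext (int34 f y1)); [lra| |now apply H2]. intros t Ht. now apply E3.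
  - apply (exI_ext (int234 f)); [lra| |exact H1]. exact E2.
  - rewrite !cube_int_eq. symmetry. apply CInt_ext; [lra|]. exact E2.
Qed.

Lemma cube_plus (f g : cube4 -> C) :
  nex f -> nex g ->
  nex (fun tau => f tau + g tau) /\
  cube_int (fun tau => f tau + g tau) = cube_int f + cube_int g.
Proof.
  intros [F4 F3 F2 F1] [G4 G3 G2 G1].
  set (h := fun tau => f tau + g tau).
  assert (P : forall u v, exI u 0 1 -> exI v 0 1 -> exI (fun t => u t + v t) 0 1).
  { intros u v [l Hl] [m Hm]. exists (l + m). now apply isI_plus. }
  assert (E4 : forall y1 y2 y3, unit_itv y1 -> unit_itv y2 -> unit_itv y3 ->
    int4 f y1 y2 y3 + int4 g y1 y2 y3 = int4 h y1 y2 y3).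
  { intros y1 y2 y3 U1 U2 U3. symmetry.
    exact (CInt_plus _ _ 0 1 (F4 _ _ _ U1 U2 U3) (G4 _ _ _ U1 U2 U3)). }
  assert (E3 : forall y1 y2, unit_itv y1 -> unit_itv y2 -> int34 f y1 y2 + int34 g y1 y2 = int34 h y1 y2).
  { intros y1 y2 U1 U2. unfold int34.
    rewrite <- (CInt_plus (fun y => int4 f y1 y2 y) (fun y => int4 g y1 y2 y) 0 1 (F3 _ _ U1 U2) (G3 _ _ U1 U2)).
    apply CInt_ext; [lra|]. intros t Ht. now apply E4. }
  assert (E2 : forall y1, unit_itv y1 -> int234 f y1 + int234 g y1 = int234 h y1).
  { intros y1 U1. unfold int234.
    rewrite <- (CInt_plus (fun y => int34 f y1 y) (fun y => int34 g y1 y) 0 1 (F2 _ U1) (G2 _ U1)).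
    apply CInt_ext; [lra|]. intros t Ht. now apply E3. }
  split; [split|].
  - intros y1 y2 y3 U1 U2 U3. exact (P _ _ (F4 _ _ _ U1 U2 U3) (G4 _ _ _ U1 U2 U3)).
  - intros y1 y2 U1 U2. apply (exI_ext (fun t => int4 f y1 y2 t + int4 g y1 y2 t));
      [lra| |exact (P _ _ (F3 _ _ U1 U2) (G3 _ _ U1 U2))].
    intros t Ht. now apply E4.
  - intros y1 U1. apply (exI_ext (fun t => int34 f y1 t + int34 g y1 t)); [lra| |exact (P _ _ (F2 _ U1) (G2 _ U1))].
    intros t Ht. now apply E3.
  - apply (exI_ext (fun t => int234 f t + int234 g t)); [lra|exact E2|exact (P _ _ F1 G1)].
  - rewrite !cube_int_eq, <- (CInt_plus (int234 f) (int234 g) 0 1 F1 G1). symmetry. apply CInt_ext; [lra|]. exact E2.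
Qed.

Lemma cube_scal (c : C) (f : cube4 -> C) :
  nex f -> nex (fun tau => c * f tau) /\ cube_int (fun tau => c * f tau) = c * cube_int f.
Proof.
  intros [F4 F3 F2 F1].
  set (h := fun tau => c * f tau).
  assert (E4 : forall y1 y2 y3, unit_itv y1 -> unit_itv y2 -> unit_itv y3 ->
    c * int4 f y1 y2 y3 = int4 h y1 y2 y3).
  { intros y1 y2 y3 U1 U2 U3. symmetry.
    exact (CInt_scal _ c 0 1 (F4 _ _ _ U1 U2 U3)). }
  assert (E3 : forall y1 y2, unit_itv y1 -> unit_itv y2 -> c * int34 f y1 y2 = int34 h y1 y2).
  { intros y1 y2 U1 U2. unfold int34.
    rewrite <- (CInt_scal (fun y => int4 f y1 y2 y) c 0 1 (F3 _ _ U1 U2)).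
    apply CInt_ext; [lra|]. intros t Ht. now apply E4. }
  assert (E2 : forall y1, unit_itv y1 -> c * int234 f y1 = int234 h y1).
  { intros y1 U1. unfold int234.
    rewrite <- (CInt_scal (fun y => int34 f y1 y) c 0 1 (F2 _ U1)).
    apply CInt_ext; [lra|]. intros t Ht. now apply E3. }
  split; [split|].
  - intros y1 y2 y3 U1 U2 U3. exact (exI_scal _ c 0 1 (F4 _ _ _ U1 U2 U3)).
  - intros y1 y2 U1 U2. apply (exI_ext (fun t => c * int4 f y1 y2 t)); [lra| |exact (exI_scal _ c 0 1 (F3 _ _ U1 U2))].
    intros t Ht. now apply E4.
  - intros y1 U1. apply (exI_ext (fun t => c * int34 f y1 t)); [lra| |exact (exI_scal _ c 0 1 (F2 _ U1))].
    intros t Ht. now apply E3.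
  - apply (exI_ext (fun t => c * int234 f t)); [lra|exact E2|exact (exI_scal _ c 0 1 F1)].
  - rewrite !cube_int_eq, <- (CInt_scal (int234 f) c 0 1 F1). symmetry. apply CInt_ext; [lra|]. exact E2.
Qed.

(** The last two variables stay together in [h], because the tubes and the inner piece of the
    triangle are not products of curves. *)
Lemma cube_prod (a b : R -> C) (h : R -> R -> C) :
  exI a 0 1 -> exI b 0 1 -> (forall y3, unit_itv y3 -> exI (h y3) 0 1) ->
  exI (fun y3 => CInt (h y3) 0 1) 0 1 ->
  nex (fun tau : cube4 => let '((y1, y2), (y3, y4)) := tau in a y1 * b y2 * h y3 y4) /\
  cube_int (fun tau : cube4 => let '((y1, y2), (y3, y4)) := tau in a y1 * b y2 * h y3 y4)
    = CInt a 0 1 * CInt b 0 1 * CInt (fun y3 => CInt (h y3) 0 1) 0 1.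
Proof.
  intros Ha Hb H4 H3.
  set (f := fun tau : cube4 => let '((y1, y2), (y3, y4)) := tau in a y1 * b y2 * h y3 y4).
  set (T := CInt (fun y3 => CInt (h y3) 0 1) 0 1).
  assert (E4 : forall y1 y2 y3, unit_itv y3 -> a y1 * b y2 * CInt (h y3) 0 1 = int4 f y1 y2 y3).
  { intros y1 y2 y3 U3. symmetry. exact (CInt_scal (h y3) (a y1 * b y2) 0 1 (H4 y3 U3)). }
  assert (E3 : forall y1 y2, a y1 * T * b y2 = int34 f y1 y2).
  { intros y1 y2. transitivity (a y1 * b y2 * T); [ring|].
    unfold T, int34. rewrite <- (CInt_scal (fun y3 => CInt (h y3) 0 1) (a y1 * b y2) 0 1 H3).
    apply CInt_ext; [lra|]. intros t Ht. now apply E4. }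
  assert (E2 : forall y1, T * CInt b 0 1 * a y1 = int234 f y1).
  { intros y1. transitivity (a y1 * T * CInt b 0 1); [ring|].
    unfold int234. rewrite <- (CInt_scal b (a y1 * T) 0 1 Hb).
    apply CInt_ext; [lra|]. intros t Ht. apply E3. }
  split; [split|].
  - intros y1 y2 y3 U1 U2 U3. exact (exI_scal (h y3) (a y1 * b y2) 0 1 (H4 y3 U3)).
  - intros y1 y2 U1 U2. apply (exI_ext (fun t => a y1 * b y2 * CInt (h t) 0 1)); [lra| |now apply exI_scal].
    intros t Ht. now apply E4.
  - intros y1 U1. apply (exI_ext (fun t => a y1 * T * b t)); [lra| |now apply exI_scal].
    intros t Ht. apply E3.
  - apply (exI_ext (fun t => T * CInt b 0 1 * a t)); [lra| |now apply exI_scal]. intros t _. apply E2.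
  - rewrite cube_int_eq. transitivity (T * CInt b 0 1 * CInt a 0 1); [|ring].
    rewrite <- (CInt_scal a (T * CInt b 0 1) 0 1 Ha). symmetry. apply CInt_ext; [lra|]. intros t _. apply E2.
Qed.

Lemma cube_limit (F : nat -> cube4 -> C) (G : cube4 -> C) :
  uconv in_cube4 F G -> (forall n, nex (F n)) ->
  nex G /\ Clim (fun n => cube_int (F n)) (cube_int G).
Proof.
  intros H HF.
  destruct (uconv_CInt (fun y : R * R * R => unit_itv (fst (fst y)) /\ unit_itv (snd (fst y)) /\ unit_itv (snd y))
    (fun n y y4 => F n ((fst (fst y), snd (fst y)), (snd y, y4)))
    (fun y y4 => G ((fst (fst y), snd (fst y)), (snd y, y4)))) as [X4 C4].
  { intros e He. destruct (H e He) as [N HN]. exists N. intros n Hn [[[y1 y2] y3] y4] [[U1 [U2 U3]] U4].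
    apply (HN n Hn). exact (conj U1 (conj U2 (conj U3 U4))). }
  { intros n [[y1 y2] y3] [U1 [U2 U3]]. now apply (nex4 _ (HF n)). }
  destruct (uconv_CInt (fun y : R * R => unit_itv (fst y) /\ unit_itv (snd y))
    (fun n y y3 => int4 (F n) (fst y) (snd y) y3)
    (fun y y3 => int4 G (fst y) (snd y) y3)) as [X3 C3].
  { intros e He. destruct (C4 e He) as [N HN]. exists N. intros n Hn [[y1 y2] y3] [[U1 U2] U3].
    exact (HN n Hn ((y1, y2), y3) (conj U1 (conj U2 U3))). }
  { intros n [y1 y2] [U1 U2]. now apply (nex3 _ (HF n)). }
  destruct (uconv_CInt unit_itv (fun n y1 y2 => int34 (F n) y1 y2) (fun y1 y2 => int34 G y1 y2)) as [X2 C2].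
  { intros e He. destruct (C3 e He) as [N HN]. exists N. intros n Hn [y1 y2] [U1 U2].
    exact (HN n Hn (y1, y2) (conj U1 U2)). }
  { intros n y1 U1. now apply (nex2 _ (HF n)). }
  (* At the outermost integral no variable is left; the parameter type is [unit]. *)
  destruct (uconv_CInt (fun _ : unit => True) (fun n _ y1 => int234 (F n) y1) (fun _ y1 => int234 G y1))
    as [X1 C1].
  { intros e He. destruct (C2 e He) as [N HN]. exists N. intros n Hn [u y1] [_ U1].
    now apply (HN n Hn y1). }
  { intros n u _. apply (nex1 _ (HF n)). }
  split; [split|].
  - intros y1 y2 y3 U1 U2 U3. exact (X4 ((y1, y2), y3) (conj U1 (conj U2 U3))).
  - intros y1 y2 U1 U2. exact (X3 (y1, y2) (conj U1 U2)).
  - exact X2.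
  - exact (X1 tt I).
  - apply Clim_eps. intros e He. destruct (C1 (e / 2)%R ltac:(lra)) as [N HN].
    exists N. intros n Hn. eapply Rle_lt_trans; [apply (HN n Hn tt I)|]. lra.
Qed.

Lemma cube_psum (u : nat -> cube4 -> C) (N : nat) :
  (forall n, nex (u n)) ->
  nex (fun tau => psum (fun n => u n tau) (S N)) /\
  cube_int (fun tau => psum (fun n => u n tau) (S N)) = psum (fun n => cube_int (u n)) (S N).
Proof.
  intros H. induction N as [|N [IH1 IH2]].
  - destruct (cube_ext (u 0%nat) (fun tau => psum (fun n => u n tau) 1)) as [A B].
    { intros tau _. simpl. ring. }
    { apply H. }
    split; [exact A|]. rewrite B. simpl. ring.
  - destruct (cube_plus _ _ IH1 (H (S N))) as [A B]. split; [exact A|].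
    change (psum (fun n => cube_int (u n)) (S (S N)))
      with (psum (fun n => cube_int (u n)) (S N) + cube_int (u (S N))).
    rewrite <- IH2, <- B. reflexivity.
Qed.

Lemma cube_binomial (k : C) (w X : cube4 -> C) (rho M : R) :
  (0 < rho < 1)%R ->
  (forall tau, in_cube4 tau -> (Cmod (w tau) <= M)%R /\ (Cmod (X tau) <= rho)%R) ->
  (forall n, nex (fun tau => w tau * X tau ^ n)) ->
  nex (fun tau => w tau * cpow (1 - X tau) k) /\
  Clim (psum (fun n => bin k n * cube_int (fun tau => w tau * X tau ^ n)))
    (cube_int (fun tau => w tau * cpow (1 - X tau) k)).
Proof.
  intros Hr HB Hn.
  destruct (bsum_uniform k rho Hr) as [tau [Ht HU]].
  destruct (cube_limit (fun N t => psum (fun n => bin k n * (w t * X t ^ n)) (S N))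
    (fun t => w t * cpow (1 - X t) k)) as [A B].
  - intros e He.
    apply is_lim_seq_spec in Ht.
    assert (HM : (0 < Rabs M + 1)%R) by (generalize (Rabs_pos M); lra).
    assert (He' : (0 < e / (Rabs M + 1))%R) by (apply Rdiv_lt_0_compat; lra).
    destruct (Ht (mkposreal _ He')) as [N HN]. exists N. intros n Hnn t Tt. simpl in HN.
    specialize (HN n Hnn). rewrite Rminus_0_r in HN.
    destruct (HB t Tt) as [H1 H2].
    replace (psum (fun n => bin k n * (w t * X t ^ n)) (S n)) with (w t * bsum k (S n) (X t)).
    2: { unfold bsum. rewrite <- psum_scal. apply psum_ext. intros i. ring. }
    replace (w t * bsum k (S n) (X t) - w t * cpow (1 - X t) k)
      with (w t * (bsum k (S n) (X t) - cpow (1 - X t) k)) by ring.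
    rewrite Cmod_mult.
    assert (Q := HU n (X t) H2). assert (Q2 := Rle_abs (tau n)). assert (Q3 := Rle_abs M).
    apply Rle_trans with ((Rabs M + 1) * (e / (Rabs M + 1)))%R; [|right; field; lra].
    apply Rmult_le_compat; try apply Cmod_ge_0; lra.
  - intros N. apply (cube_psum (fun n t => bin k n * (w t * X t ^ n))). intros n. now apply cube_scal.
  - split; [exact A|].
    apply (proj1 (Clim_incr_n (psum (fun n => bin k n * cube_int (fun tau => w tau * X tau ^ n))) 1 _)).
    apply Clim_ext with (2 := B). intros N. rewrite Nat.add_1_r.
    destruct (cube_psum (fun n t => bin k n * (w t * X t ^ n)) N) as [_ E].
    { intros n. now apply cube_scal. }
    rewrite E. apply psum_ext. intros n. now apply cube_scal.
Qed.

(** * Finite sums over the cells, and the expansion of the integral into a series *)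

Definition lsum {A : Type} (f : A -> C) (L : list A) : C := fold_right Cplus 0 (map f L).

Lemma lsum_cons {A : Type} (f : A -> C) (a : A) (L : list A) : lsum f (a :: L) = f a + lsum f L.
Proof. reflexivity. Qed.

Lemma lsum_ext {A : Type} (f g : A -> C) (L : list A) :
  (forall a, In a L -> f a = g a) -> lsum f L = lsum g L.
Proof.
  intros H. induction L as [|a L IH]; [reflexivity|]. rewrite !lsum_cons.
  rewrite H by now left. rewrite IH; [reflexivity|]. intros b Hb. apply H. now right.
Qed.

Lemma lsum_scal {A : Type} (c : C) (f : A -> C) (L : list A) :
  lsum (fun a => c * f a) L = c * lsum f L.
Proof.
  induction L as [|a L IH]; [unfold lsum; simpl; ring|]. rewrite !lsum_cons, IH. ring.
Qed.

Lemma lsum_plus {A : Type} (f g : A -> C) (L : list A) :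
  lsum (fun a => f a + g a) L = lsum f L + lsum g L.
Proof.
  induction L as [|a L IH]; [unfold lsum; simpl; ring|]. rewrite !lsum_cons, IH. ring.
Qed.

Lemma lsum_app {A : Type} (f : A -> C) (K L : list A) : lsum f (K ++ L) = lsum f K + lsum f L.
Proof.
  induction K as [|a K IH]; [unfold lsum at 2; simpl; ring|].
  rewrite <- app_comm_cons, !lsum_cons, IH. ring.
Qed.

Lemma lsum_map {A B : Type} (f : B -> C) (g : A -> B) (L : list A) :
  lsum f (map g L) = lsum (fun a => f (g a)) L.
Proof. unfold lsum. now rewrite map_map. Qed.

Lemma lsum_prod {A B : Type} (f : A -> C) (g : B -> C) (K : list A) (L : list B) :
  lsum (fun ab => f (fst ab) * g (snd ab)) (list_prod K L) = lsum f K * lsum g L.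
Proof.
  induction K as [|a K IH]; [unfold lsum; simpl; ring|].
  simpl list_prod. rewrite lsum_app, lsum_map, IH, lsum_cons. simpl.
  rewrite lsum_scal. ring.
Qed.

Lemma psum_lsum {A : Type} (f : A -> nat -> C) (L : list A) (N : nat) :
  psum (fun n => lsum (fun a => f a n) L) N = lsum (fun a => psum (f a) N) L.
Proof.
  induction N as [|N IH]; simpl.
  - rewrite (lsum_ext _ (fun _ => 0 * 0)) by (intros; ring).
    rewrite (lsum_scal 0 (fun _ => 0)). ring.
  - rewrite IH, <- lsum_plus. reflexivity.
Qed.

Lemma Clim_lsum {A : Type} (u : A -> nat -> C) (l : A -> C) (L : list A) :
  (forall a, In a L -> Clim (u a) (l a)) ->
  Clim (fun n => lsum (fun a => u a n) L) (lsum l L).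
Proof.
  intros H. induction L as [|a L IH]; [exact (Clim_const 0)|].
  rewrite lsum_cons. apply Clim_ext with (fun n => u a n + lsum (fun a => u a n) L); [reflexivity|].
  apply Clim_plus; [apply H; now left|]. apply IH. intros b Hb. apply H. now right.
Qed.

(** One binomial factor is expanded at a time, the other variable being part of the bounded weight.
    The outcome is a series in [m] whose terms are series in [n], the same nesting as in [F3], so no
    rearrangement of a double series occurs. The sum over the cells is taken inside, because the
    recurrences hold for whole chains and not for single cells. *)
Lemma cells_series {A : Type} (L : list A) (c : A -> C) (w X1 X2 : A -> cube4 -> C)
    (k1 k2 : C) (rho : R) :
  (0 < rho < 1)%R ->
  (forall a, In a L -> exists M, forall tau, in_cube4 tau ->
     (Cmod (w a tau) <= M)%R /\ (Cmod (X1 a tau) <= rho)%R /\ (Cmod (X2 a tau) <= rho)%R) ->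
  (forall a, In a L -> forall m n, nex (fun tau => w a tau * X1 a tau ^ m * X2 a tau ^ n)) ->
  (forall a, In a L -> nex (fun tau =>
     w a tau * cpow (1 - X1 a tau) k1 * cpow (1 - X2 a tau) k2)) /\
  exists g : nat -> C,
    (forall m, Clim (psum (fun n => bin k2 n *
        lsum (fun a => c a * cube_int (fun tau => w a tau * X1 a tau ^ m * X2 a tau ^ n)) L)) (g m)) /\
    Clim (psum (fun m => bin k1 m * g m))
      (lsum (fun a => c a * cube_int (fun tau =>
         w a tau * cpow (1 - X1 a tau) k1 * cpow (1 - X2 a tau) k2)) L).
Proof.
  intros Hr HB HN.
  assert (S1 : forall a, In a L -> forall m,
    nex (fun tau => w a tau * X1 a tau ^ m * cpow (1 - X2 a tau) k2) /\
    Clim (psum (fun n => bin k2 n * cube_int (fun tau => w a tau * X1 a tau ^ m * X2 a tau ^ n)))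
      (cube_int (fun tau => w a tau * X1 a tau ^ m * cpow (1 - X2 a tau) k2))).
  { intros a Ha m. destruct (HB a Ha) as [M HM].
    apply (cube_binomial k2 (fun tau => w a tau * X1 a tau ^ m) (X2 a) rho M Hr).
    - intros tau Ht. destruct (HM tau Ht) as [M1 [M2 M3]]. split; [|exact M3].
      rewrite Cmod_mult, Cmod_pow. apply Rle_trans with (Cmod (w a tau) * 1)%R; [|lra].
      apply Rmult_le_compat_l; [apply Cmod_ge_0|]. rewrite <- (pow1 m).
      apply pow_incr. split; [apply Cmod_ge_0|lra].
    - intros n. now apply HN. }
  assert (S2 : forall a, In a L ->
    nex (fun tau => w a tau * cpow (1 - X1 a tau) k1 * cpow (1 - X2 a tau) k2) /\
    Clim (psum (fun m => bin k1 m * cube_int (fun tau => w a tau * X1 a tau ^ m * cpow (1 - X2 a tau) k2)))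
      (cube_int (fun tau => w a tau * cpow (1 - X1 a tau) k1 * cpow (1 - X2 a tau) k2))).
  { intros a Ha. destruct (HB a Ha) as [M HM].
    assert (Q : forall m, nex (fun tau => w a tau * cpow (1 - X2 a tau) k2 * X1 a tau ^ m) /\
      cube_int (fun tau => w a tau * cpow (1 - X2 a tau) k2 * X1 a tau ^ m) =
      cube_int (fun tau => w a tau * X1 a tau ^ m * cpow (1 - X2 a tau) k2)).
    { intros m. apply cube_ext; [|now apply S1]. intros tau _. ring. }
    destruct (cube_binomial k1 (fun tau => w a tau * cpow (1 - X2 a tau) k2) (X1 a) rho
      (M * cpow_max (1 - rho) k2) Hr) as [T1 T2].
    - intros tau Ht. destruct (HM tau Ht) as [M1 [M2 M3]]. split; [|exact M2].
      rewrite Cmod_mult. apply Rmult_le_compat; try apply Cmod_ge_0; [exact M1|].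
      destruct (Cmod_lt_1_bounds rho _ M3 ltac:(lra)). apply cpow_bound; lra.
    - intros m. apply Q.
    - destruct (cube_ext (fun tau => w a tau * cpow (1 - X2 a tau) k2 * cpow (1 - X1 a tau) k1)
        (fun tau => w a tau * cpow (1 - X1 a tau) k1 * cpow (1 - X2 a tau) k2)) as [N1 E];
        [intros tau _; ring|exact T1|].
      split; [exact N1|].
      rewrite E. apply Clim_ext with (2 := T2). intros N. apply psum_ext. intros m.
      now rewrite (proj2 (Q m)). }
  split; [intros a Ha; now apply S2|].
  exists (fun m => lsum (fun a => c a *
    cube_int (fun tau => w a tau * X1 a tau ^ m * cpow (1 - X2 a tau) k2)) L).
  split.
  - intros m.
    apply Clim_ext with (fun N => lsum (fun a => c a * psum (fun n => bin k2 n *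
      cube_int (fun tau => w a tau * X1 a tau ^ m * X2 a tau ^ n)) N) L).
    + intros N. rewrite <- (psum_ext (fun n => lsum (fun a => c a * (bin k2 n *
        cube_int (fun tau => w a tau * X1 a tau ^ m * X2 a tau ^ n))) L)).
      * rewrite psum_lsum. apply lsum_ext. intros a _. now rewrite psum_scal.
      * intros n. rewrite <- lsum_scal. apply lsum_ext. intros a _. ring.
    + apply (Clim_lsum (fun a N => c a * psum (fun n => bin k2 n *
        cube_int (fun tau => w a tau * X1 a tau ^ m * X2 a tau ^ n)) N)).
      intros a Ha. apply Clim_scal. now apply S1.
  - apply Clim_ext with (fun N => lsum (fun a => c a * psum (fun m => bin k1 m *
      cube_int (fun tau => w a tau * X1 a tau ^ m * cpow (1 - X2 a tau) k2)) N) L).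
    + intros N. rewrite <- (psum_ext (fun m => lsum (fun a => c a * (bin k1 m *
        cube_int (fun tau => w a tau * X1 a tau ^ m * cpow (1 - X2 a tau) k2))) L)).
      * rewrite psum_lsum. apply lsum_ext. intros a _. now rewrite psum_scal.
      * intros m. rewrite <- lsum_scal. apply lsum_ext. intros a _. ring.
    + apply (Clim_lsum (fun a N => c a * psum (fun m => bin k1 m *
        cube_int (fun tau => w a tau * X1 a tau ^ m * cpow (1 - X2 a tau) k2)) N)).
      intros a Ha. apply Clim_scal. now apply S2.
Qed.

(** * The pull-back of the integrand *)

(** Rows 0 and 3 are the differentials of [t1 = s1] and [t4 = s3], each of which depends on a single
    parameter of the cell. *)
Lemma Cdet4_sparse (M : nat -> nat -> C) :
  M 0%nat 1%nat = 0 -> M 0%nat 2%nat = 0 -> M 0%nat 3%nat = 0 ->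
  M 3%nat 0%nat = 0 -> M 3%nat 2%nat = 0 -> M 3%nat 3%nat = 0 ->
  Cdet 4 M = M 0%nat 0%nat * M 3%nat 1%nat *
    (M 1%nat 2%nat * M 2%nat 3%nat - M 1%nat 3%nat * M 2%nat 2%nat).
Proof.
  intros H01 H02 H03 H30 H32 H33.
  cbn [Cdet]. repeat (rewrite ?sum_Sn, ?sum_O; unfold plus; simpl).
  rewrite ?H01, ?H02, ?H03, ?H30, ?H32, ?H33.
  ring.
Qed.

Lemma dq_inv {X : UniformSpace} (i f : X -> C) (x : X) (l : C) :
  cont i x -> dq i f x l -> f x <> 0 -> dq i (fun y => / f y) x (- l / (f x * f x)).
Proof.
  intros Hi Hf H0. assert (Cf := dq_cont _ _ _ _ Hi Hf).
  destruct Hf as [q [H1 [H2 H3]]].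
  exists (fun y => - q y / (f y * f x)). repeat split.
  - apply cont_div; [now apply cont_opp| |now apply Cmult_neq_0].
    apply cont_mult; [exact Cf|apply cont_const].
  - now rewrite H2.
  - assert (Hn : locally x (fun y => f y <> 0)).
    { assert (Hm : (0 < Cmod (f x))%R) by now apply Cmod_gt_0.
      generalize (proj1 (cont_ball _ _) Cf _ Hm). apply filter_imp.
      intros y Hy E. rewrite E in Hy. replace (0 - f x) with (- f x) in Hy by ring.
      rewrite Cmod_opp in Hy. lra. }
    generalize (filter_and _ _ Hn H3). apply filter_imp. intros y [N E].
    assert (E' : (i y - i x) * q y = f y - f x) by (rewrite E; ring).
    transitivity (/ f x - ((i y - i x) * q y) / (f y * f x)); [|unfold Cdiv; ring].
    rewrite E'. field. auto.
Qed.

Definition dphi (phi : R -> loaded * loaded) (y : R) : C := CDerive (fun t => val (fst (phi t))) y.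

Definition d3 (f : R * R -> C) (r : R * R) : C := CDerive (fun t => f (t, snd r)) (fst r).
Definition d4 (f : R * R -> C) (r : R * R) : C := CDerive (fun t => f (fst r, t)) (snd r).

Definition y0 (P : loaded * loaded * loaded) : loaded := fst (fst P).
Definition y1 (P : loaded * loaded * loaded) : loaded := snd (fst P).
Definition y2 (P : loaded * loaded * loaded) : loaded := snd P.

Definition jac (phi : R * R -> loaded * loaded * loaded) (r : R * R) : C :=
  d3 (fun r => val (y0 (phi r))) r * d4 (fun r => val (y1 (phi r))) r
  - d4 (fun r => val (y0 (phi r))) r * d3 (fun r => val (y1 (phi r))) r.

Definition W1 (p q : C) (phi : R -> loaded * loaded) (y : R) : C :=
  lpow (fst (phi y)) (p - 1) * lpow (snd (phi y)) (q - 1) * dphi phi y.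

Definition W2 (p q r : C) (phi : R * R -> loaded * loaded * loaded) (s : R * R) : C :=
  lpow (y0 (phi s)) (p - 1) * lpow (y1 (phi s)) (q - 1) * lpow (y2 (phi s)) (r - 1) * jac phi s.

(** The last bound is the one built into [cpow_max]; it holds both for principal logarithms and for
    the logarithms carried by a circle. *)
Definition good_load (e : R) (f : loaded) : Prop :=
  Cexp (log f) = val f /\ (e <= Cmod (val f))%R /\ (Cmod (log f) <= Rabs (ln e) + 1 + 2 * PI)%R.

(** What the integration uses of a cell of the interval, so that the segment and the two circles are
    treated alike. *)
Record good1 (e : R) (phi : R -> loaded * loaded) : Prop := {
  good1_der : forall y, unit_itv y -> rder (fun t => val (fst (phi t))) y (dphi phi y);
  good1_fst : forall y, unit_itv y -> good_load e (fst (phi y));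
  good1_snd : forall y, unit_itv y -> good_load e (snd (phi y));
  good1_sum : forall y, val (snd (phi y)) = 1 - val (fst (phi y));
  good1_bound : exists M, forall y, unit_itv y -> (Cmod (dphi phi y) <= M)%R;
  good1_int : forall p q, exI (W1 p q phi) 0 1 }.

(** [good2_sum] is asked for all parameters, also outside of the square: [rot3] brings the third
    coordinate into a place that is differentiated, and a derivative at a boundary point of the
    square sees both sides. *)
Record good2 (e : R) (phi : R * R -> loaded * loaded * loaded) : Prop := {
  good2_d30 : forall r, unit_itv (fst r) -> unit_itv (snd r) ->
    rder (fun t => val (y0 (phi (t, snd r)))) (fst r) (d3 (fun r => val (y0 (phi r))) r);
  good2_d40 : forall r, unit_itv (fst r) -> unit_itv (snd r) ->
    rder (fun t => val (y0 (phi (fst r, t)))) (snd r) (d4 (fun r => val (y0 (phi r))) r);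
  good2_d31 : forall r, unit_itv (fst r) -> unit_itv (snd r) ->
    rder (fun t => val (y1 (phi (t, snd r)))) (fst r) (d3 (fun r => val (y1 (phi r))) r);
  good2_d41 : forall r, unit_itv (fst r) -> unit_itv (snd r) ->
    rder (fun t => val (y1 (phi (fst r, t)))) (snd r) (d4 (fun r => val (y1 (phi r))) r);
  good2_0 : forall r, unit_itv (fst r) -> unit_itv (snd r) -> good_load e (y0 (phi r));
  good2_1 : forall r, unit_itv (fst r) -> unit_itv (snd r) -> good_load e (y1 (phi r));
  good2_2 : forall r, unit_itv (fst r) -> unit_itv (snd r) -> good_load e (y2 (phi r));
  good2_sum : forall r, val (y2 (phi r)) = 1 - val (y0 (phi r)) - val (y1 (phi r));
  good2_bound : exists M, forall r, unit_itv (fst r) -> unit_itv (snd r) -> (Cmod (jac phi r) <= M)%R;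
  good2_int4 : forall p q r s, unit_itv s -> exI (fun t => W2 p q r phi (s, t)) 0 1;
  good2_int3 : forall p q r, exI (fun s => CInt (fun t => W2 p q r phi (s, t)) 0 1) 0 1 }.

Lemma iota_t1 (x1 x2 : loaded) (s : spoint) : t1 (iota21 x1 x2 s) = fst (fst (fst s)).
Proof. destruct s as [[[a b] [c d]] [[f g] h]]. reflexivity. Qed.

Lemma iota_t4 (x1 x2 : loaded) (s : spoint) : t4 (iota21 x1 x2 s) = fst (snd (fst s)).
Proof. destruct s as [[[a b] [c d]] [[f g] h]]. reflexivity. Qed.

Lemma iota_t2 (x1 x2 : loaded) (s : spoint) :
  val (t2 (iota21 x1 x2 s)) = val x1 * / (val (fst (fst (fst s))) * val (y0 (snd s))).
Proof. destruct s as [[[a b] [c d]] [[f g] h]]. reflexivity. Qed.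

Lemma iota_t3 (x1 x2 : loaded) (s : spoint) :
  val (t3 (iota21 x1 x2 s)) = val x2 * / (val (fst (snd (fst s))) * val (y1 (snd s))).
Proof. destruct s as [[[a b] [c d]] [[f g] h]]. reflexivity. Qed.

Definition cellmap (f g : R -> loaded * loaded) (h : R * R -> loaded * loaded * loaded)
    (tau : cube4) : spoint := ((f (fst (fst tau)), g (snd (fst tau))), h (snd tau)).

Lemma good_load_neq (e : R) (f : loaded) : good_load e f -> val f <> 0.
Proof. intros [H _]. rewrite <- H. apply Cexp_neq_0. Qed.

Lemma rder_quot (c : C) (f : R -> C) (t : R) (l : C) :
  rder f t l -> f t <> 0 -> rder (fun s => c * / f s) t (- (c * / f t) * (l / f t)).
Proof.
  intros H H0. eapply dq_eq; [apply dq_scal; apply dq_inv; [apply cont_R_RtoC|exact H|exact H0]|].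
  field. exact H0.
Qed.

(** [Xa] and [Xb] are the arguments of the two binomial factors, the quantities whose moduli
    [small_at] bounds by 1. *)
Definition Xa (x1 : loaded) (f g : R -> loaded * loaded) (h : R * R -> loaded * loaded * loaded)
    (tau : cube4) : C :=
  val x1 / (val (snd (g (snd (fst tau)))) * val (fst (f (fst (fst tau)))) * val (y0 (h (snd tau)))).
Definition Xb (x2 : loaded) (f g : R -> loaded * loaded) (h : R * R -> loaded * loaded * loaded)
    (tau : cube4) : C :=
  val x2 / (val (snd (f (fst (fst tau)))) * val (fst (g (snd (fst tau)))) * val (y1 (h (snd tau)))).

(** The rows come in the order [t1, t3, t2, t4] and the parameters in the order of [s1, s3, s2, s4].
    As [t3] goes with [s4] and [t2] with [s2], the two middle rows are exchanged; this is the sign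
    of the Jacobian, which the minus in front of the chain compensates. *)
Lemma det_cell (e : R) (x1 x2 : loaded) (f g : R -> loaded * loaded)
    (h : R * R -> loaded * loaded * loaded) (tau : cube4) :
  good1 e f -> good1 e g -> good2 e h -> in_cube4 tau ->
  Cdet 4 (fun i j => partial j (fun sg =>
     val (nth i [t1; t3; t2; t4] t1 (iota21 x1 x2 (cellmap f g h sg)))) tau) =
  - (dphi f (fst (fst tau)) * dphi g (snd (fst tau)) * jac h (snd tau)
     * val (t2 (iota21 x1 x2 (cellmap f g h tau))) * val (t3 (iota21 x1 x2 (cellmap f g h tau)))
     / (val (y0 (h (snd tau))) * val (y1 (h (snd tau))))).
Proof.
  intros Hf Hg Hh Ht. destruct tau as [[u1 u2] [u3 u4]]. destruct Ht as [U1 [U2 [U3 U4]]].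
  set (s1 := val (fst (f u1))). set (s3 := val (fst (g u2))).
  set (s2 := val (y0 (h (u3, u4)))). set (s4 := val (y1 (h (u3, u4)))).
  assert (N1 : s1 <> 0) by (eapply good_load_neq; apply (good1_fst _ _ Hf); exact U1).
  assert (N3 : s3 <> 0) by (eapply good_load_neq; apply (good1_fst _ _ Hg); exact U2).
  assert (N2 : s2 <> 0) by (eapply good_load_neq; apply (good2_0 _ _ Hh); assumption).
  assert (N4 : s4 <> 0) by (eapply good_load_neq; apply (good2_1 _ _ Hh); assumption).
  assert (Z : forall (k : R -> C) (c : C) (t : R), (forall y, k y = c) -> CDerive k t = 0).
  { intros k c t Hk. apply rder_CDerive. apply dq_ext with (fun _ => c); [easy|apply dq_const]. }
  rewrite Cdet4_sparse.
  - cbn [nth partial].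
    assert (E0 : CDerive (fun y => val (t1 (iota21 x1 x2 (cellmap f g h (y, u2, (u3, u4)))))) u1 = dphi f u1).
    { apply rder_CDerive. eapply dq_ext; [|apply (good1_der _ _ Hf u1 U1)].
      intros y. now rewrite iota_t1. }
    assert (E3 : CDerive (fun y => val (t4 (iota21 x1 x2 (cellmap f g h (u1, y, (u3, u4)))))) u2 = dphi g u2).
    { apply rder_CDerive. eapply dq_ext; [|apply (good1_der _ _ Hg u2 U2)].
      intros y. now rewrite iota_t4. }
    rewrite E0, E3. clear E0 E3.
    assert (D1 := good2_d30 _ _ Hh (u3, u4) U3 U4). assert (D2 := good2_d40 _ _ Hh (u3, u4) U3 U4).
    assert (D3 := good2_d31 _ _ Hh (u3, u4) U3 U4). assert (D4 := good2_d41 _ _ Hh (u3, u4) U3 U4).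
    unfold jac. cbn [fst snd] in *.
    set (A3 := d3 (fun r => val (y0 (h r))) (u3, u4)) in *.
    set (A4 := d4 (fun r => val (y0 (h r))) (u3, u4)) in *.
    set (B3 := d3 (fun r => val (y1 (h r))) (u3, u4)) in *.
    set (B4 := d4 (fun r => val (y1 (h r))) (u3, u4)) in *.
    assert (Q : forall (c s : C) (k : R -> C) (t : R) (l : C), s <> 0 -> k t <> 0 -> rder k t l ->
      CDerive (fun y => c * / (s * k y)) t = - (c * / (s * k t)) * (l / k t)).
    { intros c s k t l Hs Hk Hl. apply rder_CDerive.
      eapply dq_eq; [apply (rder_quot c (fun y => s * k y)); [apply dq_scal; exact Hl|now apply Cmult_neq_0]|].
      field. auto. }
    assert (E12 : CDerive (fun y => val (t3 (iota21 x1 x2 (cellmap f g h (u1, u2, (y, u4)))))) u3 =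
      - (val x2 * / (s3 * s4)) * (B3 / s4)).
    { refine (eq_trans _ (Q (val x2) s3 (fun y => val (y1 (h (y, u4)))) u3 B3 N3 N4 D3)).
      unfold CDerive. f_equal; apply Derive_ext; intros y; now rewrite iota_t3. }
    assert (E13 : CDerive (fun y => val (t3 (iota21 x1 x2 (cellmap f g h (u1, u2, (u3, y)))))) u4 =
      - (val x2 * / (s3 * s4)) * (B4 / s4)).
    { refine (eq_trans _ (Q (val x2) s3 (fun y => val (y1 (h (u3, y)))) u4 B4 N3 N4 D4)).
      unfold CDerive. f_equal; apply Derive_ext; intros y; now rewrite iota_t3. }
    assert (E22 : CDerive (fun y => val (t2 (iota21 x1 x2 (cellmap f g h (u1, u2, (y, u4)))))) u3 =
      - (val x1 * / (s1 * s2)) * (A3 / s2)).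
    { refine (eq_trans _ (Q (val x1) s1 (fun y => val (y0 (h (y, u4)))) u3 A3 N1 N2 D1)).
      unfold CDerive. f_equal; apply Derive_ext; intros y; now rewrite iota_t2. }
    assert (E23 : CDerive (fun y => val (t2 (iota21 x1 x2 (cellmap f g h (u1, u2, (u3, y)))))) u4 =
      - (val x1 * / (s1 * s2)) * (A4 / s2)).
    { refine (eq_trans _ (Q (val x1) s1 (fun y => val (y0 (h (u3, y)))) u4 A4 N1 N2 D2)).
      unfold CDerive. f_equal; apply Derive_ext; intros y; now rewrite iota_t2. }
    rewrite E12, E13, E22, E23, iota_t2, iota_t3. unfold cellmap. cbn [fst snd].
    fold s1 s2 s3 s4. field. auto.
  - refine (Z (fun y => _) s1 u2 _). intros y. now rewrite iota_t1.
  - refine (Z (fun y => _) s1 u3 _). intros y. now rewrite iota_t1.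
  - refine (Z (fun y => _) s1 u4 _). intros y. now rewrite iota_t1.
  - refine (Z (fun y => _) s3 u1 _). intros y. now rewrite iota_t4.
  - refine (Z (fun y => _) s3 u3 _). intros y. now rewrite iota_t4.
  - refine (Z (fun y => _) s3 u4 _). intros y. now rewrite iota_t4.
Qed.

Definition wcell (p1 q1 p2 q2 p3 q3 r3 : C) (f g : R -> loaded * loaded)
    (h : R * R -> loaded * loaded * loaded) (tau : cube4) : C :=
  W1 p1 q1 f (fst (fst tau)) * W1 p2 q2 g (snd (fst tau)) * W2 p3 q3 r3 h (snd tau).

(** Every value is the exponential of the logarithm it carries. Once both sides are collected into
    one [Cexp], the claim is a linear identity between logarithms and no branch has to be discussed.
    The parameters of [wcell] are the exponents of the weight plus 1. *)
Lemma integrand_cell (e : R) (a1 a2 a3 b1 b2 b3 b4 : C) (x1 x2 : loaded)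
    (f g : R -> loaded * loaded) (h : R * R -> loaded * loaded * loaded) (tau : cube4) :
  Cexp (log x1) = val x1 -> Cexp (log x2) = val x2 ->
  good1 e f -> good1 e g -> good2 e h -> in_cube4 tau ->
  u_form a1 a2 a3 b1 b2 b3 b4 (iota21 x1 x2 (cellmap f g h tau)) *
  Cdet 4 (fun i j => partial j (fun sg =>
     val (nth i [t1; t3; t2; t4] t1 (iota21 x1 x2 (cellmap f g h sg)))) tau) =
  - (lpow x1 (1 - b2) * lpow x2 (1 - b3)) *
  (wcell (b2 - b1) (b1 + b3 - a1 - 1) (b3 - b4) (b2 + b4 - a2 - 1) (b2 - 1) (b3 - 1) (1 - a3) f g h tau
   * cpow (1 - Xa x1 f g h tau) (b2 + b4 - a2 - 2) * cpow (1 - Xb x2 f g h tau) (b1 + b3 - a1 - 2)).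
Proof.
  intros Hx1 Hx2 Hf Hg Hh Ht. rewrite (det_cell e) by assumption.
  destruct tau as [[u1 u2] [u3 u4]]. destruct Ht as [U1 [U2 [U3 U4]]].
  destruct (good1_fst _ _ Hf u1 U1) as [G1 _]. destruct (good1_fst _ _ Hg u2 U2) as [G3 _].
  destruct (good2_0 _ _ Hh (u3, u4) U3 U4) as [G2 _].
  destruct (good2_1 _ _ Hh (u3, u4) U3 U4) as [G4 _].
  rewrite iota_t2, iota_t3. unfold wcell, W1, W2, Xa, Xb, cellmap. cbn [fst snd].
  set (j := jac h (u3, u4)). set (df := dphi f u1). set (dg := dphi g u2).
  destruct (f u1) as [s1 s1'] eqn:Ef. destruct (g u2) as [s3 s3'] eqn:Eg.
  destruct (h (u3, u4)) as [[s2 s4] s0] eqn:Eh.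
  unfold y0, y1, y2 in *. cbn [fst snd] in *.
  unfold u_form, lpow, cpow. cbn [iota21 Defs.t1 Defs.t2 Defs.t3 Defs.t4 Defs.l13 Defs.l24 Defs.lx log val lmul ldiv].
  set (C2 := Clog (1 - val x2 / (val s1' * val s3 * val s4))).
  set (C1 := Clog (1 - val x1 / (val s3' * val s1 * val s2))).
  rewrite <- Hx1, <- Hx2, <- G1, <- G2, <- G3, <- G4.
  set (l1 := log s1). set (l2 := log s2). set (l3 := log s3). set (l4 := log s4).
  set (m1 := log s1'). set (m3 := log s3'). set (l0 := log s0).
  set (X := log x1). set (Y := log x2).
  rewrite <- !Cexp_plus. unfold Cdiv. rewrite <- !Cexp_opp.
  transitivity (- (df * dg * j) * Cexp (- b1 * l1 + - b2 * (X - (l1 + l2)) + - b3 * (Y - (l3 + l4))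
    + - b4 * l3 + (b1 + b3 - a1 - 2) * (m1 + C2) + (b2 + b4 - a2 - 2) * (m3 + C1) + - a3 * l0
    + (X + - (l1 + l2)) + (Y + - (l3 + l4)) + - (l2 + l4))).
  - rewrite (Cexp_plus _ (- (l2 + l4))), (Cexp_plus _ (Y + - (l3 + l4))), (Cexp_plus _ (X + - (l1 + l2))).
    rewrite !Cexp_plus. ring.
  - transitivity (- (df * dg * j) * Cexp ((1 - b2) * X + (1 - b3) * Y
      + ((b2 - b1 - 1) * l1 + (b1 + b3 - a1 - 1 - 1) * m1)
      + ((b3 - b4 - 1) * l3 + (b2 + b4 - a2 - 1 - 1) * m3)
      + ((b2 - 1 - 1) * l2 + (b3 - 1 - 1) * l4 + (1 - a3 - 1) * l0)
      + (b2 + b4 - a2 - 2) * C1 + (b1 + b3 - a1 - 2) * C2)).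
    + f_equal. f_equal. ring.
    + rewrite !Cexp_plus. ring.
Qed.

Lemma lpow_shift (f : loaded) (p : C) (n : nat) :
  Cexp (log f) = val f -> lpow f p * (/ val f) ^ n = lpow f (p - RtoC (INR n)).
Proof.
  intros H. unfold lpow. rewrite <- H, <- Cexp_opp, <- Cexp_mult_nat, <- Cexp_plus. f_equal. ring.
Qed.

Lemma Cpow_mult (z w : C) (n : nat) : (z * w) ^ n = z ^ n * w ^ n.
Proof. induction n as [|n IH]; simpl; [ring|]. rewrite IH. ring. Qed.

(** The powers of [Xa] and [Xb] contribute integral negative powers of the linear forms. They lower
    six exponents by [m] or [n] and leave that of [1 - s2 - s4] unchanged. *)
Lemma monomial_cell (e : R) (p1 q1 p2 q2 p3 q3 r3 : C) (x1 x2 : loaded)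
    (f g : R -> loaded * loaded) (h : R * R -> loaded * loaded * loaded) (m n : nat) (tau : cube4) :
  good1 e f -> good1 e g -> good2 e h -> in_cube4 tau ->
  wcell p1 q1 p2 q2 p3 q3 r3 f g h tau * Xa x1 f g h tau ^ m * Xb x2 f g h tau ^ n =
  val x1 ^ m * val x2 ^ n *
  wcell (p1 - RtoC (INR m)) (q1 - RtoC (INR n)) (p2 - RtoC (INR n)) (q2 - RtoC (INR m))
    (p3 - RtoC (INR m)) (q3 - RtoC (INR n)) r3 f g h tau.
Proof.
  intros Hf Hg Hh Ht. destruct tau as [[u1 u2] [u3 u4]]. destruct Ht as [U1 [U2 [U3 U4]]].
  assert (A1 := good1_fst _ _ Hf u1 U1). assert (A1' := good1_snd _ _ Hf u1 U1).
  assert (A3 := good1_fst _ _ Hg u2 U2). assert (A3' := good1_snd _ _ Hg u2 U2).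
  assert (A2 := good2_0 _ _ Hh (u3, u4) U3 U4). assert (A4 := good2_1 _ _ Hh (u3, u4) U3 U4).
  assert (N1 := good_load_neq _ _ A1). assert (N1' := good_load_neq _ _ A1').
  assert (N3 := good_load_neq _ _ A3). assert (N3' := good_load_neq _ _ A3').
  assert (N2 := good_load_neq _ _ A2). assert (N4 := good_load_neq _ _ A4).
  destruct A1 as [G1 _]. destruct A1' as [G1' _]. destruct A3 as [G3 _]. destruct A3' as [G3' _].
  destruct A2 as [G2 _]. destruct A4 as [G4 _].
  unfold wcell, W1, W2, Xa, Xb. cbn [fst snd].
  replace (val x1 / (val (snd (g u2)) * val (fst (f u1)) * val (y0 (h (u3, u4)))))
    with (val x1 * (/ val (snd (g u2)) * (/ val (fst (f u1)) * / val (y0 (h (u3, u4))))))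
    by (field; auto).
  replace (val x2 / (val (snd (f u1)) * val (fst (g u2)) * val (y1 (h (u3, u4)))))
    with (val x2 * (/ val (snd (f u1)) * (/ val (fst (g u2)) * / val (y1 (h (u3, u4))))))
    by (field; auto).
  rewrite !Cpow_mult.
  replace (p1 - RtoC (INR m) - 1) with (p1 - 1 - RtoC (INR m)) by ring.
  replace (q1 - RtoC (INR n) - 1) with (q1 - 1 - RtoC (INR n)) by ring.
  replace (p2 - RtoC (INR n) - 1) with (p2 - 1 - RtoC (INR n)) by ring.
  replace (q2 - RtoC (INR m) - 1) with (q2 - 1 - RtoC (INR m)) by ring.
  replace (p3 - RtoC (INR m) - 1) with (p3 - 1 - RtoC (INR m)) by ring.
  replace (q3 - RtoC (INR n) - 1) with (q3 - 1 - RtoC (INR n)) by ring.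
  rewrite <- (lpow_shift (fst (f u1)) (p1 - 1) m G1), <- (lpow_shift (snd (f u1)) (q1 - 1) n G1').
  rewrite <- (lpow_shift (fst (g u2)) (p2 - 1) n G3), <- (lpow_shift (snd (g u2)) (q2 - 1) m G3').
  rewrite <- (lpow_shift (y0 (h (u3, u4))) (p3 - 1) m G2), <- (lpow_shift (y1 (h (u3, u4))) (q3 - 1) n G4).
  ring.
Qed.

Lemma nex_wcell (e : R) (p1 q1 p2 q2 p3 q3 r3 : C)
    (f g : R -> loaded * loaded) (h : R * R -> loaded * loaded * loaded) :
  good1 e f -> good1 e g -> good2 e h ->
  nex (wcell p1 q1 p2 q2 p3 q3 r3 f g h) /\
  cube_int (wcell p1 q1 p2 q2 p3 q3 r3 f g h) =
    CInt (W1 p1 q1 f) 0 1 * CInt (W1 p2 q2 g) 0 1 *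
    CInt (fun s => CInt (fun t => W2 p3 q3 r3 h (s, t)) 0 1) 0 1.
Proof.
  intros Hf Hg Hh.
  destruct (cube_prod (W1 p1 q1 f) (W1 p2 q2 g) (fun s t => W2 p3 q3 r3 h (s, t))
    (good1_int _ _ Hf p1 q1) (good1_int _ _ Hg p2 q2) (good2_int4 _ _ Hh p3 q3 r3)
    (good2_int3 _ _ Hh p3 q3 r3)) as [A B].
  destruct (cube_ext _ (wcell p1 q1 p2 q2 p3 q3 r3 f g h)
    (fun tau _ => match tau return
        (let '((y1, y2), (y3, y4)) := tau in
          W1 p1 q1 f y1 * W1 p2 q2 g y2 * W2 p3 q3 r3 h (y3, y4)) =
        wcell p1 q1 p2 q2 p3 q3 r3 f g h tau
      with ((u1, u2), (u3, u4)) => eq_refl end) A) as [A' B'].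
  split; [exact A'|]. now rewrite B'.
Qed.

Lemma lpow_le (e : R) (f : loaded) (p : C) :
  good_load e f -> (Cmod (lpow f p) <= cpow_max e p)%R.
Proof.
  intros [_ [_ H]]. unfold lpow. eapply Rle_trans; [apply Cmod_Cexp_le|]. apply exp_le.
  rewrite Cmod_mult. apply Rmult_le_compat_l; [apply Cmod_ge_0|exact H].
Qed.

Lemma wcell_bound (e : R) (p1 q1 p2 q2 p3 q3 r3 : C)
    (f g : R -> loaded * loaded) (h : R * R -> loaded * loaded * loaded) :
  good1 e f -> good1 e g -> good2 e h ->
  exists M, forall tau, in_cube4 tau -> (Cmod (wcell p1 q1 p2 q2 p3 q3 r3 f g h tau) <= M)%R.
Proof.
  intros Hf Hg Hh.
  assert (B1 : forall p q k, good1 e k -> exists M, forall y, unit_itv y -> (Cmod (W1 p q k y) <= M)%R).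
  { intros p q k Hk. destruct (good1_bound _ _ Hk) as [M HM].
    exists (cpow_max e (p - 1) * cpow_max e (q - 1) * M)%R. intros y Hy. unfold W1.
    rewrite !Cmod_mult. apply Rmult3_le; split; try apply Cmod_ge_0; [| |now apply HM].
    - apply lpow_le. now apply (good1_fst _ _ Hk).
    - apply lpow_le. now apply (good1_snd _ _ Hk). }
  destruct (B1 p1 q1 f Hf) as [M1 H1]. destruct (B1 p2 q2 g Hg) as [M2 H2].
  destruct (good2_bound _ _ Hh) as [M3 H3].
  exists (M1 * M2 * (cpow_max e (p3 - 1) * cpow_max e (q3 - 1) * cpow_max e (r3 - 1) * M3))%R.
  intros [[u1 u2] [u3 u4]] [U1 [U2 [U3 U4]]]. unfold wcell. cbn [fst snd].
  rewrite !Cmod_mult. apply Rmult3_le; split; try apply Cmod_ge_0; [now apply H1|now apply H2|].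
  unfold W2. rewrite !Cmod_mult.
  apply Rmult_le_compat; [|apply Cmod_ge_0| |now apply H3].
  - repeat apply Rmult_le_pos; apply Cmod_ge_0.
  - apply Rmult3_le; split; try apply Cmod_ge_0; apply lpow_le.
    + now apply (good2_0 _ _ Hh).
    + now apply (good2_1 _ _ Hh).
    + now apply (good2_2 _ _ Hh).
Qed.

Lemma frac_bound (e : R) (x a b c : C) :
  (0 < e)%R -> (e <= Cmod a)%R -> (e <= Cmod b)%R -> (e <= Cmod c)%R ->
  (Cmod (x / (a * b * c)) <= Cmod x / (e * e * e))%R.
Proof.
  intros He Ha Hb Hc.
  assert (Ne : (0 < e * e * e)%R) by (repeat apply Rmult_lt_0_compat; exact He).
  rewrite Cmod_div, !Cmod_mult.
  2: { repeat apply Cmult_neq_0; apply Cmod_gt_0; lra. }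
  apply Rmult_le_compat_l; [apply Cmod_ge_0|]. apply Rinv_le_contravar; [exact Ne|].
  apply Rmult3_le; lra.
Qed.

Definition chain1 := chain R (loaded * loaded).
Definition chain2 := chain (R * R) (loaded * loaded * loaded).

Definition sum1 (p q : C) (K : chain1) : C := lsum (fun c => fst c * CInt (W1 p q (snd c)) 0 1) K.
Definition sum2 (p q r : C) (K : chain2) : C :=
  lsum (fun c => fst c * CInt (fun s => CInt (fun t => W2 p q r (snd c) (s, t)) 0 1) 0 1) K.

Lemma list_prod_map_l {A B D : Type} (F : A -> B) (K : list A) (L : list D) :
  list_prod (map F K) L = map (fun ab => (F (fst ab), snd ab)) (list_prod K L).
Proof.
  induction K as [|a K IH]; [reflexivity|]. simpl. rewrite IH, map_app. f_equal.
  rewrite map_map. reflexivity.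
Qed.

Definition idx : Type := ((C * (R -> loaded * loaded)) * (C * (R -> loaded * loaded)))
  * (C * (R * R -> loaded * loaded * loaded)).

Lemma int_dt_cells (u : tpoint -> C) (x1 x2 : loaded) (K1 K2 : chain1) (T : chain2) :
  int_dt u (chain_map (iota21 x1 x2) (chain_scal (- (1)) (chain_prod (chain_prod K1 K2) T))) =
  lsum (fun a : idx =>
    - (fst (fst (fst a)) * fst (snd (fst a)) * fst (snd a)) *
    cube_int (fun tau =>
      u (iota21 x1 x2 (cellmap (snd (fst (fst a))) (snd (snd (fst a))) (snd (snd a)) tau)) *
      Cdet 4 (fun i j => partial j (fun sg =>
        val (nth i [t1; t3; t2; t4] t1 (iota21 x1 x2
          (cellmap (snd (fst (fst a))) (snd (snd (fst a))) (snd (snd a)) sg)))) tau)))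
    (list_prod (list_prod K1 K2) T).
Proof.
  unfold int_dt, chain_map, chain_scal, chain_prod. rewrite list_prod_map_l.
  rewrite !map_map. unfold lsum. f_equal. apply map_ext. intros [[[c1 f] [c2 g]] [c3 h]].
  cbn [fst snd]. 
  match goal with |- ?a * ?b = ?c * ?d => change (a * b = c * b) end.
  f_equal. ring.
Qed.

(** For each monomial both the weight and the chain are products, so the coefficient splits into
    three sums, one over each factor of the chain. *)
Lemma int_dt_series (e : R) (a1 a2 a3 b1 b2 b3 b4 : C) (x1 x2 : loaded) (K1 K2 : chain1) (T : chain2) :
  (0 < e)%R -> Cexp (log x1) = val x1 -> Cexp (log x2) = val x2 ->
  (Cmod (val x1) < e * e * e)%R -> (Cmod (val x2) < e * e * e)%R ->
  (forall c, In c K1 -> good1 e (snd c)) -> (forall c, In c K2 -> good1 e (snd c)) ->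
  (forall c, In c T -> good2 e (snd c)) ->
  exists (g : nat -> C) (S : C),
    int_dt (u_form a1 a2 a3 b1 b2 b3 b4)
      (chain_map (iota21 x1 x2) (chain_scal (- (1)) (chain_prod (chain_prod K1 K2) T)))
      = lpow x1 (1 - b2) * lpow x2 (1 - b3) * S /\
    Clim (psum (fun m => bin (b2 + b4 - a2 - 2) m * g m)) S /\
    forall m, Clim (psum (fun n => bin (b1 + b3 - a1 - 2) n * (val x1 ^ m * val x2 ^ n *
      (sum1 (b2 - b1 - RtoC (INR m)) (b1 + b3 - a1 - 1 - RtoC (INR n)) K1
       * sum1 (b3 - b4 - RtoC (INR n)) (b2 + b4 - a2 - 1 - RtoC (INR m)) K2
       * sum2 (b2 - 1 - RtoC (INR m)) (b3 - 1 - RtoC (INR n)) (1 - a3) T)))) (g m).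
Proof.
  intros He Hx1 Hx2 B1 B2 G1 G2 G3.
  set (L := list_prod (list_prod K1 K2) T).
  set (F := fun a : idx => snd (fst (fst a))). set (G := fun a : idx => snd (snd (fst a))).
  set (H := fun a : idx => snd (snd a)).
  set (c := fun a : idx => fst (fst (fst a)) * fst (snd (fst a)) * fst (snd a)).
  assert (HL : forall a, In a L -> good1 e (F a) /\ good1 e (G a) /\ good2 e (H a)).
  { intros [[k1 k2] k3] Ha. apply in_prod_iff in Ha. destruct Ha as [Ha Ha3].
    apply in_prod_iff in Ha. destruct Ha as [Ha1 Ha2]. exact (conj (G1 _ Ha1) (conj (G2 _ Ha2) (G3 _ Ha3))). }
  set (p1 := b2 - b1). set (q1 := b1 + b3 - a1 - 1). set (p2 := b3 - b4). set (q2 := b2 + b4 - a2 - 1).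
  set (p3 := b2 - 1). set (q3 := b3 - 1). set (r3 := 1 - a3).
  set (w := fun a : idx => wcell p1 q1 p2 q2 p3 q3 r3 (F a) (G a) (H a)).
  assert (Ne : (0 < e * e * e)%R) by (repeat apply Rmult_lt_0_compat; exact He).
  (* The midpoint between 1 and the larger of the two bounds for [Xa] and [Xb] lies strictly between
     0 and 1. *)
  set (rho := ((1 + Rmax (Cmod (val x1) / (e * e * e)) (Cmod (val x2) / (e * e * e))) / 2)%R).
  assert (R1 : (Cmod (val x1) / (e * e * e) < 1)%R).
  { apply Rmult_lt_reg_r with (e * e * e)%R; [exact Ne|]. unfold Rdiv.
    rewrite Rmult_assoc, Rinv_l by lra. lra. }
  assert (R2 : (Cmod (val x2) / (e * e * e) < 1)%R).
  { apply Rmult_lt_reg_r with (e * e * e)%R; [exact Ne|]. unfold Rdiv.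
    rewrite Rmult_assoc, Rinv_l by lra. lra. }
  assert (Rp : (0 <= Cmod (val x1) / (e * e * e))%R).
  { apply Rmult_le_pos; [apply Cmod_ge_0|]. left. now apply Rinv_0_lt_compat. }
  assert (M1 := Rmax_l (Cmod (val x1) / (e * e * e)) (Cmod (val x2) / (e * e * e))).
  assert (M2 := Rmax_r (Cmod (val x1) / (e * e * e)) (Cmod (val x2) / (e * e * e))).
  assert (M3 := Rmax_lub_lt _ _ _ R1 R2).
  assert (Hrho : (0 < rho < 1)%R) by (unfold rho; lra).
  destruct (cells_series L c w (fun a => Xa x1 (F a) (G a) (H a)) (fun a => Xb x2 (F a) (G a) (H a))
    (b2 + b4 - a2 - 2) (b1 + b3 - a1 - 2) rho Hrho) as [Nx0 [g [S1 S2]]].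
  - intros a Ha. destruct (HL a Ha) as [Hf [Hg Hh]].
    destruct (wcell_bound e p1 q1 p2 q2 p3 q3 r3 (F a) (G a) (H a) Hf Hg Hh) as [M HM].
    exists M. intros tau Ht. split; [now apply HM|].
    destruct tau as [[u1 u2] [u3 u4]]. destruct Ht as [U1 [U2 [U3 U4]]].
    assert (A1 := good1_fst _ _ Hf u1 U1). assert (A1' := good1_snd _ _ Hf u1 U1).
    assert (A3 := good1_fst _ _ Hg u2 U2). assert (A3' := good1_snd _ _ Hg u2 U2).
    assert (A2 := good2_0 _ _ Hh (u3, u4) U3 U4). assert (A4 := good2_1 _ _ Hh (u3, u4) U3 U4).
    split.
    + eapply Rle_trans; [apply (frac_bound e)|]; [exact He|apply A3'|apply A1|apply A2|]. unfold rho. lra.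
    + eapply Rle_trans; [apply (frac_bound e)|]; [exact He|apply A1'|apply A3|apply A4|]. unfold rho. lra.
  - intros a Ha m n. destruct (HL a Ha) as [Hf [Hg Hh]].
    destruct (nex_wcell e (p1 - RtoC (INR m)) (q1 - RtoC (INR n)) (p2 - RtoC (INR n)) (q2 - RtoC (INR m))
      (p3 - RtoC (INR m)) (q3 - RtoC (INR n)) r3 (F a) (G a) (H a) Hf Hg Hh) as [N1 _].
    destruct (cube_scal (val x1 ^ m * val x2 ^ n) _ N1) as [N2 _].
    destruct (cube_ext _ (fun tau => w a tau * Xa x1 (F a) (G a) (H a) tau ^ m * Xb x2 (F a) (G a) (H a) tau ^ n)
      (fun tau Ht => eq_sym (monomial_cell e p1 q1 p2 q2 p3 q3 r3 x1 x2 (F a) (G a) (H a) m n tau Hf Hg Hh Ht)) N2)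
      as [N3 _]. exact N3.
  - exists g. eexists. split; [|split; [exact S2|]].
    + rewrite int_dt_cells. fold L. rewrite <- lsum_scal. apply lsum_ext. intros a Ha.
      destruct (HL a Ha) as [Hf [Hg Hh]].
      assert (Nx : nex (fun tau => w a tau * cpow (1 - Xa x1 (F a) (G a) (H a) tau) (b2 + b4 - a2 - 2)
        * cpow (1 - Xb x2 (F a) (G a) (H a) tau) (b1 + b3 - a1 - 2)))
        by now apply Nx0.
      destruct (cube_scal (- (lpow x1 (1 - b2) * lpow x2 (1 - b3))) _ Nx) as [Nx2 E2].
      destruct (cube_ext _ (fun tau =>
        u_form a1 a2 a3 b1 b2 b3 b4 (iota21 x1 x2 (cellmap (F a) (G a) (H a) tau)) *
        Cdet 4 (fun i j => partial j (fun sg =>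
        val (nth i [t1; t3; t2; t4] t1 (iota21 x1 x2 (cellmap (F a) (G a) (H a) sg)))) tau))
        (fun tau Ht => eq_sym (integrand_cell e a1 a2 a3 b1 b2 b3 b4 x1 x2 (F a) (G a) (H a) tau
           Hx1 Hx2 Hf Hg Hh Ht)) Nx2) as [_ E3].
      assert (E := eq_trans E3 E2).
      unfold F, G, H in E |- *. rewrite E. unfold c. ring.
    + intros m. apply Clim_ext with (2 := S1 m). intros N. apply psum_ext. intros n. f_equal.
      unfold sum1, sum2, L.
      rewrite <- lsum_prod, <- lsum_prod, <- lsum_scal. apply lsum_ext. intros a Ha.
      destruct (HL a Ha) as [Hf [Hg Hh]].
      destruct (nex_wcell e (p1 - RtoC (INR m)) (q1 - RtoC (INR n)) (p2 - RtoC (INR n)) (q2 - RtoC (INR m))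
        (p3 - RtoC (INR m)) (q3 - RtoC (INR n)) r3 (F a) (G a) (H a) Hf Hg Hh) as [N1 E1].
      destruct (cube_scal (val x1 ^ m * val x2 ^ n) _ N1) as [N2 E2].
      destruct (cube_ext _ (fun tau => w a tau * Xa x1 (F a) (G a) (H a) tau ^ m * Xb x2 (F a) (G a) (H a) tau ^ n)
        (fun tau Ht => eq_sym (monomial_cell e p1 q1 p2 q2 p3 q3 r3 x1 x2 (F a) (G a) (H a) m n tau Hf Hg Hh Ht)) N2)
        as [_ E3].
      assert (E := eq_trans E3 E2). rewrite E1 in E. rewrite E. unfold F, G, H, c. ring.
Qed.

(** * The cells of the regularized chains *)

Lemma good_lprinc (e : R) (z : C) :
  (0 < e <= Re z)%R -> (Cmod z <= 2)%R -> good_load e (lprinc z).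
Proof.
  intros He Hz. repeat split; simpl.
  - apply Cexp_Clog. lra.
  - eapply Rle_trans; [apply He|]. eapply Rle_trans; [apply Rle_abs|apply Re_le_Cmod].
  - now apply Cmod_Clog_le.
Qed.

Lemma val_lcircle (e t : R) : (0 < e)%R -> val (lcircle e t) = Cexp (circ (RtoC (ln e)) t).
Proof. intros He. unfold circ. rewrite Cexp_plus, Cexp_ln by exact He. reflexivity. Qed.

Lemma Cmod_lcircle (e t : R) : (0 < e)%R -> Cmod (val (lcircle e t)) = e.
Proof. intros He. rewrite val_lcircle by exact He. now apply Cmod_circ. Qed.

Lemma good_lcircle (e t : R) : (0 < e)%R -> unit_itv t -> good_load e (lcircle e t).
Proof.
  intros He Ht. repeat split.
  - symmetry. now apply val_lcircle.
  - rewrite Cmod_lcircle by exact He. lra.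
  - eapply Rle_trans; [apply (Cmod_circ_le e t Ht)|]. lra.
Qed.

Lemma rder_lcircle (e t : R) : (0 < e)%R ->
  rder (fun t => val (lcircle e t)) t (Cexp (circ (RtoC (ln e)) t) * (2 * RtoC PI * Ci)).
Proof.
  intros He. apply dq_ext with (fun t => Cexp (circ (RtoC (ln e)) t)).
  - intros s. symmetry. now apply val_lcircle.
  - apply (dq_Cexp RtoC (circ (RtoC (ln e)))); [apply cont_R_RtoC|apply rder_circ].
Qed.

Lemma lpow_lcircle (p : C) (e t : R) : lpow (lcircle e t) p = Cexp (p * circ (RtoC (ln e)) t).
Proof. reflexivity. Qed.

Lemma lpow_lcircle_pred (p : C) (e t : R) :
  lpow (lcircle e t) (p - 1) * Cexp (circ (RtoC (ln e)) t) = Cexp (p * circ (RtoC (ln e)) t).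
Proof. rewrite lpow_lcircle, <- Cexp_plus. f_equal. ring. Qed.

(** This and the next two are convertible with the anonymous cells of [reg_interval], so that
    membership in the chain and the sum over it are settled by conversion. *)
Definition ival_mid (e : R) (r : R) : loaded * loaded :=
  let s := RtoC e + RtoC r * (1 - 2 * RtoC e) in (lprinc s, lprinc (1 - s)).
Definition ival_left (e : R) (th : R) : loaded * loaded :=
  let s := lcircle e th in (s, lprinc (1 - val s)).
Definition ival_right (e : R) (th : R) : loaded * loaded :=
  let s' := lcircle e th in (lprinc (1 - val s'), s').

Lemma ival_mid_seg (e r : R) : RtoC e + RtoC r * (1 - 2 * RtoC e) = seg e (1 - e) r.
Proof.
  unfold seg. rewrite RtoC_plus, RtoC_mult, !RtoC_minus. ring.
Qed.

Lemma dphi_eq (phi : R -> loaded * loaded) (y : R) (l : C) :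
  rder (fun t => val (fst (phi t))) y l -> dphi phi y = l.
Proof. apply rder_CDerive. Qed.

Lemma rder_ival_mid (e r : R) : rder (fun t => val (fst (ival_mid e t))) r (RtoC (1 - e - e)).
Proof.
  apply dq_ext with (seg e (1 - e)); [|apply rder_seg].
  intros s. symmetry. apply ival_mid_seg.
Qed.

Lemma W1_ival_mid (p q : C) (e r : R) :
  W1 p q (ival_mid e) r =
  cpow (seg e (1 - e) r) (p - 1) * cpow (1 - seg e (1 - e) r) (q - 1) * RtoC (1 - e - e).
Proof.
  unfold W1. rewrite (dphi_eq _ _ _ (rder_ival_mid e r)).
  unfold ival_mid. rewrite ival_mid_seg. reflexivity.
Qed.

Lemma Cmod_1m_circle (e : R) (z : C) : (0 < e < 1 / 3)%R -> Cmod z = e ->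
  (e <= Re (1 - z))%R /\ (Cmod (1 - z) <= 2)%R.
Proof.
  intros He Hz. destruct (Cmod_lt_1_bounds e z ltac:(lra) ltac:(lra)). split; lra.
Qed.

Lemma good1_ival_mid (e : R) : (0 < e < 1 / 3)%R -> good1 e (ival_mid e).
Proof.
  intros He. split.
  - intros y Hy. rewrite (dphi_eq _ _ _ (rder_ival_mid e y)). apply rder_ival_mid.
  - intros y Hy. unfold ival_mid. rewrite ival_mid_seg. cbn [fst].
    assert (S := seg_bounds e (1 - e) y ltac:(lra) Hy). apply good_lprinc; [lra|].
    unfold seg in *. rewrite Cmod_RtoC_nonneg; simpl in S; lra.
  - intros y Hy. unfold ival_mid. rewrite ival_mid_seg. cbn [snd].
    assert (S := seg_bounds e (1 - e) y ltac:(lra) Hy). unfold seg in *. simpl in S.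
    rewrite RtoC_1m. apply good_lprinc; [simpl; lra|]. rewrite Cmod_RtoC_nonneg; lra.
  - reflexivity.
  - exists 1%R. intros y Hy. rewrite (dphi_eq _ _ _ (rder_ival_mid e y)).
    rewrite Cmod_RtoC_nonneg; lra.
  - intros p q. eapply exI_ext; [lra| |apply exI_cont; [lra|intros r Hr; apply (cont_Bint e (1 - e) p q r); lra]].
    intros r Hr. symmetry. apply W1_ival_mid.
Qed.

Lemma rder_ival_left (e r : R) : (0 < e)%R ->
  rder (fun t => val (fst (ival_left e t))) r (Cexp (circ (RtoC (ln e)) r) * (2 * RtoC PI * Ci)).
Proof. apply rder_lcircle. Qed.

Lemma rder_ival_right (e r : R) : (0 < e)%R ->
  rder (fun t => val (fst (ival_right e t))) r (- (Cexp (circ (RtoC (ln e)) r) * (2 * RtoC PI * Ci))).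
Proof.
  intros He. eapply dq_eq; [apply (dq_minus RtoC (fun _ => RtoC 1)); [apply dq_const|now apply rder_lcircle]|].
  ring.
Qed.

Lemma W1_ival_left (p q : C) (e r : R) : (0 < e)%R ->
  W1 p q (ival_left e) r =
  Cexp (p * circ (RtoC (ln e)) r) * cpow (1 - Cexp (circ (RtoC (ln e)) r)) (q - 1) * (2 * RtoC PI * Ci).
Proof.
  intros He. unfold W1. rewrite (dphi_eq _ _ _ (rder_ival_left e r He)).
  unfold ival_left. cbn [fst snd]. rewrite val_lcircle, <- (lpow_lcircle_pred p) by exact He.
  change (lpow (lprinc (1 - Cexp (circ (RtoC (ln e)) r))) (q - 1))
    with (cpow (1 - Cexp (circ (RtoC (ln e)) r)) (q - 1)). ring.
Qed.

(** The sign comes from [ds = - d(1 - s)] on the circle around [s = 1]; it cancels the minus sign of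
    the coefficient of this cell. *)
Lemma W1_ival_right (p q : C) (e r : R) : (0 < e)%R ->
  W1 p q (ival_right e) r =
  - (1) * (Cexp (q * circ (RtoC (ln e)) r) * cpow (1 - Cexp (circ (RtoC (ln e)) r)) (p - 1) * (2 * RtoC PI * Ci)).
Proof.
  intros He. unfold W1. rewrite (dphi_eq _ _ _ (rder_ival_right e r He)).
  unfold ival_right. cbn [fst snd]. rewrite val_lcircle, <- (lpow_lcircle_pred q) by exact He.
  change (lpow (lprinc (1 - Cexp (circ (RtoC (ln e)) r))) (p - 1))
    with (cpow (1 - Cexp (circ (RtoC (ln e)) r)) (p - 1)). ring.
Qed.

Lemma circle_der_bound (e r : R) : (0 < e)%R ->
  (Cmod (Cexp (circ (RtoC (ln e)) r) * (2 * RtoC PI * Ci)) <= e * (2 * PI))%R.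
Proof.
  intros He. rewrite !Cmod_mult, Cmod_circ, Cmod_Ci, !Cmod_RtoC_nonneg;
    generalize PI_RGT_0; try lra.
Qed.

Lemma exI_circle (e : R) (p q : C) : (0 < e < 1 / 3)%R ->
  exI (fun r => Cexp (p * circ (RtoC (ln e)) r) * cpow (1 - Cexp (circ (RtoC (ln e)) r)) (q - 1)
    * (2 * RtoC PI * Ci)) 0 1.
Proof.
  intros He. apply (exI_Rop e p (fun z => cpow (1 - z) (q - 1))); [lra|].
  intros z Hz. apply cont_cpow_1m. lra.
Qed.

Lemma good1_ival_left (e : R) : (0 < e < 1 / 3)%R -> good1 e (ival_left e).
Proof.
  intros He. assert (He0 := proj1 He). split.
  - intros y Hy. rewrite (dphi_eq _ _ _ (rder_ival_left e y He0)). now apply rder_ival_left.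
  - intros y Hy. now apply good_lcircle.
  - intros y Hy. destruct (Cmod_1m_circle e _ He (Cmod_lcircle e y He0)).
    apply good_lprinc; lra.
  - reflexivity.
  - exists (e * (2 * PI))%R. intros y Hy. rewrite (dphi_eq _ _ _ (rder_ival_left e y He0)).
    now apply circle_der_bound.
  - intros p q. eapply exI_ext; [lra| |apply (exI_circle e p q He)].
    intros r Hr. symmetry. now apply W1_ival_left.
Qed.

Lemma good1_ival_right (e : R) : (0 < e < 1 / 3)%R -> good1 e (ival_right e).
Proof.
  intros He. assert (He0 := proj1 He). split.
  - intros y Hy. rewrite (dphi_eq _ _ _ (rder_ival_right e y He0)). now apply rder_ival_right.
  - intros y Hy. destruct (Cmod_1m_circle e _ He (Cmod_lcircle e y He0)).
    apply good_lprinc; lra.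
  - intros y Hy. now apply good_lcircle.
  - intros y. simpl. ring.
  - exists (e * (2 * PI))%R. intros y Hy. rewrite (dphi_eq _ _ _ (rder_ival_right e y He0)).
    rewrite Cmod_opp. now apply circle_der_bound.
  - intros p q. eapply exI_ext; [lra| |exact (exI_scal _ (- (1)) 0 1 (exI_circle e q p He))].
    intros r Hr. symmetry. now apply W1_ival_right.
Qed.

Lemma good1_reg_interval (e : R) (p q : C) (c : C * (R -> loaded * loaded)) :
  (0 < e < 1 / 3)%R -> In c (reg_interval e p q) -> good1 e (snd c).
Proof.
  intros He [<-|[<-|[<-|[]]]].
  - exact (good1_ival_mid e He).
  - exact (good1_ival_left e He).
  - exact (good1_ival_right e He).
Qed.

(** [p0] and [q0] are the exponents from which the coefficients of the chain were made, [p] and [q]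
    those of the integrand. Equality of the monodromies lets one chain serve all integral shifts of
    the weight. *)
Lemma sum1_reg_interval (e : R) (p0 q0 p q : C) :
  (0 < e < 1 / 3)%R -> monodromy p0 = monodromy p -> monodromy q0 = monodromy q ->
  sum1 p q (reg_interval e p0 q0) = Ireg e p q.
Proof.
  intros He Hp Hq.
  change (RtoC 1 * CInt (W1 p q (ival_mid e)) 0 1
    + (1 / (monodromy p0 - 1) * CInt (W1 p q (ival_left e)) 0 1
    + (- (1 / (monodromy q0 - 1)) * CInt (W1 p q (ival_right e)) 0 1 + 0)) = Ireg e p q).
  rewrite Hp, Hq. unfold Ireg, Rop, Bint.
  rewrite (CInt_ext (W1 p q (ival_mid e)) _ 0 1 ltac:(lra) (fun r _ => W1_ival_mid p q e r)).
  rewrite (CInt_ext (W1 p q (ival_left e)) _ 0 1 ltac:(lra) (fun r _ => W1_ival_left p q e r (proj1 He))).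
  rewrite (CInt_ext (W1 p q (ival_right e)) _ 0 1 ltac:(lra) (fun r _ => W1_ival_right p q e r (proj1 He))).
  rewrite CInt_scal by now apply exI_circle.
  unfold Cdiv. ring.
Qed.

Lemma d3_eq (f : R * R -> C) (s t : R) (l : C) : rder (fun u => f (u, t)) s l -> d3 f (s, t) = l.
Proof. apply rder_CDerive. Qed.

Lemma d4_eq (f : R * R -> C) (s t : R) (l : C) : rder (fun u => f (s, u)) t l -> d4 f (s, t) = l.
Proof. apply rder_CDerive. Qed.

Lemma y0_rot3 (P : loaded * loaded * loaded) : y0 (rot3 P) = y2 P.
Proof. destruct P as [[a b] c]. reflexivity. Qed.
Lemma y1_rot3 (P : loaded * loaded * loaded) : y1 (rot3 P) = y0 P.
Proof. destruct P as [[a b] c]. reflexivity. Qed.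
Lemma y2_rot3 (P : loaded * loaded * loaded) : y2 (rot3 P) = y1 P.
Proof. destruct P as [[a b] c]. reflexivity. Qed.

Lemma rot_der (e : R) (phi : R * R -> loaded * loaded * loaded) (s t : R) :
  good2 e phi -> unit_itv s -> unit_itv t ->
  rder (fun u => val (y0 (rot3 (phi (u, t))))) s
    (- d3 (fun r => val (y0 (phi r))) (s, t) - d3 (fun r => val (y1 (phi r))) (s, t)) /\
  rder (fun u => val (y0 (rot3 (phi (s, u))))) t
    (- d4 (fun r => val (y0 (phi r))) (s, t) - d4 (fun r => val (y1 (phi r))) (s, t)) /\
  rder (fun u => val (y1 (rot3 (phi (u, t))))) s (d3 (fun r => val (y0 (phi r))) (s, t)) /\
  rder (fun u => val (y1 (rot3 (phi (s, u))))) t (d4 (fun r => val (y0 (phi r))) (s, t)).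
Proof.
  intros H Hs Ht.
  assert (D1 := good2_d30 _ _ H (s, t) Hs Ht). assert (D2 := good2_d40 _ _ H (s, t) Hs Ht).
  assert (D3 := good2_d31 _ _ H (s, t) Hs Ht). assert (D4 := good2_d41 _ _ H (s, t) Hs Ht).
  cbn [fst snd] in *. repeat split.
  - apply dq_ext with (fun u => 1 - val (y0 (phi (u, t))) - val (y1 (phi (u, t)))).
    + intros u. rewrite y0_rot3. symmetry. apply (good2_sum _ _ H).
    + eapply dq_eq; [apply dq_minus; [apply dq_minus; [apply dq_const|exact D1]|exact D3]|ring].
  - apply dq_ext with (fun u => 1 - val (y0 (phi (s, u))) - val (y1 (phi (s, u)))).
    + intros u. rewrite y0_rot3. symmetry. apply (good2_sum _ _ H).
    + eapply dq_eq; [apply dq_minus; [apply dq_minus; [apply dq_const|exact D2]|exact D4]|ring].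
  - eapply dq_ext; [|exact D1]. intros u. now rewrite y1_rot3.
  - eapply dq_ext; [|exact D2]. intros u. now rewrite y1_rot3.
Qed.

(** Since [dy0 + dy1 + dy2 = 0], the two-form satisfies [dy2 /\ dy0 = dy0 /\ dy1]. *)
Lemma jac_rot (e : R) (phi : R * R -> loaded * loaded * loaded) (r : R * R) :
  good2 e phi -> unit_itv (fst r) -> unit_itv (snd r) ->
  jac (fun r => rot3 (phi r)) r = jac phi r.
Proof.
  destruct r as [s t]. intros H Hs Ht. destruct (rot_der e phi s t H Hs Ht) as [E1 [E2 [E3 E4]]].
  unfold jac.
  rewrite (d3_eq (fun r => val (y0 (rot3 (phi r)))) s t _ E1), (d4_eq (fun r => val (y0 (rot3 (phi r)))) s t _ E2).
  rewrite (d3_eq (fun r => val (y1 (rot3 (phi r)))) s t _ E3), (d4_eq (fun r => val (y1 (rot3 (phi r)))) s t _ E4).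
  ring.
Qed.

Lemma W2_rot (e : R) (p q r : C) (phi : R * R -> loaded * loaded * loaded) (s t : R) :
  good2 e phi -> unit_itv s -> unit_itv t ->
  W2 p q r (fun r => rot3 (phi r)) (s, t) = W2 q r p phi (s, t).
Proof.
  intros H Hs Ht. unfold W2. rewrite (jac_rot e phi (s, t) H Hs Ht), y0_rot3, y1_rot3, y2_rot3. ring.
Qed.

Lemma good2_rot (e : R) (phi : R * R -> loaded * loaded * loaded) :
  good2 e phi -> good2 e (fun r => rot3 (phi r)).
Proof.
  intros H. split.
  - intros [s t] Hs Ht. destruct (rot_der e phi s t H Hs Ht) as [E1 [E2 [E3 E4]]].
    rewrite (d3_eq (fun r => val (y0 (rot3 (phi r)))) s t _ E1). exact E1.
  - intros [s t] Hs Ht. destruct (rot_der e phi s t H Hs Ht) as [E1 [E2 [E3 E4]]].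
    rewrite (d4_eq (fun r => val (y0 (rot3 (phi r)))) s t _ E2). exact E2.
  - intros [s t] Hs Ht. destruct (rot_der e phi s t H Hs Ht) as [E1 [E2 [E3 E4]]].
    rewrite (d3_eq (fun r => val (y1 (rot3 (phi r)))) s t _ E3). exact E3.
  - intros [s t] Hs Ht. destruct (rot_der e phi s t H Hs Ht) as [E1 [E2 [E3 E4]]].
    rewrite (d4_eq (fun r => val (y1 (rot3 (phi r)))) s t _ E4). exact E4.
  - intros r Hs Ht. rewrite y0_rot3. now apply (good2_2 _ _ H).
  - intros r Hs Ht. rewrite y1_rot3. now apply (good2_0 _ _ H).
  - intros r Hs Ht. rewrite y2_rot3. now apply (good2_1 _ _ H).
  - intros r. rewrite y0_rot3, y1_rot3, y2_rot3, (good2_sum _ _ H). ring.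
  - destruct (good2_bound _ _ H) as [M HM]. exists M. intros r Hs Ht.
    rewrite (jac_rot e phi r H Hs Ht). now apply HM.
  - intros p q r s Hs. eapply exI_ext; [lra| |apply (good2_int4 _ _ H q r p s Hs)].
    intros t Ht. symmetry. now apply (W2_rot e).
  - intros p q r. eapply exI_ext; [lra| |apply (good2_int3 _ _ H q r p)].
    intros s Hs. symmetry. apply CInt_ext; [lra|]. intros t Ht. now apply (W2_rot e).
Qed.

Definition dbl (p q r : C) (phi : R * R -> loaded * loaded * loaded) : C :=
  CInt (fun s => CInt (fun t => W2 p q r phi (s, t)) 0 1) 0 1.

Lemma dbl_rot (e : R) (p q r : C) (phi : R * R -> loaded * loaded * loaded) :
  good2 e phi -> dbl p q r (fun r => rot3 (phi r)) = dbl q r p phi.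
Proof.
  intros H. unfold dbl. apply CInt_ext; [lra|]. intros s Hs. apply CInt_ext; [lra|].
  intros t Ht. now apply (W2_rot e).
Qed.

(** For explicit partial derivatives and an explicit inner integral [I], the properties of a cell
    and the value of its double integral are obtained together; each of the three unrotated pieces
    is then one application. *)
Lemma good2_intro (e : R) (phi : R * R -> loaded * loaded * loaded)
    (A3 A4 B3 B4 : R -> R -> C) (M : R) (I : C -> C -> C -> R -> C) :
  (forall s t, unit_itv s -> unit_itv t ->
    (rder (fun u => val (y0 (phi (u, t)))) s (A3 s t) /\
     rder (fun u => val (y0 (phi (s, u)))) t (A4 s t)) /\
    (rder (fun u => val (y1 (phi (u, t)))) s (B3 s t) /\
     rder (fun u => val (y1 (phi (s, u)))) t (B4 s t))) ->
  (forall s t, unit_itv s -> unit_itv t ->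
    good_load e (y0 (phi (s, t))) /\ good_load e (y1 (phi (s, t))) /\ good_load e (y2 (phi (s, t)))) ->
  (forall r, val (y2 (phi r)) = 1 - val (y0 (phi r)) - val (y1 (phi r))) ->
  (forall s t, unit_itv s -> unit_itv t -> (Cmod (A3 s t * B4 s t - A4 s t * B3 s t) <= M)%R) ->
  (forall p q r s, unit_itv s -> isI (fun t =>
    lpow (y0 (phi (s, t))) (p - 1) * lpow (y1 (phi (s, t))) (q - 1) * lpow (y2 (phi (s, t))) (r - 1)
    * (A3 s t * B4 s t - A4 s t * B3 s t)) 0 1 (I p q r s)) ->
  (forall p q r, exI (I p q r) 0 1) ->
  good2 e phi /\ forall p q r, dbl p q r phi = CInt (I p q r) 0 1.
Proof.
  intros D L S B I4 I3.
  assert (E3 : forall s t, unit_itv s -> unit_itv t -> d3 (fun r => val (y0 (phi r))) (s, t) = A3 s t).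
  { intros s t Hs Ht. apply d3_eq. now apply D. }
  assert (E4 : forall s t, unit_itv s -> unit_itv t -> d4 (fun r => val (y0 (phi r))) (s, t) = A4 s t).
  { intros s t Hs Ht. apply d4_eq. now apply D. }
  assert (F3' : forall s t, unit_itv s -> unit_itv t -> d3 (fun r => val (y1 (phi r))) (s, t) = B3 s t).
  { intros s t Hs Ht. apply d3_eq. now apply D. }
  assert (F4 : forall s t, unit_itv s -> unit_itv t -> d4 (fun r => val (y1 (phi r))) (s, t) = B4 s t).
  { intros s t Hs Ht. apply d4_eq. now apply D. }
  assert (J : forall s t, unit_itv s -> unit_itv t -> jac phi (s, t) = A3 s t * B4 s t - A4 s t * B3 s t).
  { intros s t Hs Ht. unfold jac. now rewrite E3, E4, F3', F4. }
  assert (K : forall p q r s, unit_itv s -> isI (fun t => W2 p q r phi (s, t)) 0 1 (I p q r s)).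
  { intros p q r s Hs. apply (isI_ext _ _ 0 1 _ ltac:(lra)) with (2 := I4 p q r s Hs).
    intros t Ht. unfold W2. now rewrite J. }
  assert (K' : forall p q r s, unit_itv s -> CInt (fun t => W2 p q r phi (s, t)) 0 1 = I p q r s).
  { intros p q r s Hs. apply isI_unique. now apply K. }
  split.
  - split.
    + intros [s t] Hs Ht. rewrite E3 by assumption. now apply D.
    + intros [s t] Hs Ht. rewrite E4 by assumption. now apply D.
    + intros [s t] Hs Ht. rewrite F3' by assumption. now apply D.
    + intros [s t] Hs Ht. rewrite F4 by assumption. now apply D.
    + intros [s t] Hs Ht. now apply L.
    + intros [s t] Hs Ht. now apply L.
    + intros [s t] Hs Ht. now apply L.
    + exact S.
    + exists M. intros [s t] Hs Ht. rewrite J by assumption. now apply B.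
    + intros p q r s Hs. eexists. now apply K.
    + intros p q r. eapply exI_ext; [lra| |apply (I3 p q r)].
      intros s Hs. symmetry. now apply K'.
  - intros p q r. apply CInt_ext; [lra|]. intros s Hs. now apply K'.
Qed.

Lemma inner_real (e s t : R) : (0 < e < 1 / 3)%R -> unit_itv s -> unit_itv t ->
  (e <= e + s * (1 - 3 * e) <= 1)%R /\ (e <= e + (1 - s) * t * (1 - 3 * e) <= 1)%R /\
  (e <= 1 - (e + s * (1 - 3 * e)) - (e + (1 - s) * t * (1 - 3 * e)) <= 1)%R.
Proof.
  intros He [Hs Hs'] [Ht Ht'].
  assert (A : (0 <= (1 - s) * t)%R) by (apply Rmult_le_pos; lra).
  assert (B : (0 <= (1 - s) * (1 - t))%R) by (apply Rmult_le_pos; lra).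
  assert (C1 : (0 <= s * (1 - 3 * e))%R) by (apply Rmult_le_pos; lra).
  assert (C2 : (0 <= (1 - s) * t * (1 - 3 * e))%R) by (apply Rmult_le_pos; lra).
  assert (C3 : (0 <= (1 - s) * (1 - t) * (1 - 3 * e))%R) by (apply Rmult_le_pos; lra).
  repeat split; nra.
Qed.

Lemma good_lprinc_real (e x : R) : (0 < e)%R -> (e <= x <= 1)%R -> good_load e (lprinc (RtoC x)).
Proof.
  intros He Hx. apply good_lprinc; [simpl; lra|]. rewrite Cmod_RtoC_nonneg; lra.
Qed.

Lemma good2_tri_inner_aux (e : R) : (0 < e < 1 / 3)%R ->
  good2 e (tri_inner e) /\ forall p q r, dbl p q r (tri_inner e) = Tinner e p q r.
Proof.
  intros He. set (k := 1 - 3 * RtoC e).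
  assert (Ek : RtoC (1 - 3 * e) = k) by (unfold k; now rewrite RtoC_minus, RtoC_mult).
  apply (good2_intro e _ (fun _ _ => k) (fun _ _ => 0) (fun _ t => - (RtoC t * k))
    (fun s _ => (1 - RtoC s) * k) (Cmod k * Cmod k)
    (fun p q r s => cpow (RtoC e + RtoC s * k) (p - 1) * gseg e q r ((1 - RtoC s) * k) * k)).
  - intros s t Hs Ht. split; split.
    + apply rder_affine.
    + apply dq_ext with (fun _ : R => RtoC e + RtoC s * k); [reflexivity|apply dq_const].
    + eapply dq_eq.
      * apply dq_ext with (fun u => RtoC e + (1 - RtoC u) * (RtoC t * k)).
        -- intros u. simpl. fold k. ring.
        -- apply rder_affine_rev.
      * reflexivity.
    + apply dq_ext with (fun u => RtoC e + RtoC u * ((1 - RtoC s) * k)); [|apply rder_affine].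
      intros u. simpl. fold k. ring.
  - intros s t Hs Ht. destruct (inner_real e s t He Hs Ht) as [L0 [L1 L2]].
    assert (V0 : RtoC e + RtoC s * k = RtoC (e + s * (1 - 3 * e))) by
      (rewrite RtoC_plus, RtoC_mult, Ek; reflexivity).
    assert (V1 : RtoC e + (1 - RtoC s) * RtoC t * k = RtoC (e + (1 - s) * t * (1 - 3 * e))) by
      (rewrite RtoC_plus, !RtoC_mult, RtoC_minus, Ek; reflexivity).
    unfold tri_inner. cbn [fst snd y0 y1 y2]. fold k. unfold y0, y1, y2. cbn [fst snd].
    rewrite V0, V1, <- !RtoC_minus.
    split; [|split]; apply good_lprinc_real; lra.
  - intros r. reflexivity.
  - intros s t Hs Ht. rewrite Cmult_0_l. unfold Cminus. rewrite Copp_0, Cplus_0_r, !Cmod_mult.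
    apply Rmult_le_compat_l; [apply Cmod_ge_0|].
    rewrite <- (Rmult_1_l (Cmod k)) at 2. apply Rmult_le_compat_r; [apply Cmod_ge_0|].
    change (1 + - RtoC s)%C with (1 - RtoC s). rewrite <- RtoC_minus.
    destruct Hs. rewrite Cmod_RtoC_nonneg; lra.
  - intros p q r s Hs. destruct (Re_inner e s He Hs) as [H1 [H2 [H3 H4]]]. fold k in H1, H2, H3, H4.
    set (l := (1 - RtoC s) * k) in *.
    replace (cpow (RtoC e + RtoC s * k) (p - 1) * gseg e q r l * k)
      with (cpow (RtoC e + RtoC s * k) (p - 1) * k * gseg e q r l) by ring.
    apply (isI_ext _ _ 0 1 _ ltac:(lra)) with
      (2 := isI_scal _ (cpow (RtoC e + RtoC s * k) (p - 1) * k) _ _ _ (isI_gseg e q r l (proj1 He) H2)).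
    intros t Ht.
    change (lpow (y0 (tri_inner e (s, t))) (p - 1)) with (cpow (RtoC e + RtoC s * k) (p - 1)).
    change (lpow (y1 (tri_inner e (s, t))) (q - 1)) with (cpow (RtoC e + (1 - RtoC s) * RtoC t * k) (q - 1)).
    change (lpow (y2 (tri_inner e (s, t))) (r - 1)) with
      (cpow (1 - (RtoC e + RtoC s * k) - (RtoC e + (1 - RtoC s) * RtoC t * k)) (r - 1)).
    replace (RtoC e + (1 - RtoC s) * RtoC t * k) with (RtoC e + RtoC t * l) by (unfold l; ring).
    replace (1 - (RtoC e + RtoC s * k) - (RtoC e + RtoC t * l)) with (RtoC e + (1 - RtoC t) * l)
      by (unfold l, k; ring).
    fold l. ring.
  - intros p q r. eexists. apply (isI_inner e p q r He).
Qed.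

Lemma good2_tri_inner (e : R) : (0 < e < 1 / 3)%R -> good2 e (tri_inner e).
Proof. intros He. now apply good2_tri_inner_aux. Qed.

Lemma dbl_tri_inner (e : R) (p q r : C) : (0 < e < 1 / 3)%R ->
  dbl p q r (tri_inner e) = Tinner e p q r.
Proof. intros He. now apply good2_tri_inner_aux. Qed.

Lemma tube_bounds (e t : R) (z : C) : (0 < e < 1 / 3)%R -> unit_itv t -> Cmod z = e ->
  (e <= Re (RtoC e + RtoC t * (1 - 2 * RtoC e - z)))%R /\
  (Cmod (RtoC e + RtoC t * (1 - 2 * RtoC e - z)) <= 2)%R.
Proof.
  intros He [Ht Ht'] Hz. assert (A := Re_le_Cmod z). assert (B := Rle_abs (Re z)).
  split.
  - replace (Re (RtoC e + RtoC t * (1 - 2 * RtoC e - z))) with (e + t * (1 - 2 * e - Re z))%R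
      by (unfold Re; simpl; ring).
    assert (0 <= t * (1 - 2 * e - Re z))%R by (apply Rmult_le_pos; lra). lra.
  - eapply Rle_trans; [apply Cmod_triangle|]. rewrite Cmod_mult, !Cmod_RtoC_nonneg by lra.
    assert (Hl : (Cmod (1 - 2 * RtoC e - z) <= 1 - 2 * e + e)%R).
    { unfold Cminus at 1. eapply Rle_trans; [apply Cmod_triangle|]. rewrite Cmod_opp, Hz.
      rewrite <- RtoC_mult, <- RtoC_minus, Cmod_RtoC_nonneg; lra. }
    assert (t * Cmod (1 - 2 * RtoC e - z) <= 1 * (1 - 2 * e + e))%R
      by (apply Rmult_le_compat; [lra|apply Cmod_ge_0|lra|exact Hl]).
    lra.
Qed.

Lemma unit_itv_compl (t : R) : unit_itv t -> unit_itv (1 - t).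
Proof. intros [H1 H2]. unfold unit_itv. lra. Qed.

Lemma good2_tri_tube_aux (e : R) : (0 < e < 1 / 3)%R ->
  good2 e (tri_tube e) /\ forall p q r, dbl p q r (tri_tube e) =
    CInt (fun tau => Cexp (p * circ (RtoC (ln e)) tau)
      * gseg e q r (1 - 2 * RtoC e - Cexp (circ (RtoC (ln e)) tau)) * (2 * RtoC PI * Ci)) 0 1.
Proof.
  intros He. assert (He0 := proj1 He). set (z := fun s => Cexp (circ (RtoC (ln e)) s)).
  set (w := 2 * RtoC PI * Ci).
  assert (Hz : forall s, Cmod (z s) = e) by (intros s; now apply Cmod_circ).
  set (l := fun s => 1 - 2 * RtoC e - z s).
  assert (Hl : forall s, (- e < Re (l s))%R).
  { intros s. apply Re_tube. apply Cmod_Re_lt; [lra|apply Hz]. }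
  assert (El : forall s, 1 - 2 * RtoC e - val (lcircle e s) = l s).
  { intros s. now rewrite val_lcircle. }
  apply (good2_intro e _ (fun s _ => z s * w) (fun _ _ => 0) (fun s t => - (RtoC t * (z s * w)))
    (fun s _ => l s) (e * (2 * PI) * 2)
    (fun p q r s => Cexp (p * circ (RtoC (ln e)) s) * gseg e q r (l s) * w)).
  - intros s t Hs Ht. split; split.
    + now apply rder_lcircle.
    + apply dq_ext with (fun _ : R => val (lcircle e s)); [reflexivity|apply dq_const].
    + apply dq_ext with (fun u => (RtoC e + RtoC t * (1 - 2 * RtoC e)) - RtoC t * val (lcircle e u)).
      * intros u. simpl. ring.
      * eapply dq_eq; [apply dq_minus; [apply dq_const|apply dq_scal; now apply rder_lcircle]|].
        unfold z, w. ring.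
    + rewrite <- (El s). apply rder_affine.
  - intros s t Hs Ht. unfold tri_tube, y0, y1, y2. cbn [fst snd]. rewrite El.
    destruct (tube_bounds e t (z s) He Ht (Hz s)).
    destruct (tube_bounds e (1 - t) (z s) He (unit_itv_compl t Ht) (Hz s)) as [B1 B2].
    rewrite RtoC_minus in B1, B2.
    split; [|split].
    + now apply good_lcircle.
    + apply good_lprinc; [split; [exact He0|assumption]|assumption].
    + apply good_lprinc; [split; [exact He0|assumption]|assumption].
  - intros [s t]. simpl. ring.
  - intros s t Hs Ht. rewrite Cmult_0_l. unfold Cminus. rewrite Copp_0, Cplus_0_r, Cmod_mult.
    apply Rmult_le_compat; try apply Cmod_ge_0; [now apply circle_der_bound|].
    destruct (tube_bounds e 1 (z s) He ltac:(split; lra) (Hz s)) as [_ B].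
    assert (Hl2 : (Cmod (l s) <= 1 - 2 * e + e)%R).
    { unfold l. unfold Cminus at 1. eapply Rle_trans; [apply Cmod_triangle|]. rewrite Cmod_opp, Hz.
      rewrite <- RtoC_mult, <- RtoC_minus, Cmod_RtoC_nonneg; lra. }
    lra.
  - intros p q r s Hs.
    replace (Cexp (p * circ (RtoC (ln e)) s) * gseg e q r (l s) * w)
      with (Cexp (p * circ (RtoC (ln e)) s) * w * gseg e q r (l s)) by ring.
    apply (isI_ext _ _ 0 1 _ ltac:(lra)) with
      (2 := isI_scal _ (Cexp (p * circ (RtoC (ln e)) s) * w) _ _ _ (isI_gseg e q r (l s) He0 (Hl s))).
    intros t Ht. unfold tri_tube, y0, y1, y2. cbn [fst snd]. rewrite El.
    rewrite <- (lpow_lcircle_pred p). unfold z.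
    change (lpow (lprinc (RtoC e + RtoC t * l s)) (q - 1)) with (cpow (RtoC e + RtoC t * l s) (q - 1)).
    change (lpow (lprinc (RtoC e + (1 - RtoC t) * l s)) (r - 1))
      with (cpow (RtoC e + (1 - RtoC t) * l s) (r - 1)).
    ring.
  - intros p q r. apply (exI_Rop e p (fun y => gseg e q r (1 - 2 * RtoC e - y)) He0).
    intros y Hy. apply cont_tube; [exact He0|]. apply Cmod_Re_lt; lra.
Qed.

Lemma good2_tri_tube (e : R) : (0 < e < 1 / 3)%R -> good2 e (tri_tube e).
Proof. intros He. now apply good2_tri_tube_aux. Qed.

Lemma dbl_tri_tube (e : R) (p q r : C) : (0 < e < 1 / 3)%R ->
  / (monodromy p - 1) * dbl p q r (tri_tube e) = Ttube e p q r.
Proof. intros He. now rewrite (proj2 (good2_tri_tube_aux e He)). Qed.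

Lemma cont_corner_int (e : R) (q r y0 : C) :
  (0 < e)%R -> (Re y0 < 1 - e)%R ->
  cont (fun y => CInt (fun t => Cexp (q * circ (RtoC (ln e)) t)
    * cpow (1 - y - Cexp (circ (RtoC (ln e)) t)) (r - 1) * (2 * RtoC PI * Ci)) 0 1) y0.
Proof.
  intros He Hy. apply (cont_CInt (U := C_UniformSpace)); [lra|].
  generalize (Re_lt_open _ _ Hy). apply filter_imp. intros y H t _. change C in y.
  assert (Cc : cont (fun p : C * R => circ (RtoC (ln e)) (snd p)) (y, t)).
  { apply (cont_snd (U := C_UniformSpace) (circ (RtoC (ln e)))). apply cont_circ. }
  assert (Cy : cont (fun p : C * R => fst p) (y, t)).
  { apply (cont_fst (fun z : C => z)). apply cont_C_id. }
  assert (Hr := Re_cor e y _ H (Cmod_circ e t He)).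
  apply cont_mult; [|apply cont_const]. apply cont_mult.
  - apply cont_Cexp. apply cont_mult; [apply cont_const|exact Cc].
  - apply cont_cpow; [|exact Hr].
    apply cont_minus; [apply cont_minus; [apply cont_const|exact Cy]|now apply cont_Cexp].
Qed.

Lemma good2_tri_corner_aux (e : R) : (0 < e < 1 / 3)%R ->
  good2 e (tri_corner e) /\ forall p q r, dbl p q r (tri_corner e) =
    CInt (fun tau => Cexp (p * circ (RtoC (ln e)) tau)
      * CInt (fun t => Cexp (q * circ (RtoC (ln e)) t)
        * cpow (1 - Cexp (circ (RtoC (ln e)) tau) - Cexp (circ (RtoC (ln e)) t)) (r - 1)
        * (2 * RtoC PI * Ci)) 0 1 * (2 * RtoC PI * Ci)) 0 1.
Proof.
  intros He. assert (He0 := proj1 He). set (z := fun s => Cexp (circ (RtoC (ln e)) s)).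
  set (w := 2 * RtoC PI * Ci).
  assert (Hz : forall s, Cmod (z s) = e) by (intros s; now apply Cmod_circ).
  assert (Hr : forall s, (Re (z s) < 1 - e)%R).
  { intros s. apply Cmod_Re_lt; [lra|apply Hz]. }
  apply (good2_intro e _ (fun s _ => z s * w) (fun _ _ => 0) (fun s t => 0)
    (fun _ t => z t * w) (e * (2 * PI) * (e * (2 * PI)))
    (fun p q r s => Cexp (p * circ (RtoC (ln e)) s) * CInt (fun t => Cexp (q * circ (RtoC (ln e)) t)
        * cpow (1 - z s - z t) (r - 1) * w) 0 1 * w)).
  - intros s t Hs Ht. split; split.
    + now apply rder_lcircle.
    + apply dq_ext with (fun _ : R => val (lcircle e s)); [reflexivity|apply dq_const].
    + apply dq_ext with (fun _ : R => val (lcircle e t)); [reflexivity|apply dq_const].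
    + now apply rder_lcircle.
  - intros s t Hs Ht. unfold tri_corner, y0, y1, y2. cbn [fst snd].
    rewrite !val_lcircle by exact He0. fold (z s) (z t).
    split; [now apply good_lcircle|split; [now apply good_lcircle|]].
    apply good_lprinc.
    + assert (A := Re_le_Cmod (z s)). assert (B := Rle_abs (Re (z s))).
      assert (A' := Re_le_Cmod (z t)). assert (B' := Rle_abs (Re (z t))). rewrite Hz in A, A'.
      change (Re (1 - z s - z t)) with (1 - Re (z s) - Re (z t))%R. lra.
    + unfold Cminus. eapply Rle_trans; [apply Cmod_triangle|].
      eapply Rle_trans; [apply Rplus_le_compat_r; apply Cmod_triangle|].
      rewrite !Cmod_opp, !Hz, Cmod_1. lra.
  - intros r. reflexivity.
  - intros s t Hs Ht. rewrite Cmult_0_l. unfold Cminus. rewrite Copp_0, Cplus_0_r, Cmod_mult.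
    apply Rmult_le_compat; try apply Cmod_ge_0; now apply circle_der_bound.
  - intros p q r s Hs.
    set (F := fun t => Cexp (q * circ (RtoC (ln e)) t) * cpow (1 - z s - z t) (r - 1) * w).
    replace (Cexp (p * circ (RtoC (ln e)) s) * CInt F 0 1 * w)
      with (Cexp (p * circ (RtoC (ln e)) s) * w * CInt F 0 1) by ring.
    assert (IF : isI F 0 1 (CInt F 0 1)).
    { apply isI_CInt. apply (exI_Rop e q (fun y => cpow (1 - z s - y) (r - 1)) He0).
      intros y Hy. apply cont_cor_r. now apply Re_cor with e. }
    apply (isI_ext _ _ 0 1 _ ltac:(lra)) with
      (2 := isI_scal _ (Cexp (p * circ (RtoC (ln e)) s) * w) _ _ _ IF).
    intros t Ht. unfold tri_corner, y0, y1, y2, F. cbn [fst snd].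
    rewrite !val_lcircle by exact He0. fold (z s) (z t).
    rewrite <- (lpow_lcircle_pred p), <- (lpow_lcircle_pred q). fold (z s) (z t).
    change (lpow (lprinc (1 - z s - z t)) (r - 1)) with (cpow (1 - z s - z t) (r - 1)).
    ring.
  - intros p q r. apply (exI_Rop e p (fun y => CInt (fun t => Cexp (q * circ (RtoC (ln e)) t)
        * cpow (1 - y - z t) (r - 1) * w) 0 1) He0).
    intros y Hy. apply cont_corner_int; [exact He0|]. apply Cmod_Re_lt; lra.
Qed.

Lemma good2_tri_corner (e : R) : (0 < e < 1 / 3)%R -> good2 e (tri_corner e).
Proof. intros He. now apply good2_tri_corner_aux. Qed.

Lemma dbl_tri_corner (e : R) (p q r : C) : (0 < e < 1 / 3)%R ->
  / (monodromy p - 1) * / (monodromy q - 1) * dbl p q r (tri_corner e) = Tcor e p q r.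
Proof.
  intros He. rewrite (proj2 (good2_tri_corner_aux e He)). unfold Tcor, Rop, hcor, Rop.
  rewrite <- Cmult_assoc. f_equal. rewrite <- CInt_scal.
  - apply CInt_ext; [lra|]. intros t Ht. ring.
  - apply (exI_Rop e p (fun y => CInt (fun t => Cexp (q * circ (RtoC (ln e)) t)
        * cpow (1 - y - Cexp (circ (RtoC (ln e)) t)) (r - 1) * (2 * RtoC PI * Ci)) 0 1) (proj1 He)).
    intros y Hy. apply cont_corner_int; [lra|]. apply Cmod_Re_lt; lra.
Qed.

Lemma good2_reg_triangle (e : R) (p q r : C) (c : C * (R * R -> loaded * loaded * loaded)) :
  (0 < e < 1 / 3)%R -> In c (reg_triangle e p q r) -> good2 e (snd c).
Proof.
  intros He. assert (T := good2_tri_tube e He). assert (K := good2_tri_corner e He).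
  intros [<-|[<-|[<-|[<-|[<-|[<-|[<-|[]]]]]]]].
  - exact (good2_tri_inner e He).
  - exact T.
  - exact (good2_rot e _ T).
  - exact (good2_rot e _ (good2_rot e _ T)).
  - exact K.
  - exact (good2_rot e _ K).
  - exact (good2_rot e _ (good2_rot e _ K)).
Qed.

(** Rotating a cell amounts to permuting the exponents cyclically, by [dbl_rot]; the seven cells
    become the inner integral and the six terms of [Tbdry]. *)
Lemma sum2_reg_triangle (e : R) (p0 q0 r0 p q r : C) :
  (0 < e < 1 / 3)%R -> not_int p -> not_int q -> not_int r ->
  monodromy p0 = monodromy p -> monodromy q0 = monodromy q -> monodromy r0 = monodromy r ->
  sum2 p q r (reg_triangle e p0 q0 r0) = Treg e p q r.
Proof.
  intros He Np Nq Nr Hp Hq Hr.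
  assert (T := good2_tri_tube e He). assert (K := good2_tri_corner e He).
  change (RtoC 1 * dbl p q r (tri_inner e)
    + (1 / (monodromy p0 - 1) * dbl p q r (tri_tube e)
    + (1 / (monodromy q0 - 1) * dbl p q r (fun x => rot3 (tri_tube e x))
    + (1 / (monodromy r0 - 1) * dbl p q r (fun x => rot3 (rot3 (tri_tube e x)))
    + (1 / ((monodromy p0 - 1) * (monodromy q0 - 1)) * dbl p q r (tri_corner e)
    + (1 / ((monodromy q0 - 1) * (monodromy r0 - 1)) * dbl p q r (fun x => rot3 (tri_corner e x))
    + (1 / ((monodromy r0 - 1) * (monodromy p0 - 1)) * dbl p q r (fun x => rot3 (rot3 (tri_corner e x)))
    + 0)))))) = Treg e p q r).
  rewrite (dbl_rot e p q r (fun x => rot3 (tri_tube e x))) by now apply good2_rot.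
  rewrite (dbl_rot e p q r (fun x => rot3 (tri_corner e x))) by now apply good2_rot.
  rewrite (dbl_rot e p q r (tri_tube e)), (dbl_rot e q r p (tri_tube e)) by exact T.
  rewrite (dbl_rot e p q r (tri_corner e)), (dbl_rot e q r p (tri_corner e)) by exact K.
  rewrite Hp, Hq, Hr, dbl_tri_inner by exact He.
  unfold Treg, Tbdry.
  rewrite <- (dbl_tri_tube e p q r), <- (dbl_tri_tube e q r p), <- (dbl_tri_tube e r p q),
    <- (dbl_tri_corner e p q r), <- (dbl_tri_corner e q r p), <- (dbl_tri_corner e r p q) by exact He.
  assert (Mp := monodromy_neq p Np). assert (Mq := monodromy_neq q Nq). assert (Mr := monodromy_neq r Nr).
  field. repeat split; assumption.
Qed.

(** * Exponents lowered by integers, and the coefficients of the double series *)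

Lemma RtoC_INR_S (n : nat) : RtoC (INR (S n)) = RtoC (INR n) + 1.
Proof. now rewrite S_INR, RtoC_plus. Qed.

(** Shared by the Beta and Dirichlet integrals: the first-order recurrences are solved along [n] at
    [m = 0], then along [m]. The factor on the right depends on [m + n] only, which is the source of
    the symbols with index [n1 + n2] in the series. *)
Lemma down_shift (f : nat -> nat -> C) (a b c : C) :
  (forall m n, (a + RtoC (INR m)) * f (S m) n = (c + RtoC (INR (m + n))) * f m n) ->
  (forall m n, (b + RtoC (INR n)) * f m (S n) = (c + RtoC (INR (m + n))) * f m n) ->
  forall m n, poch a m * poch b n * f m n = poch c (m + n) * f 0%nat 0%nat.
Proof.
  intros H1 H2 m n. induction m as [|m IH].
  - induction n as [|n IH]; [simpl; ring|].
    change (poch b (S n)) with (poch b n * (b + RtoC (INR n))).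
    change (poch c (0 + S n)) with (poch c (0 + n) * (c + RtoC (INR (0 + n)))).
    transitivity (poch a 0 * poch b n * ((b + RtoC (INR n)) * f 0%nat (S n))); [ring|].
    rewrite H2. transitivity ((c + RtoC (INR (0 + n))) * (poch a 0 * poch b n * f 0%nat n)); [ring|].
    rewrite IH. ring.
  - change (poch a (S m)) with (poch a m * (a + RtoC (INR m))).
    change (poch c (S m + n)) with (poch c (m + n) * (c + RtoC (INR (m + n)))).
    transitivity (poch a m * poch b n * ((a + RtoC (INR m)) * f (S m) n)); [ring|].
    rewrite H1. transitivity ((c + RtoC (INR (m + n))) * (poch a m * poch b n * f m n)); [ring|].
    rewrite IH. ring.
Qed.

Lemma minus_INR_S (p : C) (n : nat) : p - RtoC (INR (S n)) + 1 = p - RtoC (INR n).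
Proof. rewrite RtoC_INR_S. ring. Qed.

(** With [p' = p - (m + 1)] and [q' = q - n], the factor [1 - p + m] is [- p'] and
    [1 - (p + q) + m + n] is [- (p' + q')]. The downward recurrence is thus [Ireg_S_l] at [p'] with
    both sides negated. *)
Lemma Ireg_down (e : R) (p q : C) (m n : nat) :
  (0 < e < 1 / 2)%R -> not_int p -> not_int q ->
  poch (1 - p) m * poch (1 - q) n * Ireg e (p - RtoC (INR m)) (q - RtoC (INR n)) =
  poch (1 - (p + q)) (m + n) * Ireg e p q.
Proof.
  intros He Hp Hq.
  rewrite (down_shift (fun m n => Ireg e (p - RtoC (INR m)) (q - RtoC (INR n)))
    (1 - p) (1 - q) (1 - (p + q))).
  - simpl. unfold Cminus. rewrite !Copp_0, !Cplus_0_r. reflexivity.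
  - clear m n. intros m n.
    assert (A := Ireg_S_l e (p - RtoC (INR (S m))) (q - RtoC (INR n)) He
      (not_int_minus_nat _ _ Hp) (not_int_minus_nat _ _ Hq)).
    rewrite minus_INR_S in A.
    transitivity (- ((p - RtoC (INR (S m))) * Ireg e (p - RtoC (INR (S m))) (q - RtoC (INR n))));
      [rewrite RtoC_INR_S; ring|].
    rewrite <- A, RtoC_INR_S, plus_INR, RtoC_plus. ring.
  - clear m n. intros m n.
    assert (A := Ireg_S_r e (p - RtoC (INR m)) (q - RtoC (INR (S n))) He
      (not_int_minus_nat _ _ Hp) (not_int_minus_nat _ _ Hq)).
    rewrite minus_INR_S in A.
    transitivity (- ((q - RtoC (INR (S n))) * Ireg e (p - RtoC (INR m)) (q - RtoC (INR (S n)))));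
      [rewrite RtoC_INR_S; ring|].
    rewrite <- A, RtoC_INR_S, plus_INR, RtoC_plus. ring.
Qed.

Lemma Treg_down (e : R) (p q r : C) (m n : nat) :
  (0 < e < 1 / 3)%R -> not_int p -> not_int q -> not_int r ->
  poch (1 - p) m * poch (1 - q) n * Treg e (p - RtoC (INR m)) (q - RtoC (INR n)) r =
  poch (1 - (p + q + r)) (m + n) * Treg e p q r.
Proof.
  intros He Hp Hq Hr.
  rewrite (down_shift (fun m n => Treg e (p - RtoC (INR m)) (q - RtoC (INR n)) r)
    (1 - p) (1 - q) (1 - (p + q + r))).
  - simpl. unfold Cminus. rewrite !Copp_0, !Cplus_0_r. reflexivity.
  - clear m n. intros m n.
    assert (A := Treg_S_1 e (p - RtoC (INR (S m))) (q - RtoC (INR n)) r He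
      (not_int_minus_nat _ _ Hp) (not_int_minus_nat _ _ Hq) Hr).
    rewrite minus_INR_S in A.
    transitivity (- ((p - RtoC (INR (S m))) * Treg e (p - RtoC (INR (S m))) (q - RtoC (INR n)) r));
      [rewrite RtoC_INR_S; ring|].
    rewrite <- A, RtoC_INR_S, plus_INR, RtoC_plus. ring.
  - clear m n. intros m n.
    assert (A := Treg_S_2 e (p - RtoC (INR m)) (q - RtoC (INR (S n))) r He
      (not_int_minus_nat _ _ Hp) (not_int_minus_nat _ _ Hq) Hr).
    rewrite minus_INR_S in A.
    transitivity (- ((q - RtoC (INR (S n))) * Treg e (p - RtoC (INR m)) (q - RtoC (INR (S n))) r));
      [rewrite RtoC_INR_S; ring|].
    rewrite <- A, RtoC_INR_S, plus_INR, RtoC_plus. ring.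
Qed.

Lemma poch_1 (n : nat) : poch 1 n = RtoC (INR (fact n)).
Proof.
  induction n as [|n IH]; [reflexivity|].
  rewrite fact_simpl, mult_INR, RtoC_mult, <- IH, RtoC_INR_S. simpl poch. ring.
Qed.

Lemma RtoC_fact_neq_0 (n : nat) : RtoC (INR (fact n)) <> 0.
Proof. intros E. apply (INR_fact_neq_0 n). exact (f_equal Re E). Qed.

(* The factors [poch (1 - q1) n] and [poch (1 - q2) m] of the shifted Beta
   integrals cancel against the binomial coefficients. *)
Lemma hypergeometric_term (p1 q1 p2 q2 p3 q3 r3 i1 i2 t K1 K2 T x1 x2 : C) (m n : nat) :
  not_int p1 -> not_int q1 -> not_int p2 -> not_int q2 -> not_int p3 -> not_int q3 ->
  poch (1 - p1) m * poch (1 - q1) n * i1 = poch (1 - (p1 + q1)) (m + n) * K1 ->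
  poch (1 - p2) n * poch (1 - q2) m * i2 = poch (1 - (p2 + q2)) (n + m) * K2 ->
  poch (1 - p3) m * poch (1 - q3) n * t = poch (1 - (p3 + q3 + r3)) (m + n) * T ->
  bin (q2 - 1) m * (bin (q1 - 1) n * (x1 ^ m * x2 ^ n * (i1 * i2 * t))) =
  K1 * K2 * T *
  (poch (1 - (p1 + q1)) (m + n) * poch (1 - (p2 + q2)) (m + n) * poch (1 - (p3 + q3 + r3)) (m + n)
    / (poch (1 - p1) m * poch (1 - p3) m * poch 1 m
       * (poch (1 - q3) n * poch (1 - p2) n * poch 1 n))
    * x1 ^ m * x2 ^ n).
Proof.
  intros N1 M1 N2 M2 N3 M3 E1 E2 E3.
  assert (Nz : forall z k, not_int z -> poch (1 - z) k <> 0).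
  { intros z k Hz. apply poch_neq_0, not_int_nonpole.
    replace (1 - z) with (- z + 1) by ring. now apply not_int_plus_1, not_int_opp. }
  rewrite (Nat.add_comm n m) in E2. rewrite !poch_1. unfold bin.
  replace (- (q2 - 1)) with (1 - q2) by ring. replace (- (q1 - 1)) with (1 - q1) by ring.
  assert (A1 := Nz p1 m N1). assert (A2 := Nz q1 n M1). assert (A3 := Nz p2 n N2).
  assert (A4 := Nz q2 m M2). assert (A5 := Nz p3 m N3). assert (A6 := Nz q3 n M3).
  assert (F1 := RtoC_fact_neq_0 m). assert (F2 := RtoC_fact_neq_0 n).
  transitivity ((poch (1 - p1) m * poch (1 - q1) n * i1) * (poch (1 - p2) n * poch (1 - q2) m * i2)
    * (poch (1 - p3) m * poch (1 - q3) n * t) * (x1 ^ m * x2 ^ n)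
    / (poch (1 - p1) m * poch (1 - p3) m * RtoC (INR (fact m))
       * (poch (1 - q3) n * poch (1 - p2) n * RtoC (INR (fact n))))).
  - field. repeat split; assumption.
  - rewrite E1, E2, E3. field. repeat split; assumption.
Qed.

(** * The smallness condition, the constant term and the conclusion *)

Lemma In_chain_prod {D P D' P' : Type} (K : chain D P) (L : chain D' P') c d :
  In c K -> In d L ->
  In (fst c * fst d, fun tau => (snd c (fst tau), snd d (snd tau))) (chain_prod K L).
Proof.
  intros Hc Hd. unfold chain_prod.
  apply (in_map (fun cd : (C * (D -> P)) * (C * (D' -> P')) => (fst (fst cd) * fst (snd cd),
                  fun tau : D * D' => (snd (fst cd) (fst tau), snd (snd cd) (snd tau))))
    (list_prod K L) (c, d)).
  now apply in_prod.
Qed.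

Lemma small_cube (e : R) (x : C) (a b c : loaded) : (0 < e)%R ->
  Cmod (val a) = e -> Cmod (val b) = e -> Cmod (val c) = e ->
  (Cmod (x / (val a * val b * val c)) < 1)%R -> (Cmod x < e * e * e)%R.
Proof.
  intros He Ha Hb Hc H.
  assert (Ne : (0 < e * e * e)%R) by (repeat apply Rmult_lt_0_compat; exact He).
  rewrite Cmod_div, !Cmod_mult, Ha, Hb, Hc in H.
  - apply (Rmult_lt_compat_r _ _ _ Ne) in H. unfold Rdiv in H.
    rewrite Rmult_assoc, Rinv_l in H by lra. lra.
  - repeat apply Cmult_neq_0; apply Cmod_gt_0; lra.
Qed.

(* On the product of two end circles with a corner torus, all three factors of
   the denominators have modulus [e]. *)
Lemma small_on_chain (e : R) (x1 x2 p q p' q' u v w : C) : (0 < e)%R ->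
  on_chain (small_at x1 x2) (chain_prod (reg_square e p q p' q') (reg_triangle e u v w)) ->
  (Cmod x1 < e * e * e)%R /\ (Cmod x2 < e * e * e)%R.
Proof.
  intros He H.
  set (tau := ((0%R, 0%R), (0%R, 0%R)) : cube4).
  assert (U : unit_itv 0) by (unfold unit_itv; lra).
  assert (Ht : in_cube4 tau) by exact (conj U (conj U (conj U U))).
  assert (M := Cmod_lcircle e 0 He).
  assert (P2 : forall a b, In (1 / (monodromy a - 1), ival_left e) (reg_interval e a b))
    by (intros; right; left; reflexivity).
  assert (P3 : forall a b, In (- (1 / (monodromy b - 1)), ival_right e) (reg_interval e a b))
    by (intros; right; right; left; reflexivity).
  assert (Pc : In (1 / ((monodromy u - 1) * (monodromy v - 1)), tri_corner e) (reg_triangle e u v w))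
    by (do 4 right; left; reflexivity).
  split.
  - destruct (H _ _ (In_chain_prod _ _ _ _ (In_chain_prod _ _ _ _ (P2 p q) (P3 p' q')) Pc) tau Ht) as [_ B].
    exact (small_cube e x1 (lcircle e 0) (lcircle e 0) (lcircle e 0) He M M M B).
  - destruct (H _ _ (In_chain_prod _ _ _ _ (In_chain_prod _ _ _ _ (P3 p q) (P2 p' q')) Pc) tau Ht) as [B _].
    exact (small_cube e x2 (lcircle e 0) (lcircle e 0) (lcircle e 0) He M M M B).
Qed.

Lemma not_int_minus_1 (p : C) : not_int p -> not_int (p - 1).
Proof. exact (not_int_minus_nat p 1). Qed.

(** The exponent sums of the three integrals are the arguments of the Gamma factors in the numerator
    of [C21]. Finiteness of [C21] is therefore the condition under which the Beta and Dirichlet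
    values apply. *)
Lemma C21_Beta_Dirichlet (e : R) (a1 a2 a3 b1 b2 b3 b4 : C) :
  (0 < e < 1 / 3)%R ->
  not_int (b2 - b1) -> not_int (b1 + b3 - a1 - 1) -> not_int (b3 - b4) ->
  not_int (b2 + b4 - a2 - 1) -> not_int (b2 - 1) -> not_int (b3 - 1) -> not_int (1 - a3) ->
  nonpole (b2 + b3 - a1 - 1) -> nonpole (b2 + b3 - a2 - 1) -> nonpole (b2 + b3 - a3 - 1) ->
  C21 a1 a2 a3 b1 b2 b3 b4 *
  (Ireg e (b2 - b1) (b1 + b3 - a1 - 1) * Ireg e (b3 - b4) (b2 + b4 - a2 - 1)
   * Treg e (b2 - 1) (b3 - 1) (1 - a3)) = 1.
Proof.
  intros He N1 M1 N2 M2 N3 M3 R3 G1 G2 G3.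
  assert (S1 : b2 - b1 + (b1 + b3 - a1 - 1) = b2 + b3 - a1 - 1) by ring.
  assert (S2 : b3 - b4 + (b2 + b4 - a2 - 1) = b2 + b3 - a2 - 1) by ring.
  assert (S3 : b2 - 1 + (b3 - 1) + (1 - a3) = b2 + b3 - a3 - 1) by ring.
  rewrite !Beta_CGamma, Dirichlet_CGamma; rewrite ?S1, ?S2, ?S3; try assumption.
  unfold C21.
  assert (Z : forall z, not_int z -> CGamma z <> 0)
    by (intros z Hz; now apply CGamma_neq_0, not_int_nonpole).
  assert (Z1 := Z _ N1). assert (Z2 := Z _ M1). assert (Z3 := Z _ N2). assert (Z4 := Z _ M2).
  assert (Z5 := Z _ N3). assert (Z6 := Z _ M3). assert (Z7 := Z _ R3).
  assert (Y1 := CGamma_neq_0 _ G1). assert (Y2 := CGamma_neq_0 _ G2). assert (Y3 := CGamma_neq_0 _ G3).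
  set (g1 := CGamma (b2 - b1)) in *. set (g2 := CGamma (b1 + b3 - a1 - 1)) in *.
  set (g3 := CGamma (b3 - b4)) in *. set (g4 := CGamma (b2 + b4 - a2 - 1)) in *.
  set (g5 := CGamma (b2 - 1)) in *. set (g6 := CGamma (b3 - 1)) in *. set (g7 := CGamma (1 - a3)) in *.
  set (h1 := CGamma (b2 + b3 - a1 - 1)) in *. set (h2 := CGamma (b2 + b3 - a2 - 1)) in *.
  set (h3 := CGamma (b2 + b3 - a3 - 1)) in *.
  field. repeat split; assumption.
Qed.

Theorem corollary3p4 :
  forall (a1 a2 a3 b1 b2 b3 b4 : C)
    (hb2 : not_int b2) (hb3 : not_int b3) (ha3 : not_int a3)
    (hb12 : not_int (b1 - b2)) (hb34 : not_int (b3 - b4))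
    (hba1 : not_int (b1 + b3 - a1)) (hba2 : not_int (b2 + b4 - a2))
    (hg1 : forall n : nat, b2 + b3 - a1 - 1 <> - RtoC (INR n))
    (hg2 : forall n : nat, b2 + b3 - a2 - 1 <> - RtoC (INR n))
    (hg3 : forall n : nat, b2 + b3 - a3 - 1 <> - RtoC (INR n))
    (eps : R) (heps : (0 < eps < 1 / 3)%R)
    (x1 x2 : loaded)
    (hx1 : Cexp (log x1) = val x1) (hx2 : Cexp (log x2) = val x2)
    (hsmall : on_chain (small_at (val x1) (val x2))
                (reg21 eps a1 a2 a3 b1 b2 b3 b4)),
  F21 a1 a2 a3 b1 b2 b3 b4 x1 x2
  = C21 a1 a2 a3 b1 b2 b3 b4
    * int_dt (u_form a1 a2 a3 b1 b2 b3 b4)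
        (Delta21 eps a1 a2 a3 b1 b2 b3 b4 x1 x2).
Proof.
  intros. destruct (small_on_chain eps _ _ _ _ _ _ _ _ _ (proj1 heps) hsmall) as [B1 B2].
  assert (N1 : not_int (b2 - b1)).
  { replace (b2 - b1) with (- (b1 - b2)) by ring. now apply not_int_opp. }
  assert (M1 := not_int_minus_1 _ hba1). assert (M2 := not_int_minus_1 _ hba2).
  assert (N3 := not_int_minus_1 _ hb2). assert (M3 := not_int_minus_1 _ hb3).
  assert (R3 : not_int (1 - a3)).
  { replace (1 - a3) with (- a3 + 1) by ring. now apply not_int_plus_1, not_int_opp. }
  assert (HC := C21_Beta_Dirichlet eps a1 a2 a3 b1 b2 b3 b4 heps N1 M1 hb34 M2 N3 M3 R3 hg1 hg2 hg3).
  set (K := Ireg eps (b2 - b1) (b1 + b3 - a1 - 1) * Ireg eps (b3 - b4) (b2 + b4 - a2 - 1)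
   * Treg eps (b2 - 1) (b3 - 1) (1 - a3)) in HC.
  set (K1 := reg_interval eps (b2 - b1 - 1) (b1 + b3 - a1 - 2)).
  set (K2 := reg_interval eps (b3 - b4 - 1) (b2 + b4 - a2 - 2)).
  set (T := reg_triangle eps (b2 - 2) (b3 - 2) (- a3)).
  destruct (int_dt_series eps a1 a2 a3 b1 b2 b3 b4 x1 x2 K1 K2 T (proj1 heps) hx1 hx2 B1 B2)
    as [g [S [E [H1 H2]]]];
    [intros c; now apply good1_reg_interval|intros c; now apply good1_reg_interval
    |intros c; now apply good2_reg_triangle|].
  change (Delta21 eps a1 a2 a3 b1 b2 b3 b4 x1 x2) with
    (chain_map (iota21 x1 x2) (chain_scal (- (1)) (chain_prod (chain_prod K1 K2) T))).
  rewrite E.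
  (* The chain is built from the exponents [p'] of the weight, the integrals carry [p = p' + 1]
     lowered by [n]; the monodromies agree. *)
  assert (Mm : forall p p' n, p = p' + 1 -> monodromy p' = monodromy (p - RtoC (INR n))).
  { intros p p' n ->. now rewrite monodromy_minus_nat, monodromy_plus_1. }
  set (C0 := C21 a1 a2 a3 b1 b2 b3 b4) in *.
  (* Multiplication by [C0] turns the constant term [K] into 1, after which the inner summands of
     [F3] agree one by one with those of the integral. *)
  assert (HF : forall m, CSeries (fun n =>
      poch (a1 - b2 - b3 + 2) (m + n) * poch (a2 - b2 - b3 + 2) (m + n) * poch (a3 - b2 - b3 + 2) (m + n)
      / (poch (b1 - b2 + 1) m * poch (2 - b2) m * poch 1 m
         * (poch (2 - b3) n * poch (b4 - b3 + 1) n * poch 1 n)) * val x1 ^ m * val x2 ^ n)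
    = C0 * (bin (b2 + b4 - a2 - 2) m * g m)).
  { intros m. apply psum_CSeries.
    refine (Clim_ext _ _ _ _ (Clim_scal _ C0 _ (Clim_scal _ (bin (b2 + b4 - a2 - 2) m) _ (H2 m)))).
    intros N. simpl. rewrite <- !psum_scal. apply psum_ext. intros n.
    unfold K1, K2, T. rewrite !sum1_reg_interval; try exact heps; try (apply Mm; ring).
    rewrite sum2_reg_triangle; try exact heps; try (now apply not_int_minus_nat); try exact R3;
      try (apply Mm; ring).
    2: { replace (1 - a3) with (- a3 + 1) by ring. now rewrite monodromy_plus_1. }
    assert (e2 : (0 < eps < 1 / 2)%R) by lra.
    assert (Q := hypergeometric_term _ _ _ _ _ _ _ _ _ _ _ _ _ (val x1) (val x2) m n N1 M1 hb34 M2 N3 M3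
      (Ireg_down eps _ _ m n e2 N1 M1) (Ireg_down eps _ _ n m e2 hb34 M2)
      (Treg_down eps _ _ _ m n heps N3 M3 R3)).
    replace (b2 + b4 - a2 - 1 - 1) with (b2 + b4 - a2 - 2) in Q by ring.
    replace (b1 + b3 - a1 - 1 - 1) with (b1 + b3 - a1 - 2) in Q by ring.
    rewrite Q. fold K. rewrite Cmult_assoc, HC, Cmult_1_l.
    replace (1 - (b2 - b1 + (b1 + b3 - a1 - 1))) with (a1 - b2 - b3 + 2) by ring.
    replace (1 - (b3 - b4 + (b2 + b4 - a2 - 1))) with (a2 - b2 - b3 + 2) by ring.
    replace (1 - (b2 - 1 + (b3 - 1) + (1 - a3))) with (a3 - b2 - b3 + 2) by ring.
    replace (1 - (b2 - b1)) with (b1 - b2 + 1) by ring. replace (1 - (b2 - 1)) with (2 - b2) by ring.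
    replace (1 - (b3 - 1)) with (2 - b3) by ring. replace (1 - (b3 - b4)) with (b4 - b3 + 1) by ring.
    reflexivity. }
  assert (HS : F3 (a1 - b2 - b3 + 2) (a2 - b2 - b3 + 2) (a3 - b2 - b3 + 2)
    (b1 - b2 + 1) (2 - b2) (2 - b3) (b4 - b3 + 1) (val x1) (val x2) = C0 * S).
  { unfold F3. apply psum_CSeries.
    refine (Clim_ext _ _ _ _ (Clim_scal _ C0 _ H1)).
    intros N. simpl. rewrite <- psum_scal. apply psum_ext. intros m. now rewrite HF. }
  unfold F21. rewrite HS. ring.
Qed.
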